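(* The coverability problem for conservative Elementary Object Systems (cEOS coverability) is $\mathbf{F}_{\omega 2}$-hard.
   Context: A Petri net (PN) is $N=(P,T,F)$ with finite place set $P$, finite transition set $T$ and flow $F:(P\times T)\cup(T\times P)\to\mathbb{N}$; ${\tt pre}_N(t)(p)=F(p,t)$, ${\tt post}_N(t)(p)=F(t,p)$; markings are finite multisets of places, with the usual firing rule. The empty PN $\blacksquare=(\emptyset,\emptyset,\emptyset)$ has the unique marking $\varepsilon$. For a multiset $\theta$ of transitions $t_i$ (with multiplicity), ${\tt pre}_N(\theta)=\sum_i {\tt pre}_N(t_i)$ and similarly for ${\tt post}$. An Elementary Object System (EOS) is $\mathfrak{E}=(\hat N,\mathcal{N},d,\Theta)$ where: $\hat N=(\hat P,\hat T,\hat F)$ is a PN (system net) which contains, for each $p\in\hat P$, an idle transition $id_p$ with $\hat F(p,id_p)=\hat F(id_p,p)=1$ and $\hat F(q,id_p)=\hat F(id_p,q)=0$ for $q\ne p$; $\mathcal{N}$ is a finite set of PNs (object nets) with $\blacksquare\in\mathcal{N}$, all nets in $\mathcal{N}\cup\{\hat N\}$ having pairwise disjoint place sets and transition sets; $d:\hat P\to\mathcal{N}$ is the typing function; $\Theta$ is a finite set of events $(\hat\tau,\theta)$ with $\hat\tau\in\hat T$ and $\theta$ assigning to each $N=(P,T,F)\in\mathcal N$ a finite multiset $\theta(N)$ of transitions of $N$, such that if $\hat\tau=id_p$ then $\theta(d(p))\neq\emptyset$. A nested token is a pair $(\hat p,M)$ with $\hat p\in\hat P$ and $M$ a marking of $d(\hat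 p)$; a nested marking (configuration) is a finite multiset of nested tokens. For $\mu=\sum_i(\hat p_i,M_i)$ let $\Pi^1(\mu)=\sum_i \hat p_i$ and, for $N\in\mathcal N$, $\Pi^2_N(\mu)=\sum_{i: d(\hat p_i)=N}M_i$. An event $e=(\hat\tau,\theta)$ is enabled on $\mu$ with mode $(\lambda,\rho)$ (nested markings) iff $\lambda\sqsubseteq\mu$ (multiset inclusion), $\Pi^1(\lambda)={\tt pre}_{\hat N}(\hat\tau)$, $\Pi^1(\rho)={\tt post}_{\hat N}(\hat\tau)$, and for all $N\in\mathcal N$: $\Pi^2_N(\lambda)\ge {\tt pre}_N(\theta(N))$ and $\Pi^2_N(\rho)=\Pi^2_N(\lambda)-{\tt pre}_N(\theta(N))+{\tt post}_N(\theta(N))$; firing yields $\mu-\lambda+\rho$. The order $\le_f$ on nested markings: $\mu\le_f\mu'$ iff $\mu'$ is obtained from $\mu$ by adding tokens to the inner markings of nested tokens of $\mu$ and/or adding further nested tokens. A conservative EOS (cEOS) is an EOS such that for every $\hat t\in\hat T$, $d(\mathrm{supp}({\tt pre}_{\hat N}(\hat t)))\subseteq d(\mathrm{supp}({\tt post}_{\hat N}(\hat t)))$. cEOS coverability: given a cEOS $\mathfrak E$, an initial configuration $M_0$ and a target configuration $M_t$, decide whether some configuration $M_1$ reachable from $M_0$ satisfies $M_t\le_f M_1$. $\mathbf{F}_{\omega 2}$ denotes the class of the fast-growing complexity hierarchy (Schmitz) at ordinal $\omega\cdot 2$ (''double-Ackermannian''). *)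

(* Defs.v *)
From Corelib Require Import PosDef.
From Stdlib Require Import List Relation_Operators.
From HB Require Import structures.
From mathcomp Require Import all_boot all_order all_algebra.
From mathcomp Require Import finmap multiset.

Set Implicit Arguments.
Unset Strict Implicit.
Unset Printing Implicit Defensive.

Local Open Scope mset_scope.
Local Open Scope nat_scope.

(** * Petri nets *)

Record petri_net := PetriNet {
  place : finType;
  trans : finType;
  flow_pt : place -> trans -> nat;
  flow_tp : trans -> place -> nat
}.

Definition pre (N : petri_net) (t : trans N) (p : place N) : nat := flow_pt p t.
Definition post (N : petri_net) (t : trans N) (p : place N) : nat := flow_tp t p.

Definition marking (N : petri_net) := {ffun place N -> nat}.

Definition tmultiset (N : petri_net) := {ffun trans N -> nat}.

Definition pre_ms (N : petri_net) (th : tmultiset N) (p : place N) : nat :=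
  \sum_(t : trans N) th t * pre t p.
Definition post_ms (N : petri_net) (th : tmultiset N) (p : place N) : nat :=
  \sum_(t : trans N) th t * post t p.

Definition is_empty_net (N : petri_net) : Prop :=
  #|place N| = 0 /\ #|trans N| = 0.

(** * Elementary object systems *)

(* The finite set of object nets is the family [onet] indexed by [obj]; place
   and transition sets of distinct nets are disjoint because they are distinct
   types. Two distinct members of a set of pairwise disjoint nets can only
   coincide if both are the empty net, whence [black_uniq]. The events form a
   sequence, of which only the membership predicate matters. *)
Record eos := EOS {
  sysnet : petri_net;
  obj : finType;
  onet : obj -> petri_net;
  black : obj;
  typ : place sysnet -> obj;
  idle : place sysnet -> trans sysnet;
  events : seq (trans sysnet * {dffun forall N : obj, tmultiset (onet N)});
  black_empty : is_empty_net (onet black);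
  black_uniq : forall N : obj, is_empty_net (onet N) -> N = black;
  pre_idle : forall p q : place sysnet, pre (idle p) q = (q == p);
  post_idle : forall p q : place sysnet, post (idle p) q = (q == p);
  events_idle : forall e p, e \in events -> e.1 = idle p ->
    exists t : trans (onet (typ p)), 0 < e.2 (typ p) t
}.

Definition token (E : eos) := {p : place (sysnet E) & marking (onet (typ p))}.

Notation nmarking E := {mset token E}.

Definition Pi1 (E : eos) (mu : nmarking E) (p : place (sysnet E)) : nat :=
  \sum_(x <- mu | tag x == p) 1.

(* The number of tokens on [q] in the inner marking of [x] if [x] has type [N],
   and 0 otherwise. *)
Definition inner (E : eos) (N : obj E) (q : place (onet N)) (x : token E) : nat :=
  untag 0 (fun M : marking (onet N) => M q)
    (Tagged (fun N' : obj E => marking (onet N')) (tagged x)).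

Definition Pi2 (E : eos) (N : obj E) (mu : nmarking E) (q : place (onet N)) : nat :=
  \sum_(x <- mu | typ (tag x) == N) inner q x.

Definition event (E : eos) : Type :=
  (trans (sysnet E) * {dffun forall N : obj E, tmultiset (onet N)})%type.

Definition enabled (E : eos) (e : event E) (mu la rho : nmarking E) : Prop :=
  [/\ la `<=` mu,
      (forall p, Pi1 la p = pre e.1 p),
      (forall p, Pi1 rho p = post e.1 p) &
      forall (N : obj E) (q : place (onet N)),
        pre_ms (e.2 N) q <= Pi2 la q /\
        Pi2 rho q = Pi2 la q - pre_ms (e.2 N) q + post_ms (e.2 N) q].

Definition fire (E : eos) (mu mu' : nmarking E) : Prop :=
  exists (e : event E) (la rho : nmarking E),
    [/\ e \in events E, enabled e mu la rho & mu' = (mu `\` la) `+` rho].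

Definition reachable (E : eos) : nmarking E -> nmarking E -> Prop :=
  clos_refl_trans (nmarking E) (@fire E).

Inductive token_le (E : eos) : token E -> token E -> Prop :=
| TokenLe (p : place (sysnet E)) (M M' : marking (onet (typ p))) :
    (forall q, M q <= M' q) -> token_le (existT _ p M) (existT _ p M').

Definition le_f (E : eos) (mu mu' : nmarking E) : Prop :=
  exists (s s' : seq (token E)) (nu : nmarking E),
    [/\ Forall2 (@token_le E) s s', mu = seq_mset s & mu' = seq_mset s' `+` nu].

Definition conservative (E : eos) : Prop :=
  forall t : trans (sysnet E),
    [set typ p | p in [set p | 0 < pre t p]]
      \subset [set typ p | p in [set p | 0 < post t p]].

Definition coverable (E : eos) (mu0 mut : nmarking E) : Prop :=
  exists mu1, reachable mu0 mu1 /\ le_f mut mu1.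

(** * The coverability problem as a language *)

(* Places, transitions and nets are referred to by their rank in the
   enumeration of their type, so that an instance is a list of natural numbers;
   each number is written in binary, least significant bit first, and ended by
   the separator [None]. All dimensions precede the tables they bound, so the
   word determines the instance up to renaming. *)

Fixpoint bits_of_pos (p : positive) : seq bool :=
  match p with
  | xH => [:: true]
  | xO p' => false :: bits_of_pos p'
  | xI p' => true :: bits_of_pos p'
  end.

Definition bits (n : nat) : seq bool :=
  if bin_of_nat n is Npos p then bits_of_pos p else [::].

Definition word_of_nats (s : seq nat) : seq (option bool) :=
  flatten [seq rcons (map some (bits n)) None | n <- s].

Definition code_net (N : petri_net) : seq nat :=
  [:: #|place N|; #|trans N|]
  ++ [seq pre t p | t <- enum (trans N), p <- enum (place N)]
  ++ [seq post t p | t <- enum (trans N), p <- enum (place N)].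

Definition rank (T : finType) (x : T) : nat := index x (enum T).

Definition code_event (E : eos) (e : event E) : seq nat :=
  rank e.1 ::
  flatten [seq [seq e.2 N t | t <- enum (trans (onet N))] | N <- enum (obj E)].

Definition code_eos (E : eos) : seq nat :=
  code_net (sysnet E)
  ++ #|obj E| :: flatten [seq code_net (onet N) | N <- enum (obj E)]
  ++ [seq rank (typ p) | p <- enum (place (sysnet E))]
  ++ [seq rank (idle p) | p <- enum (place (sysnet E))]
  ++ size (events E) :: flatten [seq code_event e | e <- events E].

Definition code_token (E : eos) (x : token E) : seq nat :=
  rank (tag x) :: [seq tagged x q | q <- enum (place (onet (typ (tag x))))].

Definition code_tokens (E : eos) (s : seq (token E)) : seq nat :=
  size s :: flatten [seq code_token x | x <- s].

Definition ceos_coverability (w : seq (option bool)) : Prop :=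
  exists (E : eos) (s0 st : seq (token E)),
    [/\ conservative E,
        w = word_of_nats (code_eos E ++ code_tokens s0 ++ code_tokens st) &
        coverable (seq_mset s0) (seq_mset st)].

(** * Deterministic multitape Turing machines *)

Inductive move := MoveL | Stay | MoveR.

(* [Sig] and [Del] are the input and output alphabets; a tape cell holds a
   letter of [Sig], [Del] or [work], or the blank [None]. The input is on tape
   [ord0] and the output on tape [ord_max]. *)
Record tm (Sig Del : finType) := TM {
  state : finType;
  work : finType;
  ntapes : nat;
  start : state;
  halting : pred state;
  accepting : pred state;
  delta : state -> {ffun 'I_ntapes.+1 -> option (Sig + Del + work)} ->
    state * ('I_ntapes.+1 -> option (Sig + Del + work) * move)
}.

Section Run.
Variables (Sig Del : finType) (M : tm Sig Del).

Definition cell : Type := option (Sig + Del + work M).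

Record config := Config {
  cstate : state M;
  ctape : 'I_(ntapes M).+1 -> int -> cell;
  chead : 'I_(ntapes M).+1 -> int
}.

Definition tape_of (s : seq (Sig + Del + work M)) : int -> cell :=
  fun i => if i is Posz j then onth s j else None.

Definition init (w : seq Sig) : config :=
  Config (start M)
    (fun k => tape_of (if k == ord0 then [seq inl (inl a) | a <- w] else [::]))
    (fun _ => 0%R).

Definition shift (m : move) (i : int) : int :=
  match m with MoveL => (i - 1)%R | Stay => i | MoveR => (i + 1)%R end.

Definition step (c : config) : config :=
  if halting (cstate c) then c else
  let: (q, act) := delta (cstate c) [ffun k => ctape c k (chead c k)] in
  Config q
    (fun k i => if i == chead c k then (act k).1 else ctape c k i)
    (fun k => shift (act k).2 (chead c k)).

Definition run (w : seq Sig) (n : nat) : config := iter n step (init w).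

Definition outputs (c : config) (v : seq Del) : Prop :=
  ctape c ord_max =1 tape_of [seq inl (inr b) | b <- v].

End Run.

(* [FDTime g] and [DTime g] are taken up to O(.). *)
Definition FDTime (g : nat -> nat) (Sig Del : finType)
    (f : seq Sig -> seq Del) : Prop :=
  exists (M : tm Sig Del) (C : nat), forall w : seq Sig,
    let c := run M w (C * g (size w) + C) in
    halting (cstate c) /\ outputs c (f w).

Definition DTime (g : nat -> nat) (Sig : finType) (L : seq Sig -> Prop) : Prop :=
  exists (M : tm Sig void) (C : nat), forall w : seq Sig,
    let c := run M w (C * g (size w) + C) in
    halting (cstate c) /\ (accepting (cstate c) <-> L w).

(** * The fast-growing hierarchy below omega^2 *)

(* [fast k n] is F_{omega.k + n}, for the fundamental sequences
   (omega.(k+1))(x) = omega.k + x + 1. *)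
Fixpoint fast (k : nat) : nat -> nat -> nat :=
  fix fast_k n := match n with
  | 0 => match k with 0 => S | k'.+1 => fun x => fast k' x.+1 x end
  | n'.+1 => fun x => iter x.+1 (fast_k n') x
  end.

Lemma fast_zero x : fast 0 0 x = x.+1.
Proof. by []. Qed.

Lemma fast_succ k n x : fast k n.+1 x = iter x.+1 (fast k n) x.
Proof. by case: k. Qed.

Lemma fast_limit k x : fast k.+1 0 x = fast k x.+1 x.
Proof. by []. Qed.

Definition F_omega2 : nat -> nat := fast 2 0.

(* The union over beta < omega.2 of the levels of the extended Grzegorczyk
   hierarchy. Level beta is the union over c of FDTime(F_beta^c(n)) for
   beta >= 2; the terms for beta < 2 add nothing to the union. *)
Definition FGH_lt_omega2 (Sig Del : finType) (f : seq Sig -> seq Del) : Prop :=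
  exists k n c : nat, k < 2 /\ FDTime (iter c (fast k n)) f.

(* Numerical functions are computed in unary. *)
Definition FGH_lt_omega2_nat (p : nat -> nat) : Prop :=
  FGH_lt_omega2 (fun w : seq unit => nseq (p (size w)) tt).

Definition class_F_omega2 (Sig : finType) (L : seq Sig -> Prop) : Prop :=
  exists p : nat -> nat,
    FGH_lt_omega2_nat p /\ DTime (fun n => F_omega2 (p n)) L.

(* Hardness under many-one reductions from the levels below omega.2. *)
Definition F_omega2_hard (Del : finType) (A : seq Del -> Prop) : Prop :=
  forall (Sig : finType) (L : seq Sig -> Prop), class_F_omega2 L ->
    exists f : seq Sig -> seq Del,
      FGH_lt_omega2 f /\ forall w, L w <-> A (f w).

(* Main.v *)
Require Import Defs.
From Stdlib Require Import List Relation_Operators FunctionalExtensionality.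
From mathcomp Require Import all_boot all_order all_algebra.
From mathcomp Require Import finmap multiset.
From mathcomp Require Import zify.

Set Implicit Arguments.
Unset Strict Implicit.
Unset Printing Implicit Defensive.

Local Open Scope nat_scope.

(** A nested marking provides registers that can only be tested for zero by
    discarding them, that is, up to losses, together with unboundedly many stored
    records. Expanding F_{omega+k}(1) step by step, such a machine can compute
    any value up to V = F_{omega+k}(1): each passage to the limit level stores a
    snapshot of the current expansion in a record. The same expansion can be run
    backwards, matching the stored snapshots, and returns to its starting point
    only if it is entered with at least the value V. In between, a Turing machine
    is simulated with counters that are paid for by the value obtained, and the
    payment is recovered at the end; hence a loss, and in particular a wrong zero
    test, leaves less than V and prevents the return. So the final configuration is
    coverable exactly when the machine accepts with counters of total mass V.

    For a machine running in time F_{omega 2}(p(n)) it suffices to take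
    k = n + T(n) + c, where T(n) >= p(n) is the running time of a machine
    computing p. The instance for k is a primitive recursive function of k and of
    the input, so the reduction takes a time primitive recursive in T(n), which
    stays below the level omega 2. *)

(** * The fast-growing hierarchy *)

(** The counters [c_0, ..., c_k] handle the levels from omega on, where each level unfolds into the
    one below. The obstacle is the limit step F_omega(x) = F_{x+1}(x): it needs x+1 finite levels,
    an unbounded number that no fixed set of registers can hold. Records supply them, on the way up
    as items (u, a) standing for a pending applications of F_u, on the way down as the frames of a
    recursion. But bags are unordered and retrieval is a guess, so a record may come back at the
    wrong moment or be left over from another limit step. Snapshots and frames are therefore tagged
    with the counters, and tags are compared on retrieval, though only up to losses. Soundness never
    argues outright that a record is the right one. It follows the value still promised by the
    state, which never exceeds V going up and stays below V going down once anything was lost; at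
    the value V, strict monotonicity turns the inequalities met on the way into equalities, and only
    then are the tags known to agree. On the net side, an event that takes a record must also put
    one, so whatever is discarded goes to a garbage place. *)

Section Iterates.
Variable f : nat -> nat.
Hypothesis f_gt : forall x, x < f x.
Hypothesis f_mono : {homo f : x y / x < y}.

Lemma f_leq_mono : {homo f : x y / x <= y}.
Proof. by move=> x y; rewrite leq_eqVlt => /orP[/eqP->//|/f_mono/ltnW]. Qed.

Lemma iter_leq_arg n : {homo iter n f : x y / x <= y}.
Proof. by elim: n => //= n IH x y /IH/f_leq_mono. Qed.

Lemma iter_ltn_arg n : {homo iter n f : x y / x < y}.
Proof. by elim: n => //= n IH x y /IH/f_mono. Qed.

Lemma leq_iter_addn n x : n + x <= iter n f x.
Proof. by elim: n => //= n IH; exact: leq_ltn_trans (f_gt _). Qed.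

Lemma leq_iter_count m n x : m <= n -> iter m f x <= iter n f x.
Proof.
move=> le_mn; rewrite -(subnK le_mn) iterD.
by apply: leq_trans (leq_iter_addn _ _); rewrite leq_addl.
Qed.

Lemma leq_iter2 m n x y : m <= n -> x <= y -> iter m f x <= iter n f y.
Proof. by move=> mn xy; apply: leq_trans (iter_leq_arg _ xy); apply: leq_iter_count. Qed.

Lemma iter_ltn_count m n x : m < n -> iter m f x < iter n f x.
Proof.
move=> le_mn; apply: leq_trans (leq_iter_count _ le_mn).
by rewrite iterS f_gt.
Qed.

Lemma leq_iter_self n x : x <= iter n f x.
Proof. by apply: leq_trans (leq_iter_addn _ _); rewrite leq_addl. Qed.

End Iterates.

(** Growth and monotonicity go together because a limit level needs both at all levels below it.
    There the index grows along with the argument, so monotonicity also uses that the levels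
    increase pointwise, which in turn follows from growth one level down. *)
Lemma fast_mono_gt k n :
  (forall x, x < fast k n x) /\ {homo fast k n : x y / x < y}.
Proof.
have stp j m : (forall x, x < fast j m x) /\ {homo fast j m : x y / x < y} ->
    (forall x, x < fast j m.+1 x) /\ {homo fast j m.+1 : x y / x < y}.
  case=> gt mono; split=> [x|x y xy]; rewrite !fast_succ.
    by apply: leq_trans (leq_iter_addn gt _ _); rewrite addSn ltnS leq_addl.
  apply: leq_trans (iter_ltn_arg mono _ xy) _.
  by apply: leq_iter_count => //; rewrite ltnS ltnW.
elim: k n => [|k IH].
  elim=> [|n IHn]; [by split=> x //=; rewrite ltnS | exact: stp].
elim=> [|n IHn]; last exact: stp.
split=> [x|x y xy]; rewrite !fast_limit; first by case: (IH x.+1).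
have [_ mono] := IH x.+1.
apply: leq_trans (mono _ _ xy) _.
have: x.+1 <= y.+1 by apply: ltnW.
elim: y.+1 {xy mono} => [|m IHm]; first by [].
rewrite leq_eqVlt => /orP[/eqP->//|/IHm le]; apply: leq_trans le _.
rewrite fast_succ iterSr.
have [gt mono] := IH m.
exact: leq_iter_self.
Qed.

Lemma fast_gt k n x : x < fast k n x. Proof. exact: (fast_mono_gt k n).1. Qed.
Lemma fast_ltn k n : {homo fast k n : x y / x < y}. Proof. exact: (fast_mono_gt k n).2. Qed.
Lemma fast_leq k n : {homo fast k n : x y / x <= y}.
Proof. exact: f_leq_mono (@fast_ltn k n). Qed.

Lemma leq_fast_index k m n x : m <= n -> fast k m x <= fast k n x.
Proof.
elim: n => [|n IH]; first by rewrite leqn0 => /eqP->.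
rewrite leq_eqVlt => /orP[/eqP->//|/IH le]; apply: leq_trans le _.
rewrite fast_succ iterS; apply: fast_leq; apply: leq_iter_self; exact: fast_gt.
Qed.

Lemma leq_fast k m n x y : m <= n -> x <= y -> fast k m x <= fast k n y.
Proof. by move=> mn xy; apply: leq_trans (fast_leq k n xy); apply: leq_fast_index. Qed.

(** By induction on [u]: the iterates of [F_u] that make up [F_{u+1}] let [F_v] pass one at a time,
    and starting from [F_v x] instead of [x] only adds rounds. *)
Lemma fast_comm k v u x : v <= u -> fast k v (fast k u x) <= fast k u (fast k v x).
Proof.
elim: u x => [|u IH] x; first by rewrite leqn0 => /eqP->.
rewrite leq_eqVlt => /orP[/eqP->//|]; rewrite ltnS => vu.
have key n y : fast k v (iter n (fast k u) y) <= iter n (fast k u) (fast k v y).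
  elim: n y => //= n IHn y; apply: leq_trans (IH _ vu) _; exact: fast_leq.
rewrite !fast_succ; apply: leq_trans (key _ _) _.
by apply: leq_iter_count; [exact: fast_gt | rewrite ltnS ltnW // fast_gt].
Qed.

(** * Towers of iterates *)

Definition upd (f : nat -> nat) (i v : nat) : nat -> nat := fun j => if j == i then v else f j.

Lemma updE f i v j : upd f i v j = if j == i then v else f j. Proof. by []. Qed.

(* [tower k a n x] is F_{n-1}^{a (n-1)} (... (F_0^{a 0} x)), with [F_i = fast k i]. *)
Fixpoint tower (k : nat) (a : nat -> nat) (n x : nat) : nat :=
  if n is n'.+1 then iter (a n') (fast k n') (tower k a n' x) else x.

Section Tower.
Variable k : nat.
Local Notation tower := (tower k).
Local Notation F := (fast k).

Lemma eq_tower a b n x : (forall i, i < n -> a i = b i) -> tower a n x = tower b n x.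
Proof.
elim: n => //= n IH eq; rewrite eq ?IH // => i lt; apply: eq; exact: ltnW.
Qed.

Lemma leq_tower a b n x y : (forall i, i < n -> a i <= b i) -> x <= y ->
  tower a n x <= tower b n y.
Proof.
elim: n => //= n IH le xy; apply: leq_iter2; [exact: fast_gt|exact: fast_ltn|exact: le|].
by apply: IH => // i lt; apply: le; exact: ltnW.
Qed.

Lemma tower_ltn a n : {homo tower a n : x y / x < y}.
Proof. elim: n => //= n IH x y /IH; apply: iter_ltn_arg; exact: fast_ltn. Qed.

Lemma leq_tower_self a n x : x <= tower a n x.
Proof. by elim: n => //= n /leq_trans; apply; apply: leq_iter_self; exact: fast_gt. Qed.

(** Strict monotonicity in every coefficient and in the argument makes towers rigid: if no value is
    lost, every ingredient is intact. All later arguments that a run without loss of value was exact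
    come down to this. *)
Lemma tower_eq_inv a b n x y : (forall i, i < n -> a i <= b i) -> x <= y ->
  tower b n y <= tower a n x -> (forall i, i < n -> a i = b i) /\ x = y.
Proof.
elim: n x y => [|n IH] x y le xy /=; first by move=> yx; split=> //; apply/eqP; rewrite eqn_leq xy.
move=> le2.
have le' i : i < n -> a i <= b i by move=> lt; apply: le; exact: ltnW.
have leT := leq_tower le' xy.
have lea : b n <= a n.
  rewrite leqNgt; apply/negP => lt.
  have := iter_ltn_count (@fast_gt k n) (tower a n x) lt.
  have := iter_leq_arg (@fast_ltn k n) (b n) leT.
  by move: le2; lia.
have eqa : a n = b n by apply/eqP; rewrite eqn_leq lea le.
have leT' : tower b n y <= tower a n x.
  rewrite leqNgt; apply/negP => lt.
  by have := iter_ltn_arg (@fast_ltn k n) (b n) lt; move: le2; rewrite eqa; lia.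
have [eqs ->] := IH _ _ le' xy leT'; split=> // i.
by rewrite ltnS leq_eqVlt => /orP[/eqP->|/eqs].
Qed.

Lemma tower0 a n x : (forall i, i < n -> a i = 0) -> tower a n x = x.
Proof.
by elim: n => //= n IH a0; rewrite a0 //= IH // => i ?; apply: a0; exact: ltnW.
Qed.

(** The levels below [m] act first, so they can be evaluated and handed over as a new argument. A
    local change of coefficients then reduces to comparing two inner values. *)
Lemma tower_cat a m n x : m <= n ->
  tower a n x = tower (fun i => if i < m then 0 else a i) n (tower a m x).
Proof.
elim: n => [|n IH]; first by rewrite leqn0 => /eqP->.
rewrite leq_eqVlt => /orP[/eqP->|lt].
  by rewrite [RHS]tower0 // => i ->.
by rewrite ltnS in lt; rewrite /= (IH lt) ltnNge lt.
Qed.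

(** One application of [F_{i+1}] to [z] amounts to [z+1] applications of [F_i]. Here [z] is the
    value reached after level [i], which is at least [y], so the [m+1] applications received are at
    most what is given up. *)
Lemma tower_expand a i n y m : i.+1 < n -> m <= y -> 0 < a i.+1 ->
  tower (upd (upd a i.+1 (a i.+1).-1) i (a i + m.+1)) n y <= tower a n y.
Proof.
move=> lt my pos; rewrite (tower_cat _ _ lt) [X in _ <= X](tower_cat _ _ lt).
set b := upd _ _ _; apply: leq_tower.
  move=> j _; case: ifP => // /negbT; rewrite -leqNgt /b /upd => ji.
  by rewrite !gtn_eqF //; lia.
rewrite /= {1 2}/b !updE !eqxx gtn_eqF //.
have -> : tower b i y = tower a i y.
  by apply: eq_tower => j ji; rewrite /b !updE !ltn_eqF //; lia.
case: (a i.+1) pos => // q _; rewrite [_.-1]/= iterSr.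
apply: iter_leq_arg; first exact: fast_ltn.
rewrite fast_succ addnC iterD; apply: leq_iter_count; first exact: fast_gt.
rewrite ltnS; apply: leq_trans my _; apply: leq_trans (leq_tower_self a i y) _.
by apply: leq_iter_self; exact: fast_gt.
Qed.

(** The converse of [tower_expand] needs everything below level [i+1] to be given up: then
    [F_{i+1} y] is [F_i^{y+1} y], and [a i >= y+1] applications were available. This is why the
    backward phase clears the lower counters. *)
Lemma tower_contract a b i n x y m : i.+1 < n -> y <= m -> m < a i -> y <= x ->
  (forall j, j <= i -> b j = 0) -> b i.+1 = (a i.+1).+1 ->
  (forall j, i.+1 < j < n -> b j = a j) ->
  tower b n y <= tower a n x.
Proof.
move=> lt ym ma yx b0 b1 b2; rewrite (tower_cat _ _ lt) [X in _ <= X](tower_cat _ _ lt).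
apply: leq_tower.
  by move=> j jn; case: ifP => // /negbT; rewrite -leqNgt => ji; rewrite b2 // ji.
have -> : tower b i.+2 y = iter (a i.+1) (F i.+1) (F i.+1 y).
  rewrite [LHS]/= b1 b0 // -iterSr.
  by congr iter; rewrite /= tower0 // => j ji; rewrite b0 // ltnW.
rewrite /=; apply: iter_leq_arg; first exact: fast_ltn.
rewrite fast_succ; apply: leq_iter2; [exact: fast_gt|exact: fast_ltn| |].
  exact: leq_trans ma.
exact: leq_trans (leq_tower_self _ _ _).
Qed.

Lemma tower_comm a n u x : n <= u -> tower a n (F u x) <= F u (tower a n x).
Proof.
elim: n => //= n IH lt.
have key q y z : y <= F u z -> iter q (F n) y <= F u (iter q (F n) z).
  move=> le; elim: q => //= q IHq; apply: leq_trans (fast_leq _ _ IHq) _.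
  by apply: fast_comm; exact: ltnW.
by apply: key; apply: IH; exact: ltnW.
Qed.

Lemma tower_next a n u x y : u < n -> 0 < a u -> y <= F u x ->
  tower (upd a u (a u).-1) n y <= tower a n x.
Proof.
move=> lt pos le; rewrite (tower_cat _ _ lt) [X in _ <= X](tower_cat _ _ lt).
set b := upd _ _ _; apply: leq_tower.
  by move=> j _; case: ifP => // /negbT; rewrite -leqNgt /b /upd => ji; rewrite gtn_eqF.
rewrite /= /b updE eqxx.
have -> : tower b u y = tower a u y.
  by apply: eq_tower => j ji; rewrite /b updE ltn_eqF.
case: (a u) pos => // q _; rewrite [_.-1]/= iterSr.
apply: iter_leq_arg; first exact: fast_ltn.
by apply: leq_trans (tower_comm _ _ (leqnn u)); apply: leq_tower.
Qed.

(** Lower levels are worth less although they act earlier: each of the [m] applications of [F_v] is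
    first raised to one of [F_u], which [tower_comm] then carries past the levels in between. *)
Lemma tower_exchange a v u n x m : v <= u < n -> m <= a u ->
  tower (upd (upd a u (a u - m)) v (if v == u then a u else a v + m)) n x <= tower a n x.
Proof.
case/andP=> vu lt ma; have [->|neq] := eqVneq v u.
  apply: leq_tower => // i _; rewrite !updE; case: eqP => // ->; exact: leqnn.
have {neq vu} vu : v < u by rewrite ltn_neqAle neq.
rewrite (tower_cat _ _ lt) [X in _ <= X](tower_cat _ _ lt).
set b := upd _ _ _; apply: leq_tower.
  move=> j _; case: ifP => // /negbT; rewrite -leqNgt /b /upd => ji.
  by rewrite !gtn_eqF //; lia.
rewrite /= {1}/b !updE (gtn_eqF vu) eqxx -{2}(subnK ma) iterD.
apply: iter_leq_arg; first exact: fast_ltn.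
rewrite (tower_cat _ _ vu) [X in _ <= iter m _ X](tower_cat _ _ vu).
have -> : tower b v.+1 x = iter m (F v) (tower a v.+1 x).
  rewrite /= /b !updE eqxx addnC iterD; congr (iter _ _ (iter _ _ _)).
  by apply: eq_tower => j jv; rewrite !updE !ltn_eqF //; lia.
set y := tower a v.+1 x; set d := fun i => if i < v.+1 then 0 else a i.
have -> : tower (fun i => if i < v.+1 then 0 else b i) u (iter m (F v) y) =
          tower d u (iter m (F v) y).
  apply: eq_tower => j ju; rewrite /d; case: ifP => // /negbT; rewrite -leqNgt /b !updE => vj.
  by rewrite gtn_eqF // ltn_eqF.
elim: m {ma b} => //= m IH.
apply: leq_trans (fast_leq _ _ IH); apply: leq_trans (tower_comm _ _ (leqnn u)).
by apply: leq_tower => //; apply: leq_fast_index; exact: ltnW.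
Qed.

End Tower.

Arguments fast : simpl never.

(** * Regular programs and their control graphs *)

(** Programs are regular expressions over atoms, so that each refinement of the atoms, from counters
    over registers to tokens, carries over to whole programs by [sem_bind_sound] and
    [sem_bind_complete]. *)
Inductive prog (A : Type) : Type :=
| Eps | Fail | At of A | Seq of prog A & prog A | Alt of prog A & prog A | Star of prog A.
Arguments Eps {A}.
Arguments Fail {A}.

Notation "p ;; q" := (Seq p q) (at level 65, right associativity).

Definition alts A (ps : seq (prog A)) : prog A := foldr (@Alt A) Fail ps.
Definition seqs A (ps : seq (prog A)) : prog A := foldr (@Seq A) Eps ps.

Inductive star (S : Type) (R : S -> S -> Prop) : S -> S -> Prop :=
| StarRefl x : star R x x
| StarStep x y z : R x y -> star R y z -> star R x z.

Lemma star_trans S (R : S -> S -> Prop) x y z : star R x y -> star R y z -> star R x z.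
Proof. by elim=> // {}x y' {}y r _ IH /IH; apply: StarStep. Qed.

Lemma star1 S (R : S -> S -> Prop) x y : R x y -> star R x y.
Proof. by move=> r; apply: StarStep r (StarRefl _ _). Qed.

Lemma star_rcons S (R : S -> S -> Prop) x y z : star R x y -> R y z -> star R x z.
Proof. by move=> st r; apply: star_trans st (star1 r). Qed.

Lemma star_inv S (R : S -> S -> Prop) (P : S -> Prop) x y :
  (forall a b, P a -> R a b -> P b) -> star R x y -> P x -> P y.
Proof. by move=> cl; elim=> // {}x y' {}y r _ IH /cl/(_ r)/IH. Qed.

Section Sem.
Variables (A S : Type) (step : A -> S -> S -> Prop).

Fixpoint sem (p : prog A) : S -> S -> Prop :=
  match p with
  | Eps => fun s s' => s' = s
  | Fail => fun _ _ => False
  | At a => step a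
  | Seq p q => fun s s' => exists s1, sem p s s1 /\ sem q s1 s'
  | Alt p q => fun s s' => sem p s s' \/ sem q s s'
  | Star p => star (sem p)
  end.

Lemma semS p q s s' : sem (p ;; q) s s' <-> exists s1, sem p s s1 /\ sem q s1 s'.
Proof. by []. Qed.

Lemma semAlt p q s s' : sem (Alt p q) s s' <-> sem p s s' \/ sem q s s'.
Proof. by []. Qed.

Lemma semStar p s s' : sem (Star p) s s' <-> star (sem p) s s'.
Proof. by []. Qed.

Lemma sem_seq p q s s1 s' : sem p s s1 -> sem q s1 s' -> sem (p ;; q) s s'.
Proof. by exists s1. Qed.

Lemma sem_star0 p s : sem (Star p) s s.
Proof. exact: StarRefl. Qed.

Lemma sem_starS p s s1 s' : sem p s s1 -> sem (Star p) s1 s' -> sem (Star p) s s'.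
Proof. exact: StarStep. Qed.

End Sem.
Lemma sem_alts A S (step : A -> S -> S -> Prop) ps s s' :
  sem step (alts ps) s s' <-> exists p, List.In p ps /\ sem step p s s'.
Proof.
elim: ps => [|p ps IH] /=; first by split=> // -[? []].
split=> [[sm|/IH[q [i sm]]]|[q [[<-|i] sm]]].
- by exists p; split=> //; left.
- by exists q; split=> //; right.
- by left.
- by right; apply/IH; exists q.
Qed.

Fixpoint bindp A B (f : A -> prog B) (p : prog A) : prog B :=
  match p with
  | Eps => Eps
  | Fail => Fail
  | At a => f a
  | Seq p q => Seq (bindp f p) (bindp f q)
  | Alt p q => Alt (bindp f p) (bindp f q)
  | Star p => Star (bindp f p)
  end.

Section Simulation.
Variables (A B S T : Type) (stepA : A -> S -> S -> Prop) (stepB : B -> T -> T -> Prop).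
Variables (f : A -> prog B) (R : S -> T -> Prop).

Lemma sem_bind_sound p s t t' :
  (forall a s t t', R s t -> sem stepB (f a) t t' -> exists s', stepA a s s' /\ R s' t') ->
  R s t -> sem stepB (bindp f p) t t' -> exists s', sem stepA p s s' /\ R s' t'.
Proof.
move=> sim; elim: p s t t' => [||a|p IHp q IHq|p IHp q IHq|p IHp] s t t' r /=.
- by move=> ->; exists s.
- by [].
- exact: sim.
- case=> t1 [/(IHp _ _ _ r)[s1 [sp r1]] /(IHq _ _ _ r1)[s' [sq r']]].
  by exists s'; split=> //; exists s1.
- case=> [/(IHp _ _ _ r)|/(IHq _ _ _ r)] [s' [sm r']]; exists s'; split=> //; by [left|right].
- move=> st; elim: st s r => [{}t|{}t t1 {}t' tt1 _ IH] s r.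
    by exists s; split=> //; constructor.
  have [s1 [ss1 /IH[s' [st r']]]] := IHp _ _ _ r tt1.
  by exists s'; split=> //; apply: StarStep ss1 st.
Qed.

Lemma sem_bind_complete p s s' t :
  (forall a s s' t, R s t -> stepA a s s' -> exists t', sem stepB (f a) t t' /\ R s' t') ->
  R s t -> sem stepA p s s' -> exists t', sem stepB (bindp f p) t t' /\ R s' t'.
Proof.
move=> sim; elim: p s s' t => [||a|p IHp q IHq|p IHp q IHq|p IHp] s s' t r /=.
- by move=> ->; exists t.
- by [].
- exact: sim.
- case=> s1 [/(IHp _ _ _ r)[t1 [sp r1]] /(IHq _ _ _ r1)[t' [sq r']]].
  by exists t'; split=> //; exists t1.
- case=> [/(IHp _ _ _ r)|/(IHq _ _ _ r)] [t' [sm r']]; exists t'; split=> //; by [left|right].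
- move=> st; elim: st t r => [{}s|{}s s1 {}s' ss1 _ IH] t r.
    by exists t; split=> //; constructor.
  have [t1 [tt1 /IH[t' [st r']]]] := IHp _ _ _ r ss1.
  by exists t'; split=> //; apply: StarStep tt1 st.
Qed.

End Simulation.

Fixpoint psize A (p : prog A) : nat :=
  match p with
  | Eps | Fail | At _ => 1
  | Seq p q => psize p + psize q
  | Alt p q => (psize p + psize q).+3
  | Star p => (psize p).+2
  end.

Definition edge (A : Type) : Type := (nat * option A * nat)%type.

(* The control graph of [p] lives on the states [a, ..., a + psize p], with
   entry [a] and exit [a + psize p]; no edge leaves the exit. *)
Fixpoint graph A (p : prog A) (a : nat) : seq (edge A) :=
  match p with
  | Eps => [:: (a, None, a.+1)]
  | Fail => [::]
  | At m => [:: (a, Some m, a.+1)]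
  | Seq p q => graph p a ++ graph q (a + psize p)
  | Alt p q =>
      [:: (a, None, a.+1); (a, None, a.+2 + psize p);
          (a.+1 + psize p, None, a.+3 + (psize p + psize q));
          (a.+2 + psize p + psize q, None, a.+3 + (psize p + psize q))]
      ++ graph p a.+1 ++ graph q (a.+2 + psize p)
  | Star p =>
      [:: (a, None, a.+1); (a.+1 + psize p, None, a); (a, None, a.+2 + psize p)]
      ++ graph p a.+1
  end.

Section Graph.
Variables (A S : Type) (step : A -> S -> S -> Prop).

Definition lstep (l : option A) : S -> S -> Prop :=
  if l is Some m then step m else fun s s' => s' = s.

Definition gstep (tbl : seq (edge A)) (c c' : nat * S) : Prop :=
  exists l, List.In (c.1, l, c'.1) tbl /\ lstep l c.2 c'.2.

Lemma psize_gt0 (p : prog A) : 0 < psize p.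
Proof. by elim: p => //= p + q _; rewrite addn_gt0 => ->. Qed.

Lemma graph_range (p : prog A) a q l q' : List.In (q, l, q') (graph p a) ->
  (a <= q < a + psize p) /\ (a <= q' <= a + psize p).
Proof.
elim: p a => [||m|p IHp r IHr|p IHp r IHr|p IHp] a /=.
- by case=> // -[<- _ <-]; lia.
- by [].
- by case=> // -[<- _ <-]; lia.
- by move=> /List.in_app_iff[/IHp|/IHr]; have := psize_gt0 r; lia.
- by case=> [[<- _ <-]|[[<- _ <-]|[[<- _ <-]|[[<- _ <-]|/List.in_app_iff[/IHp|/IHr]]]]]; lia.
- by case=> [[<- _ <-]|[[<- _ <-]|[[<- _ <-]|/IHp]]]; lia.
Qed.

Lemma graph_complete (p : prog A) a tbl s s' : List.incl (graph p a) tbl ->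
  sem step p s s' -> star (gstep tbl) (a, s) (a + psize p, s').
Proof.
have edge1 q l q' t t' : List.In (q, l, q') tbl -> lstep l t t' ->
    star (gstep tbl) (q, t) (q', t') by move=> i st; apply: star1; exists l.
have edge0 q q' t : List.In (q, None, q') tbl -> star (gstep tbl) (q, t) (q', t).
  by move=> i; apply: (edge1 _ None).
elim: p a s s' => [||m|p IHp r IHr|p IHp r IHr|p IHp] a s s' /= sub.
- by move=> ->; rewrite addn1; apply: edge0; apply: sub; left.
- by [].
- by move=> st; rewrite addn1; apply: (edge1 _ (Some m)) => //; apply: sub; left.
- case=> s1 [sp sr]; apply: star_trans (IHp _ _ _ _ sp) _.
    by move=> e i; apply: sub; apply/List.in_app_iff; left.
  rewrite addnA; apply: IHr sr => e i; apply: sub; apply/List.in_app_iff; by right.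
- rewrite !addnS -!addSn; case=> sp.
    apply: star_trans (edge0 _ _ _ (sub _ _)) _; first by left.
    apply: star_trans (IHp _ _ _ _ sp) _.
      by move=> e i; apply: sub; do 4 right; apply/List.in_app_iff; left.
    by apply: edge0; apply: sub; right; right; left.
  apply: star_trans (edge0 _ _ _ (sub _ _)) _; first by right; left.
  apply: star_trans (IHr _ _ _ _ sp) _.
    by move=> e i; apply: sub; do 4 right; apply/List.in_app_iff; right.
  by apply: edge0; apply: sub; right; right; right; left.
- move=> st; rewrite !addnS -!addSn; elim: st => [t|t t1 t2 sp _ IH].
    by apply: edge0; apply: sub; right; right; left.
  apply: star_trans (edge0 _ _ _ (sub _ _)) _; first by left.
  apply: star_trans (IHp _ _ _ _ sp) _.
    by move=> e i; apply: sub; do 3 right.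
  by apply: star_trans IH; apply: edge0; apply: sub; right; left.
Qed.

(* [at_state p a q s s']: a run of [p] started in [s] can be in control state
   [q] with memory [s']. *)
Fixpoint at_state (p : prog A) (a q : nat) (s s' : S) : Prop :=
  match p with
  | Eps => (q = a \/ q = a.+1) /\ s' = s
  | Fail => q = a /\ s' = s
  | At m => (q = a /\ s' = s) \/ (q = a.+1 /\ step m s s')
  | Seq p r => at_state p a q s s' \/
      exists s1, sem step p s s1 /\ at_state r (a + psize p) q s1 s'
  | Alt p r => [\/ q = a /\ s' = s, at_state p a.+1 q s s',
      at_state r (a.+2 + psize p) q s s' |
      q = a.+3 + (psize p + psize r) /\ (sem step p s s' \/ sem step r s s')]
  | Star p => exists s1, star (sem step p) s s1 /\
      [\/ q = a /\ s' = s1, at_state p a.+1 q s1 s' | q = a.+2 + psize p /\ s' = s1]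
  end.

Lemma at_entry p a s : at_state p a a s s.
Proof.
elim: p a s => [||m|p IHp r _|p _ r _|p _] a s /=; [by split; [left|]|by []|by left| by left; apply: IHp|..].
  by apply: Or41.
by exists s; split; [constructor|apply: Or31].
Qed.

Lemma at_range p a q s s' : at_state p a q s s' -> a <= q <= a + psize p.
Proof.
elim: p a s s' => [||m|p IHp r IHr|p IHp r IHr|p IHp] a s s' /=.
- by case=> -[->|->] _; lia.
- by case=> -> _; lia.
- by case=> -[-> _]; lia.
- by case=> [/IHp|[s1 [_ /IHr]]]; lia.
- by case=> [[-> _]|/IHp|/IHr|[-> _]]; lia.
- by case=> s1 [_ [[-> _]|/IHp|[-> _]]]; lia.
Qed.

Lemma at_exit p a s s' : at_state p a (a + psize p) s s' -> sem step p s s'.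
Proof.
elim: p a s s' => [||m|p IHp r IHr|p IHp r IHr|p IHp] a s s' /=.
- by case.
- by case; lia.
- by case=> -[] //; lia.
- case=> [/at_range|[s1 [sp]]]; first by have := psize_gt0 r; lia.
  by rewrite addnA => /IHr; exists s1.
- by case=> [[]|/at_range|/at_range|[]] //; lia.
- by case=> s1 [st [[]|/at_range|[_ ->]]] //; lia.
Qed.

Lemma at_exit' p a b s s' : b = a + psize p -> at_state p a b s s' -> sem step p s s'.
Proof. by move=> ->; apply: at_exit. Qed.

(** An edge of a subprogram leaves only states of its own range, so cases that mix two components
    are closed by [graph_range] against [at_range]. The state shared by the two parts of a sequence
    is exit of the first and entry of the second, and all edges leaving it belong to the second. *)
Lemma at_step p a q l q' s s' s'' : at_state p a q s s' ->
  List.In (q, l, q') (graph p a) -> lstep l s' s'' -> at_state p a q' s s''.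
Proof.
elim: p a s => [||m|p IHp r IHr|p IHp r IHr|p IHp] a s /=.
- by move=> [_ ->] [] // -[_ <- <-] /= ->; split; [right|].
- by [].
- move=> at1 [] // -[eq <- <-] st; right; split=> //.
  by case: at1 => -[]; [move=> _ <-|lia].
- move=> at1 /List.in_app_iff[i st|i st].
    left; case: at1 => [/IHp|[s1 [_ /at_range]]]; [by apply|].
    by have := graph_range i; lia.
  right; case: at1 => [at1|[s1 [sp /IHr at1]]]; last by exists s1; split=> //; apply: at1.
  have eq : q = a + psize p by have := graph_range i; have := at_range at1; lia.
  by exists s'; split; [apply: at_exit' eq at1 | apply: IHr i st; rewrite eq; apply: at_entry].
- move=> at1 [[qa <- <-]|[[qa <- <-]|[[qa <- <-]|[[qa <- <-]|]]]] /=.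
  + move=> ->; case: at1 => [[_ ->]|/at_range|/at_range|[]]; try lia.
    by apply: Or42; apply: at_entry.
  + move=> ->; case: at1 => [[_ ->]|/at_range|/at_range|[]]; try lia.
    by apply: Or43; apply: at_entry.
  + move=> ->; case: at1 => [[]|at1|/at_range|[]]; try lia.
    by apply: Or44; split=> //; left; apply: at_exit' at1.
  + move=> ->; case: at1 => [[]|/at_range|at1|[]]; try lia.
    by apply: Or44; split=> //; right; apply: at_exit' at1.
  + case/List.in_app_iff=> i st; have := graph_range i => rg.
      case: at1 => [[]|at1|/at_range|[]]; try lia.
      by apply: Or42; apply: IHp at1 i st.
    case: at1 => [[]|/at_range|at1|[]]; try lia.
    by apply: Or43; apply: IHr at1 i st.
- case=> s1 [st at1] [[qa <- <-]|[[qa <- <-]|[[qa <- <-]|]]] /=.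
  + move=> ->; case: at1 => [[_ ->]|/at_range|[]]; try lia.
    by exists s1; split=> //; apply: Or32; apply: at_entry.
  + move=> ->; case: at1 => [[]|at1|[]]; try lia.
    by exists s'; split; [apply: star_rcons st _; apply: at_exit' at1|apply: Or31].
  + move=> ->; case: at1 => [[_ ->]|/at_range|[]]; try lia.
    by exists s1; split=> //; apply: Or33.
  + move=> i lst; have := graph_range i => rg.
    case: at1 => [[]|at1|[]]; try lia.
    by exists s1; split=> //; apply: Or32; apply: IHp at1 i lst.
Qed.

Lemma graph_sound p a s q s' : star (gstep (graph p a)) (a, s) (q, s') ->
  q = a + psize p -> sem step p s s'.
Proof.
move=> st eq; apply: (at_exit' eq).
suff: at_state p a (q, s').1 s (q, s').2 by [].
apply: (@star_inv _ _ (fun c => at_state p a c.1 s c.2)) st _ => [[? t] [? t'] /= at1 [l [i ls]]|].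
  exact: at_step at1 i ls.
exact: at_entry.
Qed.

End Graph.

Arguments sem : simpl never.

Ltac upds :=
  rewrite ?updE /=;
  repeat match goal with |- context [@eq_op _ ?a ?b] => case: (@eqP _ a b) => [?|?] end;
  subst; try lia.

(** * A register machine with bags of records *)

(* Even variables are the fields of the current record, odd ones are registers.
   [iv] is a loop index bounded by [k]; a reference [(b, true)] denotes the
   variable [b + 4 * iv]. *)
Record rst := Rst { iv : nat; rg : nat -> nat; bg : nat -> seq (seq nat) }.

Definition ref := (nat * bool)%type.
Definition ev (i : nat) (r : ref) : nat := r.1 + (if r.2 then 4 * i else 0).

Inductive ctl := CZero | CInc | CDec | CTop | CBot.

Inductive ratom :=
| RInc of ref | RDec of ref | RRst of ref | RSto of nat | RGet of nat | RClr | RCtl of ctl.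

Definition updb (f : nat -> seq (seq nat)) (b : nat) (l : seq (seq nat)) :=
  fun j => if j == b then l else f j.

Definition setv (v : seq nat) (g : nat -> nat) : nat -> nat :=
  fun x => if odd x then g x else nth 0 v x./2.

Definition cstep (k : nat) (c : ctl) (i j : nat) : Prop :=
  match c with
  | CZero => j = 0
  | CInc => i < k /\ j = i.+1
  | CDec => 0 < i /\ j = i.-1
  | CTop => i = k /\ j = i
  | CBot => i = 0 /\ j = i
  end.

Section Registers.
Variables k nf : nat.

Definition rvec (g : nat -> nat) : seq nat := mkseq (fun f => g f.*2) nf.

(** Only odd variables can be reset: the fields of the current record share one token, which can
    only be discarded as a whole. [RGet] picks any record of the bag, and the order of the list has
    no influence on what can be fetched. *)
Definition rstep (a : ratom) (s s' : rst) : Prop :=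
  match a with
  | RInc r => let v := ev (iv s) r in
      v < nf.*2 /\ s' = Rst (iv s) (upd (rg s) v (rg s v).+1) (bg s)
  | RDec r => let v := ev (iv s) r in
      [/\ v < nf.*2, 0 < rg s v & s' = Rst (iv s) (upd (rg s) v (rg s v).-1) (bg s)]
  | RRst r => let v := ev (iv s) r in
      [/\ odd r.1, v < nf.*2 & s' = Rst (iv s) (upd (rg s) v 0) (bg s)]
  | RSto b => 4 + b.*2 < nf.*2 /\
      s' = Rst (iv s) (setv [::] (rg s)) (updb (bg s) b (rvec (rg s) :: bg s b))
  | RGet b => exists l1 v l2, [/\ 4 + b.*2 < nf.*2, bg s b = l1 ++ v :: l2 &
      s' = Rst (iv s) (setv v (rg s)) (updb (bg s) b (l1 ++ l2))]
  | RClr => s' = Rst (iv s) (setv [::] (rg s)) (bg s)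
  | RCtl c => exists2 j, cstep k c (iv s) j & s' = Rst j (rg s) (bg s)
  end.

Local Notation sem := (sem rstep).

Definition inc r := At (RInc r).
Definition dec r := At (RDec r).
Definition reset r := At (RRst r).
Definition ctrl c := At (RCtl c).

Definition VT : ref := (3, false).

(** The number of rounds is guessed, so a move may stop early and leave a remainder behind. *)
Definition mv (r w : ref) := Star (dec r ;; inc w).

Definition op (d : bool) (w : ref) := if d then dec w else inc w.

(** Reads [r] without destroying it: each unit is parked in [VT] while [w] changes and is moved back
    afterwards. With [d] the target decreases, which turns the copy into a test that [r] is at most
    [w]. The optional reset makes a copy that stops early cut [r] down to the amount copied. *)
Definition xfer (rs : bool) (r : ref) (d : bool) (w : ref) :=
  reset VT ;; Star (dec r ;; inc VT ;; op d w) ;; (if rs then reset r else Eps) ;; mv VT r.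

Lemma incE r s s' : sem (inc r) s s' <-> ev (iv s) r < nf.*2 /\
  s' = Rst (iv s) (upd (rg s) (ev (iv s) r) (rg s (ev (iv s) r)).+1) (bg s).
Proof. by []. Qed.

Lemma decE r s s' : sem (dec r) s s' <-> [/\ ev (iv s) r < nf.*2, 0 < rg s (ev (iv s) r) &
  s' = Rst (iv s) (upd (rg s) (ev (iv s) r) (rg s (ev (iv s) r)).-1) (bg s)].
Proof. by []. Qed.

Lemma resetE r s s' : sem (reset r) s s' <-> [/\ odd r.1, ev (iv s) r < nf.*2 &
  s' = Rst (iv s) (upd (rg s) (ev (iv s) r) 0) (bg s)].
Proof. by []. Qed.

Lemma ctrlE c s s' : sem (ctrl c) s s' <->
  exists2 j, cstep k c (iv s) j & s' = Rst j (rg s) (bg s).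
Proof. by []. Qed.

Lemma mv_sound r w s s' vr vw : ev (iv s) r = vr -> ev (iv s) w = vw ->
  vr != vw -> sem (mv r w) s s' -> exists n,
  [/\ n <= rg s vr, iv s' = iv s, bg s' = bg s &
      forall v, rg s' v = if v == vr then rg s vr - n else
                          if v == vw then rg s vw + n else rg s v].
Proof.
move=> Er Ew neq /semStar st.
pose P t := exists n, [/\ n <= rg s vr, iv t = iv s, bg t = bg s &
      forall v, rg t v = if v == vr then rg s vr - n else
                         if v == vw then rg s vw + n else rg s v].
apply: (@star_inv _ _ P _ _ _ st) => [a b [n [le ei eb eg]]|]; last first.
  by exists 0; split=> // v; upds.
move/semS=> [a1 [/decE[_ + ->] /incE[_ ->]]] /=; rewrite ei Er Ew => pos.
have eg1 := eg vr; rewrite eqxx in eg1; rewrite eg1 in pos *.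
exists n.+1; split=> //=; first by lia.
by move=> v; rewrite !updE !eg; upds.
Qed.

Lemma mv_complete r w s n vr vw : ev (iv s) r = vr -> ev (iv s) w = vw ->
  vr != vw -> vr < nf.*2 -> vw < nf.*2 -> n <= rg s vr -> exists g,
  sem (mv r w) s (Rst (iv s) g (bg s)) /\
  forall v, g v = if v == vr then rg s vr - n else if v == vw then rg s vw + n else rg s v.
Proof.
move=> + + neq lr lw; elim: n s => [|n IH] s Er Ew le.
  exists (rg s); split; first by case: (s) => i g b; apply: StarRefl.
  by move=> v; upds.
pose s1 := Rst (iv s) (upd (upd (rg s) vr (rg s vr).-1) vw (rg s vw).+1) (bg s).
have [||| g [st eg]] := IH s1 => //; first by rewrite /=; move: neq; upds.
exists g; split; last by move=> v; rewrite eg /=; move: neq; upds.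
apply: sem_starS st; apply: (@sem_seq _ _ _ _ _ _ (Rst (iv s) (upd (rg s) vr (rg s vr).-1) (bg s))).
  by apply/decE; rewrite Er; split=> //; lia.
apply/incE; rewrite /= Ew; split=> //; rewrite updE.
by move: neq; rewrite eq_sym => /negPf->.
Qed.

Lemma loop3_sound r d w s s' vr vw : ev (iv s) r = vr -> ev (iv s) w = vw ->
  vr != vw -> vr != 3 -> vw != 3 ->
  sem (Star (dec r ;; inc VT ;; op d w)) s s' -> exists n,
  [/\ n <= rg s vr, d -> n <= rg s vw, iv s' = iv s, bg s' = bg s &
      forall v, rg s' v = if v == vr then rg s vr - n else
                          if v == vw then (if d then rg s vw - n else rg s vw + n) else
                          if v == 3 then rg s 3 + n else rg s v].
Proof.
move=> Er Ew n1 n2 n3 /semStar st.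
pose P t := exists n, [/\ n <= rg s vr, d -> n <= rg s vw, iv t = iv s, bg t = bg s &
      forall v, rg t v = if v == vr then rg s vr - n else
                          if v == vw then (if d then rg s vw - n else rg s vw + n) else
                          if v == 3 then rg s 3 + n else rg s v].
apply: (@star_inv _ _ P _ _ _ st) => [a b [n [le led ei eb eg]]|]; last first.
  by exists 0; split=> // v; case: (d); upds.
move/semS=> [a1 [/decE[_ + ->] /semS[a2 [/incE[_ ->]]]]]; rewrite /= ei Er => pos.
rewrite (_ : ev _ VT = 3) // /P {P st}.
have eg1 := eg vr; rewrite eqxx in eg1; rewrite eg1 in pos *.
case: d led eg => led eg.
  move/decE=> [_] /=; rewrite Ew => pos2 ->; exists n.+1; split=> //=; first by lia.
    by move=> _; move: pos2; rewrite !updE !eg; move: n1 n3; upds.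
  by move=> v; move: pos2; rewrite !updE !eg; move: n1 n2 n3; upds.
move/incE=> [_] /=; rewrite Ew => ->; exists n.+1; split=> //=; first by lia.
by move=> v; rewrite !updE !eg; move: n1 n2 n3; upds.
Qed.

Lemma loop3_complete r (d : bool) w s n vr vw : ev (iv s) r = vr -> ev (iv s) w = vw ->
  vr != vw -> vr != 3 -> vw != 3 -> vr < nf.*2 -> vw < nf.*2 -> 3 < nf.*2 -> n <= rg s vr ->
  (d -> n <= rg s vw) -> exists g,
  sem (Star (dec r ;; inc VT ;; op d w)) s (Rst (iv s) g (bg s)) /\
  forall v, g v = if v == vr then rg s vr - n else
                  if v == vw then (if d then rg s vw - n else rg s vw + n) else
                  if v == 3 then rg s 3 + n else rg s v.
Proof.
move=> + + n1 n2 n3 lr lw l3; elim: n s => [|n IH] s Er Ew le led.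
  exists (rg s); split; first by case: (s) => i g b; apply: StarRefl.
  by move=> v; case: (d); upds.
pose g1 := upd (rg s) vr (rg s vr).-1.
pose g2 := upd g1 3 (g1 3).+1.
pose g3 := upd g2 vw (if d then (g2 vw).-1 else (g2 vw).+1).
have g2w : g2 vw = rg s vw by rewrite /g2 /g1 !updE; move: n1 n3; upds.
have [|||d1|g [st eg]] := IH (Rst (iv s) g3 (bg s)) => //.
- by rewrite /= /g3 /g2 /g1; move: n1 n2; upds.
- by rewrite /= /g3 d1 updE eqxx g2w; move/(_ d1): led; lia.
exists g; split; last first.
  move=> v; rewrite eg /= /g3 !updE !eqxx g2w /g2 /g1; move: n1 n2 n3.
  case: (d) led => [/(_ isT)|_]; upds.
apply: sem_starS st; apply: (@sem_seq _ _ _ _ _ _ (Rst (iv s) g1 (bg s))).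
  by apply/decE; rewrite Er; split=> //; lia.
apply: (@sem_seq _ _ _ _ _ _ (Rst (iv s) g2 (bg s))); first by apply/incE.
case: d led @g3 {IH eg} => led g3; last by apply/incE; rewrite /= Ew.
by apply/decE; rewrite /= Ew; split=> //; rewrite g2w; move/(_ isT): led; lia.
Qed.

(** Here [n] counts the rounds of the first loop, [z] is what [r] holds in the end, and [tz] is the
    part not moved back out of [VT], which the next transfer clears. *)
Lemma xfer_sound rs r d w s s' vr vw : ev (iv s) r = vr -> ev (iv s) w = vw ->
  vr != vw -> vr != 3 -> vw != 3 ->
  sem (xfer rs r d w) s s' -> exists n z tz,
  [/\ n <= rg s vr, z <= rg s vr, rs -> z <= n, d -> n <= rg s vw &
  [/\ iv s' = iv s, bg s' = bg s &
      forall v, rg s' v = if v == vr then z else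
                          if v == vw then (if d then rg s vw - n else rg s vw + n) else
                          if v == 3 then tz else rg s v]].
Proof.
move=> Er Ew n1 n2 n3 /semS[s1 [/resetE[_ _ ->] /semS[s2 [lp /semS[s3 [rst3 lp2]]]]]].
have E3 i : ev i VT = 3 by [].
have [||n [le led ei eb eg]] := loop3_sound _ _ n1 n2 n3 lp; [exact: Er|exact: Ew|].
rewrite /= in ei eb.
have {}le : n <= rg s vr by move: le n2; rewrite /= E3; upds.
have {}led : d -> n <= rg s vw by move/led; move: n3; rewrite /= E3; upds.
have {}eg v : rg s2 v = if v == vr then rg s vr - n else
   if v == vw then (if d then rg s vw - n else rg s vw + n) else if v == 3 then n else rg s v.
  by rewrite eg /= E3; move: n2 n3; case: (d) led => [/(_ isT)|_]; upds.
have [i3 [b3 g3]] : iv s3 = iv s /\ bg s3 = bg s /\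
    forall v, rg s3 v = if v == vr then (if rs then 0 else rg s vr - n) else rg s2 v.
  case: (rs) rst3 => /=; last by move=> ->; split=> //; split=> // v; rewrite eg; case: eqP.
  case/resetE=> _ _ ->; rewrite /= ei eb Er; split=> //; split=> // v; rewrite updE.
have Er3 : ev (iv s3) r = vr by rewrite i3.
have [|m [le2 ei2 eb2 eg2]] := mv_sound (E3 _) Er3 _ lp2; first by rewrite eq_sym.
have v3 : rg s3 3 = n by rewrite g3 eg; move: n2 n3; upds.
rewrite v3 in le2.
exists n, (rg s3 vr + m), (n - m); split=> //.
- by rewrite g3 eqxx; case: (rs); lia.
- by move=> rs1; rewrite g3 eqxx rs1.
split; [by rewrite ei2|by rewrite eb2|].
move=> v; rewrite eg2 v3; case: (v =P 3) => [->|ne3].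
  by move: n2 n3; upds.
case: (v =P vr) => // /eqP/negPf nr; rewrite g3 eg nr; case: (v =P vw) => // _.
by move/eqP/negPf: ne3 => ->.
Qed.

Lemma xfer_complete (rs : bool) r (d : bool) w s vr vw : ev (iv s) r = vr -> ev (iv s) w = vw ->
  vr != vw -> vr != 3 -> vw != 3 -> vr < nf.*2 -> vw < nf.*2 -> 3 < nf.*2 ->
  (rs -> odd r.1) -> (d -> rg s vr <= rg s vw) -> exists g,
  sem (xfer rs r d w) s (Rst (iv s) g (bg s)) /\
  forall v, g v = if v == vw then (if d then rg s vw - rg s vr else rg s vw + rg s vr) else
                  if v == 3 then 0 else rg s v.
Proof.
move=> Er Ew n1 n2 n3 lr lw l3 od led.
have E3 i : ev i VT = 3 by [].
pose s1 := Rst (iv s) (upd (rg s) 3 0) (bg s).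
have [|d1|g [st eg]] := @loop3_complete r d w s1 (rg s vr) vr vw Er Ew n1 n2 n3 lr lw l3.
- by rewrite /=; move: n2; upds.
- by move/led: d1 => /=; move: n3; upds.
pose s3 := Rst (iv s) (if rs then upd g vr 0 else g) (bg s).
have gv v : rg s3 v = if v == vr then 0 else
  if v == vw then (if d then rg s vw - rg s vr else rg s vw + rg s vr) else
  if v == 3 then rg s vr else rg s v.
  by rewrite /s3 /=; case: (rs); rewrite ?updE eg /=; move: n2 n3; case: (d); upds.
have s33 : rg s3 3 = rg s vr by rewrite gv; move: n2 n3; upds.
have [||h [st2 eh]] := @mv_complete VT r s3 (rg s vr) 3 vr (E3 _) Er _ l3 lr.
- by rewrite eq_sym.
- by rewrite s33.
exists h; split; last first.
  by move=> v; rewrite eh s33 !gv; move: n1 n2 n3; upds.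
apply: (@sem_seq _ _ _ _ _ _ s1); first by apply/resetE.
apply: sem_seq st _; apply: sem_seq st2; rewrite /s3.
by case: (rs) od => od //; apply/resetE; rewrite /= Er; split=> //; apply: od.
Qed.

(** The level enters a program only through the loop index, so the program text is the same for all
    [k]; the control graph stays fixed while [k] grows with the input. The last round stands outside
    the loop because [CInc] is blocked at [k]. *)
Definition scan (body : prog ratom) :=
  ctrl CZero ;; Star (body ;; ctrl CInc) ;; ctrl CTop ;; body.

Lemma scan_sound body (Inv : nat -> rst -> Prop) s s' :
  (forall j s s', j <= k -> iv s = j -> Inv j s -> sem body s s' ->
     iv s' = j /\ Inv j.+1 (Rst j.+1 (rg s') (bg s'))) ->
  Inv 0 (Rst 0 (rg s) (bg s)) -> sem (scan body) s s' ->
  iv s' = k /\ Inv k.+1 (Rst k.+1 (rg s') (bg s')).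
Proof.
move=> bd i0 /semS[s1 [/ctrlE[j ->{j} ->] /semS[s2 [/semStar st /semS[s3 [/ctrlE[j [ik ->{j}] ->] sb]]]]]].
have [_ inv2] : iv s2 <= k /\ Inv (iv s2) s2.
  apply: (@star_inv _ _ (fun s => iv s <= k /\ Inv (iv s) s) _ _ _ st) => //.
  move=> a b [le inv] /semS[c [/(bd _ _ _ le erefl inv)[ic invc] /ctrlE[j [lt ->{j}] ->]]] /=.
  by rewrite ic in lt *.
apply: bd sb => //=; rewrite ik // in inv2 *.
by case: s2 ik inv2 {st} => ? ? ? /= ->.
Qed.

Lemma scan_complete body (Inv : nat -> rst -> Prop) s :
  (forall j s, j <= k -> iv s = j -> Inv j s -> exists s',
     [/\ sem body s s', iv s' = j & Inv j.+1 (Rst j.+1 (rg s') (bg s'))]) ->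
  Inv 0 (Rst 0 (rg s) (bg s)) -> exists s',
  [/\ sem (scan body) s s', iv s' = k & Inv k.+1 (Rst k.+1 (rg s') (bg s'))].
Proof.
move=> bd i0.
have lp j : j <= k -> exists s1, [/\ star (sem (body ;; ctrl CInc)) (Rst 0 (rg s) (bg s)) s1,
    iv s1 = j & Inv j s1].
  elim: j => [|j IH] le; first by exists (Rst 0 (rg s) (bg s)); split=> //; apply: StarRefl.
  have [s1 [st i1 inv1]] := IH (ltnW le).
  have [s2 [sb i2 inv2]] := bd _ _ (ltnW le) i1 inv1.
  exists (Rst j.+1 (rg s2) (bg s2)); split=> //; apply: star_rcons st _.
  by apply: sem_seq sb _; apply/ctrlE; exists j.+1 => //; rewrite /= i2.
have [s1 [st i1 inv1]] := lp k (leqnn k).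
have [s2 [sb i2 inv2]] := bd _ _ (leqnn k) i1 inv1.
exists s2; split=> //.
apply: (@sem_seq _ _ _ _ _ _ (Rst 0 (rg s) (bg s))); first by apply/ctrlE; exists 0.
apply: (@sem_seq _ _ _ _ _ _ s1); first exact: st.
apply: sem_seq sb; apply/ctrlE; exists k => //.
by case: (s1) i1 => ? ? ? /= ->.
Qed.

Definition anyindex := ctrl CZero ;; Star (ctrl CInc).

Lemma anyindex_sound s s' : sem anyindex s s' -> exists2 j, j <= k & s' = Rst j (rg s) (bg s).
Proof.
move/semS=> [s1 [/ctrlE[j ->{j} ->] /semStar st]].
apply: (@star_inv _ _ (fun t => exists2 j, j <= k & t = Rst j (rg s) (bg s)) _ _ _ st); last by exists 0.
by move=> a b [j le ->] /ctrlE[j' [lt ->] ->] /=; exists j.+1.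
Qed.

Lemma anyindex_complete s j : j <= k -> sem anyindex s (Rst j (rg s) (bg s)).
Proof.
move=> le; apply: (@sem_seq _ _ _ _ _ _ (Rst 0 (rg s) (bg s))); first by apply/ctrlE; exists 0.
elim: j le => [|j IH] le; first exact: StarRefl.
by apply: star_rcons (IH (ltnW le)) _; apply/ctrlE; exists j.+1.
Qed.

End Registers.

(** * The core programs *)

Ltac eqf :=
  repeat match goal with |- context [@eq_op _ ?a ?b] =>
    first [ rewrite (_ : (a == b) = false); [|solve [by [] | by apply/eqP; lia]]
          | rewrite (_ : (a == b) = true); [|solve [by [] | by apply/eqP; lia]] ] end.

(** Numbering of the variables: odd numbers up to 13 are single registers, [15 + 4i] are the
    counters of the expansion and [17 + 4j] belong to the simulation; among the fields, 0 and 2 are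
    a key and a multiplicity and [4 + 4i] are the tags. The stride 4 keeps these families apart. *)
Definition VX : ref := (1, false).
Definition VU : ref := (5, false).
Definition VA : ref := (7, false).
Definition VD : ref := (9, false).
Definition VB : ref := (11, false).
Definition VF0 : ref := (0, false).
Definition VF1 : ref := (2, false).
Definition VC : ref := (15, true).
Definition VG : ref := (4, true).

(** The bags hold snapshots of the expansion at limit steps, frames of the recursion that inverts a
    finite level, and items, which are the pending applications of finite levels. *)
Definition SN := 0.
Definition FR := 1.
Definition IT := 2.

Definition sto b := At (RSto b).
Definition get b := At (RGet b).
Definition clr := At RClr.

(** Writes the counters to the tag fields, or compares them with the tags of a fetched record. The
    reset in [xfer] makes each counter end up at most the tag written or read, so an inexact
    comparison costs counter units. *)
Definition tags (d : bool) := scan (xfer true VC d VG).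

(** F_{omega+i+1}(x) is the (x+1)-fold iterate of F_{omega+i} at x: one unit of level [i+1] is
    exchanged for [x+1] units of level [i]. *)
Definition fwd_expand :=
  anyindex ;; ctrl CInc ;; dec VC ;; ctrl CDec ;; xfer false VX false VC ;; inc VC.

(** F_omega(x) = F_{x+1}(x): a unit of level 0 becomes the item (x+1, 1), after a snapshot of [x]
    and of the counters that remain. The pair [dec VX ;; inc VX] tests that [x] is positive. *)
Definition fwd_limit :=
  dec VX ;; inc VX ;; ctrl CZero ;; dec VC ;; clr ;; tags false ;; xfer true VX false VF0 ;;
  sto SN ;; xfer false VX false VF0 ;; inc VF0 ;; inc VF1 ;; sto IT.

(** An application of F_0. The level of the item is not inspected, as spending a unit of a higher
    level in this way only wastes value. *)
Definition fwd_next := get IT ;; dec VF1 ;; inc VX ;; sto IT.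

(** F_u(x) is the (x+1)-fold iterate of F_{u-1} at x: one unit of the item (u, a) is exchanged for
    the item (u-1, x+1). [VU] carries [u] across the store, which empties the current record. *)
Definition fwd_item :=
  get IT ;; dec VF1 ;; reset VU ;; xfer false VF0 false VU ;; sto IT ;; dec VU ;; mv VU VF0 ;;
  xfer false VX false VF1 ;; inc VF1 ;; sto IT.

Definition FWD := Star (Alt fwd_expand (Alt fwd_limit (Alt fwd_next fwd_item))).

Definition below := Star (reset VC ;; ctrl CDec) ;; ctrl CBot ;; reset VC.

(** Undoes [fwd_expand]: taking [x] units and one more from level [i] certifies that [x+1] units
    were there. [below] then clears the levels up to [i], as [tower_contract] demands. *)
Definition bwd_contract :=
  anyindex ;; xfer true VX true VC ;; dec VC ;; ctrl CInc ;; inc VC ;; ctrl CDec ;; below.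

(** The gadget inverts F_{ka+1} for the argument [ka] of a snapshot by recursion on the level. [VB]
    is the present level, [VD] the depth of the recursion, [VA] the number of rounds completed at
    this level. The reset of [VB] replaces a test for level 0: if the level was not 0, the sum of
    [VB] and [VD], which no block increases, falls short for good. *)
Definition gad_base := reset VB ;; dec VX ;; inc VA.

Definition gad_push :=
  clr ;; tags false ;; xfer true VD false VF0 ;; mv VA VF1 ;; sto FR ;; reset VA ;; dec VB ;; inc VD.

(** Return from level [b] to [b+1]: more than [x] completed rounds are required, since F_{b+1}(x) is
    the (x+1)-fold iterate of F_b at x. The frame fetched must carry at least the present counters
    and the present depth. *)
Definition gad_pop :=
  xfer true VX true VA ;; dec VA ;; reset VA ;; dec VD ;; inc VB ;; get FR ;; tags true ;;
  xfer true VD true VF0 ;; mv VF1 VA ;; inc VA.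

Definition gad_open :=
  get SN ;; tags true ;; reset VD ;; reset VB ;; mv VF0 VB ;; inc VB ;; reset VA.

(** A completed round at a level above [x] inverts F_{x+1}(x) = F_omega(x) and so earns back a unit
    of level 0. *)
Definition gad_close := dec VA ;; dec VB ;; xfer true VX true VB ;; ctrl CZero ;; inc VC.

Definition gadget := Star (Alt gad_base (Alt gad_push gad_pop)).

Definition BWD := Star (Alt bwd_contract (gad_open ;; gadget ;; gad_close)).

Definition cc (s : rst) (i : nat) : nat := rg s (15 + 4 * i).
Definition xx (s : rst) : nat := rg s 1.

(** Field [f] is variable [2f], so the tag of level [i], variable [4 + 4i], is entry [2 + 2i]. The
    key [ka] is the argument of a snapshot, the level of an item or the depth of a frame; [mu] is
    the multiplicity of an item or the round count saved in a frame. *)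
Definition tg (v : seq nat) (i : nat) : nat := nth 0 v (2 + 2 * i).
Definition ka (v : seq nat) : nat := nth 0 v 0.
Definition mu (v : seq nat) : nat := nth 0 v 1.

Ltac rgside := solve [by [] | lia | by apply/eqP; lia |
  by move=> ? ?; split; apply/eqP; lia | by move=> ? ?; apply/eqP; lia].

Ltac rgc := rewrite /xx /cc; eqf; repeat (first
  [ match goal with H : forall u, rg ?s u = _ |- context [rg ?s ?a] => rewrite (H a) end
  | match goal with H : forall u, is_true (odd u) -> rg ?s u = _ |- context [rg ?s ?a] =>
      rewrite (H a); [|rgside] end
  | match goal with H : forall u, is_true (~~ odd u) -> rg ?s u = 0 |- context [rg ?s ?a] =>
      rewrite (H a); [|rgside] end
  | match goal with H : forall v, is_true (v != 3) -> _ -> rg ?s v = _ |- context [rg ?s ?a] =>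
      rewrite (H a); [|rgside|rgside] end
  | match goal with H : rg ?s ?a = _ |- context [rg ?s ?a] => rewrite H end ]; eqf).

Ltac rgh H := move: H; rgc => H.

Lemma setvG v g i : setv v g (4 + 4 * i) = tg v i.
Proof.
rewrite /setv (_ : odd _ = false); last by lia.
by rewrite /tg; congr nth; lia.
Qed.

(** * Effect of each block on argument, counters and bags, losses included *)

Section CoreBlocks.
Variables k nf : nat.
Hypothesis nf_big : 2 * k + 12 <= nf.
Local Notation sem := (sem (rstep k nf)).

Lemma evVC i : ev i VC = 15 + 4 * i. Proof. by []. Qed.
Lemma evVG i : ev i VG = 4 + 4 * i. Proof. by []. Qed.

(** [n i] is the number of rounds at index [i]: at most the old counter because the copy may stop
    early, and at least the new counter because of the reset. *)
Lemma tags_sound d s s' : sem (tags d) s s' -> exists n : nat -> nat,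
  [/\ forall i, i <= k -> n i <= cc s i /\ cc s' i <= n i,
      forall i, i <= k -> (d -> n i <= rg s (4 + 4 * i)) /\
        rg s' (4 + 4 * i) = (if d then rg s (4 + 4 * i) - n i else rg s (4 + 4 * i) + n i),
      forall v, v != 3 -> (forall i, i <= k -> v != 15 + 4 * i /\ v != 4 + 4 * i) -> rg s' v = rg s v &
      bg s' = bg s].
Proof.
move=> sm.
pose Inv j (t : rst) := exists n : nat -> nat,
  [/\ forall i, i < j -> n i <= cc s i /\ cc t i <= n i,
      forall i, i < j -> (d -> n i <= rg s (4 + 4 * i)) /\
        rg t (4 + 4 * i) = (if d then rg s (4 + 4 * i) - n i else rg s (4 + 4 * i) + n i),
      forall v, v != 3 -> (forall i, i < j -> v != 15 + 4 * i /\ v != 4 + 4 * i) -> rg t v = rg s v &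
      bg t = bg s].
have [] := scan_sound (Inv := Inv) _ _ sm => //; last first.
  by exists (fun=> 0).
move=> j t t' jk it [n [h1 h2 h3 h4]] xf.
have [|||||m [z [tz [m1 m2 m3 m4 [m5 m6 m7]]]]] :=
  @xfer_sound k nf true VC d VG t t' (15 + 4 * j) (4 + 4 * j) _ _ _ _ _ xf.
1,2: by rewrite it.
1-3: by apply/eqP; lia.
split=> //; first by rewrite m5.
have cj : rg t (15 + 4 * j) = rg s (15 + 4 * j).
  by apply: h3 => [|i ij]; [|split]; apply/eqP; lia.
have gj : rg t (4 + 4 * j) = rg s (4 + 4 * j).
  by apply: h3 => [|i ij]; [|split]; apply/eqP; lia.
rewrite cj gj in m1 m2 m4 m7.
exists (upd n j m); split=> /=.
- move=> i; rewrite ltnS leq_eqVlt /cc /= m7 updE => /orP[/eqP->|ij].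
    by rewrite !eqxx; split=> //; apply: m3.
  by have := h1 i ij; rewrite /cc /=; upds.
- move=> i; rewrite ltnS leq_eqVlt m7 updE => /orP[/eqP->|ij].
    by rewrite !eqxx; split; [move/m4|upds].
  by have := h2 i ij; rewrite [i == j]ltn_eqF //; case=> ? <-; split=> //; upds.
- move=> v v3 fam; rewrite m7; have [] := fam j (leqnn _) => /negPf-> /negPf->.
  by rewrite (negPf v3); apply: h3 => // i ij; apply: fam; lia.
- by rewrite m6.
Qed.

Lemma tags_complete (d : bool) s : (forall i, i <= k -> d -> cc s i <= rg s (4 + 4 * i)) ->
  exists s', [/\ sem (tags d) s s', forall i, i <= k -> cc s' i = cc s i,
      forall i, i <= k ->
        rg s' (4 + 4 * i) = (if d then rg s (4 + 4 * i) - cc s i else rg s (4 + 4 * i) + cc s i),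
      forall v, v != 3 -> (forall i, i <= k -> v != 4 + 4 * i) -> rg s' v = rg s v &
      bg s' = bg s].
Proof.
move=> led.
pose Inv j (t : rst) := 
  [/\ forall i, i < j -> 
        rg t (4 + 4 * i) = (if d then rg s (4 + 4 * i) - cc s i else rg s (4 + 4 * i) + cc s i),
      forall v, v != 3 -> (forall i, i < j -> v != 4 + 4 * i) -> rg t v = rg s v &
      bg t = bg s].
have [||s' [sm ik [h1 h2 h3]]] := scan_complete (k := k) (nf := nf) (body := xfer true VC d VG) (Inv := Inv) (s := s).
- move=> j t jk it [h1 h2 h3].
  have cj : rg t (15 + 4 * j) = rg s (15 + 4 * j).
    by apply: h2 => [|i ij]; apply/eqP; lia.
  have gj : rg t (4 + 4 * j) = rg s (4 + 4 * j).
    by apply: h2 => [|i ij]; apply/eqP; lia.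
  have [||||||||||g [xf eg]] := @xfer_complete k nf true VC d VG t (15 + 4 * j) (4 + 4 * j).
  1,2: by rewrite it ?evVC ?evVG; reflexivity.
  1-3: by apply/eqP; lia.
  1-3: by rewrite -muln2; lia.
  + by [].
  + by move=> d1; rewrite cj gj; apply: led.
  exists (Rst (iv t) g (bg t)); split=> //; split=> //=.
    move=> i; rewrite ltnS leq_eqVlt eg => /orP[/eqP->|ij].
      by rewrite eqxx gj cj.
    rewrite -h1 //; upds.
  move=> v v3 fam; rewrite eg (negPf v3) (negPf (fam j _)) //; apply: h2 => // i ij.
  by apply: fam; lia.
- by split.
exists s'; split=> //= i ik'; apply: h2 => [|j _]; apply/eqP; lia.
Qed.

Lemma below_sound s s' : sem below s s' -> [/\ forall j, j <= iv s -> cc s' j = 0,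
  forall v, (forall j, j <= iv s -> v != 15 + 4 * j) -> rg s' v = rg s v & bg s' = bg s].
Proof.
move/semS=> [s1 [/semStar st /semS[s2 [/ctrlE[j [i0 ->{j}] ->] /resetE[_ _ ->]]]]].
rewrite /= i0.
have [h1 h2 h3 h4] : [/\ iv s1 <= iv s, forall j, iv s1 < j <= iv s -> cc s1 j = 0,
  forall v, (forall j, j <= iv s -> v != 15 + 4 * j) -> rg s1 v = rg s v & bg s1 = bg s].
  apply: (@star_inv _ _ (fun s1 => [/\ iv s1 <= iv s, forall j, iv s1 < j <= iv s -> cc s1 j = 0,
    forall v, (forall j, j <= iv s -> v != 15 + 4 * j) -> rg s1 v = rg s v & bg s1 = bg s]) _ _ _ st);
    last by split=> // j; lia.
  move=> a b [h1 h2 h3 h4] /semS[a1 [/resetE[_ _ ->] /ctrlE[j [pos ->{j}] ->]]] /=.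
  rewrite /= in pos; split=> //; first by lia.
    move=> j lj; rewrite /cc /= updE evVC; case: eqP => // ne; apply: h2; lia.
  by move=> v fam; rewrite updE evVC (negPf (fam _ h1)) h3.
split=> // [j ji|v fam]; rewrite /cc /= updE evVC muln0 addn0.
  by case: eqP => // ne; apply: h2; lia.
by have := fam 0 isT; rewrite muln0 addn0 => /negPf->; apply: h3.
Qed.

Lemma below_complete s : iv s <= k -> exists s', [/\ sem below s s',
  forall j, j <= iv s -> cc s' j = 0,
  forall v, (forall j, j <= iv s -> v != 15 + 4 * j) -> rg s' v = rg s v & bg s' = bg s].
Proof.
move=> ik.
suff [s1 [st i1]] : exists s', sem (Star (reset VC ;; ctrl CDec)) s s' /\ iv s' = 0.
  exists (Rst 0 (upd (rg s1) 15 0) (bg s1)).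
  suff sm : sem below s (Rst 0 (upd (rg s1) 15 0) (bg s1)).
    by have [? ? ?] := below_sound sm; split.
  apply: sem_seq st _; apply: (@sem_seq _ _ _ _ _ _ s1).
    by apply/ctrlE; exists 0; [rewrite i1|case: (s1) i1 => ? ? ? /= ->].
  by apply/resetE; rewrite i1 evVC /= -muln2; split=> //; lia.
elim: {s}(iv s) {-2}s (erefl (iv s)) ik => [|i IH] s Ei ik.
  by exists s; split=> //; apply: sem_star0.
pose t := Rst i (upd (rg s) (15 + 4 * i.+1) 0) (bg s).
have [|s' [st i']] := IH t erefl; first by rewrite Ei in ik; apply: ltnW.
exists s'; split=> //; apply: sem_starS st; apply: (@sem_seq _ _ _ _ _ _ (Rst i.+1 (upd (rg s) (15 + 4 * i.+1) 0) (bg s))).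
  by apply/resetE; rewrite Ei evVC /= -muln2; split=> //; lia.
by apply/ctrlE; exists i.
Qed.

Lemma nth_rvec g f : f < nf -> nth 0 (rvec nf g) f = g f.*2.
Proof. by move=> lt; rewrite nth_mkseq. Qed.

Lemma ka_rvec g : ka (rvec nf g) = g 0.
Proof. by rewrite /ka nth_rvec //; lia. Qed.

Lemma mu_rvec g : mu (rvec nf g) = g 2.
Proof. by rewrite /mu nth_rvec //; lia. Qed.

Lemma tg_rvec g i : i <= k -> tg (rvec nf g) i = g (4 + 4 * i).
Proof. by move=> ik; rewrite /tg nth_rvec; [congr g; lia|lia]. Qed.

Lemma stoE b s s' : sem (sto b) s s' <-> 4 + b.*2 < nf.*2 /\
  s' = Rst (iv s) (setv [::] (rg s)) (updb (bg s) b (rvec nf (rg s) :: bg s b)).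
Proof. by []. Qed.

Lemma getE b s s' : sem (get b) s s' <-> exists l1 v l2, [/\ 4 + b.*2 < nf.*2,
  bg s b = l1 ++ v :: l2 & s' = Rst (iv s) (setv v (rg s)) (updb (bg s) b (l1 ++ l2))].
Proof. by []. Qed.

Lemma clrE s s' : sem clr s s' <-> s' = Rst (iv s) (setv [::] (rg s)) (bg s).
Proof. by []. Qed.

Lemma inc_s r s s' a : ev (iv s) r = a -> sem (inc r) s s' ->
  [/\ iv s' = iv s, bg s' = bg s & forall u, rg s' u = if u == a then (rg s a).+1 else rg s u].
Proof. by move=> <- /incE[_ ->]. Qed.

Lemma dec_s r s s' a : ev (iv s) r = a -> sem (dec r) s s' -> [/\ 0 < rg s a,
  iv s' = iv s, bg s' = bg s & forall u, rg s' u = if u == a then (rg s a).-1 else rg s u].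
Proof. by move=> <- /decE[_ ? ->]. Qed.

Lemma reset_s r s s' a : ev (iv s) r = a -> sem (reset r) s s' ->
  [/\ iv s' = iv s, bg s' = bg s & forall u, rg s' u = if u == a then 0 else rg s u].
Proof. by move=> <- /resetE[_ _ ->]. Qed.

Lemma ctrl_s c s s' : sem (ctrl c) s s' ->
  [/\ cstep k c (iv s) (iv s'), bg s' = bg s & forall u, rg s' u = rg s u].
Proof. by move=> /ctrlE[j cs ->]. Qed.

Lemma clr_s s s' : sem clr s s' -> [/\ iv s' = iv s, bg s' = bg s,
  forall u, odd u -> rg s' u = rg s u & forall u, ~~ odd u -> rg s' u = 0].
Proof. by move/clrE->; split=> // u /=; rewrite /setv; case: odd; rewrite // nth_nil. Qed.

Lemma sto_s b s s' : sem (sto b) s s' -> exists v,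
  [/\ ka v = rg s 0, mu v = rg s 2, forall i, i <= k -> tg v i = rg s (4 + 4 * i),
      bg s' b = v :: bg s b & [/\ forall b', b' != b -> bg s' b' = bg s b', iv s' = iv s,
  forall u, odd u -> rg s' u = rg s u & forall u, ~~ odd u -> rg s' u = 0]].
Proof.
move/stoE=> [_ ->]; exists (rvec nf (rg s)); rewrite ka_rvec mu_rvec; split=> //=.
- by move=> i; apply: tg_rvec.
- by rewrite /updb eqxx.
split=> // u; first by rewrite /updb => /negPf->.
  by rewrite /setv => ->.
by rewrite /setv => /negPf->; rewrite nth_nil.
Qed.

Lemma get_s b s s' : sem (get b) s s' -> exists l1 v l2,
  [/\ bg s b = l1 ++ v :: l2, bg s' b = l1 ++ l2, forall b', b' != b -> bg s' b' = bg s b',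
      iv s' = iv s & [/\ forall u, odd u -> rg s' u = rg s u, rg s' 0 = ka v, rg s' 2 = mu v &
      forall i, rg s' (4 + 4 * i) = tg v i]].
Proof.
move/getE=> [l1 [v [l2 [_ eb ->]]]]; exists l1, v, l2; split=> //=.
- by rewrite /updb eqxx.
- by move=> b'; rewrite /updb => /negPf->.
by split=> // [u|i]; rewrite ?setvG // /setv => ->.
Qed.

(** As in the following descriptions, whatever may be lost is only bounded from above. The copy of
    [x] may stop after [n] units, whence [n <= x] in place of equality. *)
Lemma fwd_expand_sound s s' : sem fwd_expand s s' -> exists i n,
  [/\ i < k, n <= xx s, 0 < cc s i.+1, xx s' <= xx s &
  [/\ forall j, cc s' j = if j == i then cc s i + n.+1 else
                          if j == i.+1 then (cc s i.+1).-1 else cc s j & bg s' = bg s]].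
Proof.
case/semS=> s1 [/anyindex_sound[i ik E1]] /semS[s2 [/ctrl_s[[lt i2] b2 g2]]].
case/semS=> s3 [/dec_s-/(_ _ erefl)[pos i3 b3 g3]] /semS[s4 [/ctrl_s[[_ i4] b4 g4]]] /semS[s5 [xf i6]].
have {}i2 : iv s2 = i.+1 by rewrite i2 E1.
have {}i4 : iv s4 = i by rewrite i4 i3 i2.
have [|||||n [z [tz [m1 m2 _ _ [i5 b5 g5]]]]] :=
  @xfer_sound k nf false VX false VC _ _ 1 (15 + 4 * i) _ _ _ _ _ xf => //=; first by rewrite i4.
have [|i6' b6 g6] := @inc_s VC _ _ (15 + 4 * i) _ i6; first by rewrite i5 i4.
have g1 u : rg s1 u = rg s u by rewrite E1.
rewrite i2 evVC in pos g3.
rewrite E1 /= in lt.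
exists i, n; split=> //; [by rgh m1|by rgh pos|by rgh m2; rgc|].
split; last by rewrite b6 b5 b4 b3 b2 E1.
move=> j; have [->|ne] := eqVneq j i; first by rgc; lia.
have [->|ne'] := eqVneq j i.+1; first by rgc.
by rgc.
Qed.

Lemma fwd_next_sound s s' : sem fwd_next s s' -> exists l1 v l2 v',
  [/\ bg s IT = l1 ++ v :: l2, 0 < mu v, xx s' = (xx s).+1, forall j, cc s' j = cc s j &
  [/\ ka v' = ka v, mu v' = (mu v).-1, bg s' IT = v' :: l1 ++ l2 &
      forall b, b != IT -> bg s' b = bg s b]].
Proof.
case/semS=> s1 [/get_s[l1 [v [l2 [e1 e1' e1'' i1 [g1 g10 g12 _]]]]]] /semS[s2 [/dec_s-/(_ 2 erefl)[pos i2 b2 g2]]].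
case/semS=> s3 [/inc_s-/(_ 1 erefl)[i3 b3 g3] /sto_s[v' [k1 k2 _ k3 [k4 k5 k6 _]]]].
exists l1, v, l2, v'; split=> //; [by rgh pos|by rgc|by move=> j; rgc|].
split; [by rewrite k1; rgc|by rewrite k2; rgc|by rewrite k3 b3 b2 e1'|].
by move=> b nb; rewrite k4 // b3 b2 e1''.
Qed.

Lemma fwd_item_sound s s' : sem fwd_item s s' -> exists l1 v l2 v1 v2,
  [/\ bg s IT = l1 ++ v :: l2, 0 < mu v, xx s' <= xx s, forall j, cc s' j = cc s j &
  [/\ ka v1 <= ka v, mu v1 = (mu v).-1, ka v2 < ka v, 0 < mu v2 <= (xx s).+1 &
  [/\ bg s' IT = v2 :: v1 :: l1 ++ l2 & forall b, b != IT -> bg s' b = bg s b]]].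
Proof.
case/semS=> s1 [/get_s[l1 [v [l2 [e1 e1' e1'' i1 [g1 g10 g12 _]]]]]] /semS[s2 [/dec_s-/(_ 2 erefl)[pos i2 b2 g2]]].
case/semS=> s3 [/reset_s-/(_ 5 erefl)[i3 b3 g3]] /semS[s4 [xf]] /semS[s5 [/sto_s[v1 [k1 k2 _ k3 [k4 k5 k6 k7]]]]].
case/semS=> s6 [/dec_s-/(_ 5 erefl)[pos6 i6 b6 g6]] /semS[s7 [ml]] /semS[s8 [xf2]].
case/semS=> s9 [/inc_s-/(_ 2 erefl)[i9 b9 g9] /sto_s[v2 [q1 q2 _ q3 [q4 q5 q6 q7]]]].
have [|||||n [z [tz [m1 m2 _ _ [i4 b4 g4]]]]] :=
  @xfer_sound k nf false VF0 false VU _ _ 0 5 _ _ _ _ _ xf => //=.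
have [|||n2 [m7 i7 b7 g7]] := @mv_sound k nf VU VF0 _ _ 5 0 _ _ _ ml => //=.
have [|||||n3 [z3 [tz3 [m8 m8' _ _ [i8 b8 g8]]]]] :=
  @xfer_sound k nf false VX false VF1 _ _ 1 2 _ _ _ _ _ xf2 => //=.
exists l1, v, l2, v1, v2; split=> //; [by rgh pos|by rgh m8'; rgc|by move=> j; rgc|].
rgh m1; rgh m2; rgh m7; rgh m8; rgh pos6; rgh m8'.
split; [by rewrite k1; rgc|by rewrite k2; rgc|by rewrite q1; rgc; lia|by rewrite q2; rgc; lia|].
split; first by rewrite q3 b9 b8 b7 b6 k3 b4 b3 b2 e1'.
by move=> b nb; rewrite q4 // b9 b8 b7 b6 k4 // b4 b3 b2 e1''.
Qed.

Lemma fwd_limit_sound s s' : sem fwd_limit s s' -> exists sn it,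
  [/\ 0 < cc s 0, 0 < xx s, bg s' SN = sn :: bg s SN, bg s' IT = it :: bg s IT &
  [/\ bg s' FR = bg s FR,
      forall i, i <= k -> cc s' i <= tg sn i <= (if i == 0 then (cc s 0).-1 else cc s i),
      xx s' <= ka sn <= xx s, ka it <= (ka sn).+1 & mu it = 1]].
Proof.
case/semS=> s1 [/dec_s-/(_ 1 erefl)[pos i1 b1 g1]] /semS[s2 [/inc_s-/(_ 1 erefl)[i2 b2 g2]]].
case/semS=> s3 [/ctrl_s[i3 b3 g3]] /semS[s4 [dc]] /semS[s5 [/clr_s[i5 b5 g5 g5']]].
case/semS=> s6 [/tags_sound[n [t1 t2 g6 b6]]] /semS[s7 [xf]] /semS[s8 [/sto_s[sn [k1 k2 kt k3 [k4 k5 k6 k7]]]]].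
case/semS=> s9 [xf2] /semS[s10 [/inc_s-/(_ 0 erefl)[i10 b10 g10]]].
case/semS=> s11 [/inc_s-/(_ 2 erefl)[i11 b11 g11] /sto_s[it [q1 q2 _ q3 [q4 q5 q6 q7]]]].
have [|||||m [z [tz [m1 m2 m3 _ [i7 b7 g7]]]]] :=
  @xfer_sound k nf true VX false VF0 _ _ 1 0 _ _ _ _ _ xf => //=.
have [|||||n3 [z3 [tz3 [p1 p2 _ _ [i9 b9 g9]]]]] :=
  @xfer_sound k nf false VX false VF0 _ _ 1 0 _ _ _ _ _ xf2 => //=.
have {}m3 := m3 isT.
have [|pos4 i4 b4 g4] := @dec_s VC _ _ 15 _ dc; first by rewrite /= in i3; rewrite i3.
have E := prednK pos.
exists sn, it; split.
- by move: pos4; rewrite /cc muln0 addn0; rgc.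
- by [].
- by rewrite q4 // b11 b10 b9 k3 b7 b6 b5 b4 b3 b2 b1.
- by rewrite q3 b11 b10 b9 k4 // b7 b6 b5 b4 b3 b2 b1.
split.
- by rewrite q4 // b11 b10 b9 k4 // b7 b6 b5 b4 b3 b2 b1.
- move=> i ik; rewrite kt //; have [t11 t12] := t1 i ik; have [_ t21] := t2 i ik.
  have -> : cc s' i = cc s6 i by rgc.
  have -> : rg s7 (4 + 4 * i) = n i by rgc.
  rewrite t12 /=; apply: leq_trans t11 _.
  by case: (i =P 0) => [->|ne]; rewrite /cc ?muln0 ?addn0; rgc.
- by rewrite k1; rgh p2; rgh m1; rgh m2; rgc; lia.
- by rewrite q1 k1; rgh p1; rgc; lia.
- by rewrite q2; rgc.
Qed.

Lemma bwd_contract_sound s s' : sem bwd_contract s s' -> exists i n,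
  [/\ i < k, n < cc s i, xx s' <= n, xx s' <= xx s &
  [/\ forall j, j <= i -> cc s' j = 0, cc s' i.+1 = (cc s i.+1).+1,
      forall j, i.+1 < j -> cc s' j = cc s j & bg s' = bg s]].
Proof.
case/semS=> s1 [/anyindex_sound[i ik E1]] /semS[s2 [xf]] /semS[s3 [dc]] /semS[s4 [/ctrl_s[[lt i4] b4 g4]]].
case/semS=> s5 [ic] /semS[s6 [/ctrl_s[[_ i6] b6 g6] /below_sound[h1 h2 h3]]].
have g1 u : rg s1 u = rg s u by rewrite E1.
have [|||||n [z [tz [m1 m2 m3 m4 [i2 b2 g2]]]]] :=
  @xfer_sound k nf true VX true VC _ _ 1 (15 + 4 * i) _ _ _ _ _ xf => //=; first by rewrite E1.
have {}i2 : iv s2 = i by rewrite i2 E1.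
have [|pos i3 b3 g3] := @dec_s VC _ _ (15 + 4 * i) _ dc; first by rewrite i2.
have {}i4 : iv s4 = i.+1 by rewrite i4 i3 i2.
have [|i5 b5 g5] := @inc_s VC _ _ (15 + 4 * i.+1) _ ic; first by rewrite i4.
have {}i6 : iv s6 = i by rewrite i6 i5 i4.
rewrite i3 i2 in lt; rewrite i6 in h1 h2.
have {}m3 := m3 isT; have {}m4 := m4 isT.
have x' : xx s' = z.
  by rewrite /xx h2 => [|j _]; [rgc|apply/eqP; lia].
exists i, n; rewrite x'; split=> //.
- by rgh m4; move: pos; rgc; rewrite /cc; lia.
- by rgh m2.
split=> //.
- by rewrite /cc h2 => [|j ji]; [rgc|apply/eqP; lia].
- by move=> j ji; rewrite /cc h2 => [|j' ji']; [rgc|apply/eqP; lia].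
- by rewrite h3 b6 b5 b4 b3 b2 E1.
Qed.

Lemma gad_open_sound s s' : sem gad_open s s' -> exists l1 v l2,
  [/\ bg s SN = l1 ++ v :: l2, bg s' SN = l1 ++ l2, bg s' FR = bg s FR, xx s' = xx s &
  [/\ forall i, i <= k -> cc s' i <= cc s i /\ cc s' i <= tg v i, rg s' 9 = 0,
      rg s' 11 <= (ka v).+1 & rg s' 7 = 0]].
Proof.
case/semS=> s1 [/get_s[l1 [v [l2 [e1 e1' e1'' i1 [g1 g10 g12 g14]]]]]] /semS[s2 [/tags_sound[n [t1 t2 g2 b2]]]].
case/semS=> s3 [/reset_s-/(_ 9 erefl)[i3 b3 g3]] /semS[s4 [/reset_s-/(_ 11 erefl)[i4 b4 g4]]] /semS[s5 [ml]].
case/semS=> s6 [/inc_s-/(_ 11 erefl)[i6 b6 g6] /reset_s-/(_ 7 erefl)[i7 b7 g7]].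
have [|||n2 [m5 i5 b5 g5]] := @mv_sound k nf VF0 VB _ _ 0 11 _ _ _ ml => //=.
exists l1, v, l2; split=> //.
- by rewrite b7 b6 b5 b4 b3 b2.
- by rewrite b7 b6 b5 b4 b3 b2 e1''.
- by rgc.
split; [|by rgc| |by rgc].
- move=> i ik; have [t11 t12] := t1 i ik; have [/(_ isT) t21 _] := t2 i ik.
  have -> : cc s' i = cc s2 i by rgc.
  by rewrite g14 in t21; rgh t11; move: t12; rewrite /cc; lia.
- by rgh m5; rgc; lia.
Qed.

Lemma gad_base_sound s s' : sem gad_base s s' ->
  [/\ 0 < xx s, xx s' = (xx s).-1, rg s' 7 = (rg s 7).+1, rg s' 9 = rg s 9 &
  [/\ rg s' 11 = 0, forall i, cc s' i = cc s i & bg s' = bg s]].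
Proof.
case/semS=> s1 [/reset_s-/(_ 11 erefl)[i1 b1 g1]] /semS[s2 [/dec_s-/(_ 1 erefl)[pos i2 b2 g2]]].
move=> /inc_s-/(_ 7 erefl)[i3 b3 g3].
split; [by rgh pos|by rgc..|].
by split; [rgc|move=> i; rgc|rewrite b3 b2 b1].
Qed.

Lemma gad_push_sound s s' : sem gad_push s s' -> exists v,
  [/\ forall i, i <= k -> cc s' i <= tg v i <= cc s i, xx s' = xx s, bg s' FR = v :: bg s FR,
      bg s' SN = bg s SN & [/\ rg s' 9 <= (ka v).+1, ka v <= rg s 9, mu v <= rg s 7, rg s' 7 = 0 &
      0 < rg s 11 /\ rg s' 11 = (rg s 11).-1]].
Proof.
case/semS=> s1 [/clr_s[i1 b1 g1 g1']] /semS[s2 [/tags_sound[n [t1 t2 g2 b2]]]] /semS[s3 [xf]].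
case/semS=> s4 [ml] /semS[s5 [/sto_s[v [k1 k2 kt k3 [k4 k5 k6 k7]]]]].
case/semS=> s6 [/reset_s-/(_ 7 erefl)[i6 b6 g6]] /semS[s7 [/dec_s-/(_ 11 erefl)[pos i7 b7 g7]]].
move=> /inc_s-/(_ 9 erefl)[i8 b8 g8].
have [|||||m [z [tz [m1 m2 m3 _ [i3 b3 g3]]]]] :=
  @xfer_sound k nf true VD false VF0 _ _ 9 0 _ _ _ _ _ xf => //=.
have [|||n2 [m5 i4 b4 g4]] := @mv_sound k nf VA VF1 _ _ 7 2 _ _ _ ml => //=.
have {}m3 := m3 isT.
exists v; split.
- move=> i ik; have [t11 t12] := t1 i ik; have [_ t21] := t2 i ik.
  have -> : cc s' i = cc s2 i by rgc.
  have -> : tg v i = n i by rewrite kt //; rgc.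
  by rewrite t12; rgh t11; exact: t11.
- by rgc.
- by rewrite b8 b7 b6 k3 b4 b3 b2 b1.
- by rewrite b8 b7 b6 k4 // b4 b3 b2 b1.
split.
- by rewrite k1; rgc; lia.
- by rewrite k1; rgh m1; rgc; lia.
- by rewrite k2; rgh m5; rgc; lia.
- by rgc.
- by rgh pos; split; rgc.
Qed.

Lemma gad_pop_sound s s' : sem gad_pop s s' -> exists l1 v l2,
  [/\ bg s FR = l1 ++ v :: l2, bg s' FR = l1 ++ l2, bg s' SN = bg s SN, xx s' <= xx s &
  [/\ xx s' < rg s 7, rg s' 9 < rg s 9 /\ rg s' 9 <= ka v, rg s' 11 = (rg s 11).+1,
      forall i, i <= k -> cc s' i <= cc s i /\ cc s' i <= tg v i & rg s' 7 <= (mu v).+1]].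
Proof.
case/semS=> s1 [xf] /semS[s2 [/dec_s-/(_ 7 erefl)[pos2 i2 b2 g2]]] /semS[s3 [/reset_s-/(_ 7 erefl)[i3 b3 g3]]].
case/semS=> s4 [/dec_s-/(_ 9 erefl)[pos4 i4 b4 g4]] /semS[s5 [/inc_s-/(_ 11 erefl)[i5 b5 g5]]].
case/semS=> s6 [/get_s[l1 [v [l2 [e6 e6' e6'' i6 [g6 g60 g62 g64]]]]]] /semS[s7 [/tags_sound[n [t1 t2 g7 b7]]]].
case/semS=> s8 [xf8] /semS[s9 [ml /inc_s-/(_ 7 erefl)[i10 b10 g10]]].
have [|||||m [z [tz [m1 m2 m3 m4 [i1 b1 g1]]]]] :=
  @xfer_sound k nf true VX true VA _ _ 1 7 _ _ _ _ _ xf => //=.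
have [|||||p [z8 [tz8 [p1 p2 p3 p4 [i8 b8 g8]]]]] :=
  @xfer_sound k nf true VD true VF0 _ _ 9 0 _ _ _ _ _ xf8 => //=.
have [|||n2 [m9 i9 b9 g9]] := @mv_sound k nf VF1 VA _ _ 2 7 _ _ _ ml => //=.
have {}m3 := m3 isT; have {}p3 := p3 isT; have {}m4 := m4 isT; have {}p4 := p4 isT.
exists l1, v, l2; split.
- by rewrite -e6 b5 b4 b3 b2 b1.
- by rewrite b10 b9 b8 b7.
- by rewrite b10 b9 b8 b7 e6'' // b5 b4 b3 b2 b1.
- by rgc.
split.
- by rgh pos2; rgh m4; rgc; lia.
- by rgh pos4; rgh p2; rgh p4; split; rgc; lia.
- by rgc.
- move=> i ik; have [t11 t12] := t1 i ik; have [/(_ isT) t21 _] := t2 i ik.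
  have -> : cc s' i = cc s7 i by rgc.
  by rewrite g64 in t21; rgh t11; move: t12; rewrite /cc; lia.
- by rgh m9; rgc; lia.
Qed.

Lemma gad_close_sound s s' : sem gad_close s s' ->
  [/\ 0 < rg s 7, xx s' < rg s 11, xx s' <= xx s, bg s' = bg s &
      forall i, cc s' i = upd (cc s) 0 (cc s 0).+1 i].
Proof.
case/semS=> s1 [/dec_s-/(_ 7 erefl)[pos1 i1 b1 g1]] /semS[s2 [/dec_s-/(_ 11 erefl)[pos2 i2 b2 g2]]].
case/semS=> s3 [xf] /semS[s4 [/ctrl_s[i4 b4 g4] ic]].
have [|||||m [z [tz [m1 m2 m3 m4 [i3 b3 g3]]]]] :=
  @xfer_sound k nf true VX true VB _ _ 1 11 _ _ _ _ _ xf => //=.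
have [|i5 b5 g5] := @inc_s VC _ _ 15 _ ic; first by rewrite /= in i4; rewrite i4.
have {}m3 := m3 isT; have {}m4 := m4 isT.
split=> //.
- by rgh m4; rgh pos2; rgc; lia.
- by rgh m2; rgc.
- by rewrite b5 b4 b3 b2 b1.
- move=> i; rewrite updE; case: (i =P 0) => [->|ne]; first by rewrite /cc muln0 addn0; rgc.
  by rgc.
Qed.

End CoreBlocks.

(** * Soundness of the core *)

Definition add (b : nat -> nat) (u a : nat) : nat -> nat := upd b u (b u + a).

Lemma addE b u a j : add b u a j = (if j == u then b u + a else b j). Proof. by []. Qed.

Lemma add_exchange k v u n b a x : v <= u < n ->
  tower k (add b v a) n x <= tower k (add b u a) n x.
Proof.
move=> vun; have ha : a <= add b u a u by rewrite addE eqxx leq_addl.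
have h := tower_exchange k x vun ha; apply: leq_trans h; rewrite leq_eqVlt; apply/orP; left; apply/eqP.
apply: eq_tower => i _; rewrite !addE !updE !addE; upds.
Qed.

Lemma add_expand k u n b m x : u.+1 < n -> m <= x.+1 ->
  tower k (add b u m) n x <= tower k (add b u.+1 1) n x.
Proof.
(* [tower_expand] returns at least one unit, so the case [m = 0] is first raised to 1. *)
move=> un mx; apply: leq_trans (_ : tower k (add b u (m.-1).+1) n x <= _).
  by apply: leq_tower => // i _; rewrite !addE; upds.
have hm : m.-1 <= x by lia.
have hp : 0 < add b u.+1 1 u.+1 by rewrite addE eqxx addn1.
have h := tower_expand k un hm hp; apply: leq_trans h; rewrite leq_eqVlt; apply/orP; left; apply/eqP.
apply: eq_tower => i _; rewrite !addE !updE !addE; upds.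
Qed.

(** This fails at 0, which every level sends to 1. It is the reason why [fwd_limit] tests that [x]
    is positive. *)
Lemma fast_gt_index k j x : 0 < x -> j < fast k j x.
Proof.
move=> x0; apply: leq_trans (fast_leq k j x0); elim: j => [|j IH].
  by apply: leq_trans (fast_gt _ _ _).
by rewrite fast_succ /=; apply: leq_trans (fast_gt k j _); rewrite ltnS.
Qed.

Lemma leq_tower_prefix k a m n x : m <= n -> tower k a m x <= tower k a n x.
Proof. by move=> mn; rewrite (tower_cat _ _ _ mn); apply: leq_tower_self. Qed.

Section CoreSound.
Variables k nf : nat.
Hypothesis nf_big : 2 * k + 12 <= nf.
Local Notation sem := (sem (rstep k nf)).

(** The value still promised by a state: counter [i] stands for pending applications of F_{omega+i}.
    It starts at [V0] and serves as the potential in both phases. *)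
Definition VV (c : nat -> nat) (x : nat) : nat := tower 1 c k.+1 x.
Definition V0 : nat := fast 1 k 1.

Definition cnt (l : seq (seq nat)) (u : nat) : nat := \sum_(v <- l | ka v == u) mu v.

Lemma cnt_cons v l u : cnt (v :: l) u = add (cnt l) (ka v) (mu v) u.
Proof. by rewrite /cnt big_cons addE eq_sym; case: eqP => // ->; rewrite addnC. Qed.

Lemma cnt_mid l1 v l2 u : cnt (l1 ++ v :: l2) u = add (cnt (l1 ++ l2)) (ka v) (mu v) u.
Proof. by rewrite -cnt_cons /cnt; apply: perm_big; rewrite -[v :: l2]cat1s perm_catCA. Qed.

(** The argument once all pending items are applied. Cutting at [V0 + 2] is harmless: an item is
    created with level at most [x+1], and [x] never exceeds [V0]. *)
Definition LL (s : rst) : nat := tower 0 (cnt (bg s IT)) V0.+2 (xx s).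

(** The value of the expansion just before the limit step that took the snapshot, whence the extra
    unit of level 0. A snapshot is [full] if its record alone still accounts for the whole of
    [V0]. *)
Definition Vs (v : seq nat) : nat := VV (upd (tg v) 0 (tg v 0).+1) (ka v).
Definition full (v : seq nat) : bool := V0 <= Vs v.
Definition tge (a b : seq nat) : bool := all (fun i => tg b i <= tg a i) (iota 0 k.+1).
(** Bags list the newest record first. The counters decrease lexicographically, so no later snapshot
    dominates a full one, and a full snapshot has a larger argument than all earlier ones. Only full
    snapshots are constrained, since [V0] cannot be regained from the others. *)
Definition ord (new old : seq nat) : bool :=
  (full old ==> ~~ tge new old) && (full new ==> (ka old < ka new)).

Lemma tgeP a b : reflect (forall i, i <= k -> tg b i <= tg a i) (tge a b).
Proof.
apply: (iffP allP) => [h i ik|h i]; first by apply: h; rewrite mem_iota.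
by rewrite mem_iota => /h.
Qed.

(** Lexicographic comparison from the top level down, as an expansion lowers level [i+1] while
    raising level [i]. It is relaxed to inequalities above the level that drops, because losses may
    lower any counter. *)
Definition lexle (c t : nat -> nat) : Prop :=
  (forall i, i <= k -> c i <= t i) \/
  exists j, [/\ j <= k, c j < t j & forall i, j < i <= k -> c i <= t i].

(** [fi_pot] bounds the potential; [fi_lex] and [fi_ka] compare the present state with the stored
    snapshots, which is what is needed to put a new snapshot in front of an ordered bag. [fi_ka] is
    claimed only while nothing has been lost, as only then can a new snapshot be full. *)
Record FI (s : rst) : Prop := {
  fi_pot : VV (cc s) (LL s) <= V0;
  fi_items : forall v, v \in bg s IT -> ka v < V0.+2;
  fi_frames : bg s FR = [::];
  fi_ord : pairwise ord (bg s SN);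
  fi_snap : forall v, v \in bg s SN -> Vs v <= V0;
  fi_lex : forall v, v \in bg s SN -> full v -> lexle (cc s) (tg v);
  fi_ka : V0 <= VV (cc s) (LL s) -> forall v, v \in bg s SN -> ka v < LL s }.

Lemma V0E : VV (fun i => i == k) 1 = V0.
Proof. by rewrite /VV /= eqxx tower0 // => i ik; rewrite ltn_eqF. Qed.

Lemma VV_limit c c1 x : 0 < c 0 -> (forall i, i <= k -> c1 i = if i == 0 then (c 0).-1 else c i) ->
  VV c x = VV c1 (fast 1 0 x).
Proof.
move=> pos h; rewrite /VV (tower_cat 1 c x (isT : 1 <= k.+1)) (tower_cat 1 c1 _ (isT : 1 <= k.+1)).
have -> : tower 1 c1 1 (fast 1 0 x) = tower 1 c 1 x by rewrite /= h //= -iterSr prednK.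
by apply: eq_tower => i ik; case: i ik => // i ik; rewrite h.
Qed.

(** Let [L] be the present value. The new unit is raised to level [L+1]. Nothing is pending above
    level [L], because F_j(x) > j would already exceed [L]; so the new unit acts last and gives at
    most F_{L+1}(L) = F_omega(L). *)
Lemma low_limit b u x : 0 < x -> u <= x.+1 -> tower 0 b V0.+2 x <= V0 ->
  tower 0 (add b u 1) V0.+2 x <= fast 1 0 (tower 0 b V0.+2 x).
Proof.
set L := tower 0 b _ x => x0 ux LV.
have xL : x <= L by apply: leq_tower_self.
apply: leq_trans (_ : tower 0 (add b L.+1 1) V0.+2 x <= _); first by apply: add_exchange; lia.
have b0 j : L < j -> j < V0.+2 -> b j = 0.
  move=> Lj jV; apply/eqP; rewrite -leqn0 leqNgt; apply/negP => bj.
  have: fast 0 j x <= L.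
    apply: leq_trans (leq_tower_prefix 0 b x jV) => /=; rewrite -(prednK bj) iterSr.
    apply: leq_trans (leq_iter_self (@fast_gt 0 j) _ _); apply: fast_leq; exact: leq_tower_self.
  by have := fast_gt_index 0 j x0; lia.
have LV2 : L.+2 <= V0.+2 by lia.
rewrite (tower_cat _ _ _ LV2) tower0; last first.
  by move=> i iV; case: ifP => // /negbT; rewrite -leqNgt addE => Li; rewrite gtn_eqF // b0 //; lia.
have -> : tower 0 (add b L.+1 1) L.+2 x = fast 0 L.+1 (tower 0 (add b L.+1 1) L.+1 x).
  by rewrite -[LHS]/(iter (add b L.+1 1 L.+1) _ _) addE eqxx b0.
rewrite fast_limit; apply: fast_leq; rewrite (@eq_tower _ _ b); last by move=> i iL; rewrite addE ltn_eqF.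
by apply: leq_tower_prefix; lia.
Qed.

(** The fresh units are lifted to level [u-1], where at most [x+1] of them are worth no more than
    one unit of level [u]; the remaining [a-1] units are lifted back to level [u]. *)
Lemma low_item b u a u1 u2 m n x : 0 < a -> u1 <= u -> u2 < u -> m <= x.+1 -> u < n ->
  tower 0 (add (add b u1 a.-1) u2 m) n x <= tower 0 (add b u a) n x.
Proof.
move=> a0 u1u u2u mx un.
apply: leq_trans (_ : tower 0 (add (add b u1 a.-1) u.-1 m) n x <= _).
  by apply: add_exchange; lia.
apply: leq_trans (add_expand _ _ _ _) _ => //; first by lia.
rewrite prednK; last by lia.
rewrite (@eq_tower _ _ (add (add b u 1) u1 a.-1)); last by move=> i _; rewrite !addE; upds.
apply: leq_trans (_ : tower 0 (add (add b u 1) u a.-1) n x <= _); first by apply: add_exchange; lia.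
by apply: leq_tower => // i _; rewrite !addE; upds.
Qed.

Lemma lexle_leq c c' t : (forall i, i <= k -> c' i <= c i) -> lexle c t -> lexle c' t.
Proof.
move=> le [h|[j [jk lt h]]]; [left|right].
  by move=> i ik; apply: leq_trans (le _ ik) (h _ ik).
exists j; split=> //; first by apply: leq_ltn_trans lt; apply: le.
by move=> i /andP[ji ik]; apply: leq_trans (le _ ik) (h _ _); rewrite ji.
Qed.

(** The drop at level [i+1] overrides whatever happens from level [i] downwards; the new witness is
    the higher of [i+1] and the old one. *)
Lemma lexle_expand c c' t i : i < k -> c' i.+1 < c i.+1 -> (forall j, i.+1 < j -> c' j <= c j) ->
  lexle c t -> lexle c' t.
Proof.
move=> ik lt le [h|[j [jk ltj h]]]; right.
  exists i.+1; split=> //; first by apply: leq_trans lt (h _ _).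
  by move=> l /andP[il lk]; apply: leq_trans (le _ il) (h _ lk).
case: (ltngtP j i.+1) => [ji|ij|ji].
- exists i.+1; split=> //; first by apply: leq_trans lt (h _ _); rewrite ji.
  by move=> l /andP[il lk]; apply: leq_trans (le _ il) (h _ _); rewrite lk andbT; apply: ltn_trans il.
- exists j; split=> //; first by apply: leq_ltn_trans ltj; apply: le.
  by move=> l /andP[jl lk]; apply: leq_trans (le _ _) (h _ _); [apply: ltn_trans jl|rewrite jl].
- exists j; split=> //; first by rewrite ji in ltj *; apply: ltn_trans ltj.
  by move=> l /andP[jl lk]; apply: leq_trans (le _ _) (h _ _); [rewrite -ji|rewrite jl].
Qed.

Lemma VV_ltn c x y : x < y -> VV c x < VV c y. Proof. exact: tower_ltn. Qed.

Lemma VV_leq c c' x y : (forall i, i <= k -> c i <= c' i) -> x <= y -> VV c x <= VV c' y.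
Proof. by move=> h xy; apply: leq_tower => // i; rewrite ltnS => /h. Qed.

(** If the potential still reaches [V0] after the step then it has not dropped, and by strict
    monotonicity neither has [LL]; therefore [fi_ka] carries over. This serves all forward steps
    that take no snapshot. *)
Lemma FI_keep s s' : FI s -> VV (cc s') (LL s) <= VV (cc s) (LL s) -> LL s' <= LL s ->
  (forall v, v \in bg s' IT -> ka v < V0.+2) ->
  (forall b, b != IT -> bg s' b = bg s b) -> (forall t, lexle (cc s) t -> lexle (cc s') t) -> FI s'.
Proof.
case=> f1 f2 f3 f4 f5 f6 f7 hV hL hI hb hW.
have le' : VV (cc s') (LL s') <= VV (cc s') (LL s) by apply: VV_leq.
split=> //.
- by apply: leq_trans le' _; apply: leq_trans hV f1.
- by rewrite hb.
- by rewrite hb.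
- by rewrite hb.
- by rewrite hb // => v vs fv; apply: hW; apply: f6.
rewrite hb // => V0le v vs.
have LLle : LL s <= LL s'.
  rewrite leqNgt; apply/negP => /(VV_ltn (cc s')) lt.
  by move: hV f1 V0le; lia.
by apply: leq_trans LLle; apply: f7 => //; move: hV V0le le'; lia.
Qed.

Lemma FI_expand s s' : FI s -> sem fwd_expand s s' -> FI s'.
Proof.
move=> fi /(fwd_expand_sound nf_big)[i [n [ik nx pos xs [hc hb]]]].
have xL : xx s <= LL s by apply: leq_tower_self.
apply: (FI_keep fi).
- have := @tower_expand 1 (cc s) i k.+1 (LL s) n ik (leq_trans nx xL) pos.
  apply: leq_trans; rewrite leq_eqVlt; apply/orP; left; apply/eqP.
  by apply: eq_tower => j _; rewrite hc !updE.
- by rewrite /LL hb; apply: leq_tower.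
- by rewrite hb; apply: fi_items fi.
- by rewrite hb.
move=> t; apply: (@lexle_expand _ _ _ i) => //; first by rewrite hc; upds.
by move=> j ij; rewrite hc; upds.
Qed.

Lemma FI_next s s' : FI s -> sem fwd_next s s' -> FI s'.
Proof.
move=> fi /(fwd_next_sound nf_big)[l1 [v [l2 [v' [e1 pos hx hc [k1 k2 e2 hb]]]]]].
have vi : ka v < V0.+2 by apply: (fi_items fi); rewrite e1 mem_cat in_cons eqxx orbT.
apply: (FI_keep fi) => //.
- by apply: VV_leq => // i _; rewrite hc.
- rewrite /LL e1 e2 hx.
  apply: leq_trans (_ : tower 0 (upd (cnt (l1 ++ v :: l2)) (ka v) (cnt (l1 ++ v :: l2) (ka v)).-1) V0.+2 (xx s).+1 <= _).
    apply: leq_tower => // i _; rewrite cnt_cons k1 k2 !updE !cnt_mid !addE eqxx.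
    by case: eqP => // _; lia.
  apply: tower_next => //; last exact: fast_gt.
  by rewrite cnt_mid addE eqxx; lia.
- move=> w; rewrite e2 in_cons => /orP[/eqP->|wl]; first by rewrite k1.
  by apply: (fi_items fi); rewrite e1 mem_cat in_cons; move: wl; rewrite mem_cat => /orP[->|->] //; rewrite !orbT.
- by move=> t; apply: lexle_leq => i _; rewrite hc.
Qed.

Lemma FI_item s s' : FI s -> sem fwd_item s s' -> FI s'.
Proof.
move=> fi /(fwd_item_sound nf_big)[l1 [v [l2 [v1 [v2 [e1 pos hx hc [k1 k2 k3 /andP[_ k4] [e2 hb]]]]]]]].
have vi : ka v < V0.+2 by apply: (fi_items fi); rewrite e1 mem_cat in_cons eqxx orbT.
apply: (FI_keep fi) => //.
- by apply: VV_leq => // i _; rewrite hc.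
- rewrite /LL e1 e2; apply: leq_trans (_ : tower 0 (cnt [:: v2, v1 & l1 ++ l2]) V0.+2 (xx s) <= _).
    exact: leq_tower.
  rewrite (@eq_tower _ (cnt (l1 ++ v :: l2)) (add (cnt (l1 ++ l2)) (ka v) (mu v))); last first.
    by move=> i _; rewrite cnt_mid.
  rewrite (@eq_tower _ _ (add (add (cnt (l1 ++ l2)) (ka v1) (mu v).-1) (ka v2) (mu v2))); last first.
    by move=> i _; rewrite cnt_cons !addE !cnt_cons k2.
  exact: low_item.
- move=> w; rewrite e2 !in_cons => /orP[/eqP->|/orP[/eqP->|wl]]; [by lia|by lia|].
  by apply: (fi_items fi); rewrite e1 mem_cat in_cons; move: wl; rewrite mem_cat => /orP[->|->] //; rewrite !orbT.
- by move=> t; apply: lexle_leq => i _; rewrite hc.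
Qed.

(** The value of the new snapshot is at most the potential before the step. If the snapshot is full,
    rigidity gives [ka sn = LL s]: all items were used up and nothing was lost. By [fi_ka] this
    argument exceeds those of all older snapshots. *)
Lemma FI_limit s s' : FI s -> sem fwd_limit s s' -> FI s'.
Proof.
case=> f1 f2 f3 f4 f5 f6 f7.
case/(fwd_limit_sound nf_big)=> sn [it [c0 x0 eSN eIT [eFR hc /andP[hx1 hx2] hk hm]]].
pose c1 i := if i == 0 then (cc s 0).-1 else cc s i.
have xL : xx s <= LL s by apply: leq_tower_self.
have LV : LL s <= V0 by apply: leq_trans f1; apply: leq_tower_self.
have hL : LL s' <= fast 1 0 (LL s).
  rewrite /LL eIT (@eq_tower _ _ (add (cnt (bg s IT)) (ka it) 1)); last by move=> i _; rewrite cnt_cons hm.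
  apply: leq_trans (_ : tower 0 (add (cnt (bg s IT)) (ka it) 1) V0.+2 (xx s) <= _).
    by apply: leq_tower => //; lia.
  by apply: low_limit => //; lia.
have EV : VV (cc s) (LL s) = VV c1 (fast 1 0 (LL s)) by apply: VV_limit.
have c'1 i : i <= k -> cc s' i <= c1 i by move=> /hc/andP[h1 h2]; apply: leq_trans h1 h2.
have tg1 i : i <= k -> upd (tg sn) 0 (tg sn 0).+1 i <= cc s i.
  by move=> ik; have := hc i ik; rewrite updE; case: eqP => [->|_] /andP[]; lia.
have VsV : Vs sn <= VV (cc s) (LL s) by apply: VV_leq => //; lia.
have sn_full : full sn -> V0 <= VV (cc s) (LL s) /\ ka sn = LL s.
  move=> fl; have le := leq_trans fl VsV; split=> //.
  have [|||] := @tower_eq_inv 1 (upd (tg sn) 0 (tg sn 0).+1) (cc s) k.+1 (ka sn) (LL s) => //.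
    by lia.
  by apply: leq_trans f1 fl.
split.
- by apply: leq_trans f1; rewrite EV; apply: VV_leq.
- by move=> v; rewrite eIT in_cons => /orP[/eqP->|/f2//]; lia.
- by rewrite eFR.
(* Against a full older snapshot the counters are lexicographically smaller. In the pointwise case
   the unit of level 0 just spent makes the difference, otherwise the level of the strict drop
   does. *)
- rewrite eSN /= f4 andbT; apply/allP => v vs; apply/andP; split; apply/implyP => fl.
    apply/negP => /tgeP ge.
    have [h|[j [jk lt h]]] := f6 _ vs fl.
      by have := h 0 isT; have := ge 0 isT; have := hc 0 isT; rewrite eqxx; lia.
    by have := ge j jk; have := hc j jk; move: lt; case: eqP => [->|_]; lia.
  by have [V0le ->] := sn_full fl; apply: f7.
- by move=> v; rewrite eSN in_cons => /orP[/eqP->|/f5//]; lia.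
- move=> v; rewrite eSN in_cons => /orP[/eqP->|vs] fl.
    by left=> i /hc/andP[].
  apply: lexle_leq (f6 _ vs fl) => i ik; apply: leq_trans (c'1 _ ik) _.
  by rewrite /c1; case: eqP => [->|//]; lia.
move=> V0le.
(* No value was lost, so by rigidity the new [LL] is F_omega of the old one and hence strictly
   larger than every stored argument. *)
have [|||_ EL] := @tower_eq_inv 1 (cc s') c1 k.+1 (LL s') (fast 1 0 (LL s)) => //.
  by rewrite -/(VV _ _) -/(VV _ _) -EV; lia.
have gtL : LL s < LL s' by rewrite EL; apply: fast_gt.
move=> v; rewrite eSN in_cons => /orP[/eqP->|vs]; first by lia.
apply: ltn_trans gtL; apply: f7 => //; rewrite EV; apply: leq_trans V0le _; exact: VV_leq.
Qed.

Lemma FI_fwd s s' : FI s -> sem FWD s s' -> FI s'.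
Proof.
move=> fi /semStar st; apply: star_inv st fi => a b fi /semAlt[|/semAlt[|/semAlt[|]]].
- exact: FI_expand.
- exact: FI_limit.
- exact: FI_next.
- exact: FI_item.
Qed.

(** The potential is below [V0] and has to stay there. [bi_old] takes care of frames left behind by
    earlier gadgets: for a full snapshot whose argument is still at most [x], none of them carries
    tags that dominate those of the snapshot. *)
Record BI (s : rst) : Prop := {
  bi_pot : VV (cc s) (xx s) < V0;
  bi_ord : pairwise ord (bg s SN);
  bi_snap : forall v, v \in bg s SN -> Vs v <= V0;
  bi_old : forall v, v \in bg s SN -> full v -> ka v <= xx s ->
    forall f, f \in bg s FR -> ~~ tge f v }.

Lemma BI_contract s s' : BI s -> sem bwd_contract s s' -> BI s'.
Proof.
case=> b1 b2 b3 b4 /(bwd_contract_sound nf_big)[i [n [ik nc xn xx' [h1 h2 h3 hb]]]].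
split; rewrite ?hb //.
  apply: leq_ltn_trans b1; apply: (@tower_contract _ _ _ i _ _ _ n) => // j /andP[ij _].
  by rewrite h3.
by move=> v vs fl kx; apply: b4 => //; apply: leq_trans kx xx'.
Qed.

(** Replays the recursion outwards: from a value at level [b], the round counts saved in the frames
    reapply F_{b+1}, F_{b+2} and so on. In a faithful run this never exceeds the argument at the
    opening of the gadget. *)
Fixpoint stack (al : seq nat) (b y : nat) : nat :=
  if al is a :: al' then stack al' b.+1 (iter a (fast 0 b.+1) y) else y.

Lemma leq_stack al b x y : x <= y -> stack al b x <= stack al b y.
Proof. by elim: al b x y => //= a al IH b x y xy; apply: IH; apply: iter_leq_arg => //; exact: fast_ltn. Qed.

(** The depth kept in a frame is at most the number of frames below it, so among the frames of one
    recursion only the top one can be as deep as the next return requires. *)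
Fixpoint frames (fs : seq (seq nat)) (al : seq nat) : Prop :=
  match fs, al with
  | [::], [::] => True
  | f :: fs', a :: al' => [/\ ka f <= size fs', mu f <= a & frames fs' al']
  | _, _ => False
  end.

(** [v] is the snapshot fetched at the opening, [O] the frames already present, [x0] and [c0] the
    argument and counters at that time. The stack is only described in [gi_ex], under the condition
    that the counters still equal the tags of [v] and that [VB + VD] is still [ka v + 1]. Both
    quantities can only fall, so after any deviation the condition fails for good. *)
Record GI (v : seq nat) (rest O : seq (seq nat)) (x0 : nat) (c0 : nat -> nat) (s : rst) : Prop := {
  gi_rest : bg s SN = rest;
  gi_tg : forall i, i <= k -> cc s i <= tg v i;
  gi_c0 : forall i, i <= k -> cc s i <= c0 i;
  gi_db : rg s 9 + rg s 11 <= (ka v).+1;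
  gi_x : xx s <= x0;
  gi_fr : forall f, f \in bg s FR -> f \in O \/ tge v f;
  gi_ex : full v -> ka v <= x0 -> (forall i, i <= k -> cc s i = tg v i) -> rg s 9 + rg s 11 = (ka v).+1 ->
    exists fs al, [/\ bg s FR = fs ++ O, frames fs al, size fs = rg s 9 &
      stack al (rg s 11) (iter (rg s 7) (fast 0 (rg s 11)) (xx s)) <= x0] }.

(** The delicate case is a return: the exactness of the counters and of [VB + VD] after the step is
    used to identify the guessed frame as the top of the stack. *)
Lemma GI_step v rest O x0 c0 s s' : (full v -> ka v <= x0 -> forall f, f \in O -> ~~ tge f v) ->
  GI v rest O x0 c0 s -> sem (Alt gad_base (Alt gad_push gad_pop)) s s' -> GI v rest O x0 c0 s'.
Proof.
move=> hO [g1 g2 g3 g4 g5 g6 g7] /semAlt[/(gad_base_sound)|/semAlt[]].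
- case=> pos hx hA hd [hb hc hbg]; split; rewrite ?hbg ?hd ?hb ?hA ?hx //.
  + by move=> i ik; rewrite hc g2.
  + by move=> i ik; rewrite hc g3.
  + by lia.
  + by lia.
  move=> fv kx ex edb.
  (* [VB] is 0 after the reset, so its sum with [VD] could be preserved only if it was 0 before. *)
  have b0 : rg s 11 = 0 by lia.
  have [||fs [al [q1 q2 q3 q4]]] := g7 fv kx _ _; [by move=> i ik; rewrite -hc ex|by lia|].
  exists fs, al; split=> //; apply: leq_trans q4; rewrite b0; apply: leq_stack.
  by rewrite iterSr fast_zero prednK.
- case/(gad_push_sound nf_big)=> f [hc hx hF hS [hd hk hm hA [pos hb]]].
  have cle i : i <= k -> cc s' i <= cc s i by move=> /hc/andP[h1 h2]; apply: leq_trans h1 h2.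
  split; rewrite ?hS ?hx //.
  + by move=> i ik; apply: leq_trans (cle _ ik) (g2 _ ik).
  + by move=> i ik; apply: leq_trans (cle _ ik) (g3 _ ik).
  + by lia.
  + move=> w; rewrite hF in_cons => /orP[/eqP->|/g6//]; right; apply/tgeP => i ik.
    by have := hc i ik; have := g2 i ik; lia.
  move=> fv kx ex edb.
  have [||fs [al [q1 q2 q3 q4]]] := g7 fv kx _ _.
  + by move=> i ik; have := cle i ik; have := g2 i ik; rewrite ex //; lia.
  + by lia.
  exists (f :: fs), (rg s 7 :: al); split=> //=.
  + by rewrite hF q1.
  + by rewrite q3.
  + by rewrite q3; lia.
  by rewrite hA hb /= prednK.
case/(gad_pop_sound nf_big)=> l1 [f [l2 [e1 e2 hS hx [hA [hd hk] hb hc hA']]]].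
have cle i : i <= k -> cc s' i <= cc s i by move=> /hc[].
split; rewrite ?hS //.
- by move=> i ik; apply: leq_trans (cle _ ik) (g2 _ ik).
- by move=> i ik; apply: leq_trans (cle _ ik) (g3 _ ik).
- by lia.
- by apply: leq_trans hx g5.
- move=> w wi; apply: g6; rewrite e1 mem_cat in_cons.
  by move: wi; rewrite e2 mem_cat => /orP[->|->] //; rewrite !orbT.
move=> fv kx ex edb.
have [||fs [al [q1 q2 q3 q4]]] := g7 fv kx _ _.
- by move=> i ik; have := cle i ik; have := g2 i ik; rewrite ex //; lia.
- by lia.
have tf : tge f v by apply/tgeP => i ik; have [_] := hc i ik; rewrite ex.
have fO : f \notin O by apply/negP => /(hO fv kx); rewrite tf.
case: fs al q1 q2 q3 q4 => [|h fs] [|a al] // q1 q2 q3 q4; first by rewrite /= in q3; lia.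
case: q2 => hk2 hm2 q2; rewrite /= in q3.
have kf w : w \in fs -> ka w < size fs.
  elim: fs al q2 {q1 hk2 q3 q4} => // w' fs IH [|a' al] //= [h1 _ h3].
  by rewrite in_cons => /orP[/eqP->|/(IH _ h3)]; lia.
(* A frame from further back would be an old one, which is excluded by its tags, or a lower one of
   this recursion, which is excluded by its depth. *)
have l10 : l1 = [::].
  case: l1 e1 e2 => // w l1 e1 e2; case: (q1); rewrite e1 /= => -[_ eq].
  have : f \in fs ++ O by rewrite -eq mem_cat in_cons eqxx orbT.
  by rewrite mem_cat (negPf fO) orbF => /kf; lia.
rewrite l10 /= in e1 e2; rewrite e1 in q1; case: q1 => Ef El2; subst f l2.
exists fs, al; split=> //; first by lia.
(* The test on return shows that more than [x] rounds were completed at level [b], and these are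
   worth one application of F_{b+1} to the present [x]. *)
apply: leq_trans q4; rewrite hb /=; apply: leq_stack.
apply: leq_trans (_ : iter (mu h).+1 (fast 0 (rg s 11).+1) (xx s') <= _).
  by apply: leq_iter_count => //; exact: fast_gt.
rewrite iterSr; apply: leq_iter2 => //; [exact: fast_gt|exact: fast_ltn|].
rewrite fast_succ; apply: leq_iter2 => //; [exact: fast_gt|exact: fast_ltn].
Qed.

(** If the closing state were worth [V0], it would agree with the snapshot exactly; the recursion
    would have been faithful and F_omega(ka v) at most the argument at the opening. Then the opening
    state would already have been worth [V0]. *)
Lemma BI_gadget s s' : BI s -> sem (gad_open ;; gadget ;; gad_close) s s' -> BI s'.
Proof.
case=> b1 b2 b3 b4 /semS[s1 [/(gad_open_sound nf_big)[l1 [v [l2 [e1 e2 e3 hx [hc hd hb hA]]]]]]].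
case/semS=> s2 [/semStar st /(gad_close_sound nf_big)[A2 x2 x2' bg2 c2]].
have vs : v \in bg s SN by rewrite e1 mem_cat in_cons eqxx orbT.
have sub : subseq (l1 ++ l2) (bg s SN).
  by rewrite e1; apply: cat_subseq => //; apply: subseq_cons.
set O := bg s FR in e3.
have hO : full v -> ka v <= xx s -> forall f, f \in O -> ~~ tge f v by apply: b4.
have gi0 : GI v (l1 ++ l2) O (xx s) (cc s) s1.
  split; rewrite ?hx ?e3 //.
  - by move=> i /hc[].
  - by move=> i /hc[].
  - by rewrite hd.
  - by move=> f; left.
  by exists [::], [::]; rewrite hd hA; split.
have [g1 g2 g3 g4 g5 g6 g7] : GI v (l1 ++ l2) O (xx s) (cc s) s2.
  by apply: star_inv st gi0 => a b; apply: GI_step.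
have cup i : i <= k -> cc s' i <= upd (tg v) 0 (tg v 0).+1 i.
  by move=> ik; rewrite c2 !updE; case: eqP => [_|_]; [rewrite ltnS|]; apply: g2.
have VsV : VV (cc s') (xx s') <= Vs v by apply: VV_leq => //; lia.
split.
- rewrite ltnNge; apply/negP => le.
  have fv : full v by apply: leq_trans VsV.
  have [|||Ec Ex] := @tower_eq_inv 1 (cc s') (upd (tg v) 0 (tg v 0).+1) k.+1 (xx s') (ka v) => //.
  + by lia.
  + by apply: leq_trans le; apply: b3.
  have ex i : i <= k -> cc s2 i = tg v i.
    by move=> ik; have := Ec i ik; rewrite c2 !updE; case: eqP => [->|//] [].
  have [||fs [al [q1 q2 q3 q4]]] := g7 fv _ ex _; [by lia|by lia|].
  have d0 : rg s2 9 = 0 by lia.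
  have {}b0 : rg s2 11 = (ka v).+1 by lia.
  rewrite d0 in q3; case: fs q3 q1 q2 => // _ _; case: al q4 => //= q4 _.
  rewrite b0 in q4.
  have le2 : fast 1 0 (ka v) <= xx s.
    apply: leq_trans q4; rewrite fast_limit -(prednK A2) iterSr.
    apply: leq_trans (leq_iter_self (@fast_gt 0 _) _ _).
    by apply: leq_fast => //; rewrite -Ex.
  have : Vs v <= VV (cc s) (xx s).
    rewrite /Vs (@VV_limit _ (tg v)) ?updE //.
      by apply: VV_leq => // i ik; rewrite -ex // g3.
    by move=> i ik; rewrite updE; case: eqP => [->|].
  by move: b1 fv; rewrite /full; lia.
- by rewrite bg2 g1; apply: subseq_pairwise sub b2.
- by move=> w; rewrite bg2 g1 => /(mem_subseq sub)/b3.
move=> w; rewrite bg2 g1 => wr fw kw f fF; case: (g6 f fF) => [fO|vf].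
  by apply: b4 fw _ _ fO; [apply: (mem_subseq sub)|lia].
move: b2; rewrite e1 pairwise_cat /= => /and3P[/allrelP h1 _ /andP[/allP h2 _]].
(* The tags of a frame from this gadget are dominated by those of [v]. A full snapshot in front of
   [v] has an argument above [ka v], whereas [x] is now at most [ka v]; a full one behind [v] is not
   dominated by [v], hence not by the frame. *)
move: wr; rewrite mem_cat => /orP[wl|wl].
  have /andP[_] := h1 w v wl (mem_head _ _); rewrite fw /=; lia.
have /andP[+ _] := h2 w wl; rewrite fw /=; apply: contra => /tgeP fw'.
by apply/tgeP => i ik; apply: leq_trans (fw' i ik) _; move/tgeP: vf; apply.
Qed.

Lemma BI_bwd s s' : BI s -> sem BWD s s' -> BI s'.
Proof.
move=> bi /semStar st; apply: star_inv st bi => a b bi /semAlt[]; first exact: BI_contract.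
exact: BI_gadget.
Qed.

Lemma core_init s : (forall i, i <= k -> cc s i = (i == k)) -> xx s = 1 ->
  (forall b, bg s b = [::]) -> FI s.
Proof.
move=> hc hx hb; have EL : LL s = 1 by rewrite /LL hb hx tower0 // => i _; rewrite /cnt big_nil.
split; rewrite ?hb //.
by rewrite EL -V0E; apply: VV_leq => // i ik; rewrite hc.
Qed.

(* A loss in the middle phase can never be made up for. *)
Lemma core_sound s1 s2 s3 : FI s1 -> bg s2 SN = bg s1 SN -> bg s2 FR = bg s1 FR ->
  (forall i, i <= k -> cc s2 i = cc s1 i) -> xx s2 < xx s1 -> sem BWD s2 s3 ->
  0 < cc s3 k -> 0 < xx s3 -> False.
Proof.
case=> f1 _ f3 f4 f5 _ _ eS eF hc lx bw ck x3.
have bi : BI s2.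
  split; rewrite ?eS ?eF ?f3 //.
  apply: leq_ltn_trans (_ : VV (cc s1) (xx s2) < _); first by apply: VV_leq => // i ik; rewrite hc.
  apply: leq_trans f1; apply: VV_ltn; apply: leq_trans lx _; exact: leq_tower_self.
have [lt _ _ _] := BI_bwd bi bw.
move: lt; apply/negP; rewrite -leqNgt -V0E; apply: VV_leq => // i ik.
by case: eqP => // ->.
Qed.

End CoreSound.

(** * Completeness of the core *)

Section CoreComplete.
Variables k nf : nat.
Hypothesis nf_big : 2 * k + 12 <= nf.
Local Notation sem := (sem (rstep k nf)).

Lemma inc_c r s a : ev (iv s) r = a -> a < nf.*2 -> exists s', [/\ sem (inc r) s s',
  iv s' = iv s, bg s' = bg s & forall u, rg s' u = if u == a then (rg s a).+1 else rg s u].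
Proof.
by move=> <- lt; eexists; split; [apply/incE; split; [exact: lt|reflexivity]|..].
Qed.

Lemma dec_c r s a : ev (iv s) r = a -> a < nf.*2 -> 0 < rg s a -> exists s', [/\ sem (dec r) s s',
  iv s' = iv s, bg s' = bg s & forall u, rg s' u = if u == a then (rg s a).-1 else rg s u].
Proof.
by move=> <- lt pos; eexists; split; [apply/decE; split; [exact: lt|exact: pos|reflexivity]|..].
Qed.

Lemma reset_c r s a : ev (iv s) r = a -> a < nf.*2 -> odd r.1 -> exists s', [/\ sem (reset r) s s',
  iv s' = iv s, bg s' = bg s & forall u, rg s' u = if u == a then 0 else rg s u].
Proof.
by move=> <- lt od; eexists; split; [apply/resetE; split; [exact: od|exact: lt|reflexivity]|..].
Qed.

Lemma ctrl_c c s j : cstep k c (iv s) j -> exists s', [/\ sem (ctrl c) s s',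
  iv s' = j, bg s' = bg s & forall u, rg s' u = rg s u].
Proof. by move=> cs; eexists; split; [apply/ctrlE; exists j; [exact: cs|reflexivity]|..]. Qed.

Lemma clr_c s : exists s', [/\ sem clr s s', iv s' = iv s, bg s' = bg s &
  (forall u, odd u -> rg s' u = rg s u) /\ (forall u, ~~ odd u -> rg s' u = 0)].
Proof.
have sm : sem clr s (Rst (iv s) (setv [::] (rg s)) (bg s)) by apply/clrE.
by eexists; split; [exact: sm|..]; have [] := clr_s sm.
Qed.

Lemma sto_c b s : 4 + b.*2 < nf.*2 -> exists s' v, [/\ sem (sto b) s s',
  ka v = rg s 0, mu v = rg s 2, forall i, i <= k -> tg v i = rg s (4 + 4 * i) & 
  [/\ bg s' b = v :: bg s b, forall b', b' != b -> bg s' b' = bg s b', iv s' = iv s &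
  (forall u, odd u -> rg s' u = rg s u) /\ (forall u, ~~ odd u -> rg s' u = 0)]].
Proof.
move=> lt; set s' := Rst (iv s) (setv [::] (rg s)) (updb (bg s) b (rvec nf (rg s) :: bg s b)).
have sm : sem (sto b) s s' by apply/stoE.
by have [v [? ? ? ? [? ? ? ?]]] := sto_s nf_big sm; exists s', v.
Qed.

Lemma get_c b s l1 v l2 : 4 + b.*2 < nf.*2 -> bg s b = l1 ++ v :: l2 -> exists s',
  [/\ sem (get b) s s', bg s' b = l1 ++ l2, forall b', b' != b -> bg s' b' = bg s b',
      iv s' = iv s & [/\ forall u, odd u -> rg s' u = rg s u, rg s' 0 = ka v, rg s' 2 = mu v &
      forall i, rg s' (4 + 4 * i) = tg v i]].
Proof.
move=> lt eb; exists (Rst (iv s) (setv v (rg s)) (updb (bg s) b (l1 ++ l2))); split=> //=.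
- by apply/getE; exists l1, v, l2.
- by rewrite /updb eqxx.
- by move=> b'; rewrite /updb => /negPf->.
by split=> // [u|i]; [rewrite /setv => ->|exact: setvG].
Qed.

Lemma xfer_c (rs : bool) r (d : bool) w s vr vw : ev (iv s) r = vr -> ev (iv s) w = vw ->
  vr < nf.*2 -> vw < nf.*2 -> [&& vr != vw, vr != 3 & vw != 3] ->
  (rs -> odd r.1) -> (d -> rg s vr <= rg s vw) -> exists s',
  [/\ sem (xfer rs r d w) s s', iv s' = iv s, bg s' = bg s &
  forall v, rg s' v = if v == vw then (if d then rg s vw - rg s vr else rg s vw + rg s vr) else
                  if v == 3 then 0 else rg s v].
Proof.
move=> Er Ew lr lw /and3P[n1 n2 n3] od le.
have [|g [sm eg]] := @xfer_complete k nf rs r d w s vr vw Er Ew n1 n2 n3 lr lw _ od le; first by lia.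
by exists (Rst (iv s) g (bg s)).
Qed.

Lemma mv_c r w s vr vw : ev (iv s) r = vr -> ev (iv s) w = vw ->
  vr < nf.*2 -> vw < nf.*2 -> vr != vw -> exists s',
  [/\ sem (mv r w) s s', iv s' = iv s, bg s' = bg s &
  forall v, rg s' v = if v == vr then 0 else if v == vw then rg s vw + rg s vr else rg s v].
Proof.
move=> Er Ew lr lw n1.
have [g [sm eg]] := @mv_complete k nf r w s _ vr vw Er Ew n1 lr lw (leqnn _).
by exists (Rst (iv s) g (bg s)); split=> // v; rewrite /= eg subnn.
Qed.

Ltac ivt := repeat match goal with H : iv ?s = _ |- context [iv ?s] => rewrite H end; reflexivity.

Ltac sd := solve [reflexivity | by [] | ivt | lia | by apply/eqP; lia | by rewrite /=; ivt | by rgc; lia].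

Lemma fwd_expand_c s i : i < k -> 0 < cc s i.+1 -> exists s', [/\ sem fwd_expand s s',
  xx s' = xx s, bg s' = bg s & forall j, cc s' j = if j == i then cc s i + (xx s).+1 else
                          if j == i.+1 then (cc s i.+1).-1 else cc s j].
Proof.
move=> ik pos.
have h1 := anyindex_complete nf s (ltnW ik); set s1 := Rst i _ _ in h1.
have i1 : iv s1 = i by []. have g1 u : rg s1 u = rg s u by [].
have [|s2 [h2 i2 b2 g2]] := @ctrl_c CInc s1 i.+1; first by [].
have [|||s3 [h3 i3 b3 g3]] := @dec_c VC s2 (15 + 4 * i.+1); [by rewrite i2|by lia|by rewrite g2|].
have [|s4 [h4 i4 b4 g4]] := @ctrl_c CDec s3 i; first by rewrite i3 i2.
have [|||||||s5 [h5 i5 b5 g5]] := @xfer_c false VX false VC s4 1 (15 + 4 * i); try by sd.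
have [||s6 [h6 i6 b6 g6]] := @inc_c VC s5 (15 + 4 * i); [by rewrite i5 i4|by lia|].
exists s6; split.
- by do 5 (apply: sem_seq; first eassumption).
- by rgc.
- by rewrite b6 b5 b4 b3 b2.
move=> j; have [->|ne] := eqVneq j i; first by rgc; lia.
have [->|ne'] := eqVneq j i.+1; first by rgc.
by rgc.
Qed.

Lemma fwd_next_c s l1 v l2 : bg s IT = l1 ++ v :: l2 -> 0 < mu v -> exists s' v',
  [/\ sem fwd_next s s', xx s' = (xx s).+1, forall j, cc s' j = cc s j &
  [/\ ka v' = ka v, mu v' = (mu v).-1, bg s' IT = v' :: l1 ++ l2 &
      forall b, b != IT -> bg s' b = bg s b]].
Proof.
move=> eb pos; have [|s1 [h1 e1 e1' i1 [g1 g10 g12 _]]] := get_c _ eb; first by rewrite /IT; lia.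
have [|||s2 [h2 i2 b2 g2]] := @dec_c VF1 s1 2; try by sd.
have [||s3 [h3 i3 b3 g3]] := @inc_c VX s2 1; try by sd.
have [|s4 [v' [h4 k1 k2 _ [e4 e4' i4 [g4 g4']]]]] := @sto_c IT s3; first by rewrite /IT; lia.
exists s4, v'; split.
- by do 3 (apply: sem_seq; first eassumption).
- by rgc.
- by move=> j; rgc.
split; [by rewrite k1; rgc|by rewrite k2; rgc|by rewrite e4 b3 b2 e1|].
by move=> b nb; rewrite e4' // b3 b2 e1'.
Qed.

Lemma fwd_item_c s l1 v l2 : bg s IT = l1 ++ v :: l2 -> 0 < mu v -> 0 < ka v -> exists s' v1 v2,
  [/\ sem fwd_item s s', xx s' = xx s, forall j, cc s' j = cc s j &
  [/\ ka v1 = ka v, mu v1 = (mu v).-1, ka v2 = (ka v).-1, mu v2 = (xx s).+1 &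
  [/\ bg s' IT = v2 :: v1 :: l1 ++ l2 & forall b, b != IT -> bg s' b = bg s b]]].
Proof.
move=> eb pos posk; have [|s1 [h1 e1 e1' i1 [g1 g10 g12 _]]] := get_c _ eb; first by rewrite /IT; lia.
have [|||s2 [h2 i2 b2 g2]] := @dec_c VF1 s1 2; try by sd.
have [|||s3 [h3 i3 b3 g3]] := @reset_c VU s2 5; try by sd.
have [|||||||s4 [h4 i4 b4 g4]] := @xfer_c false VF0 false VU s3 0 5; try by sd.
have [|s5 [v1 [h5 k1 k2 _ [e5 e5' i5 [g5 g5']]]]] := @sto_c IT s4; first by rewrite /IT; lia.
have [|||s6 [h6 i6 b6 g6]] := @dec_c VU s5 5; try by sd.
have [|||||s7 [h7 i7 b7 g7]] := @mv_c VU VF0 s6 5 0; try by sd.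
have [|||||||s8 [h8 i8 b8 g8]] := @xfer_c false VX false VF1 s7 1 2; try by sd.
have [||s9 [h9 i9 b9 g9]] := @inc_c VF1 s8 2; try by sd.
have [|s10 [v2 [h10 q1 q2 _ [e10 e10' i10 [g10' g10'']]]]] := @sto_c IT s9; first by rewrite /IT; lia.
exists s10, v1, v2; split.
- by do 9 (apply: sem_seq; first eassumption).
- by rgc.
- by move=> j; rgc.
split; [by rewrite k1; rgc|by rewrite k2; rgc|by rewrite q1; rgc; lia|by rewrite q2; rgc; lia|].
split; first by rewrite e10 b9 b8 b7 b6 e5 b4 b3 b2 e1.
by move=> b nb; rewrite e10' // b9 b8 b7 b6 e5' // b4 b3 b2 e1'.
Qed.

Lemma fwd_limit_c s : 0 < cc s 0 -> 0 < xx s -> exists s' sn it,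
  [/\ sem fwd_limit s s', xx s' = xx s,
      forall i, i <= k -> cc s' i = if i == 0 then (cc s 0).-1 else cc s i,
      forall i, i <= k -> tg sn i = cc s' i &
  [/\ ka sn = xx s, ka it = (xx s).+1, mu it = 1, bg s' SN = sn :: bg s SN &
  [/\ bg s' IT = it :: bg s IT & bg s' FR = bg s FR]]].
Proof.
move=> pos x0; rewrite /cc muln0 addn0 in pos; have x0' := prednK x0; rewrite /xx in x0 x0'.
have [|||s1 [h1 i1 b1 g1]] := @dec_c VX s 1; try by sd.
have [||s2 [h2 i2 b2 g2]] := @inc_c VX s1 1; try by sd.
have [|s3 [h3 i3 b3 g3]] := @ctrl_c CZero s2 0; first by [].
have [|||s4 [h4 i4 b4 g4]] := @dec_c VC s3 15; [by rewrite i3|by lia|by rgc|].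
have [s5 [h5 i5 b5 [g5 g5']]] := clr_c s4.
have [|s6 [h6 t1 t2 g6 b6]] := @tags_complete k nf nf_big false s5; first by [].
have [|||||||s7 [h7 i7 b7 g7]] := @xfer_c true VX false VF0 s6 1 0; try by sd.
have [|s8 [sn [h8 k1 k2 kt [e8 e8' i8 [g8 g8']]]]] := @sto_c SN s7; first by rewrite /SN; lia.
have [|||||||s9 [h9 i9 b9 g9]] := @xfer_c false VX false VF0 s8 1 0; try by sd.
have [||s10 [h10 i10 b10 g10]] := @inc_c VF0 s9 0; try by sd.
have [||s11 [h11 i11 b11 g11]] := @inc_c VF1 s10 2; try by sd.
have [|s12 [it [h12 q1 q2 _ [e12 e12' i12 [g12 g12']]]]] := @sto_c IT s11; first by rewrite /IT; lia.
have c6 i : i <= k -> cc s12 i = cc s5 i by move=> ik; rewrite -t1 //; rgc.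
exists s12, sn, it; split.
- by do 11 (apply: sem_seq; first eassumption).
- by rgc.
- move=> i ik; rewrite c6 //; case: (i =P 0) => [->|ne]; first by rewrite /cc muln0 addn0; rgc.
  by rgc.
- move=> i ik; rewrite kt // c6 //.
  have -> : rg s7 (4 + 4 * i) = rg s6 (4 + 4 * i) by rewrite g7; eqf.
  by rewrite t2 // g5' ?add0n //; lia.
split.
- by rewrite k1; rgc.
- by rewrite q1; rgc; lia.
- by rewrite q2; rgc.
- by rewrite e12' // b11 b10 b9 e8 b7 b6 b5 b4 b3 b2 b1.
split; first by rewrite e12 b11 b10 b9 e8' // b7 b6 b5 b4 b3 b2 b1.
by rewrite e12' // b11 b10 b9 e8' // b7 b6 b5 b4 b3 b2 b1.
Qed.

Lemma bwd_contract_c s i : i < k -> xx s < cc s i -> exists s', [/\ sem bwd_contract s s',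
  xx s' = xx s, bg s' = bg s & [/\ forall j, j <= i -> cc s' j = 0,
  cc s' i.+1 = (cc s i.+1).+1 & forall j, i.+1 < j -> cc s' j = cc s j]].
Proof.
move=> ik lt; rewrite /xx /cc in lt.
have h1 := anyindex_complete nf s (ltnW ik); set s1 := Rst i _ _ in h1.
have i1 : iv s1 = i by []. have g1 u : rg s1 u = rg s u by [].
have [|||||||s2 [h2 i2 b2 g2]] := @xfer_c true VX true VC s1 1 (15 + 4 * i); try by sd.
have [|||s3 [h3 i3 b3 g3]] := @dec_c VC s2 (15 + 4 * i); [by rewrite i2|by lia|by rgc; lia|].
have [|s4 [h4 i4 b4 g4]] := @ctrl_c CInc s3 i.+1; first by rewrite i3 i2.
have [||s5 [h5 i5 b5 g5]] := @inc_c VC s4 (15 + 4 * i.+1); [by rewrite i4|by lia|].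
have [|s6 [h6 i6 b6 g6]] := @ctrl_c CDec s5 i; first by rewrite i5 i4.
have [|s7 [h7 q1 q2 q3]] := @below_complete k nf nf_big s6; first by rewrite i6 ltnW.
rewrite i6 in q1 q2.
exists s7; split.
- by do 6 (apply: sem_seq; first eassumption).
- by rewrite /xx q2 => [|j _]; [rgc|apply/eqP; lia].
- by rewrite q3 b6 b5 b4 b3 b2.
split=> //; first by rewrite /cc q2 => [|j ji]; [rgc|apply/eqP; lia].
by move=> j ji; rewrite /cc q2 => [|j' ji']; [rgc|apply/eqP; lia].
Qed.

Lemma gad_open_c s v l : bg s SN = v :: l -> (forall i, i <= k -> tg v i = cc s i) ->
  exists s', [/\ sem gad_open s s', xx s' = xx s, forall i, i <= k -> cc s' i = cc s i, bg s' SN = l &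
  [/\ forall b, b != SN -> bg s' b = bg s b, rg s' 9 = 0, rg s' 11 = (ka v).+1 & rg s' 7 = 0]].
Proof.
move=> eb htg; have [|s1 [h1 e1 e1' i1 [g1 g10 g12 g14]]] := @get_c SN s [::] v l _ eb; first by rewrite /SN; lia.
have c1 i : cc s1 i = cc s i by rgc.
have [|s2 [h2 t1 t2 g2 b2]] := @tags_complete k nf nf_big true s1.
  by move=> i ik _; rewrite g14 htg // c1.
have [|||s3 [h3 i3 b3 g3]] := @reset_c VD s2 9; try by sd.
have [|||s4 [h4 i4 b4 g4]] := @reset_c VB s3 11; try by sd.
have [|||||s5 [h5 i5 b5 g5]] := @mv_c VF0 VB s4 0 11; try by sd.
have [||s6 [h6 i6 b6 g6]] := @inc_c VB s5 11; try by sd.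
have [|||s7 [h7 i7 b7 g7]] := @reset_c VA s6 7; try by sd.
exists s7; split.
- by do 6 (apply: sem_seq; first eassumption).
- by rgc.
- by move=> i ik; rewrite -c1 -t1 //; rgc.
- by rewrite b7 b6 b5 b4 b3 b2 e1.
split; [|by rgc|by rgc|by rgc].
by move=> b nb; rewrite b7 b6 b5 b4 b3 b2 e1'.
Qed.

Lemma gad_base_c s : 0 < xx s -> exists s', [/\ sem gad_base s s', xx s' = (xx s).-1,
  rg s' 7 = (rg s 7).+1, rg s' 9 = rg s 9 &
  [/\ rg s' 11 = 0, forall i, cc s' i = cc s i & bg s' = bg s]].
Proof.
rewrite /xx => pos.
have [|||s1 [h1 i1 b1 g1]] := @reset_c VB s 11; try by sd.
have [|||s2 [h2 i2 b2 g2]] := @dec_c VX s1 1; try by sd.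
have [||s3 [h3 i3 b3 g3]] := @inc_c VA s2 7; try by sd.
exists s3; split; [by do 2 (apply: sem_seq; first eassumption)|by rgc|by rgc|by rgc|].
by split; [rgc|move=> i; rgc|rewrite b3 b2 b1].
Qed.

Lemma gad_push_c s : 0 < rg s 11 -> exists s' v, [/\ sem gad_push s s',
  forall i, i <= k -> cc s' i = cc s i /\ tg v i = cc s i, xx s' = xx s,
  bg s' FR = v :: bg s FR &
  [/\ forall b, b != FR -> bg s' b = bg s b, ka v = rg s 9, mu v = rg s 7, rg s' 7 = 0 &
      rg s' 9 = (rg s 9).+1 /\ rg s' 11 = (rg s 11).-1]].
Proof.
move=> pos.
have [s1 [h1 i1 b1 [g1 g1']]] := clr_c s.
have [|s2 [h2 t1 t2 g2 b2]] := @tags_complete k nf nf_big false s1; first by [].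
have [|||||||s3 [h3 i3 b3 g3]] := @xfer_c true VD false VF0 s2 9 0; try by sd.
have [|||||s4 [h4 i4 b4 g4]] := @mv_c VA VF1 s3 7 2; try by sd.
have [|s5 [v [h5 k1 k2 kt [e5 e5' i5 [g5 g5']]]]] := @sto_c FR s4; first by rewrite /FR; lia.
have [|||s6 [h6 i6 b6 g6]] := @reset_c VA s5 7; try by sd.
have [|||s7 [h7 i7 b7 g7]] := @dec_c VB s6 11; try by sd.
have [||s8 [h8 i8 b8 g8]] := @inc_c VD s7 9; try by sd.
have c1 i : cc s1 i = cc s i by rgc.
exists s8, v; split.
- by do 7 (apply: sem_seq; first eassumption).
- move=> i ik; split; first by rewrite -c1 -t1 //; rgc.
  rewrite kt //.
  have -> : rg s4 (4 + 4 * i) = rg s2 (4 + 4 * i) by rewrite g4; eqf; rewrite g3; eqf.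
  by rewrite t2 // g1' ?add0n //; lia.
- by rgc.
- by rewrite b8 b7 b6 e5 b4 b3 b2 b1.
split; [|by rewrite k1; rgc|by rewrite k2; rgc|by rgc|by split; rgc].
by move=> b nb; rewrite b8 b7 b6 e5' // b4 b3 b2 b1.
Qed.

Lemma gad_pop_c s v l : bg s FR = v :: l -> (forall i, i <= k -> tg v i = cc s i) ->
  xx s < rg s 7 -> rg s 9 = (ka v).+1 -> exists s', [/\ sem gad_pop s s',
  forall i, i <= k -> cc s' i = cc s i, xx s' = xx s, bg s' FR = l &
  [/\ forall b, b != FR -> bg s' b = bg s b, rg s' 7 = (mu v).+1,
      rg s' 9 = ka v & rg s' 11 = (rg s 11).+1]].
Proof.
rewrite /xx => eb htg lt hd.
have [|||||||s1 [h1 i1 b1 g1]] := @xfer_c true VX true VA s 1 7; try by sd.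
have [|||s2 [h2 i2 b2 g2]] := @dec_c VA s1 7; try by sd.
have [|||s3 [h3 i3 b3 g3]] := @reset_c VA s2 7; try by sd.
have [|||s4 [h4 i4 b4 g4]] := @dec_c VD s3 9; try by sd.
have [||s5 [h5 i5 b5 g5]] := @inc_c VB s4 11; try by sd.
have [||s6 [h6 e6 e6' i6 [g6 g60 g62 g64]]] := @get_c FR s5 [::] v l; first by rewrite /FR; lia.
  by rewrite b5 b4 b3 b2 b1.
have c6 i : cc s6 i = cc s i by rgc.
have [|s7 [h7 t1 t2 g7 b7]] := @tags_complete k nf nf_big true s6.
  by move=> i ik _; rewrite g64 htg // c6.
have [|||||||s8 [h8 i8 b8 g8]] := @xfer_c true VD true VF0 s7 9 0; try by sd.
have [|||||s9 [h9 i9 b9 g9]] := @mv_c VF1 VA s8 2 7; try by sd.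
have [||s10 [h10 i10 b10 g10]] := @inc_c VA s9 7; try by sd.
exists s10; split.
- by do 9 (apply: sem_seq; first eassumption).
- by move=> i ik; rewrite -c6 -t1 //; rgc.
- by rgc.
- by rewrite b10 b9 b8 b7 e6.
split; [|by rgc|by rgc|by rgc].
by move=> b nb; rewrite b10 b9 b8 b7 e6' // b5 b4 b3 b2 b1.
Qed.

Lemma gad_close_c s : 0 < rg s 7 -> xx s < rg s 11 -> exists s', [/\ sem gad_close s s',
  xx s' = xx s, bg s' = bg s & forall i, cc s' i = upd (cc s) 0 (cc s 0).+1 i].
Proof.
rewrite /xx => pos lt.
have [|||s1 [h1 i1 b1 g1]] := @dec_c VA s 7; try by sd.
have [|||s2 [h2 i2 b2 g2]] := @dec_c VB s1 11; try by sd.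
have [|||||||s3 [h3 i3 b3 g3]] := @xfer_c true VX true VB s2 1 11; try by sd.
have [|s4 [h4 i4 b4 g4]] := @ctrl_c CZero s3 0; first by [].
have [||s5 [h5 i5 b5 g5]] := @inc_c VC s4 15; [by rewrite i4|by lia|].
exists s5; split.
- by do 4 (apply: sem_seq; first eassumption).
- by rgc.
- by rewrite b5 b4 b3 b2 b1.
move=> i; rewrite updE; case: (i =P 0) => [->|ne]; first by rewrite /cc muln0 addn0; rgc.
by rgc.
Qed.

Lemma fwd_step s s1 s' : sem fwd_expand s s1 \/ sem fwd_limit s s1 \/ sem fwd_next s s1 \/
  sem fwd_item s s1 -> sem FWD s1 s' -> sem FWD s s'.
Proof. by move=> h; apply: sem_starS. Qed.

Lemma star_sem_trans p s s1 s' : sem (Star p) s s1 -> sem (Star p) s1 s' -> sem (Star p) s s'.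
Proof. exact: star_trans. Qed.

(** Induction on the level, and on the multiplicity within each level. Items of multiplicity 0
    remain in the bag as junk, which does no harm because the guesses always pick the item at the
    known position. *)
Lemma item_run u a s l0 v l : bg s IT = l0 ++ v :: l -> ka v = u -> mu v = a -> exists s' junk,
  [/\ sem FWD s s', xx s' = iter a (fast 0 u) (xx s), forall j, cc s' j = cc s j,
      bg s' IT = junk ++ l & forall b, b != IT -> bg s' b = bg s b].
Proof.
elim: u a s l0 v l => [|u IHu] a; elim: a => [|a IHa] s l0 v l eb kv mv.
- by exists s, (rcons l0 v); split=> //; [apply: sem_star0|rewrite cat_rcons].
- have [|s1 [v' [h1 x1 c1 [k1 m1 e1 e1']]]] := fwd_next_c eb; first by rewrite mv.
  have [|||s2 [jk [h2 x2 c2 e2 e2']]] := IHa s1 [::] v' (l0 ++ l).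
  + by rewrite e1.
  + by rewrite k1.
  + by rewrite m1 mv.
  exists s2, (jk ++ l0); split.
  + by apply: fwd_step h2; right; right; left.
  + by rewrite x2 x1 iterSr fast_zero.
  + by move=> j; rewrite c2 c1.
  + by rewrite e2 catA.
  + by move=> b nb; rewrite e2' // e1'.
- by exists s, (rcons l0 v); split=> //; [apply: sem_star0|rewrite cat_rcons].
have [||s1 [v1 [v2 [h1 x1 c1 [k1 m1 k2 m2 [e1 e1']]]]]] := fwd_item_c eb; [by rewrite mv|by rewrite kv|].
have [|||s2 [jk [h2 x2 c2 e2 e2']]] := IHu (xx s).+1 s1 [::] v2 (v1 :: l0 ++ l).
- by rewrite e1.
- by rewrite k2 kv.
- by rewrite m2.
have [|||s3 [jk3 [h3 x3 c3 e3 e3']]] := IHa s2 jk v1 (l0 ++ l).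
- by rewrite e2.
- by rewrite k1.
- by rewrite m1 mv.
exists s3, (jk3 ++ l0); split.
- by apply: fwd_step (star_sem_trans h2 h3); do 3 right.
- by rewrite x3 x2 x1 [RHS]iterSr fast_succ.
- by move=> j; rewrite c3 c2 c1.
- by rewrite e3 catA.
- by move=> b nb; rewrite e3' // e2' // e1'.
Qed.

Lemma gad_step s s1 s' : sem gad_base s s1 \/ sem gad_push s s1 \/ sem gad_pop s s1 ->
  sem gadget s1 s' -> sem gadget s s'.
Proof. by move=> h; apply: sem_starS. Qed.

(** Inverting F_{b+1}(y) takes a push, [y+1] inversions at level [b], and a pop whose test succeeds
    because [y+1] rounds were counted and [x] is back at [y]. *)
Lemma gadget_run b s y : rg s 11 = b -> xx s = fast 0 b y -> exists s',
  [/\ sem gadget s s', xx s' = y, rg s' 7 = (rg s 7).+1, rg s' 9 = rg s 9 &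
  [/\ rg s' 11 = b, forall i, i <= k -> cc s' i = cc s i & forall b, bg s' b = bg s b]].
Proof.
elim: b s y => [|b IH] s y db xs.
  have [|s1 [h1 x1 a1 d1 [b1 c1 e1]]] := @gad_base_c s; first by rewrite xs.
  exists s1; split=> //; first by apply: gad_step (sem_star0 _ _ _); left.
    by rewrite x1 xs.
  by split=> // b; rewrite e1.
have iterate n t : rg t 11 = b -> xx t = iter n (fast 0 b) y -> exists s',
    [/\ sem gadget t s', xx s' = y, rg s' 7 = rg t 7 + n, rg s' 9 = rg t 9 &
    [/\ rg s' 11 = b, forall i, i <= k -> cc s' i = cc t i & forall b, bg s' b = bg t b]].
  elim: n t => [|n IHn] t tb tx; first by exists t; split=> //; [apply: sem_star0|rewrite addn0].
  have [t1 [h1 x1 a1 d1 [b1 c1 e1]]] := IH t _ tb tx.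
  have [t2 [h2 x2 a2 d2 [b2 c2 e2]]] := IHn t1 b1 x1.
  exists t2; split=> //; [exact: star_sem_trans h1 h2|by rewrite a2 a1 addSnnS|by rewrite d2|].
  by split=> // [i ik|b']; rewrite ?c2 ?c1 ?e2 ?e1.
have [|s1 [v [h1 c1 x1 e1 [e1' k1 m1 a1 [d1 b1]]]]] := @gad_push_c s; first by rewrite db.
have [||s2 [h2 x2 a2 d2 [b2 c2 e2]]] := iterate y.+1 s1.
- by rewrite b1 db.
- by rewrite x1 xs fast_succ.
have [||||s3 [h3 c3 x3 e3 [e3' a3 d3 b3]]] := @gad_pop_c s2 v (bg s FR).
- by rewrite e2 e1.
- by move=> i ik; rewrite c2 //; have [-> ->] := c1 i ik.
- by rewrite x2 a2 a1.
- by rewrite d2 d1 k1.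
exists s3; split.
- apply: gad_step (star_sem_trans h2 _); first by right; left.
  by apply: gad_step (sem_star0 _ _ _); right; right.
- by rewrite x3.
- by rewrite a3 m1.
- by rewrite d3 k1.
split; first by rewrite b3 b2.
  by move=> i ik; rewrite c3 // c2 //; have [-> _] := c1 i ik.
by move=> b'; have [->|nb] := eqVneq b' FR; [rewrite e3|rewrite e3' // e2 e1'].
Qed.

Definition core (c : nat -> nat) (x : nat) (S : seq (seq nat)) (s : rst) : Prop :=
  [/\ forall i, i <= k -> cc s i = c i, xx s = x & bg s SN = S].

(** The forward run comes with a way back from every state that agrees with its end on counters,
    argument and snapshots; this leaves room for the simulation in between. Quantifying over the
    older snapshots [R] makes the induction compose. The levels below [i] are empty because a
    contraction clears them. *)
Lemma core_level i c x : i <= k -> 0 < x -> (forall j, j < i -> c j = 0) ->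
  forall R s, core (add c i 1) x R s -> exists S s',
  [/\ sem FWD s s', core c (fast 1 i x) (S ++ R) s', bg s' FR = bg s FR &
   forall R t, core c (fast 1 i x) (S ++ R) t ->
     exists t', [/\ sem BWD t t', core (add c i 1) x R t' & bg t' FR = bg t FR]].
Proof.
elim: i c x => [|i IH] c x ik x0 c0 R s [hc hx hS].
  have [||s1 [sn [it [h1 x1 c1 t1 [k1 k2 m2 e1 [e1' e1'']]]]]] := @fwd_limit_c s.
  - by rewrite hc // addE eqxx addn1.
  - by rewrite hx.
  have [|||s2 [jk [h2 x2 c2 e2 e2']]] := @item_run x.+1 1 s1 [::] it (bg s IT) => //.
    by rewrite k2 hx.
  have cs j : j <= k -> cc s1 j = c j.
    by move=> jk'; rewrite c1 // !hc // !addE; case: eqP => [->|//]; rewrite eqxx addn1.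
  exists [:: sn], s2; split.
  - by apply: fwd_step h2; right; left.
  - split=> [j jk'|//|]; first by rewrite c2 cs.
      by rewrite x2 x1 hx.
    by rewrite e2' // e1 hS.
  - by rewrite e2'.
  move=> R' t [tc tx tS].
  have [||t1' [g1 y1 d1 f1 [f1' D1 B1 A1]]] := @gad_open_c t sn R'; first by rewrite tS.
    by move=> j jk'; rewrite t1 // cs // tc.
  have [||t2 [g2 y2 A2 D2 [B2 d2 f2]]] := @gadget_run x.+1 t1' x.
  - by rewrite B1 k1 hx.
  - by rewrite y1 tx.
  have [||t3 [g3 y3 f3 d3]] := @gad_close_c t2; [by rewrite A2|by rewrite y2 B2|].
  exists t3; split.
  - apply: sem_starS (sem_star0 _ _ _); right.
    by apply: sem_seq g1 _; apply: sem_seq g2 g3.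
  - split=> [j jk'||]; [|by rewrite y3 y2|by rewrite f3 f2 f1].
    by rewrite d3 updE addE addn1; case: eqP => [_|_]; rewrite d2 // d1 // tc.
  - by rewrite f3 f2 f1'.
have ik' := ltnW ik.
have iterate n y : 0 < y -> forall (c : nat -> nat) R s, (forall j, j < i -> c j = 0) -> core (add c i n) y R s ->
  exists S s', [/\ sem FWD s s', core c (iter n (fast 1 i) y) (S ++ R) s', bg s' FR = bg s FR &
   forall R t, core c (iter n (fast 1 i) y) (S ++ R) t ->
     exists t', [/\ sem BWD t t', core (add c i n) y R t' & bg t' FR = bg t FR]].
  elim: n y => [|n IHn] y y0 {c0 hc}c R' s' c0 [hc' hx' hS'].
    exists [::], s'; split=> //; first exact: sem_star0.
      by split=> // j jk; rewrite hc' // addE addn0; case: eqP => // ->.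
    move=> R'' t [tc tx tS]; exists t; split=> //; first exact: sem_star0.
    by split=> // j jk; rewrite tc // addE addn0; case: eqP => // ->.
  have ca j : add (add c i n) i 1 j = add c i n.+1 j.
    by rewrite !addE eqxx; case: eqP => // _; lia.
  have [||S1 [s1 [h1 [hc1 hx1 hS1] f1 bw1]]] := IH (add c i n) y ik' y0 _ R' s'.
  - by move=> j ji; rewrite addE ltn_eqF // c0.
  - by split=> // j jk; rewrite ca hc'.
  have [||S2 [s2 [h2 [hc2 hx2 hS2] f2 bw2]]] := IHn (fast 1 i y) _ c (S1 ++ R') s1 c0.
  - by apply: leq_trans (fast_gt _ _ _).
  - by split.
  exists (S2 ++ S1), s2; split.
  - exact: star_sem_trans h1 h2.
  - by split=> //; [rewrite hx2 -iterSr|rewrite hS2 catA].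
  - by rewrite f2.
  move=> R'' t [tc tx tS].
  have [|t1 [g1 ct1 e1]] := bw2 (S1 ++ R'') t; first by split=> //; [rewrite tx iterSr|rewrite tS catA].
  have [t2 [g2 [ct2 x2 S2'] e2]] := bw1 _ _ ct1.
  exists t2; split; [exact: star_sem_trans g1 g2|split=> // j jk; by rewrite ct2 // ca|by rewrite e2].
have [|s1 [h1 x1 b1 c1]] := @fwd_expand_c s i ik; first by rewrite hc // addE eqxx addn1.
have [||S2 [s2 [h2 cs2 f2 bw2]]] := iterate x.+1 x x0 c R s1.
- by move=> j ji; apply: c0; apply: ltnW.
- split; [|by rewrite x1|by rewrite b1].
  move=> j jk; rewrite c1 !hc ?hx ?(ltnW ik) // !addE eqxx.
  case: (j =P i) => [_|ne]; first by rewrite ltn_eqF.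
  by case: (j =P i.+1) => [->|//]; rewrite addn1.
exists S2, s2; rewrite fast_succ; split=> //.
- by apply: fwd_step h2; left.
- by rewrite f2 b1.
move=> R' t ct.
have [t1 [g1 [ct1 x1' S1'] e1]] := bw2 _ _ ct.
have [|t2 [g2 x2 b2 [q1 q2 q3]]] := @bwd_contract_c t1 i ik.
  by rewrite x1' ct1 // addE eqxx; lia.
exists t2; split.
- by apply: star_sem_trans g1 _; apply: sem_starS (sem_star0 _ _ _); left.
- split; [|by rewrite x2|by rewrite b2].
  move=> j jk; rewrite addE; case: (ltngtP j i.+1) => [ji|ij|->].
  + by rewrite q1 // c0.
  + by rewrite q3 // ct1 // addE gtn_eqF // ltnW.
  + by rewrite q2 ct1 // addE gtn_eqF // addn1.
- by rewrite b2.
Qed.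

End CoreComplete.

(** * Frame conditions *)

(** An indexed reference may denote any variable from its base on in steps of 4, so the frame
    condition can be decided without knowing the loop index. *)
Definition mayset (r : ref) (v : nat) : bool :=
  if r.2 then (r.1 <= v) && (4 %| v - r.1) else v == r.1.

Fixpoint touches (p : prog ratom) (v : nat) : bool :=
  match p with
  | Eps | Fail => false
  | At (RInc r) | At (RDec r) | At (RRst r) => mayset r v
  | At (RSto _) | At (RGet _) | At RClr => ~~ odd v
  | At (RCtl _) => false
  | Seq p q | Alt p q => touches p v || touches q v
  | Star p => touches p v
  end.

Lemma sem_frame k nf p s s' v : sem (rstep k nf) p s s' -> ~~ touches p v -> rg s' v = rg s v.
Proof.
elim: p s s' => [||a|p IHp q IHq|p IHp q IHq|p IHp] s s'.
- by move=> ->.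
- by [].
- have ms i r x : ~~ mayset r v -> upd (rg s) (ev i r) x v = rg s v.
    rewrite updE /mayset /ev; case: r => b [] /=; last by rewrite addn0 => /negPf->.
    by case: eqP => // -> /negP[]; rewrite leq_addr addKn dvdn_mulr.
  case: a => [r|r|r|b|b||c] /=.
  + by case=> _ -> /= /ms.
  + by case=> _ _ -> /= /ms.
  + by case=> _ _ -> /= /ms.
  + by case=> _ ->; rewrite negbK /= /setv => ->.
  + by case=> l1 [w [l2 [_ _ ->]]]; rewrite negbK /= /setv => ->.
  + by move=> ->; rewrite negbK /= /setv => ->.
  + by case=> j _ ->.
- by case/semS=> s1 [h1 h2]; rewrite /= negb_or => /andP[t1 t2]; rewrite (IHq _ _ h2) // (IHp _ _ h1).
- by case/semAlt=> h; rewrite /= negb_or => /andP[t1 t2]; [apply: IHp|apply: IHq].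
- move/semStar=> st /= t; elim: st => // a b c ab _ ->; exact: IHp ab t.
Qed.

(* The registers from 17 on with residue 1 modulo 4, and register 13, are left
   to the middle phase. *)
Definition midreg (v : nat) : bool := (v == 13) || (17 <= v) && (4 %| v - 17).

Lemma midreg_facts v : midreg v ->
  [/\ (odd v = true) * ((v == 0) = false) * ((v == 2) = false),
      ((15 <= v) && (4 %| v - 15) = false) * ((4 <= v) && (4 %| v - 4) = false),
      ((v == 1) = false) * ((v == 3) = false) * ((v == 5) = false) &
      ((v == 7) = false) * ((v == 9) = false) * ((v == 11) = false)].
Proof. by rewrite /midreg => mv; split; do ?split; lia. Qed.

Lemma fwd_frame v : midreg v -> ~~ touches FWD v.
Proof.
case/midreg_facts=> h1 h2 h3 h4.
by rewrite /= /mayset /= ?h1 ?h2 ?h3 ?h4.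
Qed.

Lemma bwd_frame v : midreg v -> ~~ touches BWD v.
Proof.
case/midreg_facts=> h1 h2 h3 h4.
by rewrite /= /mayset /= ?h1 ?h2 ?h3 ?h4.
Qed.

(** * Budgeted counters *)

Inductive matom := MInc of nat | MDec of nat | MZero of nat.

Definition mst : Type := (nat * (nat -> nat))%type.

Section Mid.
Variable nr : nat.

(* The first component is the budget; with [ex = false], a zero test may lose
   the contents of the counter. *)
Definition mstep (ex : bool) (a : matom) (s s' : mst) : Prop :=
  match a with
  | MInc j => [/\ j < nr, 0 < s.1 & s' = (s.1.-1, upd s.2 j (s.2 j).+1)]
  | MDec j => [/\ j < nr, 0 < s.2 j & s' = (s.1.+1, upd s.2 j (s.2 j).-1)]
  | MZero j => [/\ j < nr, ex -> s.2 j = 0 & s' = (s.1, upd s.2 j 0)]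
  end.

Definition mass (m : nat -> nat) : nat := \sum_(j < nr) m j.
Definition msum (s : mst) : nat := s.1 + mass s.2.

Lemma sum_upd (m : nat -> nat) j v : j < nr ->
  mass (upd m j v) + m j = mass m + v.
Proof.
move=> jn; rewrite /mass (bigD1 (Ordinal jn)) // [in RHS](bigD1 (Ordinal jn)) //= updE eqxx.
rewrite (eq_bigr (fun i : 'I_nr => m i)); first by lia.
by move=> i ne; rewrite updE; case: eqP => // e; case/eqP: ne; apply: val_inj.
Qed.

Lemma mstep_exact a s s' : mstep false a s s' ->
  msum s' <= msum s /\ (msum s <= msum s' -> mstep true a s s').
Proof.
case: s => x m; case: a => j [jn /= h ->]; rewrite /msum /=.
- by have := sum_upd m (m j).+1 jn; split=> //; lia.
- by have := sum_upd m (m j).-1 jn; split=> //; lia.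
by have := sum_upd m 0 jn; split; [lia|split=> //; lia].
Qed.

(** The sum of budget and counters changes only when a zero test discards something, and then it
    drops. Hence a run that keeps the sum has passed correct tests only. *)
Lemma mid_lossless p s s' : sem (mstep false) p s s' ->
  msum s' <= msum s /\ (msum s <= msum s' -> sem (mstep true) p s s').
Proof.
elim: p s s' => [||a|p IHp q IHq|p IHp q IHq|p IHp] s s'.
- by move=> ->.
- by [].
- exact: mstep_exact.
- case/semS=> s1 [/IHp[l1 e1] /IHq[l2 e2]]; split; first by lia.
  by move=> le; apply: sem_seq (e1 _) (e2 _); lia.
- by case/semAlt=> [/IHp|/IHq] [l e]; split=> // /e; [left|right].
- move/semStar=> st; elim: st => [a|a b c /IHp[l1 e1] _ [l2 e2]]; first by split=> // _; exact: sem_star0.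
  split; first by lia.
  by move=> le; apply: sem_starS (e1 _) (e2 _); lia.
Qed.

Lemma mid_conserve p s s' : sem (mstep true) p s s' -> msum s' = msum s.
Proof.
elim: p s s' => [||a|p IHp q IHq|p IHp q IHq|p IHp] s s'.
- by move=> ->.
- by [].
- case: s => x m; case: a => j [jn /= h ->]; rewrite /msum /=.
  + by have := sum_upd m (m j).+1 jn; lia.
  + by have := sum_upd m (m j).-1 jn; lia.
  + by have := sum_upd m 0 jn; rewrite h //; lia.
- by case/semS=> s1 [/IHp <- /IHq].
- by case/semAlt=> [/IHp|/IHq].
- by move/semStar; elim=> // a b c /IHp <- _ ->.
Qed.

Definition midv (j : nat) : ref := (17 + 4 * j, false).

(** Every unit put in a counter is borrowed from [VX] and every unit removed is returned, so a loss
    in a counter shows up in [VX] once everything has been paid back. *)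
Definition mimpl (a : matom) : prog ratom :=
  match a with
  | MInc j => if j < nr then dec VX ;; inc (midv j) else Fail
  | MDec j => if j < nr then dec (midv j) ;; inc VX else Fail
  | MZero j => if j < nr then reset (midv j) else Fail
  end.

Section Impl.
Variables k nf : nat.
Hypothesis nf_big : 2 * nr + 12 <= nf.
Local Notation rsem := (sem (rstep k nf)).

Definition mrep (s0 : rst) (x : mst) (s : rst) : Prop :=
  [/\ xx s = x.1, forall j, rg s (17 + 4 * j) = x.2 j, bg s = bg s0 &
      forall v, v != 1 -> (forall j, v != 17 + 4 * j) -> rg s v = rg s0 v].

Lemma mid_sound p s0 x s s' : mrep s0 x s -> rsem (bindp mimpl p) s s' ->
  exists x', sem (mstep false) p x x' /\ mrep s0 x' s'.
Proof.
apply: sem_bind_sound => {x s s' p}; case=> j x s s' [hx hm hb hv] /=; case: ifP => // jn.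
- case/semS=> s1 [/dec_s-/(_ 1 erefl)[pos i1 b1 g1]] /inc_s-/(_ (17 + 4 * j))[|i2 b2 g2].
    by rewrite /ev /= addn0.
  rewrite /xx in hx; rewrite hx in pos g1.
  exists (x.1.-1, upd x.2 j (x.2 j).+1); split=> //; split=> /=.
  + by rgc.
  + by move=> i; rewrite g2 !g1 updE !hm; eqf; case: (i =P j) => [->|ne]; eqf.
  + by rewrite b2 b1.
  + by move=> v v1 vj; rewrite g2 (negPf (vj j)) g1 (negPf v1) hv.
- case/semS=> s1 [/dec_s-/(_ (17 + 4 * j))[|pos i1 b1 g1]].
    by rewrite /ev /= addn0.
  move=> /inc_s-/(_ 1 erefl)[i2 b2 g2]; rewrite /xx in hx; rewrite hm in pos g1.
  exists (x.1.+1, upd x.2 j (x.2 j).-1); split=> //; split=> /=.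
  + by rgc.
  + by move=> i; rewrite g2 !g1 updE !hm; eqf; case: (i =P j) => [->|ne]; eqf.
  + by rewrite b2 b1.
  + by move=> v v1 vj; rewrite g2 (negPf v1) g1 (negPf (vj j)) hv.
- move=> /reset_s-/(_ (17 + 4 * j))[|i1 b1 g1]; first by rewrite /ev /= addn0.
  rewrite /xx in hx.
  exists (x.1, upd x.2 j 0); split=> //; split=> /=.
  + by rgc.
  + by move=> i; rewrite !g1 updE !hm; case: (i =P j) => [->|ne]; eqf.
  + by rewrite b1.
  + by move=> v v1 vj; rewrite g1 (negPf (vj j)) hv.
Qed.

Lemma mid_complete p s0 x x' s : mrep s0 x s -> sem (mstep true) p x x' ->
  exists s', rsem (bindp mimpl p) s s' /\ mrep s0 x' s'.
Proof.
apply: sem_bind_complete => {x x' s p}; case=> j x x' s [hx hm hb hv] /= [jn h ->]; rewrite jn.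
- have [|||s1 [h1 i1 b1 g1]] := @dec_c k nf VX s 1 => //; [by lia|by rewrite -/(xx s) hx|].
  have [||s2 [h2 i2 b2 g2]] := @inc_c k nf (midv j) s1 (17 + 4 * j); [by rewrite /ev /= addn0|by lia|].
  exists s2; split; first exact: sem_seq h1 h2.
  rewrite /xx in hx; split=> /=.
  + by rgc.
  + by move=> i; rewrite g2 !g1 updE !hm; eqf; case: (i =P j) => [->|ne]; eqf.
  + by rewrite b2 b1.
  + by move=> v v1 vj; rewrite g2 (negPf (vj j)) g1 (negPf v1) hv.
- have [|||s1 [h1 i1 b1 g1]] := @dec_c k nf (midv j) s (17 + 4 * j); [by rewrite /ev /= addn0|by lia|by rewrite hm|].
  have [||s2 [h2 i2 b2 g2]] := @inc_c k nf VX s1 1 => //; first by lia.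
  exists s2; split; first exact: sem_seq h1 h2.
  rewrite /xx in hx; split=> /=.
  + by rgc.
  + by move=> i; rewrite g2 !g1 updE !hm; eqf; case: (i =P j) => [->|ne]; eqf.
  + by rewrite b2 b1.
  + by move=> v v1 vj; rewrite g2 (negPf v1) g1 (negPf (vj j)) hv.
- have [|||s1 [h1 i1 b1 g1]] := @reset_c k nf (midv j) s (17 + 4 * j); [by rewrite /ev /= addn0|by lia|by rewrite /=; lia|].
  exists s1; split=> //; rewrite /xx in hx; split=> /=.
  + by rgc.
  + by move=> i; rewrite !g1 updE !hm; case: (i =P j) => [->|ne]; eqf.
  + by rewrite b1.
  + by move=> v v1 vj; rewrite g1 (negPf (vj j)) hv.
Qed.

End Impl.

(** * Exact counter programs *)

Local Notation sem := (sem (mstep true)).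

Definition addp (j b : nat) : prog matom := seqs (nseq b (At (MInc j))).
Definition subp (j a : nat) : prog matom := seqs (nseq a (At (MDec j))).
Definition zerop (j : nat) : prog matom := At (MZero j).
(** Any number of rounds may be made; it is a zero test afterwards that forces the move to be
    complete. *)
Definition moveb (r a w b : nat) : prog matom := Star (subp r a ;; addp w b).

Lemma addp_sound j b s s' : sem (addp j b) s s' -> forall i, s'.2 i = if i == j then s.2 j + b else s.2 i.
Proof.
elim: b s => [|b IH] s; first by move=> -> i; rewrite addn0; case: eqP => // ->.
case/semS=> s1 [[_ _ ->] /IH h] i; rewrite h /= !updE eqxx.
by case: eqP => // _; lia.
Qed.

Lemma subp_sound j a s s' : sem (subp j a) s s' ->
  a <= s.2 j /\ forall i, s'.2 i = if i == j then s.2 j - a else s.2 i.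
Proof.
elim: a s => [|a IH] s; first by move=> ->; split=> // i; rewrite subn0; case: eqP => // ->.
case/semS=> s1 [[_ /= pos ->] /IH[/=]]; rewrite updE eqxx => le h; split; first by lia.
by move=> i; rewrite h !updE; case: eqP => // _; lia.
Qed.

Lemma moveb_sound r a w b s s' : r != w -> sem (moveb r a w b) s s' -> exists n,
  n * a <= s.2 r /\ forall i, s'.2 i = if i == r then s.2 r - n * a else
                                       if i == w then s.2 w + n * b else s.2 i.
Proof.
move=> rw /semStar st.
apply: (@star_inv _ _ (fun t => exists n, n * a <= s.2 r /\ forall i, t.2 i = if i == r then s.2 r - n * a else
                                       if i == w then s.2 w + n * b else s.2 i) _ _ _ st).
  move=> t t' [n [le h]] /semS[t1 [/subp_sound[le1 h1] /addp_sound h2]].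
  rewrite h eqxx in le1; exists n.+1; split; first by lia.
  by move=> i; rewrite h2 !h1 !h; move: rw; upds.
by exists 0; split=> // i; upds.
Qed.

(** Only the counters are prescribed; the budget is then determined by the conserved total [K]. *)
Definition mstate (K : nat) (m : nat -> nat) (s : mst) : Prop :=
  (forall i, i < nr -> s.2 i = m i) /\ msum s = K.

Lemma mstate_sum K m s : mstate K m s -> s.1 + mass m = K.
Proof. by case=> h <-; rewrite /msum /mass; congr addn; apply: eq_bigr => i _; rewrite h. Qed.

Lemma eq_mstate K m m' s : (forall i, i < nr -> m i = m' i) -> mstate K m s -> mstate K m' s.
Proof. by move=> e [h1 h2]; split=> // i ir; rewrite h1 // e. Qed.

Lemma addp_complete K m j b s : j < nr -> mstate K m s -> mass m + b <= K ->
  exists s', sem (addp j b) s s' /\ mstate K (upd m j (m j + b)) s'.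
Proof.
move=> jn; elim: b m s => [|b IH] m s ms le.
  by exists s; split=> //; apply: eq_mstate ms => i _; upds.
have pos : 0 < s.1 by have := mstate_sum ms; lia.
pose s1 : mst := (s.1.-1, upd s.2 j (s.2 j).+1).
have st1 : sem (At (MInc j)) s s1 by [].
have ms1 : mstate K (upd m j (m j).+1) s1.
  split; last by rewrite (mid_conserve st1); case: ms.
  by move=> i ir; have [h _] := ms; rewrite /s1 /= !updE !h.
have [|s' [st2 ms2]] := IH _ _ ms1; first by have := sum_upd m (m j).+1 jn; lia.
exists s'; split; first exact: sem_seq st1 st2.
by apply: eq_mstate ms2 => i _; upds.
Qed.

Lemma subp_complete K m j a s : j < nr -> mstate K m s -> a <= m j ->
  exists s', sem (subp j a) s s' /\ mstate K (upd m j (m j - a)) s'.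
Proof.
move=> jn; elim: a m s => [|a IH] m s ms le.
  by exists s; split=> //; apply: eq_mstate ms => i _; upds.
pose s1 : mst := (s.1.+1, upd s.2 j (s.2 j).-1).
have ej : s.2 j = m j by case: ms => ->.
have st1 : sem (At (MDec j)) s s1 by split=> //; rewrite ej; lia.
have ms1 : mstate K (upd m j (m j).-1) s1.
  split; last by rewrite (mid_conserve st1); case: ms.
  by move=> i ir; have [h _] := ms; rewrite /s1 /= !updE !h.
have [|s' [st2 ms2]] := IH _ _ ms1; first by rewrite updE eqxx; lia.
exists s'; split; first exact: sem_seq st1 st2.
by apply: eq_mstate ms2 => i _; upds.
Qed.

Lemma zerop_complete K m j s : j < nr -> mstate K m s -> m j = 0 ->
  exists s', sem (zerop j) s s' /\ mstate K m s'.
Proof.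
move=> jn ms m0; pose s1 : mst := (s.1, upd s.2 j 0).
have ej : s.2 j = m j by case: ms => ->.
have st1 : sem (zerop j) s s1 by split=> // _; rewrite ej.
exists s1; split=> //; split; last by rewrite (mid_conserve st1); case: ms.
by move=> i ir; have [h _] := ms; rewrite /s1 /= updE; case: eqP => [->|_]; rewrite ?m0 ?h.
Qed.

Lemma moveb_complete K m r a w b n s : r < nr -> w < nr -> r != w -> mstate K m s ->
  n * a <= m r -> mass m + n * b <= K ->
  exists s', sem (moveb r a w b) s s' /\
    mstate K (upd (upd m r (m r - n * a)) w (m w + n * b)) s'.
Proof.
move=> rn wn rw; elim: n m s => [|n IH] m s ms le1 le2.
  exists s; split; first exact: sem_star0.
  by apply: eq_mstate ms => i _; upds.
have [|s1 [h1 ms1]] := @subp_complete _ _ r a _ rn ms; first by lia.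
have e1 := sum_upd m (m r - a) rn.
have [|s2 [h2 ms2]] := @addp_complete _ _ w b _ wn ms1; first by lia.
have e2 := @sum_upd (upd m r (m r - a)) w (upd m r (m r - a) w + b) wn.
have [||s3 [h3 ms3]] := IH _ _ ms2.
- by move: rw; upds.
- by lia.
exists s3; split; first by apply: sem_starS h3; apply: sem_seq h1 h2.
by apply: eq_mstate ms3 => i _; move: rw; upds.
Qed.

Variable B : nat.
Variable t : nat.
Hypothesis t_lt : t < nr.

(** A stack kept as a number in base [B], with the top as last digit. The zero tests force both
    moves to run to the end; in [pop] the test also verifies the digit [d], which has been guessed
    by the caller. The scratch counter [t] is empty before and after. *)
Definition push (r d : nat) := moveb r 1 t 1 ;; zerop r ;; moveb t 1 r B ;; zerop t ;; addp r d.
Definition pop (r d : nat) := moveb r B t 1 ;; subp r d ;; zerop r ;; moveb t 1 r 1 ;; zerop t.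

Lemma push_sound r d s s' : r != t -> s.2 t = 0 -> sem (push r d) s s' ->
  forall i, s'.2 i = if i == r then s.2 r * B + d else s.2 i.
Proof.
move=> rt t0; have tr : t != r by rewrite eq_sym.
case/semS=> s1 [/(moveb_sound rt)[n [l1 h1]] /semS[s2 [[_ /(_ isT) z1 E2]]]].
case/semS=> s3 [/(moveb_sound tr)[n2 [l2 h2]] /semS[s4 [[_ /(_ isT) z2 E4] /addp_sound h3]]] i.
have h2' j : s2.2 j = if j == r then 0 else s1.2 j by rewrite E2.
have h4' j : s4.2 j = if j == t then 0 else s3.2 j by rewrite E4.
have en : n = s.2 r by move: z1 l1; rewrite h1 eqxx; lia.
have e2 : s2.2 t = s.2 r by rewrite h2' (negPf tr) h1 (negPf tr) eqxx t0 en; lia.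
have en2 : n2 = s.2 r by move: z2 l2; rewrite h2 eqxx e2; lia.
rewrite h3 !h4' !h2 !h2' !h1 en2 t0; move: rt; upds.
Qed.

Lemma pop_sound r d s s' : r != t -> s.2 t = 0 -> sem (pop r d) s s' ->
  exists n, s.2 r = n * B + d /\ forall i, s'.2 i = if i == r then n else s.2 i.
Proof.
move=> rt t0; have tr : t != r by rewrite eq_sym.
case/semS=> s1 [/(moveb_sound rt)[n [l1 h1]] /semS[s2 [/subp_sound[l2 h2]]]].
case/semS=> s3 [[_ /(_ isT) z1 E3]] /semS[s4 [/(moveb_sound tr)[n2 [l4 h4]] [_ /(_ isT) z2 E5]]].
have h3 j : s3.2 j = if j == r then 0 else s2.2 j by rewrite E3.
have h5 j : s'.2 j = if j == t then 0 else s4.2 j by rewrite E5.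
have e1 : s1.2 r = s.2 r - n * B by rewrite h1 eqxx.
have er : s.2 r = n * B + d by move: z1 l2; rewrite h2 eqxx e1; lia.
have e3 : s3.2 t = n by rewrite h3 (negPf tr) h2 (negPf tr) h1 (negPf tr) eqxx t0; lia.
have en2 : n2 = n by move: z2 l4; rewrite h4 eqxx e3; lia.
exists n; split=> // i; rewrite h5 !h4 !h3 !h2 !h1 en2 t0; move: rt; upds.
Qed.

Lemma push_complete K m r d s : r < nr -> r != t -> m t = 0 -> mstate K m s ->
  mass m + m r * B + m r + d <= K ->
  exists s', sem (push r d) s s' /\ mstate K (upd m r (m r * B + d)) s'.
Proof.
move=> rn rt t0 ms le; have tr : t != r by rewrite eq_sym.
have [||s1 [h1 ms1]] := @moveb_complete _ _ r 1 t 1 (m r) _ rn t_lt rt ms; [by lia|by lia|].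
have E1 := sum_upd m (m r - m r * 1) rn.
have E2 := sum_upd (upd m r (m r - m r * 1)) (m t + m r * 1) t_lt.
set m1 := upd _ t _ in ms1 E2.
have m1r : m1 r = 0 by rewrite /m1; move: rt; upds.
have m1t : m1 t = m r by rewrite /m1; upds.
have tz : upd m r (m r - m r * 1) t = 0 by rewrite updE (negPf tr).
have [|s2 [h2 ms2]] := zerop_complete rn ms1; first by [].
have [||s3 [h3 ms3]] := @moveb_complete _ _ t 1 r B (m r) _ t_lt rn tr ms2; [by lia|by lia|].
have E3 := sum_upd m1 (m1 t - m r * 1) t_lt.
have E4 := sum_upd (upd m1 t (m1 t - m r * 1)) (m1 r + m r * B) rn.
set m2 := upd _ r _ in ms3 E4.
have m2t : m2 t = 0 by rewrite /m2; move: tr; upds.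
have r2 : upd m1 t (m1 t - m r * 1) r = 0 by move: rt; rewrite updE => /negPf->.
have [|s4 [h4 ms4]] := zerop_complete t_lt ms3; first by [].
have [|s5 [h5 ms5]] := addp_complete (b := d) rn ms4; first by lia.
exists s5; split; first by do 4 (apply: sem_seq; first eassumption).
by apply: eq_mstate ms5 => i _; rewrite /m2 /m1; move: rt t0; upds.
Qed.

Lemma pop_complete K m r d n s : r < nr -> r != t -> m t = 0 -> mstate K m s ->
  m r = n * B + d -> mass m + n + n <= K ->
  exists s', sem (pop r d) s s' /\ mstate K (upd m r n) s'.
Proof.
move=> rn rt t0 ms er le; have tr : t != r by rewrite eq_sym.
have [||s1 [h1 ms1]] := @moveb_complete _ _ r B t 1 n _ rn t_lt rt ms; [by lia|by lia|].
have E1 := sum_upd m (m r - n * B) rn.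
have E2 := sum_upd (upd m r (m r - n * B)) (m t + n * 1) t_lt.
set m1 := upd _ t _ in ms1 E2.
have m1r : m1 r = d by rewrite /m1; move: rt; upds.
have m1t : m1 t = n by rewrite /m1; upds.
have tz : upd m r (m r - n * B) t = 0 by rewrite updE (negPf tr).
have [|s2 [h2 ms2]] := subp_complete (a := d) rn ms1; first by rewrite m1r.
have E3 := sum_upd m1 (m1 r - d) rn.
set m2 := upd m1 _ _ in ms2 E3.
have m2r : m2 r = 0 by rewrite /m2 updE eqxx m1r subnn.
have m2t : m2 t = n by rewrite /m2 updE (negPf tr).
have [|s3 [h3 ms3]] := zerop_complete rn ms2; first by [].
have [||s4 [h4 ms4]] := @moveb_complete _ _ t 1 r 1 n _ t_lt rn tr ms3; [by lia|by lia|].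
have [|s5 [h5 ms5]] := zerop_complete t_lt ms4; first by rewrite !updE (negPf tr) eqxx m2t; lia.
exists s5; split; first by do 4 (apply: sem_seq; first eassumption).
apply: eq_mstate ms5 => i _; rewrite m2r m2t updE; move: rt tr t0 er; rewrite /m2 /m1; clear; upds.
Qed.

Definition dump (j : nat) := Star (At (MDec j)).

Lemma dump_complete K m j s : j < nr -> mstate K m s ->
  exists s', sem (dump j) s s' /\ mstate K (upd m j 0) s'.
Proof.
move=> jn; elim: {m}(m j) {-2}m (erefl (m j)) s => [|n IH] m mj s ms.
  exists s; split; first exact: sem_star0.
  by apply: eq_mstate ms => i _; upds.
have [|s1 [/semS[s1' [h1 ->]] ms1]] := subp_complete (a := 1) jn ms; first by lia.
have [|s2 [h2 ms2]] := IH _ _ _ ms1; first by rewrite updE eqxx; lia.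
exists s2; split; first exact: sem_starS h1 h2.
by apply: eq_mstate ms2 => i _; upds.
Qed.

Lemma dump_all_complete K m s : mstate K m s ->
  exists s', sem (seqs [seq dump j | j <- iota 0 nr]) s s' /\ mstate K (fun=> 0) s'.
Proof.
move=> ms.
suff h n a m' s' : a + n <= nr -> mstate K m' s' -> exists s'', sem (seqs [seq dump j | j <- iota a n]) s' s'' /\
    mstate K (fun i => if a <= i < a + n then 0 else m' i) s''.
  have [s' [h1 ms1]] := h nr 0 m s (leqnn _) ms; exists s'; split=> //.
  by apply: eq_mstate ms1 => i ir; rewrite add0n ir.
elim: n a m' s' => [|n IH] a m' s' le ms'.
  by exists s'; split=> //; apply: eq_mstate ms' => i _; case: ifP => //; lia.
have [|s1 [h1 ms1]] := dump_complete (j := a) _ ms'; first by lia.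
have [|s2 [h2 ms2]] := IH a.+1 _ _ _ ms1; first by lia.
exists s2; split; first exact: sem_seq h1 h2.
apply: eq_mstate ms2 => i _; rewrite updE; case: eqP => [->|ne]; first by do 2 case: ifP => //; lia.
by case: ifP => h'; case: ifP => h'' //; lia.
Qed.

End Mid.

(** * Simulation of Turing machines by exact counters *)

Section TMSim.
Variables (Sig : finType) (M : tm Sig void).

Local Notation letter := (Sig + void + work M)%type.
Local Notation cellM := (option letter).

(** The blank is the digit 0, so that the blank cells beyond the written part do not contribute to
    the number. *)
Definition dig (c : cellM) : nat := if c is Some a then (enum_rank a).+1 else 0.
Definition base : nat := #|{: letter}|.+1.
Local Notation B := base.

Lemma dig_lt c : dig c < B.
Proof. by case: c => //= a; rewrite /B ltnS. Qed.

Lemma dig_inj : injective dig.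
Proof. by case=> [a|] [b|] //= [/val_inj/enum_rank_inj->]. Qed.

Fixpoint num (n : nat) (f : nat -> nat) : nat :=
  if n is n'.+1 then f 0 + B * num n' (fun i => f i.+1) else 0.

Lemma eq_num n f g : (forall i, f i = g i) -> num n f = num n g.
Proof. by elim: n f g => //= n IH f g h; rewrite h (IH _ (fun i => g i.+1)). Qed.

Lemma numS n f : num n.+1 f = num n (fun i => f i.+1) * B + f 0.
Proof. by rewrite /= addnC mulnC. Qed.

Lemma num_widen n f : (forall i, n <= i -> f i = 0) -> num n.+1 f = num n f.
Proof.
elim: n f => [|n IH] f f0; first by rewrite /= f0 // muln0.
by rewrite [LHS]/= -/(num n.+1 (fun i => f i.+1)) IH // => i ni; apply: f0.
Qed.

Lemma num_lt n f : (forall i, f i < B) -> num n f < B ^ n.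
Proof.
elim: n f => [|n IH] f fB; first by rewrite expn0.
rewrite /= expnS; have := IH (fun i => f i.+1) (fun i => fB _).
have := fB 0; move: (num n _) => u; nia.
Qed.

Lemma base_unique n d n' d' : d < B -> d' < B -> n * B + d = n' * B + d' -> n = n' /\ d = d'.
Proof.
move=> dB d'B e; have n_ : n = n'.
  by have := congr1 (divn^~ B) e; rewrite /= !divnMDl // !divn_small // !addn0.
by split=> //; move: e; rewrite n_ => /addnI.
Qed.

(** * Half tapes as numbers in base [B], least significant digit next to the head *)

Local Open Scope ring_scope.
Definition rside (T : int -> cellM) (h : int) (i : nat) : nat := dig (T (h + i%:Z)).
Definition lside (T : int -> cellM) (h : int) (i : nat) : nat := dig (T (h - 1 - i%:Z)).
Local Close Scope ring_scope.

Lemma rside0 T h : rside T h 0 = dig (T h).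
Proof. by rewrite /rside; congr (dig (T _)); lia. Qed.

Lemma lside0 T h : lside T h 0 = dig (T (h - 1)%R).
Proof. by rewrite /lside; congr (dig (T _)); lia. Qed.

(** Cells outside the width [sz] are blank, so the width can always be enlarged; it serves to bound
    the two numbers by [B ^ sz]. *)
Definition trep (T : int -> cellM) (h : int) (sz r l : nat) : Prop :=
  [/\ r = num sz (rside T h), l = num sz (lside T h),
      forall i, sz <= i -> rside T h i = 0 & forall i, sz <= i -> lside T h i = 0].

Lemma trep_widen T h sz r l : trep T h sz r l -> trep T h sz.+1 r l.
Proof.
case=> er el z1 z2; split; [by rewrite num_widen|by rewrite num_widen|..].
  by move=> i /ltnW; apply: z1.
by move=> i /ltnW; apply: z2.
Qed.

Lemma trep_lt T h sz r l : trep T h sz r l -> r < B ^ sz /\ l < B ^ sz.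
Proof. by case=> -> -> _ _; split; apply: num_lt => i; apply: dig_lt. Qed.

Lemma trep_head T h sz r l : trep T h sz r l -> exists n, r = n * B + dig (T h).
Proof.
case/trep_widen=> -> _ _ _; exists (num sz (fun i => rside T h i.+1)).
by rewrite numS rside0.
Qed.

Lemma trep_left T h sz r l : trep T h sz r l -> exists n, l = n * B + dig (T (h - 1)%R).
Proof.
case/trep_widen=> _ -> _ _; exists (num sz (fun i => lside T h i.+1)).
by rewrite numS lside0.
Qed.

Definition wr (T : int -> cellM) (h : int) (a : cellM) : int -> cellM :=
  fun i => if i == h then a else T i.

Lemma trep_write T h sz n l a : trep T h sz (n * B + dig (T h)) l ->
  trep (wr T h a) h sz.+1 (n * B + dig a) l.
Proof.
case/trep_widen=> er el z1 z2.
have e0 : n = num sz (fun i => rside T h i.+1).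
  by move: er; rewrite numS rside0 => /base_unique[]; rewrite ?dig_lt.
have rs i : rside (wr T h a) h i.+1 = rside T h i.+1.
  by rewrite /rside /wr; case: eqP => //; lia.
have ls i : lside (wr T h a) h i = lside T h i.
  by rewrite /lside /wr; case: eqP => //; lia.
split.
- by rewrite numS rside0 {2}/wr eqxx (eq_num _ rs) -e0.
- by rewrite el; apply: eq_num.
- by case=> // i si; rewrite rs; apply: z1.
- by move=> i si; rewrite ls z2.
Qed.

Lemma trep_right T h sz n l : trep T h sz (n * B + dig (T h)) l ->
  trep T (h + 1)%R sz.+1 n (l * B + dig (T h)).
Proof.
move=> tr; have [er el z1 z2] := trep_widen tr; have [_ el' _ z2'] := tr.
have e0 : n = num sz (fun i => rside T h i.+1).
  by move: er; rewrite numS rside0 => /base_unique[]; rewrite ?dig_lt.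
have rs i : rside T (h + 1)%R i = rside T h i.+1.
  by rewrite /rside; congr (dig (T _)); lia.
have ls i : lside T (h + 1)%R i.+1 = lside T h i.
  by rewrite /lside; congr (dig (T _)); lia.
have l0 : lside T (h + 1)%R 0 = dig (T h).
  by rewrite /lside; congr (dig (T _)); lia.
split.
- rewrite num_widen; first by rewrite e0; apply: eq_num.
  by move=> i si; rewrite rs z1.
- by rewrite numS l0 (eq_num _ ls) -el'.
- by move=> i si; rewrite rs z1 // ltnS ltnW.
- by case=> // i si; rewrite ls z2'.
Qed.

Lemma trep_leftward T h sz r n : trep T h sz r (n * B + dig (T (h - 1)%R)) ->
  trep T (h - 1)%R sz.+1 (r * B + dig (T (h - 1)%R)) n.
Proof.
move=> tr; have [er el z1 z2] := trep_widen tr; have [er' _ z1' _] := tr.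
have e0 : n = num sz (fun i => lside T h i.+1).
  by move: el; rewrite numS lside0 => /base_unique[]; rewrite ?dig_lt.
have ls i : lside T (h - 1)%R i = lside T h i.+1.
  by rewrite /lside; congr (dig (T _)); lia.
have rs i : rside T (h - 1)%R i.+1 = rside T h i.
  by rewrite /rside; congr (dig (T _)); lia.
have r0 := rside0 T (h - 1)%R.
split.
- by rewrite numS r0 (eq_num _ rs) -er'.
- rewrite num_widen; first by rewrite e0; apply: eq_num.
  by move=> i si; rewrite ls z2.
- by case=> // i si; rewrite rs z1'.
- by move=> i si; rewrite ls z2 // ltnS ltnW.
Qed.

Local Notation nt := (ntapes M).+1.
Definition nregs : nat := 2 + 2 * nt.
Definition rq : nat := 0.
Definition rt : nat := 1.
Definition rL (j : nat) : nat := 2 + 2 * j.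
Definition rR (j : nat) : nat := 3 + 2 * j.

Local Notation sem := (sem (mstep nregs true)).
Local Notation push := (push B rt).
Local Notation pop := (pop B rt).

(** Reading is guessing: popping the digit of [g] succeeds only if [g] is the scanned letter. A move
    to the left guesses in the same way the letter that becomes the scanned one and shifts it to the
    right half. *)
Definition tapeop (j : nat) (g a : cellM) (mv : move) : prog matom :=
  pop (rR j) (dig g) ;;
  match mv with
  | Stay => push (rR j) (dig a)
  | MoveR => push (rL j) (dig a)
  | MoveL => push (rR j) (dig a) ;;
      alts [seq pop (rL j) (dig l) ;; push (rR j) (dig l) | l <- enum {: cellM}]
  end.

Lemma rRt j : rR j != rt. Proof. by rewrite /rR /rt; lia. Qed.
Lemma rLt j : rL j != rt. Proof. by rewrite /rL /rt; lia. Qed.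
Lemma rRL j : (rR j == rL j) = false. Proof. by apply/eqP; rewrite /rR /rL; lia. Qed.
Lemma rLR j : (rL j == rR j) = false. Proof. by apply/eqP; rewrite /rR /rL; lia. Qed.

Lemma tlt_ : rt < nregs. Proof. by []. Qed.

Lemma In_mem (T : eqType) (x : T) l : x \in l -> List.In x l.
Proof. by elim: l => //= y l IH; rewrite in_cons => /orP[/eqP->|/IH]; [left|right]. Qed.

(** Writing and moving widen the representation by at most one cell each; the third cell is slack
    that gives all directions the same bound. *)
Lemma tapeop_sound j g a mv s s' T h sz : s.2 rt = 0 ->
  trep T h sz (s.2 (rR j)) (s.2 (rL j)) -> sem (tapeop j g a mv) s s' ->
  [/\ g = T h, trep (wr T h a) (shift mv h) sz.+3 (s'.2 (rR j)) (s'.2 (rL j)) &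
      forall i, i != rR j -> i != rL j -> s'.2 i = s.2 i].
Proof.
move=> t0 tr /semS[s1 [/(pop_sound tlt_ (rRt j) t0)[n [er h1]]]].
have t1 : s1.2 rt = 0 by rewrite h1 eq_sym (negPf (rRt j)).
have [n' er'] := trep_head tr.
have [en /dig_inj eg] : n = n' /\ dig g = dig (T h).
  by apply: base_unique; rewrite ?dig_lt // -er.
rewrite er eg in tr; have {}tr := trep_write a tr.
have whd : wr T h a h = a by rewrite /wr eqxx.
case: mv.
- case/semS=> s2 [/(push_sound tlt_ (rRt j) t1) h2 /sem_alts[p [/in_map_iff[l [<- _]]]]].
  have t2 : s2.2 rt = 0 by rewrite h2 eq_sym (negPf (rRt j)).
  case/semS=> s3 [/(pop_sound tlt_ (rLt j) t2)[n3 [el h3]]].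
  have t3 : s3.2 rt = 0 by rewrite h3 eq_sym (negPf (rLt j)).
  move/(push_sound tlt_ (rRt j) t3) => h4.
  have l1 : s2.2 (rL j) = s.2 (rL j) by rewrite h2 rLR h1 rLR.
  have r2 : s2.2 (rR j) = n * B + dig a by rewrite h2 eqxx h1 eqxx.
  have [n4 el4] := trep_left tr.
  have [e4 /dig_inj eg4] : n3 = n4 /\ dig l = dig (wr T h a (h - 1)%R).
    by apply: base_unique; rewrite ?dig_lt // -el l1.
  rewrite -l1 el eg4 in tr.
  split=> //.
  + apply: trep_widen; rewrite h4 eqxx h4 rLR h3 rRL h3 eqxx r2 eg4.
    by apply: trep_leftward.
  + by move=> i nR nL; rewrite h4 (negPf nR) h3 (negPf nL) h2 (negPf nR) h1 (negPf nR).
- move/(push_sound tlt_ (rRt j) t1)=> h2; split=> //.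
  + by do 2 apply: trep_widen; rewrite h2 eqxx h2 rLR !h1 eqxx rLR.
  + by move=> i nR nL; rewrite h2 (negPf nR) h1 (negPf nR).
- move/(push_sound tlt_ (rLt j) t1)=> h2; split=> //.
  + apply: trep_widen; rewrite h2 rRL h2 eqxx !h1 eqxx rLR -{2}whd.
    by apply: trep_right; rewrite whd.
  + by move=> i nR nL; rewrite h2 (negPf nL) h1 (negPf nR).
Qed.

Lemma mass_leq (m : nat -> nat) U : (forall i, i < nregs -> m i <= U) -> mass nregs m <= nregs * U.
Proof.
move=> h; apply: leq_trans (_ : \sum_(i < nregs) U <= _).
  by apply: leq_sum => i _; apply: h.
by rewrite big_const_ord iter_addn_0 mulnC.
Qed.

(** [U] bounds each counter between operations, so [nregs * U] covers their sum. The four further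
    multiples of [U] pay for intermediate states, where a number coexists with its multiple by
    [B]. *)
Lemma tapeop_complete K m j a mv s T h sz U : j < nt -> mstate nregs K m s -> m rt = 0 ->
  trep T h sz (m (rR j)) (m (rL j)) -> (forall i, i < nregs -> m i <= U) -> B ^ sz.+2 <= U ->
  (nregs + 4) * U <= K ->
  exists s' m', [/\ sem (tapeop j (T h) a mv) s s', mstate nregs K m' s',
    trep (wr T h a) (shift mv h) sz.+3 (m' (rR j)) (m' (rL j)), forall i, i < nregs -> m' i <= U &
    forall i, i != rR j -> i != rL j -> m' i = m i].
Proof.
move=> jn ms t0 tr mU BU UK.
have rn : rR j < nregs by rewrite /rR /nregs; lia.
have ln : rL j < nregs by rewrite /rL /nregs; lia.
have tn : rt < nregs by rewrite /rt /nregs; lia.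
have trt := negPf (rRt j). have tlt := negPf (rLt j).
have BB : B ^ sz.+1 * B <= U by rewrite mulnC -expnS.
have B0 : 0 < B by [].
have BU1 : B ^ sz.+1 <= U by apply: leq_trans BU; rewrite leq_pexp2l.
have dU c : dig c < U.
  by apply: leq_trans (dig_lt c) _; apply: leq_trans BU1; rewrite expnS leq_pmulr // expn_gt0.
have MU (m' : nat -> nat) : (forall i, i < nregs -> m' i <= U) -> mass nregs m' + 4 * U <= K.
  by move/mass_leq; lia.
have [n er] := trep_head tr.
have [s1 [h1 ms1]] : exists s', sem (pop (rR j) (dig (T h))) s s' /\ mstate nregs K (upd m (rR j) n) s'.
  apply: (pop_complete tn rn (rRt j) t0 ms er).
  have := MU _ mU; have := mU _ rn; rewrite er; nia.
have nU : n <= U by have := mU _ rn; rewrite er; nia.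
have m1U i : i < nregs -> upd m (rR j) n i <= U by move=> ir; rewrite updE; case: eqP => // _; apply: mU.
have m1t : upd m (rR j) n rt = 0 by rewrite updE eq_sym trt.
have tr' : trep T h sz (n * B + dig (T h)) (m (rL j)) by rewrite -er.
have {tr'}tr' := trep_write a tr'.
have [rb lb] := trep_lt tr'.
have lb' : m (rL j) < B ^ sz by case: (trep_lt tr).
have lB : m (rL j) * B <= U.
  apply: leq_trans BU1; rewrite expnS mulnC leq_pmul2l //; exact: ltnW.
have whd : wr T h a h = a by rewrite /wr eqxx.
have m1L : upd m (rR j) n (rL j) = m (rL j) by rewrite updE rLR.
case: mv.
- pose m2 := upd (upd m (rR j) n) (rR j) (n * B + dig a).
  have [s2 [h2 ms2]] : exists s', sem (push (rR j) (dig a)) s1 s' /\ mstate nregs K m2 s'.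
    have [|s2 [h2 ms2]] := push_complete tn rn (rRt j) m1t ms1 (B := B) (d := dig a).
      by rewrite updE eqxx; have := MU _ m1U; have := dU a; nia.
    by exists s2; split=> //; apply: eq_mstate ms2 => i _; rewrite /m2 !updE !eqxx.
  have m2U i : i < nregs -> m2 i <= U.
    by move=> ir; rewrite /m2 updE; case: eqP => // _; [lia|apply: m1U].
  have m2t : m2 rt = 0 by rewrite /m2 updE eq_sym trt.
  have [n4 el4] := trep_left tr'.
  have m2L : m2 (rL j) = m (rL j) by rewrite /m2 !updE rLR.
  have n4U : n4 <= U by have := mU _ ln; nia.
  have [s3 [h3 ms3]] : exists s', sem (pop (rL j) (dig (wr T h a (h - 1)%R))) s2 s' /\ mstate nregs K (upd m2 (rL j) n4) s'.
    apply: (pop_complete tn ln (rLt j) m2t ms2); first by rewrite m2L.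
    by have := MU _ m2U; lia.
  rewrite el4 in tr'.
  have tr3 := trep_leftward tr'.
  have [rb3 lb3] := trep_lt tr3.
  have m3U i : i < nregs -> upd m2 (rL j) n4 i <= U.
    by move=> ir; rewrite updE; case: eqP => // _; apply: m2U.
  have m3R : upd m2 (rL j) n4 (rR j) = n * B + dig a by rewrite updE rRL /m2 updE eqxx.
  have [||s4 [h4 ms4]] := push_complete tn rn (rRt j) _ ms3 (B := B) (d := dig (wr T h a (h - 1)%R)).
  + by rewrite updE eq_sym tlt m2t.
  + rewrite m3R; have := MU _ m3U; have := dU (wr T h a (h - 1)%R); lia.
  rewrite m3R in ms4; eexists s4, _; split; [|exact: ms4|..].
  + apply: sem_seq h1 _; apply: sem_seq h2 _; apply/sem_alts; eexists; split; last exact: sem_seq h3 h4.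
    by apply/in_map_iff; eexists; split; [reflexivity|apply: In_mem; rewrite mem_enum].
  + by apply: trep_widen; rewrite updE eqxx !updE rLR eqxx.
  + by move=> i ir; rewrite updE; case: eqP => // _; [lia|apply: m3U].
  + by move=> i nR nL; rewrite !updE (negPf nR) (negPf nL) /m2 !updE (negPf nR).
- have [|s2 [h2 ms2]] := push_complete tn rn (rRt j) m1t ms1 (B := B) (d := dig a).
    by rewrite updE eqxx; have := MU _ m1U; have := dU a; nia.
  rewrite updE eqxx in ms2.
  eexists s2, _; split; [exact: sem_seq h1 h2|exact: ms2|..].
  + by do 2 apply: trep_widen; rewrite updE eqxx !updE rLR.
  + by move=> i ir; rewrite updE; case: eqP => // _; [lia|apply: m1U].
  + by move=> i nR nL; rewrite !updE (negPf nR).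
- have [|s2 [h2 ms2]] := push_complete tn ln (rLt j) m1t ms1 (B := B) (d := dig a).
    by rewrite m1L; have := MU _ m1U; have := dU a; have := mU _ ln; lia.
  rewrite m1L in ms2; rewrite -{2}whd in tr'.
  have tr3 := trep_right tr'; rewrite whd in tr3; have [rb3 lb3] := trep_lt tr3.
  eexists s2, _; split; [exact: sem_seq h1 h2|exact: ms2|..].
  + by apply: trep_widen; rewrite !updE eqxx rRL eqxx.
  + by move=> i ir; rewrite updE; case: eqP => // _; [lia|apply: m1U].
  + by move=> i nR nL; rewrite !updE (negPf nR) (negPf nL).
Qed.

Definition acts := 'I_nt -> cellM * move.

Definition tapeops (ks : seq 'I_nt) (g : 'I_nt -> cellM) (act : acts) : prog matom :=
  seqs [seq tapeop k (g k) (act k).1 (act k).2 | k : 'I_nt <- ks].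

Lemma rR_inj i j : rR i = rR j -> i = j. Proof. by rewrite /rR; lia. Qed.

Lemma tapeops_sound ks g (act : acts) s s' (T : 'I_nt -> int -> cellM) (h : 'I_nt -> int) sz :
  uniq ks -> s.2 rt = 0 -> (forall k, k \in ks -> trep (T k) (h k) sz (s.2 (rR k)) (s.2 (rL k))) ->
  sem (tapeops ks g act) s s' ->
  (forall k, k \in ks -> g k = T k (h k) /\
     trep (wr (T k) (h k) (act k).1) (shift (act k).2 (h k)) sz.+3 (s'.2 (rR k)) (s'.2 (rL k))) /\
  (forall i, (forall k, k \in ks -> i != rR k /\ i != rL k) -> s'.2 i = s.2 i).
Proof.
elim: ks s => [|k ks IH] s /=; first by move=> _ _ _ ->.
case/andP=> kn un t0 tr /semS[s1 [op1 ops]].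
have [eg tr1 fr1] := tapeop_sound t0 (tr k (mem_head _ _)) op1.
have ne k' : k' \in ks -> [/\ rR k' != rR k, rR k' != rL k, rL k' != rR k & rL k' != rL k].
  move=> k'i; have nk : (k' : nat) <> k.
    by move=> /val_inj ek; move: kn; rewrite -ek k'i.
  by split; apply/eqP; rewrite /rR /rL; lia.
have [|k' k'i|ih1 ih2] := IH s1 un _ _ ops.
- by rewrite fr1 // /rt /rR /rL; lia.
- by have [? ? ? ?] := ne _ k'i; rewrite !fr1 //; apply: tr; rewrite in_cons k'i orbT.
split.
  move=> k'; rewrite in_cons => /orP[/eqP->|/ih1//]; split=> //.
  by rewrite !ih2 // => k'' /ne[n1 n2 n3 n4]; split; rewrite eq_sym.
move=> i fi; have [f1 f2] := fi k (mem_head _ _).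
by rewrite ih2 ?fr1 // => k' k'i; apply: fi; rewrite in_cons k'i orbT.
Qed.

Lemma tapeops_complete ks (act : acts) K m s (T : 'I_nt -> int -> cellM) (h : 'I_nt -> int) sz U :
  uniq ks -> mstate nregs K m s -> m rt = 0 ->
  (forall k, k \in ks -> trep (T k) (h k) sz (m (rR k)) (m (rL k))) ->
  (forall i, i < nregs -> m i <= U) -> B ^ sz.+2 <= U -> (nregs + 4) * U <= K ->
  exists s' m', [/\ sem (tapeops ks (fun k => T k (h k)) act) s s', mstate nregs K m' s',
    forall k, k \in ks ->
      trep (wr (T k) (h k) (act k).1) (shift (act k).2 (h k)) sz.+3 (m' (rR k)) (m' (rL k)),
    forall i, i < nregs -> m' i <= U &
    forall i, (forall k, k \in ks -> i != rR k /\ i != rL k) -> m' i = m i].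
Proof.
move=> + + + + + BU UK; elim: ks m s => [|k ks IH] m s /=.
  by move=> _ ms _ _ mU; exists s, m.
case/andP=> kn un ms t0 tr mU.
have [s1 [m1 [op1 ms1 tr1 m1U fr1]]] :=
  tapeop_complete (act k).1 (act k).2 (ltn_ord k) ms t0 (tr k (mem_head _ _)) mU BU UK.
have ne k' : k' \in ks -> [/\ rR k' != rR k, rR k' != rL k, rL k' != rR k & rL k' != rL k].
  move=> k'i; have nk : (k' : nat) <> k.
    by move=> /val_inj ek; move: kn; rewrite -ek k'i.
  by split; apply/eqP; rewrite /rR /rL; lia.
have [|k' k'i|s2 [m2 [op2 ms2 tr2 m2U fr2]]] := IH m1 s1 un ms1 _ _ m1U.
- by rewrite fr1 // /rt /rR /rL; lia.
- by have [? ? ? ?] := ne _ k'i; rewrite !fr1 //; apply: tr; rewrite in_cons k'i orbT.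
exists s2, m2; split=> //.
- exact: sem_seq op1 op2.
- move=> k'; rewrite in_cons => /orP[/eqP->|/tr2//].
  by rewrite !fr2 // => k'' /ne[n1 n2 n3 n4]; split; rewrite eq_sym.
move=> i fi; have [f1 f2] := fi k (mem_head _ _).
by rewrite fr2 ?fr1 // => k' k'i; apply: fi; rewrite in_cons k'i orbT.
Qed.

Definition qn (q : state M) : nat := enum_rank q.

Lemma qn_inj : injective qn.
Proof. by move=> p q /val_inj/enum_rank_inj. Qed.

(** State and view are guessed together. Subtracting the number of the state and testing for zero
    verifies the state, and the pops verify the view. *)
Definition stepP (x : state M * {ffun 'I_nt -> cellM}) : prog matom :=
  subp rq (qn x.1) ;; zerop rq ;; addp rq (qn (delta x.1 x.2).1) ;;
  tapeops (enum 'I_nt) x.2 (delta x.1 x.2).2.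

Definition stepsP : prog matom :=
  alts [seq stepP x | x <- enum {: state M * {ffun 'I_nt -> cellM}} & ~~ halting x.1].

Definition finP : prog matom :=
  alts [seq subp rq (qn q) ;; zerop rq | q <- enum {: state M} & halting q && accepting q].

(** The final dump returns all borrowed units to the budget, whatever is left on the tapes, so that
    the final budget can be compared with the initial one. *)
Definition midP : prog matom :=
  addp rq (qn (start M)) ;; Star stepsP ;; finP ;; seqs [seq dump j | j <- iota 0 nregs].

Definition conf_rep (c : config M) (sz : nat) (m : nat -> nat) : Prop :=
  [/\ m rq = qn (cstate c), m rt = 0 &
      forall k, trep (ctape c k) (chead c k) sz (m (rR k)) (m (rL k))].

Lemma rq_lt : rq < nregs. Proof. by []. Qed.

Lemma In_filter_enum (T : finType) (P : pred T) (x : T) :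
  List.In x [seq y <- enum T | P y] <-> P x.
Proof.
split=> [|Px]; last by apply: In_mem; rewrite mem_filter Px mem_enum.
by elim: (enum T) => //= y l IH; case: ifP => // Py [<-|].
Qed.

Lemma stepsP_sound c sz s s' : conf_rep c sz s.2 -> sem stepsP s s' ->
  conf_rep (step c) sz.+3 s'.2.
Proof.
case=> eq t0 tr /sem_alts[p [/in_map_iff[[q g] [<- /In_filter_enum/= nh]]]].
case/semS=> s1 [/subp_sound[le h1] /semS[s2 [[_ /(_ isT) z E2] /semS[s3 [/addp_sound h3 ops]]]]].
have qc : q = cstate c.
  by apply: qn_inj; move: z le; rewrite h1 eqxx eq /=; lia.
have h2 i : s2.2 i = if i == rq then 0 else s1.2 i by rewrite E2.
have fr i : i != rq -> s3.2 i = s.2 i by move=> ne; rewrite h3 (negPf ne) h2 (negPf ne) h1 (negPf ne).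
have [|k _|ih1 ih2] := tapeops_sound (T := ctape c) (h := chead c) (sz := sz) (enum_uniq _) _ _ ops.
- by rewrite fr.
- by rewrite !fr.
have eg : g = [ffun k => ctape c k (chead c k)].
  by apply/ffunP => k; rewrite ffunE; case: (ih1 k (mem_enum _ _)).
rewrite /step -qc (negPf nh) -eg; case ed : (delta q g) => [q' act]; rewrite ed /= in ih1 h3.
split=> /=.
- rewrite ih2; last by move=> k _; rewrite /rq /rR /rL; lia.
  by rewrite h3 eqxx h2 eqxx.
- rewrite ih2; last by move=> k _; rewrite /rt /rR /rL; lia.
  by rewrite fr.
by move=> k; case: (ih1 k (mem_enum _ _)).
Qed.

Lemma step_run w n : step (run M w n) = run M w n.+1. Proof. by []. Qed.

(** The first letter is the least significant digit, so this number is the right half of the input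
    tape in the initial configuration. *)
Definition Nw (w : seq Sig) : nat := foldr (fun a acc => acc * B + dig (Some (inl (inl a)))) 0 w.

Definition minit (w : seq Sig) (i : nat) : nat := if i == rR 0 then Nw w else 0.

Lemma num0 n : num n (fun=> 0) = 0.
Proof. by elim: n => //= n ->; rewrite muln0. Qed.

Lemma init_rep w : conf_rep (init M w) (size w) (upd (minit w) rq (qn (start M))).
Proof.
have e0 i : lside (tape_of [::] : int -> cellM) 0 i = 0.
  by rewrite /lside (_ : (0 - 1 - i%:Z)%R = Negz i) //; lia.
have e1 (z : seq letter) i : lside (tape_of z : int -> cellM) 0 i = 0.
  by rewrite /lside (_ : (0 - 1 - i%:Z)%R = Negz i) //; lia.
have e2 (z : seq letter) i : rside (tape_of z : int -> cellM) 0 i = dig (onth z i).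
  by rewrite /rside (_ : (0 + i%:Z)%R = Posz i) //; lia.
split=> // k.
have -> : upd (minit w) rq (qn (start M)) (rL k) = 0.
  by rewrite updE /minit /rL /rR /rq; eqf.
rewrite updE /minit (_ : (rR k == rq) = false) //=.
set z : seq letter := if k == ord0 then _ else _.
have ez : (if rR k == rR 0 then Nw w else 0) = num (size w) (fun i => dig (onth z i)).
  rewrite /z; have [->|ne] := eqVneq k ord0.
    rewrite eqxx; elim: (w) => // a v IH.
    by rewrite numS /= IH.
  rewrite (_ : (rR k == rR 0) = false); last first.
    by apply/eqP => /rR_inj e; case/eqP: ne; apply: val_inj.
  by rewrite (eq_num _ (g := fun=> 0)) ?num0 // => -[].
have sz : size z <= size w by rewrite /z; case: ifP; rewrite ?size_map.
split.
- by rewrite ez; apply: eq_num => i; rewrite e2.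
- by rewrite (eq_num _ (e1 z)) num0.
- by move=> i wi; rewrite e2 onth_default //; apply: leq_trans sz wi.
- by move=> i _; rewrite e1.
Qed.

Lemma midP_sound w s s' : (forall i, s.2 i = minit w i) -> sem midP s s' ->
  exists n, halting (cstate (run M w n)) /\ accepting (cstate (run M w n)).
Proof.
move=> hs /semS[s1 [/addp_sound h1 /semS[s2 [/semStar st /semS[s3 [fin _]]]]]].
have cr1 : conf_rep (run M w 0) (size w) s1.2.
  have [r1 r2 r3] := init_rep w.
  have e i : s1.2 i = upd (minit w) rq (qn (start M)) i.
    by rewrite h1 !hs updE.
  by split=> [||k]; rewrite !e.
have [n [sz cr2]] : exists n sz, conf_rep (run M w n) sz s2.2.
  apply: (@star_inv _ _ (fun t => exists n sz, conf_rep (run M w n) sz t.2) _ _ _ st); last by exists 0, (size w).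
  move=> a b [n [sz cr]] stp; exists n.+1, sz.+3; rewrite -step_run.
  exact: stepsP_sound cr stp.
exists n; case: cr2 => eq _ _.
case/sem_alts: fin => p [/in_map_iff[q [<- /In_filter_enum/andP[hq aq]]]].
case/semS=> s4 [/subp_sound[le h4] [_ /(_ isT) z _]].
have -> // : cstate (run M w n) = q.
by apply: qn_inj; move: z le; rewrite h4 eqxx eq; lia.
Qed.

Lemma stepsP_complete c sz K m s U : conf_rep c sz m -> mstate nregs K m s -> ~~ halting (cstate c) ->
  (forall i, i < nregs -> m i <= U) -> B ^ sz.+2 <= U -> #|{: state M}| <= U -> (nregs + 4) * U <= K ->
  exists s' m', [/\ sem stepsP s s', mstate nregs K m' s', conf_rep (step c) sz.+3 m' &
    forall i, i < nregs -> m' i <= U].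
Proof.
case=> eq t0 tr ms nh mU BU SU UK.
pose g := [ffun k => ctape c k (chead c k)].
have qU q : qn q <= U by apply: leq_trans SU; apply: ltnW; apply: ltn_ord.
have [|s1 [h1 ms1]] := subp_complete rq_lt ms (a := qn (cstate c)); first by rewrite eq.
have [|s2 [h2 ms2]] := zerop_complete rq_lt ms1; first by rewrite updE eqxx eq subnn.
set m1 := upd m _ _ in ms1 ms2.
have m1U i : i < nregs -> m1 i <= U by move=> ir; rewrite /m1 updE; case: eqP => // _; [lia|apply: mU].
have m10 : m1 rq = 0 by rewrite /m1 updE eqxx eq subnn.
have [|s3 [h3 ms3]] := addp_complete (b := qn (delta (cstate c) g).1) rq_lt ms2.
  by have := mass_leq m1U; have := qU (delta (cstate c) g).1; lia.
rewrite m10 add0n in ms3; set m2 := upd m1 _ _ in ms3.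
have m2U i : i < nregs -> m2 i <= U by move=> ir; rewrite /m2 updE; case: eqP => // _; apply: m1U.
have fr i : i != rq -> m2 i = m i by move=> ne; rewrite /m2 /m1 !updE (negPf ne).
have t2 : m2 rt = 0 by rewrite fr.
have tr2 k : k \in enum 'I_nt -> trep (ctape c k) (chead c k) sz (m2 (rR k)) (m2 (rL k)).
  by move=> _; rewrite !fr.
have [s4 [m4 [h4 ms4 tr4 m4U fr4]]] :=
  tapeops_complete (delta (cstate c) g).2 (enum_uniq _) ms3 t2 tr2 m2U BU UK.
exists s4, m4; split=> //.
  apply/sem_alts; exists (stepP (cstate c, g)); split.
    by apply/in_map_iff; exists (cstate c, g); split=> //; apply/In_filter_enum.
  apply: sem_seq h1 _; apply: sem_seq h2 _; apply: sem_seq h3 _.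
  move: h4; congr (sem _ _ _); rewrite /tapeops; congr seqs; apply: eq_map => k.
  by rewrite /= ffunE.
rewrite /step (negPf nh) -/g; case ed : (delta (cstate c) g) => [q' act]; rewrite ed /= in tr4 fr4 ms3 m2U fr *.
split=> /=.
- rewrite fr4; last by move=> k _; rewrite /rq /rR /rL; lia.
  by rewrite /m2 updE eqxx ed.
- rewrite fr4; last by move=> k _; rewrite /rt /rR /rL; lia.
  by rewrite fr.
by move=> k; apply: tr4; rewrite mem_enum.
Qed.

(** After [n] steps the width is at most [size w + 3n], and a tape operation needs room for two more
    digits. If the machine halts earlier, the remaining rounds only widen the representation. *)
Lemma midP_complete w n K s U : mstate nregs K (minit w) s ->
  halting (cstate (run M w n)) -> accepting (cstate (run M w n)) ->
  B ^ (size w + 3 * n + 2) <= U -> #|{: state M}| <= U -> (nregs + 4) * U <= K ->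
  exists s', sem midP s s' /\ mstate nregs K (fun=> 0) s'.
Proof.
move=> ms hq aq BU SU UK.
have qU q : qn q <= U by apply: leq_trans SU; apply: ltnW; apply: ltn_ord.
have BUi i : i <= n -> B ^ (size w + 3 * i).+2 <= U.
  by move=> le; apply: leq_trans BU; rewrite leq_pexp2l //; lia.
have NU : Nw w <= U.
  have [_ _ /(_ ord0)] := init_rep w.
  rewrite updE /minit (_ : (rR ord0 == rq) = false) // (_ : rR ord0 = rR 0) // eqxx => /trep_lt[lt _].
  apply: ltnW; apply: leq_trans lt _; apply: leq_trans (BUi 0 isT); rewrite leq_pexp2l //; lia.
have m0U i : i < nregs -> minit w i <= U by move=> _; rewrite /minit; case: ifP.
have [|s1 [h1 ms1]] := addp_complete (b := qn (start M)) rq_lt ms.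
  by have := mass_leq m0U; have := qU (start M); lia.
rewrite {2}/minit add0n in ms1.
have m1U i : i < nregs -> upd (minit w) rq (qn (start M)) i <= U.
  by move=> ir; rewrite updE; case: eqP => // _; apply: m0U.
have [s2 [m2 [h2 ms2 cr2 m2U]]] : exists s2 m2, [/\ sem (Star stepsP) s1 s2, mstate nregs K m2 s2,
    conf_rep (run M w n) (size w + 3 * n) m2 & forall i, i < nregs -> m2 i <= U].
  have: n <= n by []. move: {1 3 4}n => j; elim: j => [|j IH] jn.
    exists s1, (upd (minit w) rq (qn (start M))); split=> //; first exact: sem_star0.
    by rewrite muln0 addn0; apply: init_rep.
  have [s2 [m2 [h2 ms2 cr2 m2U]]] := IH (ltnW jn).
  case hj : (halting (cstate (run M w j))).
    exists s2, m2; split=> //.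
    rewrite -step_run /step hj; case: cr2 => ? ? tr; split=> // k.
    have -> : size w + 3 * j.+1 = (size w + 3 * j).+3 by lia.
    by do 3 apply: trep_widen.
  have [||s3 [m3 [h3 ms3 cr3 m3U]]] := stepsP_complete cr2 ms2 _ m2U _ SU UK; [by rewrite hj|by apply: BUi; lia|].
  exists s3, m3; split=> //; first by apply: star_rcons h2 h3.
  by rewrite -step_run (_ : size w + 3 * j.+1 = (size w + 3 * j).+3) //; lia.
case: (cr2) => eq _ _.
have [|s3 [h3 ms3]] := subp_complete rq_lt ms2 (a := qn (cstate (run M w n))); first by rewrite eq.
have [|s4 [h4 ms4]] := zerop_complete rq_lt ms3; first by rewrite updE eqxx eq subnn.
have [s5 [h5 ms5]] := dump_all_complete tlt_ ms4.
exists s5; split=> //; apply: sem_seq h1 _; apply: sem_seq h2 _; apply: sem_seq h5.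
apply/sem_alts; eexists; split; last exact: sem_seq h3 h4.
by apply/in_map_iff; eexists; split; [reflexivity|apply/In_filter_enum; rewrite hq].
Qed.

End TMSim.

(** * Registers and records as tokens on places *)

(* An odd place carries one token whose field 0 is the register of that number;
   place 0 carries the current record, place 2 the garbage and place [4 + 2b]
   the bag [b]. *)
Inductive patom :=
| PInc of ref | PDec of ref | PMv of ref & ref | PNew of ref | PCtl of ctl.

Record pst := Pst { pi : nat; pl : nat -> seq (seq nat) }.

Definition vplace (v : nat) : nat := if odd v then v else 0.
Definition vfield (v : nat) : nat := if odd v then 0 else v./2.

Definition cref (p : nat) : ref := (p, false).

(** In a conservative system an event that takes a record must also put one. Resetting and clearing
    therefore move the old token to the garbage place 2 and create an empty one in a second step. *)
Definition pimpl (a : ratom) : prog patom :=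
  match a with
  | RInc r => At (PInc r)
  | RDec r => At (PDec r)
  | RRst r => if odd r.1 then At (PMv r (cref 2)) ;; At (PNew r) else Fail
  | RSto b => At (PMv (cref 0) (cref (4 + b.*2))) ;; At (PNew (cref 0))
  | RGet b => At (PMv (cref 0) (cref 2)) ;; At (PMv (cref (4 + b.*2)) (cref 0))
  | RClr => At (PMv (cref 0) (cref 2)) ;; At (PNew (cref 0))
  | RCtl c => At (PCtl c)
  end.

Section Places.
Variables k nf : nat.
Hypothesis nf_big : 12 <= nf.

Definition incf (x : seq nat) (f : nat) : seq nat := mkseq (fun j => nth 0 x j + (j == f)) nf.
Definition decf (x : seq nat) (f : nat) : seq nat := mkseq (fun j => nth 0 x j - (j == f)) nf.
Definition zerov : seq nat := nseq nf 0.
Definition regv (x : nat) : seq nat := mkseq (fun j => if j == 0 then x else 0) nf.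

Definition pstep (a : patom) (s s' : pst) : Prop :=
  match a with
  | PInc r => let v := ev (pi s) r in exists x l,
      [/\ v < nf.*2, pi s' = pi s, perm_eq (pl s (vplace v)) (x :: l),
          perm_eq (pl s' (vplace v)) (incf x (vfield v) :: l) &
          forall p, p < nf.*2 -> p != vplace v -> perm_eq (pl s' p) (pl s p)]
  | PDec r => let v := ev (pi s) r in exists x l,
      [/\ v < nf.*2 /\ 0 < nth 0 x (vfield v), pi s' = pi s, perm_eq (pl s (vplace v)) (x :: l),
          perm_eq (pl s' (vplace v)) (decf x (vfield v) :: l) &
          forall p, p < nf.*2 -> p != vplace v -> perm_eq (pl s' p) (pl s p)]
  | PMv r w => let p := ev (pi s) r in let q := ev (pi s) w in exists x,
      [/\ [/\ p < nf.*2, q < nf.*2 & p != q], pi s' = pi s, perm_eq (pl s p) (x :: pl s' p),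
          perm_eq (pl s' q) (x :: pl s q) &
          forall r, r < nf.*2 -> r != p -> r != q -> perm_eq (pl s' r) (pl s r)]
  | PNew r => let p := ev (pi s) r in
      [/\ p < nf.*2, pi s' = pi s, perm_eq (pl s' p) (zerov :: pl s p) &
          forall r, r < nf.*2 -> r != p -> perm_eq (pl s' r) (pl s r)]
  | PCtl c => cstep k c (pi s) (pi s') /\ forall p, p < nf.*2 -> perm_eq (pl s' p) (pl s p)
  end.

(** Nothing is said about the garbage place. Bags are compared up to order, and stored records must
    have full length, since fetching one overwrites all fields of the current record. *)
Definition prep (s : rst) (t : pst) : Prop :=
  [/\ pi t = iv s, pl t 0 = [:: rvec nf (rg s)],
      forall p, p < nf.*2 -> odd p -> pl t p = [:: regv (rg s p)],
      forall b, 4 + b.*2 < nf.*2 -> perm_eq (pl t (4 + b.*2)) (bg s b) &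
      forall b v, v \in bg s b -> size v = nf].

Lemma regv0 : zerov = regv 0.
Proof.
apply: (@eq_from_nth _ 0) => [|i]; rewrite size_nseq ?size_mkseq // => ilt.
by rewrite nth_nseq ilt nth_mkseq //; case: ifP.
Qed.

Lemma rvec0 g : (forall v, ~~ odd v -> g v = 0) -> rvec nf g = zerov.
Proof.
move=> g0; apply: (@eq_from_nth _ 0) => [|i]; rewrite size_mkseq ?size_nseq // => ilt.
by rewrite nth_nseq ilt nth_mkseq // g0 // odd_double.
Qed.

Lemma eq_rvec g h : (forall v, v < nf.*2 -> ~~ odd v -> g v = h v) -> rvec nf g = rvec nf h.
Proof.
move=> e; apply: (@eq_from_nth _ 0) => [|i]; rewrite !size_mkseq // => ilt.
by rewrite !nth_mkseq // e ?odd_double // ltn_double.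
Qed.

Lemma incf_regv x : incf (regv x) 0 = regv x.+1.
Proof.
apply: (@eq_from_nth _ 0) => [|i]; rewrite !size_mkseq // => ilt.
by rewrite !nth_mkseq //; case: i ilt => //= _; rewrite addn1.
Qed.

Lemma decf_regv x : decf (regv x) 0 = regv x.-1.
Proof.
apply: (@eq_from_nth _ 0) => [|i]; rewrite !size_mkseq // => ilt.
by rewrite !nth_mkseq //; case: i ilt => //= _; rewrite subn1.
Qed.

Lemma nth_regv0 x : nth 0 (regv x) 0 = x.
Proof. by rewrite nth_mkseq //; lia. Qed.

Lemma incf_rvec g v : ~~ odd v -> incf (rvec nf g) v./2 = rvec nf (upd g v (g v).+1).
Proof.
move=> ov; apply: (@eq_from_nth _ 0) => [|i]; rewrite !size_mkseq // => ilt.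
rewrite !nth_mkseq // updE; case: (i =P v./2) => [->|ne].
  by rewrite even_halfK // eqxx addn1.
by rewrite (_ : (i.*2 == v) = false) ?addn0 //; apply/eqP => e; apply: ne; rewrite -e doubleK.
Qed.

Lemma decf_rvec g v : ~~ odd v -> decf (rvec nf g) v./2 = rvec nf (upd g v (g v).-1).
Proof.
move=> ov; apply: (@eq_from_nth _ 0) => [|i]; rewrite !size_mkseq // => ilt.
rewrite !nth_mkseq // updE; case: (i =P v./2) => [->|ne].
  by rewrite even_halfK // eqxx subn1.
by rewrite (_ : (i.*2 == v) = false) ?subn0 //; apply/eqP => e; apply: ne; rewrite -e doubleK.
Qed.

Lemma perm1 (T : eqType) (l : seq T) x : perm_eq l [:: x] -> l = [:: x].
Proof. by move=> h; apply: perm_small_eq. Qed.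

Lemma perm1_cons (T : eqType) (x y : T) l : perm_eq [:: x] (y :: l) -> x = y /\ l = [::].
Proof. by move=> /[dup]/perm_size/=; case: l => // _; rewrite perm_sym => /perm1[->]. Qed.

Lemma rvec_odd g v x : odd v -> rvec nf (upd g v x) = rvec nf g.
Proof. by move=> ov; apply: eq_rvec => u _ ou; rewrite updE; case: eqP => // e; rewrite -e (negPf ou) in ov. Qed.

Lemma prep_set s t t' v x : prep s t -> v < nf.*2 -> pi t' = iv s ->
  pl t' (vplace v) = [:: if odd v then regv x else rvec nf (upd (rg s) v x)] ->
  (forall p, p < nf.*2 -> p != vplace v -> perm_eq (pl t' p) (pl t p)) ->
  prep (Rst (iv s) (upd (rg s) v x) (bg s)) t'.
Proof.
case=> h1 h2 h3 h4 h5 lt ei ev eo; rewrite /vplace in ev eo.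
split=> //=.
- case: ifP ev eo => ov ev eo //.
  have v0 : 0 != v by case: (v) ov.
  by rewrite rvec_odd //; apply: perm1; rewrite -h2; apply: eo => //; lia.
- move=> p pn op; rewrite updE; case: (p =P v) => [e|ne].
    by subst v; rewrite op in ev.
  apply: perm1; rewrite -h3 //; apply: eo => //.
  by case: ifP => _; apply/eqP => // e; rewrite e in op.
- move=> b bn; apply: perm_trans (h4 b bn); apply: eo => //.
  by case: ifP => ov; apply/eqP => // e; move: ov; rewrite -e oddD odd_double.
Qed.

Lemma rvec_setv v g : size v = nf -> rvec nf (setv v g) = v.
Proof.
move=> sv; apply: (@eq_from_nth _ 0) => [|i]; rewrite size_mkseq // => ilt.
by rewrite nth_mkseq // /setv odd_double doubleK.
Qed.

Lemma pimpl_sound a s t t' : prep s t -> sem pstep (pimpl a) t t' ->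
  exists s', rstep k nf a s s' /\ prep s' t'.
Proof.
move=> rp; case: (rp) => h1 h2 h3 h4 h5.
have nf0 : 0 < nf.*2 by lia.
have pv v : v < nf.*2 -> pl t (vplace v) = [:: if odd v then regv (rg s v) else rvec nf (rg s)].
  by rewrite /vplace; case: ifP => // ov vn; apply: h3.
have ne02 p : odd p -> (p != 0) && (p != 2) by move=> op; apply/andP; split; apply/eqP => e; rewrite e in op.
have neb (b p : nat) : odd p -> p != 4 + b.*2.
  by move=> op; apply/eqP => e; rewrite e oddD odd_double in op.
case: a => [r|r|r|b|b||c] /=.
- rewrite /sem /= h1; case=> x [l [vn ei]]; rewrite pv // => /perm1_cons[<- ->] /perm1 e2 eo.
  eexists; split; first by split; [exact: vn|reflexivity].
  apply: (prep_set rp vn ei) => //; rewrite e2 /vfield; case: ifP => ov; first by rewrite incf_regv.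
  by rewrite incf_rvec // ov.
- rewrite /sem /= h1; case=> x [l [[vn pos] ei]]; rewrite pv // => /perm1_cons[ex ->] /perm1 e2 eo.
  rewrite -{}ex in pos e2; eexists; split.
    split; [exact: vn| |reflexivity].
    move: pos; rewrite /vfield; case: ifP => ov; first by rewrite nth_regv0.
    have vh : (ev (iv s) r)./2 < nf by rewrite ltn_half_double.
    by rewrite nth_mkseq // even_halfK // ov.
  apply: (prep_set rp vn ei) => //; rewrite e2 /vfield; case: ifP => ov; first by rewrite decf_regv.
  by rewrite decf_rvec // ov.
- case: ifP => // od /semS[t1 []]; rewrite /sem /= h1 /=.
  have ov : odd (ev (iv s) r) by rewrite /ev oddD od; case: (r.2); rewrite //= oddM.
  case=> x [[vn _ ne] ei e1 _ eo]; rewrite ei; case=> _ ei' e' eo'.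
  set v := ev (iv s) r in vn ne eo ov e1 e' eo' *.
  move: e1; rewrite h3 // => /perm1_cons[_ e1].
  eexists; split; first by split; [|exact: vn|reflexivity].
  have v2 : v != 2 by case/andP: (ne02 _ ov).
  have v0 : v != 0 by case/andP: (ne02 _ ov).
  split=> //=.
  + rewrite rvec_odd //; apply: perm1; rewrite -h2; apply: perm_trans (eo' _ _ _) (eo _ _ _ _) => //;
    by rewrite eq_sym.
  + move=> p pn op; have /andP[p0 p2] := ne02 _ op; rewrite updE; case: (p =P v) => [->|/eqP pv'].
      by apply: perm1; rewrite -regv0 -e1.
    by apply: perm1; rewrite -h3 //; apply: perm_trans (eo' _ _ _) (eo _ _ _ _).
  + move=> b bn; apply: perm_trans (h4 b bn); have nb := neb b _ ov.
    by apply: perm_trans (eo' _ _ _) (eo _ _ _ _) => //; rewrite eq_sym.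
- case/semS=> t1 []; rewrite /sem /= /ev /= !addn0.
  case=> x [[_ bn _] ei]; rewrite h2 => /perm1_cons[<- e1] eb eo [_ ei' e0 eo'].
  eexists; split; first by split; [exact: bn|reflexivity].
  split=> /=; [by rewrite ei' ei h1| | | |].
  + by apply: perm1; rewrite rvec0 -?e1 // => v /negPf; rewrite /setv => ->; rewrite nth_nil.
  + move=> p pn op; have /andP[p0 p2] := ne02 _ op; rewrite /setv op; apply: perm1; rewrite -h3 //.
    by apply: perm_trans (eo' _ _ _) (eo _ _ _ _) => //; apply: neb.
  + move=> b' bn'; rewrite /updb; case: (b' =P b) => [->|/eqP nb].
      by apply: perm_trans (eo' _ _ _) _ => //; apply: perm_trans eb _; rewrite perm_cons; apply: h4.
    apply: perm_trans (h4 _ bn'); apply: perm_trans (eo' _ _ _) (eo _ _ _ _) => //.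
    by rewrite eqn_add2l -!muln2 eqn_pmul2r.
  + move=> b' v; rewrite /updb; case: eqP => [_|_]; last exact: h5.
    by rewrite in_cons => /orP[/eqP->|/h5//]; rewrite size_mkseq.
- case/semS=> t1 []; rewrite /sem /= /ev /= !addn0.
  case=> x [_ ei]; rewrite h2 => /perm1_cons[<- e1] _ eo [y [[bn _ _] ei' eb e0 eo']].
  have b2 : 4 + b.*2 != 2 by lia.
  have b0 : 4 + b.*2 != 0 by lia.
  have eb1 : perm_eq (bg s b) (y :: pl t' (4 + b.*2)).
    by rewrite perm_sym in eb; rewrite perm_sym; apply: perm_trans eb _; apply: perm_trans (eo _ _ _ _) (h4 _ _).
  have yb : y \in bg s b by rewrite (perm_mem eb1) mem_head.
  have sy := h5 _ _ yb.
  have [l1 [l2 ebg]] : exists l1 l2, bg s b = l1 ++ y :: l2.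
    by case/splitPr: yb => l1 l2; exists l1, l2.
  rewrite ebg in eb1.
  eexists; split; first by exists l1, y, l2; split; [exact: bn|exact: ebg|reflexivity].
  split=> /=; [by rewrite ei' ei h1| | | |].
  + by rewrite rvec_setv //; apply: perm1; rewrite -e1.
  + move=> p pn op; have /andP[p0 p2] := ne02 _ op; rewrite /setv op; apply: perm1; rewrite -h3 //.
    by apply: perm_trans (eo' _ _ _ _) (eo _ _ _ _) => //; apply: neb.
  + move=> b' bn'; rewrite /updb; case: (b' =P b) => [->|/eqP nb].
      by rewrite -(perm_cons y) perm_sym -cat1s perm_catCA.
    apply: perm_trans (h4 _ bn'); apply: perm_trans (eo' _ _ _ _) (eo _ _ _ _) => //.
    by rewrite eqn_add2l -!muln2 eqn_pmul2r.
  + move=> b' v; rewrite /updb; case: eqP => [_|_]; last exact: h5.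
    by move=> vi; apply: (h5 b); rewrite ebg mem_cat in_cons; move: vi; rewrite mem_cat => /orP[->|->] //; rewrite !orbT.
- case/semS=> t1 []; rewrite /sem /= /ev /= !addn0.
  case=> x [_ ei]; rewrite h2 => /perm1_cons[<- e1] _ eo [_ ei' e0 eo'].
  eexists; split; first by reflexivity.
  split=> //=; first by rewrite ei' ei h1.
  + by apply: perm1; rewrite rvec0 -?e1 // => v /negPf; rewrite /setv => ->; rewrite nth_nil.
  + move=> p pn op; have /andP[p0 p2] := ne02 _ op; rewrite /setv op; apply: perm1; rewrite -h3 //.
    by apply: perm_trans (eo' _ _ _) (eo _ _ _ _).
  + by move=> b bn; apply: perm_trans (h4 _ bn); apply: perm_trans (eo' _ _ _) (eo _ _ _ _).
- rewrite /sem /= h1; case=> cs eo; eexists; split; first by exists (pi t'); [exact: cs|reflexivity].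
  split=> //=.
  + by apply: perm1; rewrite -h2; apply: eo.
  + by move=> p pn op; apply: perm1; rewrite -h3 //; apply: eo.
  + by move=> b bn; apply: perm_trans (eo _ _) (h4 _ _).
Qed.

Definition updp (f : nat -> seq (seq nat)) (p : nat) (l : seq (seq nat)) :=
  fun j => if j == p then l else f j.

Lemma updpE f p l j : updp f p l j = if j == p then l else f j. Proof. by []. Qed.

Lemma pimpl_complete a s s' t : prep s t -> rstep k nf a s s' ->
  exists t', sem pstep (pimpl a) t t' /\ prep s' t'.
Proof.
move=> rp; case: (rp) => h1 h2 h3 h4 h5.
have nf0 : 0 < nf.*2 by lia.
have nf2 : 2 < nf.*2 by lia.
have pv v : v < nf.*2 -> pl t (vplace v) = [:: if odd v then regv (rg s v) else rvec nf (rg s)].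
  by rewrite /vplace; case: ifP => // ov vn; apply: h3.
(* For a deterministic atom it is enough to run its implementation: by soundness the end represents
   a successor of [s], which can only be [s']. [RGet] chooses a record and is treated by hand. *)
have det t' : (forall s1 s2, rstep k nf a s s1 -> rstep k nf a s s2 -> s1 = s2) ->
    rstep k nf a s s' -> sem pstep (pimpl a) t t' ->
    exists t', sem pstep (pimpl a) t t' /\ prep s' t'.
  move=> dt st sm; exists t'; split=> //.
  by have [s1 [st1 rp1]] := pimpl_sound rp sm; rewrite (dt _ _ st st1).
case: a det => [r|r|r|b|b||c] det st.
- case: (st) => vn _; set v := ev (iv s) r in vn.
  apply: (det (Pst (pi t) (updp (pl t) (vplace v) [:: incf (if odd v then regv (rg s v) else rvec nf (rg s)) (vfield v)]))) => //.
    by move=> s1 s2 [_ ->] [_ ->].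
  rewrite /sem /= h1 -/v pv //; eexists; exists [::]; split=> //=; first by rewrite updpE eqxx.
  by move=> p pn /negPf np; rewrite updpE np.
- case: (st) => vn pos _; set v := ev (iv s) r in vn pos.
  apply: (det (Pst (pi t) (updp (pl t) (vplace v) [:: decf (if odd v then regv (rg s v) else rvec nf (rg s)) (vfield v)]))) => //.
    by move=> s1 s2 [_ _ ->] [_ _ ->].
  rewrite /sem /= h1 -/v pv //; eexists; exists [::]; split=> //=.
  + split=> //; rewrite /vfield; case: ifP => ov; first by rewrite nth_regv0.
    have vh : v./2 < nf by rewrite ltn_half_double.
    by rewrite nth_mkseq // even_halfK // ov.
  + by rewrite updpE eqxx.
  + by move=> p pn /negPf np; rewrite updpE np.
- case: (st) => od vn _; set v := ev (iv s) r in vn.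
  have ov : odd v by rewrite /v /ev oddD od; case: (r.2); rewrite //= oddM.
  have v2 : v != 2 by apply/eqP => e; rewrite e in ov.
  pose t1 := Pst (pi t) (updp (updp (pl t) v [::]) 2 (regv (rg s v) :: pl t 2)).
  apply: (det (Pst (pi t) (updp (pl t1) v [:: zerov]))) => //.
    by move=> s1 s2 [_ _ ->] [_ _ ->].
  rewrite /= od; apply: (@sem_seq _ _ _ _ _ _ t1); rewrite /sem /= h1 -/v.
    exists (regv (rg s v)); split=> //=; [by rewrite !updpE eqxx (negPf v2) h3|].
    by move=> p pn /negPf np /negPf np2; rewrite !updpE np np2.
  split=> //=; first by rewrite !updpE eqxx (negPf v2).
  by move=> p pn /negPf np; rewrite !updpE np.
- case: (st) => bn _.
  have b0 : (4 + b.*2 == 0) = false by lia.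
  have b0' : (0 == 4 + b.*2) = false by lia.
  pose t1 := Pst (pi t) (updp (updp (pl t) 0 [::]) (4 + b.*2) (rvec nf (rg s) :: pl t (4 + b.*2))).
  apply: (det (Pst (pi t) (updp (pl t1) 0 [:: zerov]))) => //.
    by move=> s1 s2 [_ ->] [_ ->].
  apply: (@sem_seq _ _ _ _ _ _ t1); rewrite /sem /= /ev /= !addn0.
    exists (rvec nf (rg s)); split=> //=; [by rewrite !updpE b0' h2|by rewrite !updpE !eqxx|].
    by move=> p pn /negPf np /negPf np2; rewrite !updpE np np2.
  split=> //=; try by rewrite !updpE b0'.
  by move=> p pn /negPf np; rewrite !updpE np.
- case: st => l1 [v [l2 [bn eb ->]]].
  have b0 : (4 + b.*2 == 0) = false by lia.
  have b0' : (0 == 4 + b.*2) = false by lia.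
  have b2 : (4 + b.*2 == 2) = false by lia.
  pose t1 := Pst (pi t) (updp (updp (pl t) 0 [::]) 2 (rvec nf (rg s) :: pl t 2)).
  exists (Pst (pi t) (updp (updp (pl t1) (4 + b.*2) (l1 ++ l2)) 0 [:: v])); split.
    apply: (@sem_seq _ _ _ _ _ _ t1); rewrite /sem /= /ev /= !addn0.
      exists (rvec nf (rg s)); split=> //=; [by rewrite h2|].
      by move=> p pn /negPf np /negPf np2; rewrite !updpE np np2.
    exists v; split=> //=.
    + by rewrite !updpE eqxx b0 b2 (permPl (h4 _ bn)) eb -cat1s perm_catCA.
    + by move=> p pn /negPf np /negPf np2; rewrite !updpE np np2.
  have sv : size v = nf by apply: (h5 b); rewrite eb mem_cat mem_head orbT.
  split=> //=.
  + by rewrite rvec_setv.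
  + move=> p pn op; rewrite !updpE /setv op -h3 //.
    have [-> [-> ->]] : (p == 0) = false /\ (p == 2) = false /\ (p == 4 + b.*2) = false.
      by split; [|split]; apply/eqP => e; move: op; rewrite e // oddD odd_double.
    by [].
  + move=> b' bn'; rewrite !updpE /updb.
    have -> : (4 + b'.*2 == 0) = false by lia.
    have -> : (4 + b'.*2 == 2) = false by lia.
    by rewrite eqn_add2l -!muln2 eqn_pmul2r // !muln2; case: eqP => // _; apply: h4.
  + move=> b' w; rewrite /updb; case: eqP => [_|_]; last exact: h5.
    by move=> vi; apply: (h5 b); rewrite eb mem_cat in_cons; move: vi; rewrite mem_cat => /orP[->|->] //; rewrite !orbT.
- pose t1 := Pst (pi t) (updp (updp (pl t) 0 [::]) 2 (rvec nf (rg s) :: pl t 2)).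
  apply: (det (Pst (pi t) (updp (pl t1) 0 [:: zerov]))) => //.
    by move=> s1 s2 -> ->.
  apply: (@sem_seq _ _ _ _ _ _ t1); rewrite /sem /= /ev /= !addn0.
    exists (rvec nf (rg s)); split=> //=; [by rewrite h2|].
    by move=> p pn /negPf np /negPf np2; rewrite !updpE np np2.
  split=> //=.
  by move=> p pn /negPf np; rewrite !updpE np.
- case: (st) => j cs _; apply: (det (Pst j (pl t))) => //.
    move=> s1 s2 [j1 c1 ->] [j2 c2 ->]; congr Rst.
    by move: c1 c2; case: (c) => /= [-> ->|[_ ->] [_ ->]|[_ ->] [_ ->]|[_ ->] [_ ->]|[_ ->] [_ ->]].
  by rewrite /sem /= h1.
Qed.

Lemma prog_sound p s t t' : prep s t -> sem pstep (bindp pimpl p) t t' ->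
  exists s', sem (rstep k nf) p s s' /\ prep s' t'.
Proof. by apply: sem_bind_sound => a s0 t0 t0'; exact: pimpl_sound. Qed.

Lemma prog_complete p s s' t : prep s t -> sem (rstep k nf) p s s' ->
  exists t', sem pstep (bindp pimpl p) t t' /\ prep s' t'.
Proof. by apply: sem_bind_complete => a s0 s0' t0; exact: pimpl_complete. Qed.

End Places.

(** * The whole program *)

Definition VO : ref := (13, false).

(* The registers of the middle phase initially hold the code [N] of the input and
   end up returned to the budget, from which the target demands [N] units in [VO]:
   exactly the budget computed by [FWD] is left to [BWD] if nothing was lost. *)
Definition MAIN (nr : nat) (P : prog matom) : prog ratom :=
  anyindex ;; ctrl CTop ;; inc VC ;; inc VX ;; FWD ;; bindp (mimpl nr) P ;;
  mv VX VO ;; BWD ;; anyindex ;; ctrl CTop ;; dec VC ;; dec VX ;; ctrl CZero.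

(** Variable 29 is [17 + 4 * 3], where 3 is [rR 0], the right half of the input tape. *)
Definition rinit (N : nat) : rst :=
  Rst 0 (fun v => if v == 29 then N else 0) (fun=> [::]).

Section Main.
Variables (Sig : finType) (M : tm Sig void) (w : seq Sig) (k nf : nat).
Hypothesis nf_k : 2 * k + 12 <= nf.
Hypothesis nf_r : 2 * nregs M + 12 <= nf.
Local Notation rsem := (sem (rstep k nf)).
Local Notation N := (Nw M w).

Lemma mass_minit : mass (nregs M) (minit M w) = N.
Proof.
have r0 : rR 0 < nregs M by rewrite /nregs /rR; lia.
rewrite /mass (bigD1 (Ordinal r0)) //= /minit eqxx big1 ?addn0 // => i ne.
by case: eqP => // e; case/eqP: ne; apply: val_inj.
Qed.

Lemma eq_mass nr m m' : (forall i, i < nr -> m i = m' i) -> mass nr m = mass nr m'.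
Proof. by move=> e; apply: eq_bigr => i _; apply: e. Qed.

Lemma midreg_mid j : midreg (17 + 4 * j).
Proof. by rewrite /midreg; apply/orP; right; rewrite addKn dvdn_mulr //; lia. Qed.

(** The [N] units required in [VO] are taken from the budget left by the simulation, whose total was
    the value reached by [FWD] plus [N]. If any unit was lost, [BWD] starts with less than that
    value, which [core_sound] excludes; so all zero tests were correct. *)
Lemma main_sound s' : rsem (MAIN (nregs M) (midP M)) (rinit N) s' -> N <= rg s' 13 ->
  exists n, halting (cstate (run M w n)) /\ accepting (cstate (run M w n)).
Proof.
case/semS=> s1 [/anyindex_sound[j jk e1]] /semS[s2 [/ctrl_s[[ej e2] b2 g2]]].
case/semS=> s3 [/(inc_s (a := 15 + 4 * k))i3] /semS[s4 [/(inc_s (a := 1))i4]].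
have [|e3 b3 g3] := i3; first by rewrite /ev e2 /= ej.
have [|e4 b4 g4] := i4; first by [].
case/semS=> s5 [fw] /semS[s6 [md]] /semS[s7 [/(mv_sound (vr := 1) (vw := 13))mv]] /semS[s8 [bw]].
case/semS=> s9 [/anyindex_sound[j9 _ e9]] /semS[s10 [/ctrl_s[[ej10 e10] b10 g10]]].
case/semS=> s11 [/(dec_s (a := 15 + 4 * k))d11] /semS[s12 [/(dec_s (a := 1))d12]].
case/ctrl_s=> _ _ g13.
have [|c8 e11 b11 g11] := d11; first by rewrite /ev e10 /= ej10.
have [|x8 e12 b12 g12] := d12; first by [].
have init v : rg s4 v = if v == 15 + 4 * k then 1 else if v == 1 then 1 else if v == 29 then N else 0.
  by rewrite g4 !g3 !g2 e1 /=; do !case: eqP => ? //; lia.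
have FI4 : FI k s4.
  apply: core_init => [i ik||b].
  - by rewrite /cc init; do !case: eqP => ? //; lia.
  - by rewrite /xx init; do !case: eqP => ? //; lia.
  - by rewrite b4 b3 b2 e1.
have FI5 := FI_fwd nf_k FI4 fw.
have fr v : midreg v -> rg s5 v = rg s4 v by move=> mr; apply: (sem_frame fw); apply: fwd_frame.
have m5 j' : rg s5 (17 + 4 * j') = minit M w j'.
  rewrite fr ?midreg_mid // init /minit /rR; do !case: eqP => ? //; lia.
pose x0 : mst := (xx s5, fun j => rg s5 (17 + 4 * j)).
have r0 : mrep s5 x0 s5 by [].
have [x' [sx [rx1 rx2 rx3 rx4]]] := mid_sound nf_r r0 md.
have [//|//|//|n [n6 e7 b7 g7]] := mv.
have nN : N <= rg s' 13 -> N <= n.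
  rewrite g13 g12 !g11 !g10 e9 /=.
  rewrite (sem_frame bw) ?bwd_frame // g7 /= rx4 // ?fr // init; case: eqP => //; lia.
move/nN=> {}nN.
have [le ex] := mid_lossless sx.
have ms0 : msum (nregs M) x0 = xx s5 + N.
  by rewrite /msum /= -mass_minit; congr addn; apply: eq_mass => i _; apply: m5.
case: (leqP (msum (nregs M) x0) (msum (nregs M) x')) => [/ex ex'|lt].
  by apply: midP_sound ex' => i; apply: m5.
exfalso; apply: (core_sound nf_k FI5 _ _ _ _ bw).
- by rewrite b7 rx3.
- by rewrite b7 rx3.
- move=> i ik; rewrite /cc g7; case: eqP => [?|_]; first by lia.
  case: eqP => [?|_]; first by lia.
  by apply: rx4; [apply/eqP; lia|move=> j'; apply/eqP; lia].
- rewrite /xx g7 eqxx; rewrite ms0 in lt; move: rx1 n6; rewrite /xx => -> n6.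
  move: lt; rewrite /msum /xx; lia.
- by move: c8; rewrite g10 e9.
- by move: x8; rewrite g11 !g10 e9 /xx /=.
Qed.

(** The forward half of [core_level] provides the budget [V0 k], an exact simulation returns it
    together with the [N] input units, and after [N] units have gone to [VO] the backward half
    applies. *)
Lemma main_complete n U : halting (cstate (run M w n)) -> accepting (cstate (run M w n)) ->
  base M ^ (size w + 3 * n + 2) <= U -> #|{: state M}| <= U -> (nregs M + 4) * U <= V0 k ->
  exists s', [/\ rsem (MAIN (nregs M) (midP M)) (rinit N) s', rg s' 13 = N & iv s' = 0].
Proof.
move=> hn an Ub Us UV.
have [s1 [a1 e1]] : exists s1, rsem anyindex (rinit N) s1 /\ s1 = Rst k (rg (rinit N)) (bg (rinit N)).
  by eexists; split; [apply: (@anyindex_complete k nf (rinit N) k)|].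
have [|s2 [a2 e2 b2 g2]] := @ctrl_c k nf CTop s1 k; first by rewrite e1.
have [||s3 [a3 e3 b3 g3]] := @inc_c k nf VC s2 (15 + 4 * k); [by rewrite /ev e2|lia|].
have [||s4 [a4 e4 b4 g4]] := @inc_c k nf VX s3 1; [by []|lia|].
have init v : rg s4 v = if v == 15 + 4 * k then 1 else if v == 1 then 1 else if v == 29 then N else 0.
  by rewrite g4 !g3 !g2 e1 /=; do !case: eqP => ? //; lia.
have c4 : core k (add (fun=> 0) k 1) 1 [::] s4.
  split; last by rewrite b4 b3 b2 e1.
  - by move=> i ik; rewrite /cc init /add updE; do !case: eqP => ? //; lia.
  - by rewrite /xx init; do !case: eqP => ? //; lia.
have [S [s5 [fw [c5 x5 S5] f5 back]]] := core_level nf_k (leqnn k) (ltn0Sn 0) (fun _ _ => erefl) c4.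
have fr v : midreg v -> rg s5 v = rg s4 v by move=> mr; apply: (sem_frame fw); apply: fwd_frame.
have m5 j' : rg s5 (17 + 4 * j') = minit M w j'.
  rewrite fr ?midreg_mid // init /minit /rR; do !case: eqP => ? //; lia.
pose x0 : mst := (xx s5, fun j => rg s5 (17 + 4 * j)).
have r0 : mrep s5 x0 s5 by [].
(* The input number is not borrowed from the budget, so it adds to the conserved total. *)
have ms : mstate (nregs M) (V0 k + N) (minit M w) x0.
  split=> [i _|]; first exact: m5.
  by rewrite /msum /= x5 -mass_minit; congr addn; apply: eq_mass => i _; apply: m5.
have [x' [sx [z' s']]] := midP_complete ms hn an Ub Us (leq_trans UV (leq_addr _ _)).
have x'1 : x'.1 = V0 k + N.
  by rewrite -s' /msum (@eq_mass _ _ (fun=> 0)) // /mass big1 // addn0.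
have [s6 [md [rx1 rx2 rx3 rx4]]] := mid_complete k nf_r r0 sx.
have [//|//|//| | | |g7 [mv7 e7]] := @mv_complete k nf VX VO s6 N 1 13; [lia|lia| |].
  by rewrite -/(xx s6) rx1 x'1 leq_addl.
set s7 := Rst _ _ _ in mv7.
have [|s8 [bw [c8 x8 S8] f8]] := back [::] s7.
  split; last by rewrite /= rx3 S5.
  - move=> i ik; rewrite /cc /= e7; case: eqP => [?|_]; first by lia.
    case: eqP => [?|_]; first by lia.
    rewrite rx4; [exact: c5|by apply/eqP; lia|by move=> j'; apply/eqP; lia].
  - by rewrite /xx /= e7 eqxx -/(xx s6) rx1 x'1 addnK.
have [s9 [a9 e9]] : exists s9, rsem anyindex s8 s9 /\ s9 = Rst k (rg s8) (bg s8).
  by eexists; split; [apply: (@anyindex_complete k nf s8 k)|].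
have [|s10 [a10 e10 b10 g10]] := @ctrl_c k nf CTop s9 k; first by rewrite e9.
have [|||s11 [a11 e11 b11 g11]] := @dec_c k nf VC s10 (15 + 4 * k); [by rewrite /ev e10|lia| |].
  by rewrite g10 e9 -[rg _ _]/(cc s8 k) c8 // /add updE eqxx.
have [|||s12 [a12 e12 b12 g12]] := @dec_c k nf VX s11 1; [by []|lia| |].
  by rewrite g11 !g10 e9 /= -[rg s8 1]/(xx s8) x8.
have [|s13 [a13 e13 b13 g13]] := @ctrl_c k nf CZero s12 0; first by [].
exists s13; split=> //; last first.
  rewrite g13 g12 !g11 !g10 e9 /= (sem_frame bw) ?bwd_frame // /= e7 /= rx4 //.
  by rewrite fr // init; do !case: eqP => ? //; lia.
by do 12 (apply: sem_seq; first eassumption).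
Qed.

End Main.

(** * A numerical presentation of the object system *)

(** A token reduced to its place number and the list of its inner marking; firing can then be
    studied without dependent types and independently of the system that realises it. *)
Definition tk : Type := (nat * seq nat)%type.

Definition oseq (T : Type) (o : option T) : seq T := if o is Some x then [:: x] else [::].

Lemma perm_map_inv (S T : eqType) (f : S -> T) s t : perm_eq (map f s) t ->
  exists2 s', perm_eq s s' & map f s' = t.
Proof.
elim: t s => [|y t IH] s.
  by move=> /perm_size; case: s => // _; exists [::].
move=> pe; have : y \in map f s by rewrite (perm_mem pe) mem_head.
case/mapP=> x xs ey; have px := perm_to_rem xs.
have [s' ps es] : exists2 s', perm_eq (rem x s) s' & map f s' = t.
  by apply: IH; rewrite -(perm_cons y) ey -map_cons -(permPl (perm_map f px)) -ey.
by exists (x :: s'); [rewrite (permPl px) perm_cons|rewrite /= es ey].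
Qed.

Lemma In_cat T (x : T) s1 s2 : List.In x (s1 ++ s2) <-> List.In x s1 \/ List.In x s2.
Proof. exact: List.in_app_iff. Qed.

Lemma In_nth T d (s : seq T) j : j < size s -> List.In (nth d s j) s.
Proof. by elim: s j => // x s IH [|j] lt; [left|right; apply: IH]. Qed.

Lemma In_index T d (s : seq T) x : List.In x s -> exists2 j, j < size s & nth d s j = x.
Proof. by elim: s => // y s IH [->|/IH[j jl jn]]; [exists 0|exists j.+1]. Qed.

Section Numeric.
Variables (k nf NQ : nat) (tbl : seq (edge patom)).
Hypothesis nf_big : 12 <= nf.
Hypothesis tbl_range : forall q l q', List.In (q, l, q') tbl -> 0 < q < NQ /\ 0 < q' < NQ.

Local Notation np := nf.*2.

(** The loop index is part of the control place, so guards on the index are settled when the table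
    of events is generated and need no test by the net. *)
Definition ctlp (q i : nat) : nat := np + q * k.+1 + i.
Definition npl : nat := np + NQ * k.+1.

Definition lok (l : option patom) (i : nat) : bool :=
  match l with
  | None => true
  | Some (PInc r) | Some (PDec r) | Some (PNew r) => ev i r < np
  | Some (PMv r w) => [&& ev i r < np, ev i w < np & ev i r != ev i w]
  | Some (PCtl CZero) => true
  | Some (PCtl CInc) => i < k
  | Some (PCtl CDec) => 0 < i
  | Some (PCtl CTop) => i == k
  | Some (PCtl CBot) => i == 0
  end.

Definition lnxt (l : option patom) (i : nat) : nat :=
  match l with
  | Some (PCtl CZero) => 0
  | Some (PCtl CInc) => i.+1
  | Some (PCtl CDec) => i.-1
  | _ => i
  end.

Definition ltake (l : option patom) (i : nat) : option nat :=
  match l with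
  | Some (PInc r) | Some (PDec r) => Some (vplace (ev i r))
  | Some (PMv r _) => Some (ev i r)
  | _ => None
  end.

Definition lput (l : option patom) (i : nat) : option nat :=
  match l with
  | Some (PInc r) | Some (PDec r) => Some (vplace (ev i r))
  | Some (PMv _ r) | Some (PNew r) => Some (ev i r)
  | _ => None
  end.

Definition lfld (l : option patom) (i : nat) : option (bool * nat) :=
  match l with
  | Some (PInc r) => Some (true, vfield (ev i r))
  | Some (PDec r) => Some (false, vfield (ev i r))
  | _ => None
  end.

Definition EV : seq (edge patom * nat) := [seq (e, i) | e <- tbl, i <- iota 0 k.+1].

(* A template whose guard fails at an index is instantiated in the control state
   0, which is never reached. *)
Definition eok (x : edge patom * nat) : bool := lok x.1.1.2 x.2.
Definition esrc (x : edge patom * nat) : nat := ctlp (if eok x then x.1.1.1 else 0) x.2.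
Definition edst (x : edge patom * nat) : nat :=
  if eok x then ctlp x.1.2 (lnxt x.1.1.2 x.2) else ctlp 0 x.2.
Definition etake (x : edge patom * nat) : seq nat :=
  if eok x then oseq (ltake x.1.1.2 x.2) else [::].
Definition eput (x : edge patom * nat) : seq nat :=
  if eok x then oseq (lput x.1.1.2 x.2) else [::].
Definition efld (b : bool) (x : edge patom * nat) (q : nat) : nat :=
  eok x && (lfld x.1.1.2 x.2 == Some (b, q)).

Lemma In_EV e i : List.In (e, i) EV <-> List.In e tbl /\ i <= k.
Proof.
have inm f (s : seq nat) : List.In (e, i) [seq (f, j) | j <- s] <-> f = e /\ i \in s.
  elim: s => [|j s IH]; first by split=> [|[]].
  rewrite in_cons; split=> [[[<- <-]|/IH[-> ->]]|[fe /orP[/eqP->|im]]]; rewrite ?eqxx ?orbT //.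
    by left; rewrite fe.
  by right; apply/IH.
rewrite /EV; elim: (tbl) => [|f t IH]; first by split=> [|[]].
rewrite allpairs_cons; split.
  case/In_cat=> [/inm[<-]|/IH[? ?]]; last by split=> //; right.
  by rewrite mem_iota => /andP[_ ik]; split; [left|].
move=> [[->|ie] ik]; apply/In_cat; [left|by right; apply/IH].
by apply/inm; rewrite mem_iota.
Qed.

Definition wft (y : tk) : bool :=
  (y.1 < npl) && (size y.2 == if y.1 < np then nf else 0).

Definition cont (l : seq tk) (q : nat) : nat := \sum_(y <- l | y.1 < np) nth 0 y.2 q.

(** The firing rule chooses the produced inner markings freely, subject only to the totals; for
    lists this freedom must be restricted to markings of the right length, whence the condition on
    [rho]. *)
Definition fires (x : edge patom * nat) (la rho : seq tk) : Prop :=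
  [/\ perm_eq (map fst la) (esrc x :: etake x), perm_eq (map fst rho) (edst x :: eput x),
      all wft rho &
      forall q, q < nf -> efld false x q <= cont la q /\
        cont rho q = cont la q - efld false x q + efld true x q].

Definition nfire (mu mu' : seq tk) : Prop := exists x la rho rest,
  [/\ List.In x EV, perm_eq mu (la ++ rest), perm_eq mu' (rho ++ rest) & fires x la rho].

Definition at_ (p : nat) (mu : seq tk) : seq (seq nat) := [seq y.2 | y <- mu & y.1 == p].
Definition ctls (mu : seq tk) : seq tk := [seq y <- mu | np <= y.1].

Definition crep (c : nat * pst) (mu : seq tk) : Prop :=
  [/\ pi c.2 <= k, 0 < c.1 < NQ, all wft mu, ctls mu = [:: (ctlp c.1 (pi c.2), [::])] &
      forall p, p < np -> perm_eq (at_ p mu) (pl c.2 p)].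

Lemma perm_at p mu mu' : perm_eq mu mu' -> perm_eq (at_ p mu) (at_ p mu').
Proof. by move=> pe; apply: perm_map; apply: perm_filter. Qed.

Lemma perm_ctls mu mu' : perm_eq mu mu' -> perm_eq (ctls mu) (ctls mu').
Proof. exact: perm_filter. Qed.

Lemma at_cat p mu mu' : at_ p (mu ++ mu') = at_ p mu ++ at_ p mu'.
Proof. by rewrite /at_ filter_cat map_cat. Qed.

Lemma ctls_cat mu mu' : ctls (mu ++ mu') = ctls mu ++ ctls mu'.
Proof. exact: filter_cat. Qed.

Lemma perm_cont la la' q : perm_eq la la' -> cont la q = cont la' q.
Proof. exact: perm_big. Qed.

Lemma ctlp_inj q i q' i' : i <= k -> i' <= k -> ctlp q i = ctlp q' i' -> q = q' /\ i = i'.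
Proof.
move=> ik ik' /eqP; rewrite /ctlp -!addnA eqn_add2l => /eqP e.
have eq : q = q'.
  by move: (congr1 (divn^~ k.+1) e); rewrite !divnMDl // !divn_small ?addn0.
by split=> //; move: e; rewrite eq => /addnI.
Qed.

Lemma ctlp_np q i : np <= ctlp q i.
Proof. by rewrite /ctlp -addnA leq_addr. Qed.

Lemma ctlp_npl q i : q < NQ -> i <= k -> ctlp q i < npl.
Proof. by move=> qn ik; rewrite /ctlp /npl -addnA ltn_add2l; nia. Qed.

Lemma vplace_np v : v < np -> vplace v < np.
Proof. by rewrite /vplace; case: ifP => // _ _; rewrite double_gt0; lia. Qed.

Lemma vfield_nf v : v < np -> vfield v < nf.
Proof. by rewrite /vfield; case: ifP => // _ vn; [lia|rewrite ltn_half_double]. Qed.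

Lemma lok_take l i p : lok l i -> ltake l i = Some p -> p < np.
Proof.
case: l => [[r|r|r w|r|c]|] //= ok [<-] //; try exact: vplace_np.
by case/and3P: ok.
Qed.

Lemma lok_put l i p : lok l i -> lput l i = Some p -> p < np.
Proof.
case: l => [[r|r|r w|r|c]|] //= ok [<-] //; try exact: vplace_np.
by case/and3P: ok.
Qed.

Lemma lok_nxt l i : lok l i -> i <= k -> lnxt l i <= k.
Proof. by case: l => [[r|r|r w|r|[]]|] //=; lia. Qed.

Lemma NQ_gt0 q l q' : List.In (q, l, q') tbl -> 0 < NQ.
Proof. by case/tbl_range; lia. Qed.

Lemma esrc_npl x : List.In x EV -> esrc x < npl.
Proof.
case: x => [[[q l] q'] i] /In_EV[ie ik]; apply: ctlp_npl => //=.
by case: ifP => _; [have [] := tbl_range ie; lia|exact: NQ_gt0 ie].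
Qed.

Lemma edst_npl x : List.In x EV -> edst x < npl.
Proof.
case: x => [[[q l] q'] i] /In_EV[ie ik]; rewrite /edst; case: ifP => ok; apply: ctlp_npl => //=.
- by have [] := tbl_range ie; lia.
- exact: lok_nxt.
- exact: NQ_gt0 ie.
Qed.

Lemma etake_np x : all (fun p => p < np) (etake x).
Proof.
rewrite /etake; case: ifP => // ok; case e: ltake => [p|] //=.
by rewrite (lok_take ok e).
Qed.

Lemma eput_np x : all (fun p => p < np) (eput x).
Proof.
rewrite /eput; case: ifP => // ok; case e: lput => [p|] //=.
by rewrite (lok_put ok e).
Qed.

Lemma ctls_low la : all (fun p => p < np) (map fst la) -> ctls la = [::].
Proof.
rewrite all_map => al; apply/eqP; rewrite -size_eq0 size_filter -leqn0 leqNgt -has_count.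
by apply/hasPn => y /(allP al) /=; rewrite -ltnNge.
Qed.

Lemma cont_ctl p u la q : np <= p -> cont ((p, u) :: la) q = cont la q.
Proof. by move=> pn; rewrite /cont big_cons ltnNge pn. Qed.

Lemma cont1 p u q : p < np -> cont [:: (p, u)] q = nth 0 u q.
Proof. by move=> pn; rewrite /cont big_cons pn big_nil addn0. Qed.

Lemma efldE b x q : eok x -> efld b x q = (lfld x.1.1.2 x.2 == Some (b, q)) :> nat.
Proof. by rewrite /efld => ->. Qed.

(** Each event takes at most one record and puts at most one. The condition on totals then
    determines the produced inner marking, and no content can be redistributed between tokens. *)
Lemma nfire_sound c mu mu' : crep c mu -> nfire mu mu' ->
  exists c', gstep (pstep k nf) tbl c c' /\ crep c' mu'.
Proof.
case: c => [q t] [/= tk_ q0 wf ct at_t] [x [la0 [rho0 [rest [xEV pm0 pm0' [pl0 pr0 wr0 ct0]]]]]].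
have [la pla ela] := perm_map_inv pl0; have [rho prho erho] := perm_map_inv pr0.
have pm : perm_eq mu (la ++ rest) by rewrite (permPl pm0) perm_cat2r.
have pm' : perm_eq mu' (rho ++ rest) by rewrite (permPl pm0') perm_cat2r.
have wr : all wft rho by rewrite -(perm_all _ prho).
have {}ct0 f : f < nf -> efld false x f <= cont la f /\
    cont rho f = cont la f - efld false x f + efld true x f.
  by rewrite -(perm_cont f pla) -(perm_cont f prho); apply: ct0.
move=> {pm0 pm0' pl0 pr0 wr0 pla prho la0 rho0}.
case: la ela pm ct0 => // -[s0 u] la [es ela] pm ct0.
case: rho erho wr pm' ct0 => // -[d0 u'] rho [ed erho] wr pm' ct0.
have wmu : all wft (((s0, u) :: la) ++ rest) by rewrite -(perm_all _ pm).
have lac : ctls la = [::] by apply: ctls_low; rewrite ela etake_np.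
have rhoc : ctls rho = [::] by apply: ctls_low; rewrite erho eput_np.
have s0n : np <= s0 by rewrite es ctlp_np.
have d0n : np <= d0 by rewrite ed /edst; case: ifP => _; apply: ctlp_np.
have : perm_eq (ctls mu) ((s0, u) :: ctls rest).
  by rewrite (permPl (perm_ctls pm)) ctls_cat {1}/ctls /= s0n -/(ctls la) lac.
rewrite ct => /perm1_cons[[e1 e2] cr].
case: x xEV es ela ed erho ct0 => [[[q1 l] q1'] i] /In_EV[ie ik] es ela ed erho ct0.
(* An event whose guard fails starts in control state 0, whereas the present state is positive. *)
have ok : eok ((q1, l, q1'), i).
  apply/negP => /negP/negPf nok; move: e1; rewrite es /esrc nok /= => /(ctlp_inj tk_ ik)[e0 _].
  by rewrite e0 in q0.
have [eq ei] : q = q1 /\ pi t = i by apply: ctlp_inj => //; rewrite e1 es /esrc ok.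
subst q1 i; rewrite /edst ok /= in ed; rewrite /etake ok /= in ela; rewrite /eput ok /= in erho.
have {}ct0 f : f < nf -> (lfld l (pi t) == Some (false, f)) <= cont la f /\
    cont rho f = cont la f - (lfld l (pi t) == Some (false, f)) + (lfld l (pi t) == Some (true, f)).
  by move=> fn; have := ct0 f fn; rewrite !efldE // !cont_ctl.
have u'0 : u' = [::].
  move: wr => /= /andP[/andP[_ /=]]; rewrite ltnNge d0n /= size_eq0 => /eqP ->.
  by [].
have wf' : all wft mu'.
  rewrite (perm_all _ pm') all_cat wr /=.
  by move: wmu; rewrite all_cat => /andP[].
have ok' : lok l (pi t) := ok.
have nx : lnxt l (pi t) <= k by apply: lok_nxt.
have [_ q1n] := tbl_range ie.
have cr' t' : pi t' = lnxt l (pi t) -> (forall p, p < np -> perm_eq (at_ p mu') (pl t' p)) ->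
    crep (q1', t') mu'.
  move=> et' ep; split=> //=; first by rewrite et'.
  apply: perm1; rewrite (permPl (perm_ctls pm')) ctls_cat {1}/ctls /= d0n.
  by rewrite -/(ctls rho) rhoc cr u'0 ed et'.
have aM p : p < np -> perm_eq (pl t p) (at_ p la ++ at_ p rest).
  move=> pn; rewrite -(permPl (at_t p pn)) (permPl (perm_at p pm)) at_cat {1}/at_ /= -/(at_ p la).
  by case: eqP => // e; rewrite e leqNgt pn in s0n.
have aM' p : p < np -> perm_eq (at_ p mu') (at_ p rho ++ at_ p rest).
  move=> pn; rewrite (permPl (perm_at p pm')) at_cat {1}/at_ /= -/(at_ p rho).
  by case: eqP => // e; rewrite e leqNgt pn in d0n.
have wr2 : all wft rho by case/andP: wr.
have rest_eq p : p < np -> at_ p la = [::] -> at_ p rho = [::] -> perm_eq (at_ p mu') (pl t p).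
  by move=> pn e3 e4; rewrite (permPl (aM' p pn)) perm_sym (permPl (aM p pn)) e3 e4.
have at1 (p p0 : nat) v : at_ p [:: (p0, v)] = if p0 == p then [:: v] else [::].
  by rewrite /at_ /=; case: eqP.
have sz (p0 : nat) v : p0 < np -> rho = [:: (p0, v)] -> size v = nf.
  by move=> pn e; move: wr2; rewrite e /= /wft /= pn andbT => /andP[_ /eqP].
have one (s : seq _) (p : nat) : map fst s = [:: p] -> exists v : seq nat, s = [:: (p, v)].
  by case: s => // -[a b] [|//] [->]; exists b.
have nil (s : seq tk) : map fst s = [::] -> s = [::] by case: s.
move=> {es ok wf}; case: l ie ed ela erho ct0 ok' nx cr' => [a|] ie ed ela erho ct0 ok' nx cr'; last first.
  have e1' := nil _ ela; have e2' := nil _ erho; exists (q1', t); split; first by exists None.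
  by apply: cr' => // p pn; apply: rest_eq; rewrite ?e1' ?e2'.
exists (q1', Pst (lnxt (Some a) (pi t)) (at_^~ mu')); split; last exact: cr'.
exists (Some a); split=> //=; move=> {cr'}.
case: a ie ed ela erho ct0 ok' nx => [r|r|r w|r|c] /= ie ed ela erho ct0 ok' nx.
- have vp := vplace_np ok'; have [v ev1] := one _ _ ela; have [v' ev2] := one _ _ erho.
  exists v, (at_ (vplace (ev (pi t) r)) rest); split=> //.
  + by rewrite (permPl (aM _ vp)) ev1 at1 eqxx.
  + rewrite (permPl (aM' _ vp)) ev2 at1 eqxx /=.
    suff -> : v' = incf nf v (vfield (ev (pi t) r)) by [].
    apply: (@eq_from_nth _ 0) => [|j]; rewrite (sz _ _ vp ev2) ?size_mkseq // => jn.
    have [_] := ct0 j jn; rewrite ev1 ev2 !cont1 // nth_mkseq // subn0 => ->.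
    by congr (_ + nat_of_bool _); apply/eqP/eqP => [[->]|->].
  + move=> p pn /negPf np'; apply: rest_eq => //; rewrite ?ev1 ?ev2 at1 eq_sym np' //.
- have vp := vplace_np ok'; have [v ev1] := one _ _ ela; have [v' ev2] := one _ _ erho.
  exists v, (at_ (vplace (ev (pi t) r)) rest); split=> //.
  + split=> //; have [+ _] := ct0 _ (vfield_nf ok'); rewrite ev1 cont1 // eqxx //.
  + by rewrite (permPl (aM _ vp)) ev1 at1 eqxx.
  + rewrite (permPl (aM' _ vp)) ev2 at1 eqxx /=.
    suff -> : v' = decf nf v (vfield (ev (pi t) r)) by [].
    apply: (@eq_from_nth _ 0) => [|j]; rewrite (sz _ _ vp ev2) ?size_mkseq // => jn.
    have [_] := ct0 j jn; rewrite ev1 ev2 !cont1 // nth_mkseq // addn0 => ->.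
    by congr (_ - nat_of_bool _); apply/eqP/eqP => [[->]|->].
  + move=> p pn /negPf np'; apply: rest_eq => //; rewrite ?ev1 ?ev2 at1 eq_sym np' //.
- case/and3P: ok' => pn qn pq; have [v ev1] := one _ _ ela; have [v' ev2] := one _ _ erho.
  have ev' : v' = v.
    have sv : size v = nf.
      move: wmu; rewrite ev1 /= => /and3P[_ /andP[_ /= /eqP->]] _.
      by rewrite pn.
    apply: (@eq_from_nth _ 0) => [|j]; rewrite (sz _ _ qn ev2) ?sv // => jn.
    by have [_] := ct0 j jn; rewrite ev1 ev2 !cont1 // subn0 addn0.
  have qp : (ev (pi t) w == ev (pi t) r) = false by rewrite eq_sym (negPf pq).
  exists v; split=> //.
  + rewrite (permPl (aM _ pn)) ev1 at1 eqxx /= perm_cons perm_sym.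
    by rewrite (permPl (aM' _ pn)) ev2 at1 qp.
  + rewrite (permPl (aM' _ qn)) ev2 at1 eqxx /= ev' perm_cons perm_sym.
    by rewrite (permPl (aM _ qn)) ev1 at1 (negPf pq).
  + move=> p pn' /negPf np' /negPf nq'; apply: rest_eq => //; rewrite ?ev1 ?ev2 at1 eq_sym ?np' ?nq' //.
- have e1' := nil _ ela; have [v' ev2] := one _ _ erho; split=> //.
  + rewrite (permPl (aM' _ ok')) ev2 at1 eqxx /=.
    have -> : v' = zerov nf.
      apply: (@eq_from_nth _ 0) => [|j]; rewrite (sz _ _ ok' ev2) ?size_nseq // => jn.
      have [_] := ct0 j jn; rewrite ev2 e1' cont1 // /cont big_nil nth_nseq jn => ->.
      by [].
    by rewrite perm_cons perm_sym (permPl (aM _ ok')) e1'.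
  + by move=> p pn /negPf np'; apply: rest_eq => //; rewrite ?e1' // ev2 at1 eq_sym np'.
- have e1' := nil _ ela; have e2' := nil _ erho; split.
    by case: (c) ok' => //= /eqP->.
  by move=> p pn; apply: rest_eq; rewrite ?e1' ?e2'.
Qed.

Lemma perm_ctl_rest c mu : crep c mu -> exists2 rest,
  perm_eq mu ((ctlp c.1 (pi c.2), [::]) :: rest) &
  ctls rest = [::] /\ forall p, p < np -> perm_eq (at_ p rest) (pl c.2 p).
Proof.
case=> _ _ _ ct at_t; have cm : (ctlp c.1 (pi c.2), [::]) \in mu.
  have : (ctlp c.1 (pi c.2), [::]) \in ctls mu by rewrite ct mem_head.
  by rewrite mem_filter => /andP[].
have pm := perm_to_rem cm; exists (rem (ctlp c.1 (pi c.2), [::]) mu) => //; split.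
  have := perm_ctls pm; rewrite ct {2}/ctls /= ctlp_np.
  by move/perm1_cons=> [_].
move=> p pn; rewrite -(permPr (at_t p pn)) perm_sym (permPl (perm_at p pm)) {1}/at_ /=.
by case: eqP => // e; have := ctlp_np c.1 (pi c.2); rewrite e leqNgt pn.
Qed.

(* The tokens [la] and [rho] are those consumed and produced besides the control
   token. *)
Lemma nfire_intro q l q' t t' mu la rho rest : List.In (q, l, q') tbl -> crep (q, t) mu ->
  lok l (pi t) -> pi t' = lnxt l (pi t) ->
  perm_eq mu ((ctlp q (pi t), [::]) :: la ++ rest) -> ctls rest = [::] ->
  map fst la = oseq (ltake l (pi t)) -> map fst rho = oseq (lput l (pi t)) -> all wft rho ->
  (forall f, f < nf -> (lfld l (pi t) == Some (false, f)) <= cont la f /\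
     cont rho f = cont la f - (lfld l (pi t) == Some (false, f)) + (lfld l (pi t) == Some (true, f))) ->
  (forall p, p < np -> perm_eq (at_ p rho ++ at_ p rest) (pl t' p)) ->
  exists mu', nfire mu mu' /\ crep (q', t') mu'.
Proof.
move=> ie [/= ik q0 wf ct at_t] ok et' pm cr ela erho wr ctn at_t'.
have [_ q'n] := tbl_range ie; have nk := lok_nxt ok ik.
have eo : eok ((q, l, q'), pi t) by [].
have wd : wft (ctlp q' (pi t'), [::]).
  by rewrite /wft /= [ctlp _ _ < np]ltnNge ctlp_np /= andbT; apply: ctlp_npl; [lia|rewrite et'].
exists ((ctlp q' (pi t'), [::]) :: rho ++ rest); split.
  exists ((q, l, q'), pi t), ((ctlp q (pi t), [::]) :: la), ((ctlp q' (pi t'), [::]) :: rho), rest.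
  split=> //; first by apply/In_EV.
  split.
  - by rewrite /= ela /esrc /etake eo.
  - by rewrite /= erho /edst /eput eo et'.
  - by rewrite /= wd.
  - by move=> f fn; rewrite !efldE // !cont_ctl ?ctlp_np //; apply: ctn.
have rhoc : ctls rho = [::].
  apply: ctls_low; rewrite erho; case e: lput => [p|] //=.
  by rewrite (lok_put ok e).
split=> //=.
- by rewrite et'.
- rewrite wd all_cat wr; move: wf; rewrite (perm_all _ pm) /= all_cat.
  by case/and3P.
- by rewrite /ctls /= ctlp_np -/(ctls _) ctls_cat rhoc cr.
- move=> p pn; rewrite -(permPr (at_t' p pn)) /at_ /=.
  by case: eqP => [e|_]; [have := ctlp_np q' (pi t'); rewrite e leqNgt pn|rewrite -/(at_ _ _) at_cat].
Qed.

Lemma take_token p x l rest : ctls rest = [::] -> perm_eq (at_ p rest) (x :: l) ->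
  exists rest', [/\ perm_eq rest ((p, x) :: rest'), ctls rest' = [::], perm_eq (at_ p rest') l &
    forall r, r != p -> perm_eq (at_ r rest') (at_ r rest)].
Proof.
move=> cr pe; have : x \in at_ p rest by rewrite (perm_mem pe) mem_head.
case/mapP=> -[p' x']; rewrite mem_filter => /andP[/= /eqP-> im] /= ex; subst x'.
have pm := perm_to_rem im; exists (rem (p, x) rest); split=> //.
- apply/eqP; rewrite -size_eq0; have := perm_size (perm_ctls pm); rewrite cr /ctls /=.
  by case: ifP => //= _ <-.
- have := perm_at p pm; rewrite (permPl pe) {1}/at_ /= eqxx /= -/(at_ p _) perm_cons perm_sym => pe'.
  exact: pe'.
- move=> r /negPf rp; rewrite (permPr (perm_at r pm)) /at_ /=.
  by rewrite eq_sym rp.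
Qed.

Lemma nfire_complete q t q' t' mu : crep (q, t) mu -> gstep (pstep k nf) tbl (q, t) (q', t') ->
  exists mu', nfire mu mu' /\ crep (q', t') mu'.
Proof.
move=> cr [l [/= ie st]]; have [rest pm [cr0 at0]] := perm_ctl_rest cr; rewrite /= in pm at0.
have at1 (p p0 : nat) v : at_ p [:: (p0, v)] = if p0 == p then [:: v] else [::].
  by rewrite /at_ /=; case: eqP.
have wf1 p v : p < np -> size v = nf -> all wft [:: (p, v)].
  by move=> pn sv; rewrite /wft /= pn sv eqxx !andbT /npl; lia.
case: l ie st => [[r|r|r w|r|c]|] ie /=.
- case=> x [l [vn ei p1 p2 p3]]; have vp := vplace_np vn.
  have [|rest' [pr cr' ap ao]] := @take_token (vplace (ev (pi t) r)) x l rest cr0; first by rewrite (permPl (at0 _ vp)).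
  apply: (nfire_intro (la := [:: (vplace (ev (pi t) r), x)])
    (rho := [:: (vplace (ev (pi t) r), incf nf x (vfield (ev (pi t) r)))]) (rest := rest') ie cr) => //.
  + by rewrite (permPl pm) perm_cons.
  + by apply: wf1; rewrite ?size_mkseq.
  + move=> f fn; rewrite !cont1 //; split=> //; rewrite nth_mkseq // subn0.
    by congr (_ + nat_of_bool _); apply/eqP/eqP => [->|[]].
  + move=> p pn; rewrite at1; case: eqP => [<-|/eqP ne].
      by rewrite perm_sym (permPl p2) /= perm_cons perm_sym.
    rewrite eq_sym in ne; by rewrite /= (permPl (ao _ ne)) (permPl (at0 _ pn)) perm_sym p3.
- case=> x [l [[vn pos] ei p1 p2 p3]]; have vp := vplace_np vn.
  have [|rest' [pr cr' ap ao]] := @take_token (vplace (ev (pi t) r)) x l rest cr0; first by rewrite (permPl (at0 _ vp)).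
  apply: (nfire_intro (la := [:: (vplace (ev (pi t) r), x)])
    (rho := [:: (vplace (ev (pi t) r), decf nf x (vfield (ev (pi t) r)))]) (rest := rest') ie cr) => //.
  + by rewrite (permPl pm) perm_cons.
  + by apply: wf1; rewrite ?size_mkseq.
  + move=> f fn; rewrite !cont1 //= addn0 nth_mkseq //.
    have -> : (Some (false, vfield (ev (pi t) r)) == Some (false, f)) = (f == vfield (ev (pi t) r)).
      by apply/eqP/eqP => [[]|->].
    by split=> //; case: eqP => // ->.
  + move=> p pn; rewrite at1; case: eqP => [<-|/eqP ne].
      by rewrite perm_sym (permPl p2) /= perm_cons perm_sym.
    rewrite eq_sym in ne; by rewrite /= (permPl (ao _ ne)) (permPl (at0 _ pn)) perm_sym p3.
- case=> x [[pn qn pq] ei p1 p2 p3].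
  have [|rest' [pr cr' ap ao]] := @take_token (ev (pi t) r) x (pl t' (ev (pi t) r)) rest cr0; first by rewrite (permPl (at0 _ pn)).
  have sx : size x = nf.
    case: cr => _ _ + _ _; rewrite (perm_all _ pm) /= (perm_all _ pr) /= => /and3P[_ /andP[_ /= /eqP->] _].
    by rewrite pn.
  have qp : ev (pi t) w != ev (pi t) r by rewrite eq_sym.
  apply: (nfire_intro (la := [:: (ev (pi t) r, x)]) (rho := [:: (ev (pi t) w, x)]) (rest := rest') ie cr) => //.
  + by rewrite /= pn qn.
  + by rewrite (permPl pm) perm_cons.
  + exact: wf1.
  + by move=> f fn; rewrite !cont1 // addn0 subn0.
  + move=> p pn'; rewrite at1; case: eqP => [<-|/eqP ne].
      by rewrite perm_sym (permPl p2) /= perm_cons perm_sym (permPl (ao _ qp)) at0.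
    case: (p =P ev (pi t) r) => [->|/eqP pr'] //=.
    by rewrite (permPl (ao _ pr')) (permPl (at0 _ pn')) perm_sym p3 // eq_sym.
- case=> pn ei p1 p2.
  apply: (nfire_intro (la := [::]) (rho := [:: (ev (pi t) r, zerov nf)]) (rest := rest) ie cr) => //.
  + by apply: wf1; rewrite ?size_nseq.
  + by move=> f fn; rewrite cont1 // /cont big_nil nth_nseq fn.
  + move=> p pn'; rewrite at1; case: eqP => [<-|/eqP ne].
      by rewrite perm_sym (permPl p1) /= perm_cons perm_sym at0.
    by rewrite /= (permPl (at0 _ pn')) perm_sym p2 // eq_sym.
- case=> cs p1.
  apply: (nfire_intro (la := [::]) (rho := [::]) (rest := rest) ie cr) => //.
  + by move: cs; case: (c) => //= [[]|[]|[->]|[->]].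
  + by move: cs; case: (c) => //= [[]|[]|[]|[]].
  + by move=> f fn; rewrite /cont big_nil.
  + by move=> p pn /=; rewrite (permPl (at0 _ pn)) perm_sym p1.
- move=> ->; apply: (nfire_intro (la := [::]) (rho := [::]) (rest := rest) ie cr) => // f fn.
  by rewrite /cont big_nil.
Qed.

Lemma nfires_sound c mu mu' : crep c mu -> star nfire mu mu' ->
  exists c', star (gstep (pstep k nf) tbl) c c' /\ crep c' mu'.
Proof.
move=> cr st; elim: st c cr => [a c cr|a b d ab _ IH c cr]; first by exists c; split=> //; apply: StarRefl.
have [c1 [s1 cr1]] := nfire_sound cr ab; have [c2 [s2 cr2]] := IH _ cr1.
by exists c2; split=> //; apply: StarStep s1 s2.
Qed.

Lemma nfires_complete c c' mu : crep c mu -> star (gstep (pstep k nf) tbl) c c' ->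
  exists mu', star nfire mu mu' /\ crep c' mu'.
Proof.
move=> cr st; elim: st mu cr => [a mu cr|[q t] [q' t'] d ab _ IH mu cr].
  by exists mu; split=> //; apply: StarRefl.
have [mu1 [s1 cr1]] := nfire_complete cr ab; have [mu2 [s2 cr2]] := IH _ cr1.
by exists mu2; split=> //; apply: StarStep s1 s2.
Qed.

End Numeric.

(** * Object systems given by their tables *)

Section Rank.
Variable T : finType.

Lemma rank_lt (x : T) : rank x < #|T|.
Proof. by rewrite /rank cardE index_mem mem_enum. Qed.

Lemma rank_inj : injective (@rank T).
Proof. by move=> x y /(congr1 (nth x (enum T))); rewrite !nth_index ?mem_enum. Qed.

Lemma rank_surj i : i < #|T| -> exists x : T, rank x = i.
Proof.
rewrite cardE => lt; have [x0 _] : exists x0 : T, true by case: (enum T) lt => // x0; exists x0.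
by exists (nth x0 (enum T) i); rewrite /rank index_uniq ?enum_uniq.
Qed.

Lemma map_rank : [seq rank x | x <- enum T] = iota 0 #|T|.
Proof.
rewrite cardE; apply: (@eq_from_nth _ 0) => [|i]; rewrite size_map ?size_iota // => lt.
case E: (enum T) lt (enum_uniq T) => [//|x0 s] lt u; rewrite -E in lt u *.
by rewrite (nth_map x0) // nth_iota // add0n /rank index_uniq.
Qed.

Lemma sum_rank1 (F : nat -> nat) j : j < #|T| -> \sum_(t : T) F (rank t) * (rank t == j) = F j.
Proof.
move=> jn; have [y ey] := rank_surj jn.
rewrite (bigD1 y) //= ey eqxx muln1 big1 ?addn0 // => t ty.
by case: eqP => [e|]; rewrite ?muln0 //; case/eqP: ty; apply: rank_inj; rewrite e.
Qed.
End Rank.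

Lemma seq_mset_cat (K : choiceType) (s1 s2 : seq K) :
  seq_mset (s1 ++ s2) = (seq_mset s1 `+` seq_mset s2)%mset.
Proof. by apply/msetP => x; rewrite msetE2 !mset_seqE count_cat. Qed.

Lemma perm_msetD (K : choiceType) (A B : {mset K}%mset) : perm_eq (A `+` B)%mset (A ++ B).
Proof. by apply/eq_seq_msetP; rewrite seq_mset_cat !seq_mset_id. Qed.

Section System.
Variables (k nf NQ : nat) (tbl : seq (edge patom)) (E : eos) (o1 : obj E).
Hypothesis nf_big : 12 <= nf.
Hypothesis tbl_range : forall q l q', List.In (q, l, q') tbl -> 0 < q < NQ /\ 0 < q' < NQ.

Local Notation np := nf.*2.
Local Notation npl_ := (npl k nf NQ).
Local Notation EV_ := (EV k tbl).
Local Notation wft_ := (wft k nf NQ).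
Local Notation nfire_ := (nfire k nf NQ tbl).

Definition fits (e : event E) (x : edge patom * nat) : Prop :=
  [/\ forall p, pre e.1 p = count_mem (rank p) (esrc k nf x :: etake k nf x),
      forall p, post e.1 p = count_mem (rank p) (edst k nf x :: eput k nf x) &
      forall t : trans (onet o1), e.2 o1 t =
        if rank t < nf then efld k nf true x (rank t) else efld k nf false x (rank t - nf)].

(** What the word of an instance reveals about a system. In the net [o1] of records each field has
    one transition that fills it and one that empties it; all other object nets are without places,
    so the control tokens have no content. *)
Record presents : Prop := Presents {
  pr_place : #|{: place (sysnet E)}| = npl_;
  pr_fields : #|{: place (onet o1)}| = nf;
  pr_trans : #|{: trans (onet o1)}| = np;
  pr_opre : forall (t : trans (onet o1)) q, pre t q = (rank t == nf + rank q);
  pr_opost : forall (t : trans (onet o1)) q, post t q = (rank t == rank q);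
  pr_other : forall N : obj E, N != o1 -> #|{: place (onet N)}| = 0;
  pr_typ : forall p : place (sysnet E), (typ p == o1) = (rank p < np);
  pr_event : forall e, e \in events E -> exists2 x, List.In x EV_ & fits e x;
  pr_event' : forall x, List.In x EV_ -> exists2 e, e \in events E & fits e x }.

Hypothesis pr : presents.

Definition cd (x : token E) : tk :=
  (rank (tag x), [seq tagged x q | q <- enum (place (onet (typ (tag x))))]).

Lemma pr_card (p : place (sysnet E)) :
  #|{: place (onet (typ p))}| = if rank p < np then nf else 0.
Proof.
rewrite -(pr_typ pr); case: eqP => [->|/eqP ne]; first exact: pr_fields.
exact: pr_other.
Qed.

Lemma cd_wf x : wft_ (cd x).
Proof.
case: x => p M; rewrite /cd /wft /= size_map -cardE pr_card eqxx andbT.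
by rewrite -(pr_place pr) rank_lt.
Qed.

Lemma cd_nth (x : token E) (q : place (onet (typ (tag x)))) : nth 0 (cd x).2 (rank q) = tagged x q.
Proof.
by rewrite /cd /= (nth_map q) ?nth_index ?mem_enum // index_mem mem_enum.
Qed.

Lemma cd_surj y : wft_ y -> exists x, cd x = y.
Proof.
case: y => p v /andP[/= pn /eqP sv]; rewrite -(pr_place pr) in pn.
have [P eP] := rank_surj pn; subst p; rewrite -pr_card in sv.
exists (existT _ P [ffun q => nth 0 v (rank q)]); rewrite /cd /=; congr pair.
apply: (@eq_from_nth _ 0) => [|i]; rewrite size_map -cardE // => lt.
have [q eq] := rank_surj lt.
by rewrite -eq (nth_map q) ?index_mem ?mem_enum // nth_index ?mem_enum // ffunE.
Qed.

Lemma cd_surjs l : all wft_ l -> exists s, map cd s = l.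
Proof.
elim: l => [|y l IH] /=; first by exists [::].
by case/andP=> /cd_surj[x <-] /IH[s <-]; exists (x :: s).
Qed.

Lemma Pi1E (mu : nmarking E) p : Pi1 mu p = count_mem (rank p) (map fst (map cd mu)).
Proof.
rewrite /Pi1 sum1_count -map_comp count_map; apply: eq_count => x /=.
by rewrite (inj_eq (@rank_inj _)).
Qed.

Lemma innerE (N : obj E) (q : place (onet N)) x : typ (tag x) = N ->
  inner q x = nth 0 (cd x).2 (rank q).
Proof.
case: x => p M /= e; subst N; have /= -> := @cd_nth (existT _ p M) q.
by rewrite /inner /untag; case: eqP => //= e; rewrite (eq_axiomK e).
Qed.

Lemma Pi2E (mu : nmarking E) (q : place (onet o1)) : Pi2 mu q = cont nf (map cd mu) (rank q).
Proof.
rewrite /Pi2 /cont big_map; apply: eq_big => x /=; first by rewrite (pr_typ pr).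
by move/eqP=> e; apply: innerE.
Qed.

Lemma pre_msE e x (q : place (onet o1)) : fits e x -> pre_ms (e.2 o1) q = efld k nf false x (rank q).
Proof.
case=> _ _ th; have qn := rank_lt q; rewrite (pr_fields pr) in qn.
pose F i := if i < nf then efld k nf true x i else efld k nf false x (i - nf).
have -> : pre_ms (e.2 o1) q = \sum_(t : trans (onet o1)) F (rank t) * (rank t == nf + rank q).
  by apply: eq_bigr => t _; rewrite th (pr_opre pr).
rewrite sum_rank1 ?(pr_trans pr); last by lia.
by rewrite /F addKn ltnNge leq_addr.
Qed.

Lemma post_msE e x (q : place (onet o1)) : fits e x -> post_ms (e.2 o1) q = efld k nf true x (rank q).
Proof.
case=> _ _ th; have qn := rank_lt q; rewrite (pr_fields pr) in qn.
pose F i := if i < nf then efld k nf true x i else efld k nf false x (i - nf).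
have -> : post_ms (e.2 o1) q = \sum_(t : trans (onet o1)) F (rank t) * (rank t == rank q).
  by apply: eq_bigr => t _; rewrite th (pr_opost pr).
rewrite sum_rank1 ?(pr_trans pr); last by lia.
by rewrite /F qn.
Qed.

Lemma count_perm s t : all (fun p => p < npl_) s -> all (fun p => p < npl_) t ->
  (forall p : place (sysnet E), count_mem (rank p) s = count_mem (rank p) t) -> perm_eq s t.
Proof.
move=> sn tn h; apply/allP => p; rewrite mem_cat => pst.
have pn : p < npl_ by case/orP: pst => [/(allP sn)|/(allP tn)].
rewrite -(pr_place pr) in pn; have [P <-] := rank_surj pn.
by apply/eqP; apply: h.
Qed.

Lemma cd_fst_npl s : all (fun p => p < npl_) (map fst (map cd s)).
Proof. by rewrite all_map; apply/allP => y /mapP[x _ ->]; case/andP: (cd_wf x). Qed.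

Lemma lt_np_npl p : p < np -> p < npl_.
Proof. by rewrite /npl; lia. Qed.

Lemma all_wf s : all wft_ (map cd s).
Proof. by rewrite all_map; apply/allP => x _; apply: cd_wf. Qed.

Lemma enabled_fires e x mu la rho : List.In x EV_ -> fits e x -> enabled e mu la rho ->
  fires k nf NQ x (map cd la) (map cd rho).
Proof.
move=> xE ft [_ h1 h2 h3]; split.
- apply: count_perm; first exact: cd_fst_npl.
    rewrite /= (esrc_npl nf_big tbl_range xE); apply: sub_all (etake_np k nf_big x); exact: lt_np_npl.
  by move=> p; rewrite -Pi1E h1; case: ft.
- apply: count_perm; first exact: cd_fst_npl.
    rewrite /= (edst_npl nf_big tbl_range xE); apply: sub_all (eput_np k nf_big x); exact: lt_np_npl.
  by move=> p; rewrite -Pi1E h2; case: ft.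
- exact: all_wf.
- move=> q qn; have [|Q <-] := @rank_surj (place (onet o1)) q; first by rewrite (pr_fields pr).
  by rewrite -!Pi2E -(pre_msE _ ft) -(post_msE _ ft).
Qed.

Lemma fires_enabled e x (mu la rho : nmarking E) : fits e x -> (la `<=` mu)%mset ->
  fires k nf NQ x (map cd la) (map cd rho) -> enabled e mu la rho.
Proof.
move=> ft le [h1 h2 _ h3]; split=> //.
- by move=> p; rewrite Pi1E (permP h1); case: ft.
- by move=> p; rewrite Pi1E (permP h2); case: ft.
- move=> N q; case: (N =P o1) => [e1|/eqP ne]; last first.
    by have := rank_lt q; rewrite (pr_other pr ne).
  subst N; rewrite !Pi2E (pre_msE _ ft) (post_msE _ ft); apply: h3.
  by rewrite -(pr_fields pr) rank_lt.
Qed.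

Lemma fire_nfire mu mu' : fire mu mu' -> nfire_ (map cd mu) (map cd mu').
Proof.
case=> e [la [rho [ev en ->]]]; have [x xE ft] := pr_event pr ev.
have [le _ _ _] := en.
exists x, (map cd la), (map cd rho), (map cd (mu `\` la)%mset); split=> //.
- rewrite -map_cat; apply: perm_map; rewrite -(permPr (perm_msetD _ _)).
  by rewrite msetBDKC.
- by rewrite -map_cat; apply: perm_map; rewrite (permPl (perm_msetD _ _)) perm_catC.
- exact: enabled_fires ft en.
Qed.

Lemma nfire_fire (mu : nmarking E) nu : nfire_ (map cd mu) nu ->
  exists2 mu' : nmarking E, fire mu mu' & perm_eq (map cd mu') nu.
Proof.
case=> x [la [rho [rest [xE pm pn fi]]]].
have [e ev ft] := pr_event' pr xE.
have [s ps es] := perm_map_inv pm; have [h1 h2 h3 h4] := fi.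
have [r er] := cd_surjs h3.
have ls : size la <= size s by move: (congr1 size es); rewrite size_map size_cat => ->; exact: leq_addr.
pose a := take (size la) s; pose b := drop (size la) s.
have ea : map cd a = la by rewrite map_take es take_size_cat.
have eb : map cd b = rest by rewrite map_drop es drop_size_cat.
have emu : mu = (seq_mset a `+` seq_mset b)%mset.
  rewrite -seq_mset_cat cat_take_drop -[LHS]seq_mset_id; exact/eq_seq_msetP.
have le : (seq_mset a `<=` mu)%mset by rewrite emu; apply/msubsetP => z; rewrite msetE2 leq_addr.
have emb : (mu `\` seq_mset a)%mset = seq_mset b.
  by rewrite emu; apply/msetP => z; rewrite !msetE2 addKn.
have pa : perm_eq (map cd (seq_mset a)) la by rewrite -ea; apply/perm_map/perm_eq_seq_mset.
have pr' : perm_eq (map cd (seq_mset r)) rho by rewrite -er; apply/perm_map/perm_eq_seq_mset.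
exists ((mu `\` seq_mset a) `+` seq_mset r)%mset.
  exists e, (seq_mset a), (seq_mset r); split=> //.
  apply: (fires_enabled ft) => //; split.
  - by rewrite (permPl (perm_map _ pa)).
  - by rewrite (permPl (perm_map _ pr')).
  - by rewrite (perm_all _ pr').
  - by move=> q qn; rewrite (perm_cont _ _ pa) (perm_cont _ _ pr'); apply: h4.
rewrite emb (permPr pn) (permPl (perm_map _ (perm_msetD _ _))) map_cat perm_catC.
by apply: perm_cat => //; rewrite -eb; apply/perm_map/perm_eq_seq_mset.
Qed.

Lemma nfire_perm mu mu1 nu : perm_eq mu mu1 -> nfire_ mu nu -> nfire_ mu1 nu.
Proof.
move=> pm [x [la [rho [rest [h1 h2 h3 h4]]]]]; exists x, la, rho, rest; split=> //.
by rewrite -(permPl pm).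
Qed.

Lemma reachable_star mu mu' : reachable mu mu' -> star nfire_ (map cd mu) (map cd mu').
Proof.
elim=> [a b fi|a|a b c _ IH1 _ IH2]; [exact/star1/fire_nfire|exact: StarRefl|].
exact: star_trans IH1 IH2.
Qed.

Lemma star_reachable (mu : nmarking E) nu nu' : perm_eq (map cd mu) nu -> star nfire_ nu nu' ->
  exists2 mu' : nmarking E, reachable mu mu' & perm_eq (map cd mu') nu'.
Proof.
move=> pm st; elim: st mu pm => [a mu pm|a b c ab _ IH mu pm].
  by exists mu => //; apply: rt_refl.
rewrite perm_sym in pm; have [mu1 f1 p1] := nfire_fire (nfire_perm pm ab).
have [mu2 f2 p2] := IH _ p1; exists mu2 => //.
by apply: rt_trans f2; apply: rt_step.
Qed.

Lemma token_leE x y : token_le x y <->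
  rank (tag x) = rank (tag y) /\ forall q, nth 0 (cd x).2 q <= nth 0 (cd y).2 q.
Proof.
split.
  case=> p M M' le; split=> //= q; case: (ltnP q #|{: place (onet (typ p))}|) => qn; last first.
    by rewrite nth_default // size_map -cardE.
  have [Q <-] := rank_surj qn.
  by rewrite (@cd_nth (existT _ p M) Q) (@cd_nth (existT _ p M') Q) /=.
move=> []; have := @cd_nth x; have := @cd_nth y.
case: x y => p M [p' M'] /= h1 h2 /rank_inj e h; subst p'; apply: TokenLe => q.
by rewrite -h1 -h2.
Qed.

(** Stated for two tokens because the targets consist of the final control token and one
    register. *)
Lemma le_f2E (a b : token E) (mu : nmarking E) : le_f (seq_mset [:: a; b]) mu <->
  exists a' b' rest, [/\ perm_eq mu [:: a', b' & rest], token_le a a' & token_le b b'].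
Proof.
split.
  case=> s [s' [nu [f2 es ->]]].
  have pe : perm_eq [:: a; b] s by apply/eq_seq_msetP.
  have [a' [b' [ps' la lb]]] : exists a' b', [/\ perm_eq s' [:: a'; b'], token_le a a' & token_le b b'].
    move: pe f2; rewrite perm_sym => pe f2; have sz := perm_size pe.
    case: s {es} f2 pe sz => [|x [|y [|z s]]] // f2 pe _.
    inversion f2 as [|? x' ? s1 lx f2']; subst; inversion f2' as [|? y' ? s2 ly f2'']; subst.
    inversion f2''; subst.
    have : x \in [:: a; b] by rewrite -(perm_mem pe) mem_head.
    rewrite !inE => /orP[]/eqP ex; subst x.
      move: pe; rewrite perm_cons => /perm1[ey]; subst y.
      by exists x', y'.
    have pe2 : perm_eq [:: b; y] [:: b; a] by rewrite (permPl pe) (perm_catC [:: a] [:: b]).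
    move: pe2; rewrite perm_cons => /perm1[ey]; subst y.
    by exists y', x'; split=> //; rewrite (perm_catC [:: x'] [:: y']).
  exists a', b', nu; split=> //; rewrite (permPl (perm_msetD _ _)).
  rewrite -[[:: a', b' & _]]/([:: a'; b'] ++ nu) perm_cat2r.
  by rewrite (permPl (perm_eq_seq_mset _)).
case=> a' [b' [rest [pe la lb]]]; exists [:: a; b], [:: a'; b'], (seq_mset rest); split=> //.
  by constructor=> //; constructor.
by rewrite -seq_mset_cat -[mu]seq_mset_id; apply/eq_seq_msetP.
Qed.

End System.

(** * Instances as words *)

Lemma bits_of_pos_inj : injective bits_of_pos.
Proof.
have nz p : bits_of_pos p <> [::] by case: p.
elim=> [p IH|p IH|] [q|q|] //= [].
- by move/IH=> ->.
- by move/nz.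
- by move/IH=> ->.
- by move/esym/nz.
Qed.

Lemma bits_inj : injective bits.
Proof.
move=> n m; rewrite /bits => e; apply: (can_inj bin_of_natK).
case: (bin_of_nat n) (bin_of_nat m) e => [|p] [|q] //.
- by case: q.
- by case: p.
- by move/bits_of_pos_inj=> ->.
Qed.

(** Digits are letters [Some _], so the first [None] marks the end of the number. *)
Lemma separator_inj (a b : seq bool) u v :
  map some a ++ None :: u = map some b ++ None :: v -> a = b /\ u = v.
Proof. by elim: a b => [|x a IH] [|y b] //= [] => [->|-> /IH[-> ->]]. Qed.

Lemma word_of_nats_inj : injective word_of_nats.
Proof.
rewrite /word_of_nats; elim=> [|n s IH] [|m t] //=.
- by case: (bits m).
- by case: (bits n).
by rewrite !cat_rcons => /separator_inj[/bits_inj-> /IH->].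
Qed.

Definition cnet (a b : nat) (f g : nat -> nat -> nat) : seq nat :=
  [:: a; b] ++ [seq f t p | t <- iota 0 b, p <- iota 0 a]
  ++ [seq g t p | t <- iota 0 b, p <- iota 0 a].

Definition ctok (l : seq tk) : seq nat := size l :: flatten [seq y.1 :: y.2 | y <- l].

Lemma allpairs_inj (S T : eqType) (s : seq S) (t : seq T) (f g : S -> T -> nat) :
  [seq f x y | x <- s, y <- t] = [seq g x y | x <- s, y <- t] ->
  forall x y, x \in s -> y \in t -> f x y = g x y.
Proof.
elim: s => //= x0 s IH /eqP; rewrite eqseq_cat ?size_map // => /andP[/eqP/eq_in_map h /eqP/IH h'].
by move=> x y; rewrite in_cons => /orP[/eqP->|xs] yt; [apply: h|apply: h'].
Qed.

Lemma allpairs_rank (S T : finType) (F : nat -> nat -> nat) :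
  [seq F i j | i <- iota 0 #|S|, j <- iota 0 #|T|] =
  [seq F (rank x) (rank y) | x <- enum S, y <- enum T].
Proof.
by rewrite -!map_rank allpairs_mapl; congr flatten; apply: eq_map => x; rewrite -map_comp.
Qed.

(** The dimensions are read first and fix the lengths of both tables, so the equation can be cut at
    the right places. *)
Lemma decode_net (N : petri_net) a b f g r r' : code_net N ++ r = cnet a b f g ++ r' ->
  [/\ #|{: place N}| = a, #|{: trans N}| = b,
      forall t p, @pre N t p = f (rank t) (rank p), forall t p, @post N t p = g (rank t) (rank p) & r = r'].
Proof.
rewrite /code_net /cnet -!catA /= => -[ea eb]; subst a b => /eqP.
rewrite eqseq_cat ?size_allpairs -?cardE ?size_iota // => /andP[/eqP h1].
rewrite eqseq_cat ?size_allpairs -?cardE ?size_iota // => /andP[/eqP h2 /eqP er].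
rewrite !allpairs_rank in h1 h2.
split=> // t p; first by apply: (allpairs_inj h1); rewrite mem_enum.
by apply: (allpairs_inj h2); rewrite mem_enum.
Qed.

Lemma decode_map (T : finType) (f : T -> nat) F n r r' : n = #|T| ->
  [seq f x | x <- enum T] ++ r = [seq F i | i <- iota 0 n] ++ r' ->
  (forall x, f x = F (rank x)) /\ r = r'.
Proof.
move=> -> /eqP; rewrite -map_rank -map_comp eqseq_cat ?size_map //.
by case/andP=> /eqP/eq_in_map h /eqP ->; split=> // x; rewrite h // mem_enum.
Qed.

Lemma decode_flatten (S T : Type) (f : S -> seq nat) (g : T -> seq nat) m s t r r' :
  (forall x, size (f x) = m) -> (forall y, size (g y) = m) -> size s = size t ->
  flatten (map f s) ++ r = flatten (map g t) ++ r' -> map f s = map g t /\ r = r'.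
Proof.
move=> sf sg; elim: s t => [|x s IH] [|y t] //= [sz]; rewrite -!catA => /eqP.
by rewrite eqseq_cat ?sf ?sg // => /andP[/eqP-> /eqP/IH[//|-> ->]].
Qed.

Section Code.
Variables (k nf NQ : nat) (tbl : seq (edge patom)).
Hypothesis nf_big : 12 <= nf.
Hypothesis tbl_range : forall q l q', List.In (q, l, q') tbl -> 0 < q < NQ /\ 0 < q' < NQ.

Local Notation np := nf.*2.
Local Notation n_pl := (npl k nf NQ).
Local Notation evs := (EV k tbl).
Local Notation ne := (size evs).

Definition evd : edge patom * nat := ((0, None, 0), 0).
Definition evn (j : nat) : edge patom * nat := nth evd evs j.

(** The first [n_pl] transitions are the idle ones, in the order of the places; each of the others
    belongs to one event. *)
Definition tpre (t p : nat) : nat :=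
  if t < n_pl then nat_of_bool (p == t)
  else count_mem p (esrc k nf (evn (t - n_pl)) :: etake k nf (evn (t - n_pl))).
Definition tpost (t p : nat) : nat :=
  if t < n_pl then nat_of_bool (p == t)
  else count_mem p (edst k nf (evn (t - n_pl)) :: eput k nf (evn (t - n_pl))).
Definition tth (x : edge patom * nat) (t : nat) : nat :=
  if t < nf then efld k nf true x t else efld k nf false x (t - nf).

Definition csys : seq nat :=
  cnet n_pl (n_pl + ne) tpre tpost
  ++ 2 :: ([:: 0; 0] ++ cnet nf np (fun t q => t == nf + q) (fun t q => t == q))
  ++ [seq nat_of_bool (p < np) | p <- iota 0 n_pl]
  ++ iota 0 n_pl
  ++ ne :: flatten [seq (n_pl + j) :: [seq tth (evn j) t | t <- iota 0 np] | j <- iota 0 ne].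

Lemma decode_tokens (E : eos) (o1 : obj E) (s : seq (token E)) l r r' :
  presents k nf NQ tbl o1 -> all (wft k nf NQ) l ->
  code_tokens s ++ r = ctok l ++ r' -> map (@cd E) s = l /\ r = r'.
Proof.
move=> pr wl; rewrite /code_tokens /ctok /= => -[].
elim: s l wl => [|x s IH] [|[p v] l] //= /andP[wy wl] [sz [ep]].
rewrite -!catA => /eqP; rewrite eqseq_cat.
  by case/andP=> /eqP ev /eqP/(IH _ wl sz)[-> ->]; rewrite /cd ep ev.
have /andP[_ /eqP] := cd_wf pr x; have /andP[_ /eqP /= ->] := wy.
by rewrite /cd /= ep.
Qed.

(** The problem asks for some system with the given word, so soundness cannot assume the intended
    one: all that is needed about [E] has to be read off the word. *)
Lemma decode_sys (E : eos) r r' : code_eos E ++ r = csys ++ r' ->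
  (exists o1 : obj E, presents k nf NQ tbl o1) /\ r = r'.
Proof.
rewrite /code_eos /csys -[LHS]catA -[RHS]catA => /decode_net[c1 c2 hpre hpost] -[co].
have [a0 [a1 eo]] : exists a0 a1, enum (obj E) = [:: a0; a1].
  by move: co; rewrite cardE; case: (enum (obj E)) => [|a0 [|a1 [|a2 s]]] // _; exists a0, a1.
have ne01 : a0 != a1 by have := enum_uniq (obj E); rewrite eo /= inE andbT.
rewrite eo -!/(cat _ _) => H.
have {H} : code_net (onet a0) ++ (code_net (onet a1) ++ ([seq rank (typ p) | p <- enum (place (sysnet E))]
      ++ ([seq rank (idle p) | p <- enum (place (sysnet E))]
      ++ (size (events E) :: flatten [seq code_event e | e <- events E]) ++ r)))
    = cnet 0 0 (fun _ _ => 0) (fun _ _ => 0)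
      ++ (cnet nf np (fun t q => t == nf + q) (fun t q => t == q)
      ++ ([seq nat_of_bool (p < np) | p <- iota 0 n_pl] ++ ([seq i | i <- iota 0 n_pl]
      ++ (ne :: flatten [seq (n_pl + j) :: [seq tth (evn j) t | t <- iota 0 np] | j <- iota 0 ne]) ++ r'))).
  by rewrite map_id; move: H; rewrite /= -!catA /= -!catA.
case/decode_net=> p0 t0 _ _ /decode_net[p1 t1 opre opost].
case/(decode_map (esym c1)) => htyp /(decode_map (esym c1))[_ /=].
case=> sz hev.
have cev (e : event E) : code_event e = rank e.1 :: [seq e.2 a1 t | t <- enum (trans (onet a1))].
  rewrite /code_event eo /= cats0.
  have -> : enum (trans (onet a0)) = [::] by apply/eqP; rewrite -size_eq0 -cardE t0.
  by [].
have [] := decode_flatten (m := np.+1) _ _ _ hev.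
- by move=> e; rewrite cev /= size_map -cardE t1.
- by move=> j; rewrite /= size_map size_iota.
- by rewrite size_iota.
move=> hmap er; split=> //; exists a1.
have fit j e0 : j < ne -> @fits k nf E a1 (nth e0 (events E) j) (evn j).
  move=> jn; have := congr1 (fun s => nth [::] s j) hmap.
  rewrite (nth_map e0) ?sz // (nth_map 0) ?size_iota // nth_iota // add0n cev => -[hr ht].
  rewrite -t1 -map_rank -map_comp in ht; move/eq_in_map: ht => ht.
  split.
  - by move=> p; rewrite hpre hr /tpre ltnNge leq_addr addKn.
  - by move=> p; rewrite hpost hr /tpost ltnNge leq_addr addKn.
  - by move=> t; rewrite ht ?mem_enum.
split=> //.
- move=> N nN; have : N \in enum (obj E) by rewrite mem_enum.
  by rewrite eo !inE (negPf nN) orbF => /eqP->.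
- move=> p; have := htyp p.
  have : typ p \in enum (obj E) by rewrite mem_enum.
  rewrite /rank eo !inE => /orP[]/eqP-> /=; rewrite ?eqxx ?(negPf ne01); first by case: (_ < _).
  by case: (_ < _).
- move=> e ein; have jn : index e (events E) < size (events E) by rewrite index_mem.
  exists (evn (index e (events E))); first by apply: In_nth; rewrite -sz.
  by rewrite -{1}(nth_index e ein); apply: fit; rewrite -sz.
- move=> x /(In_index evd)[j jn <-].
  case ev: (events E) => [|e0 s]; first by move: jn; rewrite -sz ev.
  exists (nth e0 (events E) j); first by rewrite -ev mem_nth ?sz.
  by apply: fit.
Qed.

(** * A conservative object system with the prescribed code *)

Definition cnet_sys : petri_net :=
  @PetriNet 'I_n_pl 'I_(n_pl + ne) (fun p t => tpre t p) (fun t p => tpost t p).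
(** The factor [n] is 0 for the empty net and 1 for the net of records, so both object nets form one
    family over ['I_2]. *)
Definition cnet_obj (n : nat) : petri_net :=
  @PetriNet 'I_(n * nf) 'I_(n * np) (fun q t => t == nf + q :> nat) (fun t q => t == q :> nat).

Definition ctyp (p : place cnet_sys) : 'I_2 := inord (p < np).
Definition cidle (p : place cnet_sys) : trans cnet_sys := lshift ne p.
Definition cevents : seq (trans cnet_sys * {dffun forall N : 'I_2, tmultiset (cnet_obj N)}) :=
  [seq (rshift n_pl j, [ffun N : 'I_2 => [ffun t : trans (cnet_obj N) => tth (evn j) t]]) | j <- enum 'I_ne].

Lemma cblack_empty : is_empty_net (cnet_obj (ord0 : 'I_2)).
Proof. by rewrite /is_empty_net !card_ord. Qed.

Lemma cblack_uniq (N : 'I_2) : is_empty_net (cnet_obj N) -> N = ord0.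
Proof.
case=> + _; rewrite card_ord => /eqP; rewrite muln_eq0 => /orP[/eqP e|]; first exact: val_inj.
by move: nf_big; case: (nf).
Qed.

Lemma cpre_idle (p q : place cnet_sys) : pre (cidle p) q = (q == p).
Proof. by rewrite /pre /= /tpre /= ltn_ord. Qed.

Lemma cpost_idle (p q : place cnet_sys) : post (cidle p) q = (q == p).
Proof. by rewrite /post /= /tpost /= ltn_ord. Qed.

(** Vacuously true: the transitions of events are numbered after the idle ones. *)
Lemma cevents_idle e p : e \in cevents -> e.1 = cidle p ->
  exists t : trans (cnet_obj (ctyp p)), 0 < e.2 (ctyp p) t.
Proof.
case/mapP=> j _ -> /= /(congr1 val) /= e'; have := ltn_ord p.
by rewrite -e' ltnNge leq_addr.
Qed.

Definition ceos : eos :=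
  EOS cblack_empty cblack_uniq cpre_idle cpost_idle cevents_idle.

Lemma rank_ord n (i : 'I_n) : rank i = i.
Proof. exact: index_enum_ord. Qed.

Lemma map_enum_ord (n : nat) T (F : nat -> T) : [seq F i | i : 'I_n <- enum 'I_n] = map F (iota 0 n).
Proof. by rewrite -val_enum_ord -map_comp. Qed.

Lemma allpairs_enum_ord (n m : nat) (F : nat -> nat -> nat) :
  [seq F i j | i : 'I_n <- enum 'I_n, j : 'I_m <- enum 'I_m] =
  [seq F i j | i <- iota 0 n, j <- iota 0 m].
Proof.
rewrite -!val_enum_ord allpairs_mapl; congr flatten; apply: eq_map => x.
by rewrite -map_comp.
Qed.

Lemma code_objs : flatten [seq code_net (cnet_obj N) | N : 'I_2 <- enum 'I_2] =
  [:: 0; 0] ++ cnet nf np (fun t q => t == nf + q) (fun t q => t == q).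
Proof.
have cn n : code_net (cnet_obj n) = cnet (n * nf) (n * np) (fun t q => t == nf + q) (fun t q => t == q).
  by rewrite /code_net !card_ord /= (allpairs_enum_ord _ _ (fun t q => t == nf + q))
    (allpairs_enum_ord _ _ (fun t q => t == q)).
by rewrite (eq_map (fun N : 'I_2 => cn N)) !enum_ordSl enum_ord0 /= !mul1n cats0.
Qed.

Lemma code_ceos : code_eos ceos = csys.
Proof.
have cs : code_net cnet_sys = cnet n_pl (n_pl + ne) tpre tpost.
  by rewrite /code_net !card_ord /= (allpairs_enum_ord _ _ tpre) (allpairs_enum_ord _ _ tpost).
have ct : [seq rank (ctyp p) | p <- enum 'I_n_pl] = [seq nat_of_bool (p < np) | p <- iota 0 n_pl].
  rewrite -(@map_enum_ord n_pl _ (fun p => nat_of_bool (p < np))); apply: eq_map => p.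
  by rewrite rank_ord /ctyp inordK //; case: (p < np).
have ci : [seq rank (cidle p) | p <- enum 'I_n_pl] = iota 0 n_pl.
  rewrite -[RHS]map_id -(@map_enum_ord n_pl _ id); apply: eq_map => p.
  by rewrite rank_ord.
have ce : flatten [seq code_event e | e : event ceos <- cevents] =
    flatten [seq (n_pl + j) :: [seq tth (evn j) t | t <- iota 0 np] | j <- iota 0 ne].
  rewrite -(@map_enum_ord ne _ (fun j => (n_pl + j) :: [seq tth (evn j) t | t <- iota 0 np])) /cevents -map_comp.
  congr flatten; apply: eq_map => j; rewrite /= /code_event rank_ord; congr (_ :: _).
  have tn (N : 'I_2) : [seq (([ffun N : 'I_2 => [ffun t : trans (cnet_obj N) => tth (evn j) t]]
       : {dffun forall N : 'I_2, tmultiset (cnet_obj N)}) N) t | t <- enum (trans (cnet_obj N))]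
      = [seq tth (evn j) t | t <- iota 0 (N * np)].
    by rewrite -(@map_enum_ord _ _ (tth (evn j))); apply: eq_map => t; rewrite !ffunE.
  rewrite (eq_map (fun N : 'I_2 => tn N)).
  by rewrite !enum_ordSl enum_ord0 /= mul1n cats0.
have sz : size cevents = ne by rewrite size_map size_enum_ord.
rewrite -[LHS]/(code_net cnet_sys ++ #|{: 'I_2}| :: flatten [seq code_net (cnet_obj N) | N : 'I_2 <- enum 'I_2]
  ++ [seq rank (ctyp p) | p <- enum 'I_n_pl] ++ [seq rank (cidle p) | p <- enum 'I_n_pl]
  ++ size cevents :: flatten [seq code_event e | e : event ceos <- cevents]).
by rewrite cs card_ord code_objs ct ci sz ce.
Qed.

(** Every event passes the control token on, which settles the black type, and every event that
    takes a record also puts one; the only unbalanced atom, [PNew], creates records. *)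
Lemma conservative_ceos : conservative ceos.
Proof.
move=> t; apply/subsetP => N /imsetP[p]; rewrite inE => pos ->.
suff [p' pos' et] : exists2 p' : 'I_n_pl, 0 < tpost t p' & ctyp p' = ctyp p.
  by apply/imsetP; exists p'; rewrite ?inE //.
move: pos; rewrite /pre /= /tpre /tpost; case: ifP => tn pos; first by exists p.
have jn : t - n_pl < ne by have := ltn_ord t; lia.
have xE : List.In (evn (t - n_pl)) evs by apply: In_nth.
set x := evn (t - n_pl) in pos xE *; move: pos; rewrite -has_count => /hasP[r rin /eqP er]; subst r.
move: rin; rewrite in_cons => /orP[/eqP ep|pt].
  exists (Ordinal (edst_npl nf_big tbl_range xE)); first by rewrite /= eqxx.
  congr inord; rewrite ep /=; congr nat_of_bool.
  rewrite !ltnNge ctlp_np /edst; case: ifP => _; rewrite ctlp_np //.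
have pn : p < np by apply: (allP (etake_np k nf_big x)).
have [p' p'in] : exists p', p' \in eput k nf x.
  move: pt; rewrite /etake /eput; case: ifP => // _.
  by case: (x.1.1.2) => [[r|r|r w|r|c]|] //= _; eexists; exact: mem_head.
have p'n : p' < np by apply: (allP (eput_np k nf_big x)).
have p'l : p' < n_pl by rewrite /npl; lia.
exists (Ordinal p'l); last by congr inord; rewrite /= p'n pn.
by rewrite /= addn_gt0 -has_count has_pred1 p'in orbT.
Qed.

End Code.

(** * The reduction *)

Section Instance.
Variables (Sig : finType) (M : tm Sig void).

Definition mainp : prog patom := bindp pimpl (MAIN (nregs M) (midP M)).
(** Control state 0 is reserved for events with a failing guard, so the graph starts at 1 and its
    exit is [mqf]. *)
Definition mtbl : seq (edge patom) := graph mainp 1.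
Definition mNQ : nat := psize mainp + 2.
Definition mqf : nat := (psize mainp).+1.

(* Room for the core, whose records have a field per level, and for the
   registers of the simulation. *)
Definition mnf (k : nat) : nat := 2 * k + 2 * nregs M + 12.

Definition tok0 (k N : nat) : seq tk :=
  [:: (ctlp k (mnf k) 1 0, [::]), (0, zerov (mnf k)) &
    [seq (v.*2.+1, regv (mnf k) (if v.*2.+1 == 29 then N else 0)) | v <- iota 0 (mnf k)]].
Definition tok1 (k N : nat) : seq tk :=
  [:: (ctlp k (mnf k) mqf 0, [::]); (13, regv (mnf k) N)].

Definition instance (k N : nat) : seq (option bool) :=
  word_of_nats (csys k (mnf k) mNQ mtbl ++ ctok (tok0 k N) ++ ctok (tok1 k N)).

Variables (w : seq Sig) (k : nat).
Local Notation N := (Nw M w).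
Local Notation nf := (mnf k).

Let nf12 : 12 <= nf. Proof. by rewrite /mnf; lia. Qed.
Let np0 : 0 < nf.*2. Proof. by rewrite /mnf; lia. Qed.
Let np13 : 13 < nf.*2. Proof. by rewrite /mnf; lia. Qed.

Lemma mtbl_range q l q' : List.In (q, l, q') mtbl -> 0 < q < mNQ /\ 0 < q' < mNQ.
Proof. by move/graph_range; rewrite /mNQ; lia. Qed.

Lemma at_odd p n (g : nat -> seq nat) :
  at_ p [seq (v.*2.+1, g v) | v <- iota 0 n] = if odd p && (p./2 < n) then [:: g p./2] else [::].
Proof.
rewrite /at_ filter_map -map_comp; case: ifP => [/andP[op pn]|pf].
  rewrite (_ : filter _ _ = [:: p./2]) //.
  rewrite -(@filter_pred1_uniq _ (iota 0 n) p./2) ?iota_uniq ?mem_iota //.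
  by apply: eq_filter => v /=; apply/eqP/eqP; lia.
rewrite (_ : filter _ _ = [::]) //; apply/eqP; rewrite -[_ == _]negbK -has_filter.
apply/hasPn => v; rewrite mem_iota /= add0n => vn; apply/eqP => e; move: pf; rewrite -e /=.
by rewrite odd_double /= uphalf_double vn.
Qed.

Lemma at_tok0 p : p < nf.*2 -> at_ p (tok0 k N) =
  if p == 0 then [:: zerov nf] else
  if odd p then [:: regv nf (if p == 29 then N else 0)] else [::].
Proof.
move=> pn; rewrite /tok0 -[[:: _, _ & _]]/([:: (ctlp k nf 1 0, [::])] ++ [:: (0, zerov nf)] ++ _) !at_cat at_odd.
have -> : at_ p [:: (ctlp k nf 1 0, [::])] = [::].
  by rewrite /at_ /=; case: eqP => // e; have := ctlp_np k nf 1 0; rewrite e leqNgt pn.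
rewrite cat0s /at_ /= eq_sym; case: eqP => [->|_] //=.
by rewrite ltn_half_double pn andbT; case: ifP => // op; rewrite -[in RHS](odd_double_half p) op add1n.
Qed.

Definition t0 : pst := Pst 0 (at_^~ (tok0 k N)).

Lemma prep_t0 : prep nf (rinit N) t0.
Proof.
split=> //=.
- by rewrite at_tok0 // rvec0 // => v ov; case: eqP => // e; rewrite e in ov.
- by move=> p pn op; rewrite at_tok0 // op; case: eqP => // e; rewrite e in op.
- by move=> b bn; rewrite at_tok0 // oddD odd_double.
Qed.

Lemma wf_tok0 : all (wft k nf mNQ) (tok0 k N).
Proof.
have np1 p : p < nf.*2 -> p < npl k nf mNQ by rewrite /npl; lia.
have c1 : ctlp k nf 1 0 < npl k nf mNQ by apply: (ctlp_npl nf12); rewrite // /mNQ; lia.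
have w1 : wft k nf mNQ (ctlp k nf 1 0, [::]) by rewrite /wft /= c1 [_ < nf.*2]ltnNge ctlp_np.
have w2 : wft k nf mNQ (0, zerov nf) by rewrite /wft /= size_nseq np1 // np0 eqxx.
rewrite /= w1 w2 all_map; apply/allP => v; rewrite mem_iota /= add0n => /= vn.
have vn' : v.*2.+1 < nf.*2 by lia.
by rewrite /wft /= np1 // vn' size_mkseq eqxx.
Qed.

Lemma wf_tok1 : all (wft k nf mNQ) (tok1 k N).
Proof.
have np1 p : p < nf.*2 -> p < npl k nf mNQ by rewrite /npl; lia.
have c1 : ctlp k nf mqf 0 < npl k nf mNQ by apply: (ctlp_npl nf12); rewrite // /mNQ /mqf; lia.
have w1 : wft k nf mNQ (ctlp k nf mqf 0, [::]) by rewrite /wft /= c1 [_ < nf.*2]ltnNge ctlp_np.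
by rewrite /= w1 /wft /= np1 // np13 size_mkseq eqxx.
Qed.

Lemma crep_t0 : crep k nf mNQ (1, t0) (tok0 k N).
Proof.
split=> /=; [by []|by rewrite /mNQ; lia|exact: wf_tok0| |by []].
rewrite /ctls /= ctlp_np ifF; last by lia.
congr cons; apply/eqP; rewrite -[_ == _]negbK -has_filter; apply/hasPn => y /mapP[v].
by rewrite mem_iota /= => vn ->; rewrite -ltnNge /=; lia.
Qed.

(** Covering the target means that the control has reached the exit of the program with at least [N]
    units in [VO]. These are the two premises of [main_sound]. *)
Lemma instance_sound : ceos_coverability (instance k N) ->
  exists n, halting (cstate (run M w n)) /\ accepting (cstate (run M w n)).
Proof.
case=> E [s0 [st [_ /word_of_nats_inj/esym e cov]]].
have [[o1 pr]] := decode_sys e; case/(decode_tokens pr wf_tok0) => e0.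
rewrite -[code_tokens st]cats0 -[ctok (tok1 _ _)]cats0; case/(decode_tokens pr wf_tok1) => e1 _.
case: cov => mu1 [rch le].
have st1 := reachable_star nf12 mtbl_range pr rch.
have p0 : perm_eq (map (@cd E) (seq_mset s0)) (tok0 k N).
  by rewrite -e0; apply/perm_map/perm_eq_seq_mset.
have [cr0 cr1 cr2 cr3 cr4] := crep_t0.
have crs : crep k nf mNQ (1, t0) (map (@cd E) (seq_mset s0)).
  split=> //.
  - by rewrite (perm_all _ p0).
  - by apply: perm1; rewrite -cr3; apply: perm_ctls.
  - by move=> p pn; rewrite (permPl (perm_at p p0)).
have [[q t] [gs [/= ik qn wfm ctm atm]]] := nfires_sound nf12 mtbl_range crs st1.
case: st {e} e1 le => [|a [|b [|? ?]]] // [ea1 ea2 eb1 eb2].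
case/le_f2E=> a' [b' [rest [pm la lb]]].
have /token_leE [ra _] := la; have /token_leE [rb hb] := lb.
have pm' := perm_map (@cd E) pm.
have ctq : cd a' \in ctls nf (map (@cd E) mu1).
  by rewrite mem_filter (perm_mem pm') mem_head andbT /= -ra ea1 ctlp_np.
have [eq ei] : mqf = q /\ 0 = pi t.
  apply: (ctlp_inj (k := k) (nf := nf)) => //; rewrite -ea1 ra.
  by move: ctq; rewrite ctm inE => /eqP[].
have sm : sem (pstep k nf) mainp t0 t by apply: (graph_sound gs); rewrite -eq.
have [s' [sm' [_ _ h13 _ _]]] := prog_sound nf12 prep_t0 sm.
apply: (main_sound _ _ sm'); [by rewrite /mnf; lia|by rewrite /mnf; lia|].
have : (cd b').2 \in at_ 13 (map (@cd E) mu1).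
  apply/mapP; exists (cd b') => //; rewrite mem_filter /= -rb eb1 eqxx /= (perm_mem pm') /= !inE.
  by rewrite eqxx orbT.
rewrite (perm_mem (atm 13 np13)) h13 // inE => /eqP ebv.
by have := hb 0; rewrite ebv [(cd b).2]eb2 !nth_regv0.
Qed.

Lemma instance_complete n U : halting (cstate (run M w n)) -> accepting (cstate (run M w n)) ->
  base M ^ (size w + 3 * n + 2) <= U -> #|{: state M}| <= U -> (nregs M + 4) * U <= V0 k ->
  ceos_coverability (instance k N).
Proof.
move=> hn an h1 h2 h3.
have [||s' [sm' e13 ei]] := main_complete (k := k) (nf := nf) _ _ hn an h1 h2 h3.
- by rewrite /mnf; lia.
- by rewrite /mnf; lia.
have [t [sm [et _ h13 _ _]]] := prog_complete nf12 prep_t0 sm'.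
have gs := graph_complete (List.incl_refl mtbl) sm.
have [mu' [st1 [_ _ wfm ctm atm]]] := nfires_complete nf12 mtbl_range crep_t0 gs.
set E := @ceos k nf mNQ mtbl nf12.
have [[o1 pr] _] : (exists o1 : obj E, presents k nf mNQ mtbl o1) /\ [::] = [::] :> seq nat.
  by apply: decode_sys; rewrite !cats0; apply: code_ceos.
have [s0 e0] := cd_surjs pr wf_tok0; have [st e1] := cd_surjs pr wf_tok1.
have ect s l : map (@cd E) s = l -> code_tokens s = ctok l.
  by move=> <-; rewrite /ctok /code_tokens size_map -map_comp.
exists E, s0, st; split; first exact: (conservative_ceos mtbl_range).
  by rewrite /instance code_ceos (ect _ _ e0) (ect _ _ e1).
have p0 : perm_eq (map (@cd E) (seq_mset s0)) (tok0 k N).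
  by rewrite -e0; apply/perm_map/perm_eq_seq_mset.
have [mu1 rch pmu] := star_reachable nf12 pr p0 st1.
exists mu1; split=> //.
case: st e1 => [|a [|b [|? ?]]] // [ea1 ea2 eb1 eb2]; apply/le_f2E.
have am : (ctlp k nf mqf 0, [::]) \in map (@cd E) mu1.
  rewrite (perm_mem pmu); have : (ctlp k nf mqf 0, [::]) \in ctls nf mu'.
    by rewrite ctm /= et ei inE.
  by rewrite mem_filter => /andP[].
have bm : (13, regv nf N) \in map (@cd E) mu1.
  rewrite (perm_mem pmu); have : regv nf N \in at_ 13 mu'.
    by rewrite (perm_mem (atm 13 np13)) /= h13 // e13 mem_head.
  by case/mapP=> -[p v]; rewrite mem_filter /= => /andP[/eqP -> im] ->.
case/mapP: am => a' a'm ea'; case/mapP: bm => b' b'm eb'.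
have ab : b' != a'.
  apply/eqP => e; move: eb'; rewrite e -ea' => -[e' _].
  by have := ctlp_np k nf mqf 0; rewrite -e' leqNgt np13.
have pa := perm_to_rem a'm.
have b'r : b' \in rem a' mu1.
  by move: b'm; rewrite (perm_mem pa) in_cons (negPf ab).
have pb := perm_to_rem b'r.
have caE : cd a = cd a' by rewrite -ea' /cd ea1 ea2.
have cbE : cd b = cd b' by rewrite -eb' /cd eb1 eb2.
exists a', b', (rem b' (rem a' mu1)); split.
- by rewrite (permPl pa) perm_cons.
- by apply/token_leE; rewrite caE; split=> //; case: caE.
- by apply/token_leE; rewrite cbE; split=> //; case: cbE.
Qed.

End Instance.

(** * Structured programs for Turing machines *)

Definition ribbon (T : Type) (s : seq T) : int -> option T :=
  fun i => if i is Posz j then onth s j else None.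

Section TapePrograms.
Variables (Sig Del W X : finType).

Local Notation cell := (option (Sig + Del + W)).

(** Tapes are addressed by their role; they receive numbers, with input first and output last, only
    when [ptm] turns a program into a machine. *)
Inductive kind := KIn | KOut | KX of X.

Definition tapes : Type := ((kind -> int -> cell) * (kind -> int))%type.
Definition view : Type := kind -> cell.
Definition action : Type := view -> kind -> cell * move.

Definition rd (s : tapes) : view := fun x => s.1 x (s.2 x).

Definition doact (f : action) (s : tapes) : tapes :=
  (fun x i => if i == s.2 x then (f (rd s) x).1 else s.1 x i,
   fun x => shift (f (rd s) x).2 (s.2 x)).

Inductive dprog :=
| DAct of action
| DSeq of dprog & dprog
| DWhile of (view -> bool) & dprog.

(** The step counts are exact: a test and the jump back to it cost one step each. *)
Inductive dexec : dprog -> tapes -> nat -> tapes -> Prop :=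
| EAct f s : dexec (DAct f) s 1 (doact f s)
| ESeq p q s n s1 m s2 : dexec p s n s1 -> dexec q s1 m s2 -> dexec (DSeq p q) s (n + m) s2
| EDone t p s : ~~ t (rd s) -> dexec (DWhile t p) s 1 s
| ELoop (t : view -> bool) p s n s1 m s2 : t (rd s) -> dexec p s n s1 -> dexec (DWhile t p) s1 m s2 ->
    dexec (DWhile t p) s (1 + (n + (1 + m))) s2.

Inductive instr := IAct of action | IBr of (view -> bool) & nat.

Fixpoint dsize (p : dprog) : nat :=
  match p with
  | DAct _ => 1
  | DSeq p q => dsize p + dsize q
  | DWhile _ p => (dsize p).+2
  end.

Fixpoint dcode (p : dprog) (a : nat) : seq instr :=
  match p with
  | DAct f => [:: IAct f]
  | DSeq p q => dcode p a ++ dcode q (a + dsize p)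
  | DWhile t p => IBr t (a + (dsize p).+2) :: dcode p a.+1 ++ [:: IBr (fun=> false) a]
  end.

Lemma size_dcode p a : size (dcode p a) = dsize p.
Proof.
elim: p a => [f|p IHp q IHq|t p IHp] a //=; first by rewrite size_cat IHp IHq.
by rewrite size_cat IHp addn1.
Qed.

Section Code.
Variable c : seq instr.

Definition istep (x : nat * tapes) : nat * tapes :=
  match nth (IBr (fun=> true) 0) c x.1 with
  | IAct f => (x.1.+1, doact f x.2)
  | IBr t j => (if t (rd x.2) then x.1.+1 else j, x.2)
  end.

(** The second half keeps the run in front of position [b] until its end; at the end of the code the
    machine would halt. *)
Definition goes (b n : nat) (x y : nat * tapes) : Prop :=
  iter n istep x = y /\ forall k, k < n -> (iter k istep x).1 < b.

Lemma goes1 b x y : istep x = y -> x.1 < b -> goes b 1 x y.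
Proof. by move=> e lt; split=> // -[|k]. Qed.

Lemma goes_trans b n m x y z : goes b n x y -> goes b m y z -> goes b (n + m) x z.
Proof.
move=> [e1 l1] [e2 l2]; split; first by rewrite addnC iterD e1.
move=> k km; case: (ltnP k n) => [/l1//|nk].
by rewrite -(subnK nk) iterD e1; apply: l2; lia.
Qed.

Lemma goesW b b' n x y : b <= b' -> goes b n x y -> goes b' n x y.
Proof. by move=> le [e l]; split=> // k /l lt; apply: leq_trans lt le. Qed.

Lemma istep_act f pr po s : c = pr ++ IAct f :: po ->
  istep (size pr, s) = ((size pr).+1, doact f s).
Proof. by move=> ec; rewrite /istep /= ec nth_cat ltnn subnn. Qed.

Lemma istep_br t j pr po s : c = pr ++ IBr t j :: po ->
  istep (size pr, s) = (if t (rd s) then (size pr).+1 else j, s).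
Proof. by move=> ec; rewrite /istep /= ec nth_cat ltnn subnn. Qed.

Lemma dcode_run p s n s' : dexec p s n s' -> forall pre post, c = pre ++ dcode p (size pre) ++ post ->
  goes (size pre + dsize p) n (size pre, s) (size pre + dsize p, s').
Proof.
elim=> {p s n s'} [f s|p q s n s1 m s2 _ IH1 _ IH2|t p s tf|t p s n s1 m s2 tt _ IH1 _ IH2] pr po /= ec.
- by apply: goes1; rewrite /= ?addn1 // (istep_act _ ec).
- have h1 := IH1 pr (dcode q (size pr + dsize p) ++ po); rewrite ec -catA in h1.
  have h2 := IH2 (pr ++ dcode p (size pr)) po; rewrite ec size_cat size_dcode -!catA in h2.
  rewrite addnA; apply: goes_trans (goesW _ (h1 erefl)) (h2 erefl).
  by rewrite leq_addr.
- by apply: goes1; rewrite /= ?(istep_br _ ec) ?(negPf tf) //; lia.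
- have h1 := IH1 (rcons pr (IBr t (size pr + (dsize p).+2))) ([:: IBr (fun=> false) (size pr)] ++ po).
  rewrite size_rcons cat_rcons ec /= -catA in h1.
  have e2 : c = (pr ++ IBr t (size pr + (dsize p).+2) :: dcode p (size pr).+1) ++ IBr (fun=> false) (size pr) :: po.
    by rewrite ec -catA /= -catA.
  have s2' : size (pr ++ IBr t (size pr + (dsize p).+2) :: dcode p (size pr).+1) = (size pr).+1 + dsize p.
    by rewrite size_cat /= size_dcode addnS addSn.
  apply: (@goes_trans _ 1 _ _ ((size pr).+1, s)).
    by apply: goes1; rewrite /= ?(istep_br _ ec) ?tt //; lia.
  apply: (@goes_trans _ n _ _ ((size pr).+1 + dsize p, s1)).
    by apply: goesW (h1 erefl); lia.
  apply: (@goes_trans _ 1 _ _ (size pr, s1)).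
    by rewrite -s2'; apply: goes1; rewrite ?(istep_br _ e2) //= s2'; lia.
  exact: (IH2 pr po ec).
Qed.
End Code.

Local Notation nx := #|X|.

Definition kd (i : 'I_nx.+2) : kind :=
  if i == ord0 then KIn else
  if insub (i : nat).-1 : option 'I_nx is Some j then KX (enum_val j) else KOut.

Definition kx (x : kind) : 'I_nx.+2 :=
  match x with
  | KIn => ord0
  | KOut => ord_max
  | KX y => inord (enum_rank y).+1
  end.

Lemma kxK : cancel kx kd.
Proof.
case=> [||x] //.
  by rewrite /kd /=; case: insubP => //= j; rewrite ltnn.
have lt : (enum_rank x).+1 < nx.+2 by rewrite !ltnS ltnW // ltn_ord.
rewrite /kd /kx -val_eqE /= inordK //=.
case: insubP => [j _ ej|]; last by rewrite ltn_ord.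
by rewrite -[x in RHS]enum_rankK; congr (KX (enum_val _)); apply: val_inj.
Qed.

Variable p : dprog.
Local Notation c := (dcode p 0).

Definition ptm : tm Sig Del :=
  @TM Sig Del 'I_(dsize p).+1 W nx.+1 ord0 (fun q => q == dsize p :> nat) (fun=> false)
    (fun q v => match nth (IBr (fun=> true) 0) c q with
     | IAct f => (inord q.+1, fun k => f (fun x => v (kx x)) (kd k))
     | IBr t j => (inord (if t (fun x => v (kx x)) then q.+1 else j), fun k => (v k, Stay))
     end).

Definition pcfg (q : nat) (s : tapes) : config ptm :=
  @Config Sig Del ptm (inord q : 'I_(dsize p).+1) (fun k => s.1 (kd k)) (fun k => s.2 (kd k)).

Lemma ptm_step q s : q < dsize p -> step (pcfg q s) = pcfg (istep c (q, s)).1 (istep c (q, s)).2.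
Proof.
move=> qn; have q1 : q < (dsize p).+1 by rewrite ltnS ltnW.
rewrite /step /= inordK // ifF; last by rewrite ltn_eqF.
have -> : (fun x => [ffun k : 'I_nx.+2 => s.1 (kd k) (s.2 (kd k))] (kx x)) = rd s.
  by apply: functional_extensionality => x; rewrite ffunE kxK.
rewrite /istep /=; case: (nth _ _ _) => [f|t j] //=; rewrite /pcfg; congr Config.
by do 2 (apply: functional_extensionality => ?); rewrite ffunE; case: eqP => // ->.
Qed.

Definition initial (w : seq Sig) : tapes :=
  (fun x => ribbon (if x is KIn then [seq inl (inl a) | a <- w] else [::]) , fun=> 0%R).

Lemma init_pcfg w : init ptm w = pcfg 0 (initial w).
Proof.
rewrite /init /pcfg /initial /=; congr Config; first by apply: val_inj; rewrite /= inordK.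
apply: functional_extensionality => k; rewrite /kd.
by case: eqP => // _; case: insub.
Qed.

Lemma ptm_run w n s : dexec p (initial w) n s -> forall m, n <= m -> run ptm w m = pcfg (dsize p) s.
Proof.
move=> ex m nm; have [rn lt] := dcode_run ex (c := c) (pre := [::]) (post := [::]) (esym (cats0 _)).
rewrite /run init_pcfg -(subnK nm) iterD.
have hf k : iter k (@step _ _ ptm) (pcfg (dsize p) s) = pcfg (dsize p) s.
  by elim: k => //= k ->; rewrite /step /= inordK // eqxx.
suff -> : iter n (@step _ _ ptm) (pcfg 0 (initial w)) = pcfg (dsize p) s by exact: hf.
have it k : k <= n -> iter k (@step _ _ ptm) (pcfg 0 (initial w)) =
    pcfg (iter k (istep c) (0, initial w)).1 (iter k (istep c) (0, initial w)).2.
  elim: k => // k IH kn; rewrite !iterS IH; last exact: ltnW.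
  rewrite ptm_step; last exact: lt.
  by case: (iter k _ _).
by rewrite it // rn.
Qed.

End TapePrograms.

(** * Counter programs *)

Inductive cprog :=
| WInc of nat
| WDec of nat
| WOut of option bool
| WSeq of cprog & cprog
| WWhile of nat & cprog.

Definition cst : Type := ((nat -> nat) * seq (option bool))%type.

Inductive cexec : cprog -> cst -> nat -> cst -> Prop :=
| XInc r g o : cexec (WInc r) (g, o) 1 (upd g r (g r).+1, o)
| XDec r g o : 0 < g r -> cexec (WDec r) (g, o) 1 (upd g r (g r).-1, o)
| XOut b g o : cexec (WOut b) (g, o) 1 (g, rcons o b)
| XSeq p q s n s1 m s2 : cexec p s n s1 -> cexec q s1 m s2 -> cexec (WSeq p q) s (n + m) s2
| XDone r p s : s.1 r = 0 -> cexec (WWhile r p) s 1 s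
| XLoop r p s n s1 m s2 : 0 < s.1 r -> cexec p s n s1 -> cexec (WWhile r p) s1 m s2 ->
    cexec (WWhile r p) s (1 + (n + (1 + m))) s2.

Fixpoint cregs (p : cprog) : nat :=
  match p with
  | WInc r | WDec r => r
  | WOut _ => 0
  | WSeq p q => maxn (cregs p) (cregs q)
  | WWhile r p => maxn r (cregs p)
  end.

(** [S j] is the state with [j] rounds to go, so that a loop is analysed by giving its states in
    closed form. *)
Lemma cexec_loop r p (S : nat -> cst) t J : (forall j, j <= J -> (S j).1 r = j) ->
  (forall j, j < J -> exists n, cexec p (S j.+1) n (S j) /\ n <= t) ->
  exists n, cexec (WWhile r p) (S J) n (S 0) /\ n <= J * (t + 2) + 1.
Proof.
elim: J => [|J IH] hr hb; first by exists 1; split=> //; apply: XDone; apply: hr.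
have [n1 [e1 l1]] := hb J (ltnSn _).
have [||n2 [e2 l2]] := IH; [by move=> j jJ; apply: hr; lia|by move=> j jJ; apply: hb; lia|].
exists (1 + (n1 + (1 + n2))); split; last by rewrite mulSn; lia.
by apply: XLoop e1 e2; rewrite hr.
Qed.

Ltac feq := congr pair; apply: functional_extensionality => ?; upds.

Lemma clear_exec r g o : exists n,
  cexec (WWhile r (WDec r)) (g, o) n (upd g r 0, o) /\ n <= g r * 3 + 1.
Proof.
have [||n [e l]] := @cexec_loop r (WDec r) (fun j => (upd g r j, o)) 1 (g r).
- by move=> j _ /=; rewrite updE eqxx.
- move=> j _; exists 1; split=> //.
  have -> : (upd g r j, o) = (upd (upd g r j.+1) r (upd g r j.+1 r).-1, o) by feq.
  by apply: XDec; rewrite updE eqxx.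
exists n; split; last by move: l; lia.
by have <- : (upd g r (g r), o) = (g, o) by feq.
Qed.

Lemma move_exec r a g o : r != a -> exists n,
  cexec (WWhile r (WSeq (WDec r) (WInc a))) (g, o) n (upd (upd g a (g a + g r)) r 0, o) /\
  n <= g r * 4 + 1.
Proof.
move/eqP=> ra; have [||n [e l]] := @cexec_loop r (WSeq (WDec r) (WInc a))
  (fun j => (upd (upd g a (g a + (g r - j))) r j, o)) 2 (g r).
- by move=> j _ /=; rewrite updE eqxx.
- move=> j jr; exists 2; split=> //.
  set g1 := upd _ r j.+1.
  have -> : (upd (upd g a (g a + (g r - j))) r j, o) =
     (upd (upd g1 r (g1 r).-1) a (upd g1 r (g1 r).-1 a).+1, o).
    by rewrite /g1; feq.
  by apply: (XSeq (n := 1) (m := 1)); [apply: XDec; rewrite /g1 updE eqxx|apply: XInc].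
exists n; split; last by move: l; lia.
have e0 : (upd (upd g a (g a + (g r - g r))) r (g r), o) = (g, o) by feq.
by rewrite e0 subn0 in e.
Qed.

Lemma copy_exec r a b g o : r != a -> r != b -> a != b -> g b = 0 -> exists n,
  cexec (WSeq (WWhile r (WSeq (WDec r) (WSeq (WInc a) (WInc b))))
              (WWhile b (WSeq (WDec b) (WInc r)))) (g, o) n (upd g a (g a + g r), o) /\
  n <= g r * 9 + 2.
Proof.
move=> /eqP ra /eqP rb /eqP ab b0; have [||n [e l]] := @cexec_loop r (WSeq (WDec r) (WSeq (WInc a) (WInc b)))
  (fun j => (upd (upd (upd g a (g a + (g r - j))) b (g r - j)) r j, o)) 3 (g r).
- by move=> j _ /=; rewrite updE eqxx.
- move=> j jr; exists 3; split=> //.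
  set g1 := upd _ r j.+1.
  set g2 := upd g1 r (g1 r).-1; set g3 := upd g2 a (g2 a).+1.
  have -> : (upd (upd (upd g a (g a + (g r - j))) b (g r - j)) r j, o) = (upd g3 b (g3 b).+1, o).
    by rewrite /g3 /g2 /g1; feq.
  apply: (XSeq (n := 1) (m := 1 + 1)); first by apply: XDec; rewrite /g1 updE eqxx.
  by apply: XSeq; apply: XInc.
have [|m [e' l']] := @move_exec b r (upd (upd (upd g a (g a + g r)) b (g r)) r 0) o.
  by apply/eqP => e0; apply: rb.
exists (n + m); split.
  have e0 : (upd (upd (upd g a (g a + (g r - g r))) b (g r - g r)) r (g r), o) = (g, o).
    by feq.
  rewrite e0 subn0 in e; apply: (XSeq e).
  have <- : (upd (upd (upd (upd (upd g a (g a + g r)) b (g r)) r 0) r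
     (upd (upd (upd g a (g a + g r)) b (g r)) r 0 r + upd (upd (upd g a (g a + g r)) b (g r)) r 0 b)) b 0, o)
     = (upd g a (g a + g r), o) by feq.
  exact: e'.
have -> : g r * 9 + 2 = (g r * 5 + 1) + (g r * 4 + 1) by lia.
apply: leq_add; first exact: l.
by move: l'; upds.
Qed.

Definition regs (l : seq nat) : nat -> nat := fun i => nth 0 l i.
(** The successor keeps the argument of the growth bounds positive, as [bd_comp] requires. *)
Definition mx (l : seq nat) : nat := (\max_(y <- l) y).+1.

Lemma mx_cat l s : mx (l ++ s) = maxn (mx l) (mx s).
Proof. by rewrite /mx big_cat /= maxnSS. Qed.

Lemma mx_cons y s : mx (y :: s) = maxn y.+1 (mx s).
Proof. by rewrite /mx big_cons maxnSS. Qed.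

Lemma mx_nil : mx [::] = 1. Proof. by rewrite /mx big_nil. Qed.

Lemma nth_mx l i : nth 0 l i < mx l.
Proof.
case: (ltnP i (size l)) => il; last by rewrite nth_default.
rewrite /mx ltnS (big_nth 0) big_mkord; exact: (leq_bigmax (Ordinal il)).
Qed.

Lemma eq_regs l s t : (forall i, nth 0 s i = nth 0 t i) -> regs (l ++ s) = regs (l ++ t).
Proof. by move=> e; apply: functional_extensionality => i; rewrite /regs !nth_cat e. Qed.

Lemma upd_regs l s i v : upd (regs (l ++ s)) (size l + i) v = regs (l ++ set_nth 0 s i v).
Proof.
apply: functional_extensionality => j; rewrite /regs updE !nth_cat nth_set_nth /=.
by case: (ltnP j (size l)) => jl; do !case: eqP => ? //; lia.
Qed.

Lemma regs_add l s i : regs (l ++ s) (size l + i) = nth 0 s i.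
Proof. by rewrite /regs nth_cat ltnNge leq_addr addKn. Qed.


(** Composition costs one level: two applications of a level are no more than the [x+1] that make up
    the next one. So every fixed arithmetic expression is bounded by a finite level, which [bds]
    finds by unification. *)
Lemma bd_comp m m' a y x : 0 < x -> y <= fast 0 m' x -> a <= fast 0 m y ->
  a <= fast 0 (maxn m m').+1 x.
Proof.
move=> x0 yx ay; rewrite fast_succ.
have le : iter 2 (fast 0 (maxn m m')) x <= iter x.+1 (fast 0 (maxn m m')) x.
  by apply: leq_iter_count; [exact: fast_gt|lia].
apply: leq_trans le => /=; apply: (leq_trans ay); apply: leq_fast; first exact: leq_maxl.
by apply: (leq_trans yx); apply: leq_fast_index; exact: leq_maxr.
Qed.

Lemma fast01 x : fast 0 1 x = x + x.+1.
Proof. by rewrite fast_succ -[fast 0 0]/succn iter_succn. Qed.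

Lemma fast02 x : x * x <= fast 0 2 x.
Proof.
have it j : j * x <= iter j (fast 0 1) x.
  elim: j => // j IH; rewrite iterS fast01 mulSn.
  have : x <= iter j (fast 0 1) x by apply: leq_iter_self; exact: fast_gt.
  by move: IH; lia.
by rewrite fast_succ; apply: leq_trans (it x.+1); rewrite mulSn leq_addl.
Qed.

Lemma bd_max m m' a b x : a <= fast 0 m x -> b <= fast 0 m' x -> maxn a b <= fast 0 (maxn m m') x.
Proof.
move=> am bm; rewrite geq_max (leq_trans am) ?(leq_trans bm) //; apply: leq_fast_index.
  exact: leq_maxr.
exact: leq_maxl.
Qed.

Lemma bd_add m m' a b x : 0 < x -> a <= fast 0 m x -> b <= fast 0 m' x ->
  a + b <= fast 0 (maxn 1 (maxn m m')).+1 x.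
Proof.
move=> x0 am bm; apply: (bd_comp x0 (bd_max am bm)); rewrite fast01.
by have := leq_maxl a b; have := leq_maxr a b; lia.
Qed.

Lemma bd_mul m m' a b x : 0 < x -> a <= fast 0 m x -> b <= fast 0 m' x ->
  a * b <= fast 0 (maxn 2 (maxn m m')).+1 x.
Proof.
move=> x0 am bm; apply: (bd_comp x0 (bd_max am bm)); apply: leq_trans (fast02 _).
by apply: leq_mul; [exact: leq_maxl|exact: leq_maxr].
Qed.

Lemma bd_const c x : 0 < x -> c <= fast 0 c x.
Proof. by move=> x0; apply: ltnW; apply: fast_gt_index. Qed.

Lemma bd_arg x : x <= fast 0 0 x. Proof. exact: ltnW (fast_gt _ _ _). Qed.

Lemma bd_leq m a b x : a <= b -> b <= fast 0 m x -> a <= fast 0 m x.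
Proof. exact: leq_trans. Qed.

Lemma mx_gt0 l : 0 < mx l. Proof. by []. Qed.

Ltac bds := repeat first [eassumption | exact: mx_gt0 | apply: bd_add | apply: bd_mul | apply: bd_const | exact: bd_arg].

Section Computes.
Variable T : Type.
Implicit Types (G : seq (T -> nat)) (f : T -> nat).

Definition vals G (x : T) : seq nat := [seq g x | g <- G].

(* The program pushes the value of [f] on the stack of registers whose current
   contents are given by [G]. *)
Definition computesG G f : Prop := exists p m m', forall x o, exists n,
  [/\ cexec p (regs (vals G x), o) n (regs (vals G x ++ [:: f x]), o),
      n <= fast 0 m (mx (vals G x)) & f x <= fast 0 m' (mx (vals G x))].

Definition printsG G (F : T -> seq (option bool)) : Prop := exists p m, forall x o, exists n,
  cexec p (regs (vals G x), o) n (regs (vals G x), o ++ F x) /\ n <= fast 0 m (mx (vals G x)).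

Lemma size_vals G x : size (vals G x) = size G. Proof. by rewrite size_map. Qed.

Lemma vals_cat G H x : vals (G ++ H) x = vals G x ++ vals H x. Proof. exact: map_cat. Qed.

Lemma computesG_var G f : List.In f G -> computesG G f.
Proof.
move=> /(In_index (fun=> 0))[i iG e].
exists (WSeq (WWhile i (WSeq (WDec i) (WSeq (WInc (size G + 0)) (WInc (size G + 1)))))
   (WWhile (size G + 1) (WSeq (WDec (size G + 1)) (WInc i)))); eexists; exists 0 => x o.
have vi : regs (vals G x) i = f x by rewrite /regs (nth_map (fun=> 0)) // e.
have big j : regs (vals G x) (size G + j) = 0 by rewrite /regs nth_default // size_vals leq_addr.
have [||||n [ex le]] := @copy_exec i (size G + 0) (size G + 1) (regs (vals G x)) o; try by apply/eqP; lia.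
  exact: big.
rewrite big vi in ex le.
have fx : f x <= fast 0 0 (mx (vals G x)).
  by apply: leq_trans (ltnW (fast_gt _ _ _)); rewrite -vi; exact: ltnW (nth_mx _ _).
exists n; split=> //; last by apply: (bd_leq le); bds.
by move: ex; rewrite -{2}[vals G x]cats0 -(size_vals G x) upd_regs.
Qed.

Lemma computesG_zero G : computesG G (fun=> 0).
Proof.
exists (WSeq (WInc (size G)) (WDec (size G))); eexists; exists 0 => x o; exists (1 + 1); split=> //; last by bds.
set g := regs _.
have g0 : g (size G) = 0 by rewrite /g /regs nth_default // size_vals.
have -> : (regs (vals G x ++ [:: 0]), o) =
    (upd (upd g (size G) (g (size G)).+1) (size G) (upd g (size G) (g (size G)).+1 (size G)).-1, o).
  have -> : regs (vals G x ++ [:: 0]) = g.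
    by rewrite /g -{2}[vals G x]cats0; apply: eq_regs => -[|[|i]].
  by feq.
by apply: XSeq; [apply: XInc|apply: XDec; rewrite updE eqxx].
Qed.

Lemma computesG_succ G f : computesG G f -> computesG G (fun x => (f x).+1).
Proof.
case=> p [m [m' h]]; exists (WSeq p (WInc (size G + 0))); eexists; eexists => x o.
have [n [ex ln lf]] := h x o; exists (n + 1); split; [|by bds|by rewrite -addn1; bds].
apply: XSeq ex _; rewrite -(size_vals G x).
have -> : regs (vals G x ++ [:: (f x).+1]) =
   upd (regs (vals G x ++ [:: f x])) (size (vals G x) + 0) (regs (vals G x ++ [:: f x]) (size (vals G x) + 0)).+1.
  by rewrite upd_regs regs_add.
exact: XInc.
Qed.

End Computes.

Section ListRegisters.
Variables (l : seq nat) (o : seq (option bool)).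
Local Notation d := (size l).

Lemma inc_regs s i : cexec (WInc (d + i)) (regs (l ++ s), o) 1 (regs (l ++ set_nth 0 s i (nth 0 s i).+1), o).
Proof. by rewrite -upd_regs -(regs_add l); apply: XInc. Qed.

Lemma dec_regs s i : 0 < nth 0 s i ->
  cexec (WDec (d + i)) (regs (l ++ s), o) 1 (regs (l ++ set_nth 0 s i (nth 0 s i).-1), o).
Proof. by rewrite -upd_regs -(regs_add l); apply: XDec. Qed.

Lemma clear_regs s i : exists n,
  cexec (WWhile (d + i) (WDec (d + i))) (regs (l ++ s), o) n (regs (l ++ set_nth 0 s i 0), o) /\
  n <= nth 0 s i * 3 + 1.
Proof. by rewrite -upd_regs -(regs_add l); apply: clear_exec. Qed.

Lemma move_regs s i j : i != j -> exists n,
  cexec (WWhile (d + i) (WSeq (WDec (d + i)) (WInc (d + j)))) (regs (l ++ s), o) n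
    (regs (l ++ set_nth 0 (set_nth 0 s j (nth 0 s j + nth 0 s i)) i 0), o) /\
  n <= nth 0 s i * 4 + 1.
Proof. by move=> ij; rewrite -!upd_regs -!(regs_add l); apply: move_exec; rewrite eqn_add2l. Qed.

End ListRegisters.

Fixpoint prec (a : nat) (h : nat -> nat -> nat) (n : nat) : nat :=
  if n is j.+1 then h j (prec a h j) else a.

(* A program of [h] is run in the context extended by the number of rounds left,
   the number of rounds done and the value so far. *)
Definition loop_ctx (T : Type) (G : seq (T -> nat)) : seq (T * (nat * nat * nat) -> nat) :=
  [seq (fun y => g y.1) | g <- G] ++ [:: fun y => y.2.1.1; fun y => y.2.1.2; fun y => y.2.2].

Lemma vals_loop T (G : seq (T -> nat)) x c i v : vals (loop_ctx G) (x, (c, i, v)) = vals G x ++ [:: c; i; v].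
Proof. by rewrite /vals /loop_ctx map_cat -map_comp. Qed.

(** Adding the parameters to the value turns one round into a step in a single variable, bounded by
    one fixed level. [N] rounds are an iterate of that level and are absorbed by the next one. *)
Lemma prec_bound (X N a M : nat) (h : nat -> nat -> nat) :
  (forall i v, h i v <= fast 0 M (X + N + v + i + 1)) ->
  forall j, j <= N -> prec a h j + X + N + N + 2 <= fast 0 (maxn 1 (maxn M 0)).+2 (X + N + N + 2 + a).
Proof.
move=> hb j jN; set M' := (maxn 1 (maxn M 0)).+1; set Y0 := X + N + N + 2 + a.
have st : prec a h j + X + N + N + 2 <= iter j (fast 0 M') Y0.
  elim: j jN => [|j IH] jN; first by rewrite /= /Y0; lia.
  have {}IH := IH (ltnW jN); set Y := iter j _ _ in IH; rewrite iterS -/Y /=.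
  have Ypos : 0 < Y by lia.
  have := bd_add Ypos (leqnn (fast 0 M Y)) (bd_arg Y); apply: leq_trans.
  have : h j (prec a h j) <= fast 0 M Y by apply: leq_trans (hb _ _) _; apply: fast_leq; lia.
  by lia.
apply: leq_trans st _; rewrite [fast 0 M'.+1 _]fast_succ; apply: leq_iter_count; first exact: fast_gt.
by rewrite /Y0; lia.
Qed.

(** Above the context, register [L] holds the rounds left, [L+1] the rounds done, [L+2] the value
    and [L+3] the result of [h], which replaces the value after each round. In the end the value
    moves down to [L]. *)
Lemma computesG_rec T (G : seq (T -> nat)) (n a : T -> nat) (h : T * (nat * nat) -> nat) :
  computesG G n -> computesG (G ++ [:: n; fun=> 0]) a ->
  computesG (loop_ctx G) (fun y => h (y.1, (y.2.1.2, y.2.2))) ->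
  computesG G (fun x => prec (a x) (fun i v => h (x, (i, v))) (n x)).
Proof.
case=> pn [mtn [mn hn]] [pa [mta [ma ha]]] [ph [mth [mh hh]]].
pose L := size G.
pose body := WSeq (WDec (L + 0)) (WSeq ph (WSeq (WWhile (L + 2) (WDec (L + 2)))
  (WSeq (WWhile (L + 3) (WSeq (WDec (L + 3)) (WInc (L + 2)))) (WInc (L + 1))))).
exists (WSeq pn (WSeq pa (WSeq (WWhile (L + 0) body) (WSeq (WWhile (L + 1) (WDec (L + 1)))
  (WWhile (L + 2) (WSeq (WDec (L + 2)) (WInc (L + 0)))))))).
(* The two levels must not depend on [x]; they stay open until the bounds of all phases have been
   assembled. *)
eexists; eexists => x o.
have [tn [en ltn' lvn]] := hn x o.
have [ta [ea lta lva]] := ha x o.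
rewrite vals_cat [vals [:: _; _] x]/= in ea lta lva.
set l := vals G x in en ltn' lvn ea lta lva *.
have sl : size l = L by rewrite size_vals.
set N := n x in en lvn ea lta lva *; set A := a x in ea lva *; set H := fun i v => h (x, (i, v)).
set X := mx l in ltn' lvn *.
have X0 : 0 < X by [].
have mx2 : mx (l ++ [:: N; 0]) <= X + N + N + 2 by rewrite mx_cat !mx_cons mx_nil !geq_max -/X; lia.
have hX := bd_arg X.
have hc := bd_add X0 (bd_add X0 (bd_add X0 hX lvn) lvn) (bd_const 2 X0).
have hA := bd_comp X0 hc (leq_trans lva (fast_leq 0 ma mx2)).
have hta := bd_comp X0 hc (leq_trans lta (fast_leq 0 mta mx2)).
have hY0 := bd_add X0 hc hA.
have hb i v : H i v <= fast 0 mh (X + N + v + i + 1).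
  have [_ [_ _ lh]] := hh (x, (0, i, v)) o; rewrite vals_loop /= in lh.
  apply: leq_trans lh _; apply: fast_leq; rewrite mx_cat !mx_cons mx_nil !geq_max -/l -/X; lia.
have hp := @prec_bound X N A mh H hb.
have hZ := bd_comp X0 hY0 (leqnn (fast 0 (maxn 1 (maxn mh 0)).+2 (X + N + N + 2 + A))).
set Z := fast 0 (maxn 1 (maxn mh 0)).+2 (X + N + N + 2 + A) in hZ.
have {}hp j : j <= N -> prec A H j + X + N + N + 2 <= Z by apply: hp.
have hth := bd_comp X0 hZ (leqnn (fast 0 mth Z)).
pose tb := 1 + (fast 0 mth Z + ((Z * 3 + 1) + ((Z * 4 + 1) + 1))).
pose S t : cst := (regs (l ++ [:: t; N - t; prec A H (N - t)]), o).
have [||tl [el ll]] := @cexec_loop (L + 0) body S tb N.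
- by move=> j _; rewrite /S /= -sl regs_add.
- move=> j jN; set i := N - j.+1; set v := prec A H i.
  have iN : i <= N by rewrite /i; lia.
  have ei : N - j = i.+1 by rewrite /i; lia.
  have vZ := hp i iN; have vZ' := hp i.+1 (ltac:(rewrite /i; lia)).
  have [th [eh lth lvh]] := hh (x, (j, i, v)) o; rewrite vals_loop /= -/l in eh lth lvh.
  have lth' : th <= fast 0 mth Z.
    by apply: leq_trans lth _; apply: fast_leq; rewrite mx_cat !mx_cons mx_nil !geq_max -/X /i /v; lia.
  have [t3 [e3 l3]] := clear_regs l o ([:: j; i; v; H i v]) 2; rewrite /= sl in e3 l3.
  have [//|t4 [e4 l4]] := @move_regs l o ([:: j; i; 0; H i v]) 3 2; rewrite /= sl add0n in e4 l4.
  exists (1 + (th + (t3 + (t4 + 1)))); split; last first.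
    have : v <= Z by rewrite /v; lia.
    have : H i v <= Z by move: vZ'; rewrite /= -/v; lia.
    by rewrite /tb; lia.
  apply: (XSeq (s1 := (regs (l ++ [:: j; i; v]), o))).
    have := @dec_regs l o [:: j.+1; i; v] 0 isT; rewrite /= sl; exact.
  apply: (XSeq (s1 := (regs (l ++ [:: j; i; v; H i v]), o))).
    by move: eh; rewrite -catA.
  apply: XSeq e3 _; apply: XSeq e4 _.
  have := @inc_regs l o [:: j; i; H i v; 0] 1; rewrite /= sl /S ei /= -/v.
  have -> : regs (l ++ [:: j; i.+1; H i v; 0]) = regs (l ++ [:: j; i.+1; H i v]).
    by apply: eq_regs => -[|[|[|[|[|q]]]]].
  exact.
have [t5 [e5 l5]] := clear_regs l o ([:: 0; N; prec A H N]) 1; rewrite /= sl in e5 l5.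
have [//|t6 [e6 l6]] := @move_regs l o ([:: 0; 0; prec A H N]) 2 0; rewrite /= sl add0n in e6 l6.
have NZ : N <= Z by have := hp 0 (leq0n _); lia.
have PZ : prec A H N <= Z by have := hp N (leqnn _); lia.
exists (tn + (ta + (tl + (t5 + t6)))); split; last first.
- by apply: bd_leq PZ hZ.
- apply: (@bd_leq _ _ (tn + (ta + ((Z * (tb + 2) + 1) + ((Z * 3 + 1) + (Z * 4 + 1)))))).
    have : N * (tb + 2) <= Z * (tb + 2) by rewrite leq_mul2r NZ orbT.
    by lia.
  by rewrite /tb; bds.
apply: XSeq en _; apply: (XSeq (s1 := (regs (l ++ [:: N; 0; A]), o))).
  have -> : regs (l ++ [:: N]) = regs (l ++ [:: N; 0]) by apply: eq_regs => -[|[|[|i]]].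
  by move: ea; rewrite -catA.
apply: (XSeq (s1 := S 0)).
  by move: el; rewrite /S subnn.
rewrite /S subn0; apply: XSeq e5 _.
have -> : regs (l ++ [:: prec A H N]) = regs (l ++ [:: prec A H N; 0; 0]).
  by apply: eq_regs => -[|[|[|[|i]]]].
exact: e6.
Qed.

Definition print_ctx (T : Type) (G : seq (T -> nat)) : seq (T * (nat * nat) -> nat) :=
  [seq (fun y => g y.1) | g <- G] ++ [:: fun y => y.2.1; fun y => y.2.2].

Lemma vals_print T (G : seq (T -> nat)) x c i : vals (print_ctx G) (x, (c, i)) = vals G x ++ [:: c; i].
Proof. by rewrite /vals /print_ctx map_cat -map_comp. Qed.

Lemma printsG_loop T (G : seq (T -> nat)) (n : T -> nat) (F : T * nat -> seq (option bool)) :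
  computesG G n -> printsG (print_ctx G) (fun y => F (y.1, y.2.2)) ->
  printsG G (fun x => flatten [seq F (x, i) | i <- iota 0 (n x)]).
Proof.
case=> pn [mtn [mn hn]] [pb [mb hb]].
pose L := size G.
pose body := WSeq (WDec (L + 0)) (WSeq pb (WInc (L + 1))).
exists (WSeq pn (WSeq (WWhile (L + 0) body) (WWhile (L + 1) (WDec (L + 1))))).
eexists => x o.
have [tn [en ltn' lvn]] := hn x o.
set l := vals G x in en ltn' lvn *.
have sl : size l = L by rewrite size_vals.
set N := n x in en lvn *; set X := mx l in ltn' lvn *.
have X0 : 0 < X by [].
have hc := bd_add X0 (bd_add X0 (bd_arg X) lvn) (bd_const 1 X0).
have htb := bd_comp X0 hc (leqnn (fast 0 mb (X + N + 1))).
pose tb := 1 + (fast 0 mb (X + N + 1) + 1).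
pose S t : cst := (regs (l ++ [:: t; N - t]), o ++ flatten [seq F (x, i) | i <- iota 0 (N - t)]).
have [||tl [el ll]] := @cexec_loop (L + 0) body S tb N.
- by move=> j _; rewrite /S /= -sl regs_add.
- move=> j jN; set i := N - j.+1; have ei : N - j = i.+1 by rewrite /i; lia.
  set o1 := o ++ flatten [seq F (x, i') | i' <- iota 0 i].
  have [th [eh lth]] := hb (x, (j, i)) o1; rewrite vals_print /= -/l in eh lth.
  exists (1 + (th + 1)); split; last first.
    rewrite /tb !leq_add2l leq_add2r; apply: leq_trans lth _; apply: fast_leq.
    by rewrite mx_cat !mx_cons mx_nil !geq_max -/X /i; lia.
  apply: (XSeq (s1 := (regs (l ++ [:: j; i]), o1))).
    have := @dec_regs l o1 [:: j.+1; i] 0 isT; rewrite /= sl; exact.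
  apply: XSeq eh _.
  have := @inc_regs l (o1 ++ F (x, i)) [:: j; i] 1; rewrite /= sl /S ei.
  have -> : iota 0 i.+1 = iota 0 i ++ [:: i] by rewrite -addn1 iotaD.
  by rewrite map_cat flatten_cat /= cats0 catA.
have [t5 [e5 l5]] := clear_regs l (o ++ flatten [seq F (x, i) | i <- iota 0 N]) ([:: 0; N]) 1.
rewrite /= sl in e5 l5.
exists (tn + (tl + t5)); split; last first.
  apply: (@bd_leq _ _ (tn + ((N * (tb + 2) + 1) + (N * 3 + 1)))); first by lia.
  by rewrite /tb; bds.
apply: XSeq en _; apply: (XSeq (s1 := S 0)).
  have -> : (regs (l ++ [:: N]), o) = S N.
    by rewrite /S subnn /= cats0; congr pair; apply: eq_regs => -[|[|[|i]]].
  exact: el.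
rewrite /S subn0.
have -> : regs l = regs (l ++ [:: 0; 0]).
  by rewrite -{1}[l]cats0; apply: eq_regs => -[|[|[|i]]].
exact: e5.
Qed.

Lemma printsG_sym T (G : seq (T -> nat)) b : printsG G (fun=> [:: b]).
Proof.
by exists (WOut b); eexists => x o; exists 1; split; [rewrite cats1; apply: XOut|bds].
Qed.

Lemma printsG_cat T (G : seq (T -> nat)) F F' :
  printsG G F -> printsG G F' -> printsG G (fun x => F x ++ F' x).
Proof.
case=> p [m h] [p' [m' h']]; exists (WSeq p p'); eexists => x o.
have [n [e le]] := h x o; have [n' [e' le']] := h' x (o ++ F x).
by exists (n + n'); split; [apply: XSeq e _; rewrite catA|bds].
Qed.

(** * Primitive recursive functions and the words they print *)

Lemma In_map S T (f : S -> T) s y : List.In y (map f s) <-> exists2 x, List.In x s & f x = y.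
Proof.
elim: s => [|x s IH]; first by split=> [|[]].
split=> [[<-|/IH[z zs <-]]|[z [<-|zs] ez]]; [by exists x; [left|]|by exists z; [right|]|by left|].
by right; apply/IH; exists z.
Qed.

Definition lift S T (phi : S -> T) (V : seq (T -> nat)) : seq (S -> nat) :=
  [seq (fun y => v (phi y)) | v <- V].

(* [f] is computable from the functions in [V], in every context that provides
   them. *)
Definition comp T (V : seq (T -> nat)) (f : T -> nat) : Prop :=
  forall S (phi : S -> T) G, List.incl (lift phi V) G -> computesG G (fun y => f (phi y)).

Definition prt T (V : seq (T -> nat)) (F : T -> seq (option bool)) : Prop :=
  forall S (phi : S -> T) G, List.incl (lift phi V) G -> printsG G (fun y => F (phi y)).

Definition bind1 T (V : seq (T -> nat)) : seq (T * nat -> nat) := lift fst V ++ [:: snd].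
Definition bind2 T (V : seq (T -> nat)) : seq (T * (nat * nat) -> nat) :=
  lift fst V ++ [:: fun y => y.2.1; fun y => y.2.2].

Lemma incl_lift S T (phi : S -> T) V V' : List.incl V V' -> List.incl (lift phi V) (lift phi V').
Proof. by move=> le y /In_map[v /le vV <-]; apply/In_map; exists v. Qed.

Lemma comp_ext T (V : seq (T -> nat)) f g : comp V f -> f =1 g -> comp V g.
Proof. by move=> + /functional_extensionality<-. Qed.

Lemma prt_ext T (V : seq (T -> nat)) F F' : prt V F -> F =1 F' -> prt V F'.
Proof. by move=> + /functional_extensionality<-. Qed.

Lemma lift_comp R S T (phi : R -> S) (psi : S -> T) V :
  lift (fun y => psi (phi y)) V = lift phi (lift psi V).
Proof. by rewrite /lift -map_comp. Qed.

Lemma comp_lift S T (psi : S -> T) V V' f : comp V f -> List.incl (lift psi V) V' ->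
  comp V' (fun y => f (psi y)).
Proof.
move=> cf le R phi G leG; apply: (cf R (fun y => psi (phi y)) G).
by rewrite lift_comp => y yV; apply: leG; apply: (incl_lift le).
Qed.

Lemma prt_lift S T (psi : S -> T) V V' F : prt V F -> List.incl (lift psi V) V' ->
  prt V' (fun y => F (psi y)).
Proof.
move=> cf le R phi G leG; apply: (cf R (fun y => psi (phi y)) G).
by rewrite lift_comp => y yV; apply: leG; apply: (incl_lift le).
Qed.

Lemma comp_bind1 T (V : seq (T -> nat)) f : comp V f -> comp (bind1 V) (fun y => f y.1).
Proof. by move=> cf; apply: (comp_lift cf); apply: List.incl_appl; apply: List.incl_refl. Qed.

Lemma prt_bind1 T (V : seq (T -> nat)) F : prt V F -> prt (bind1 V) (fun y => F y.1).
Proof. by move=> cf; apply: (prt_lift cf); apply: List.incl_appl; apply: List.incl_refl. Qed.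

Lemma comp_bind2 T (V : seq (T -> nat)) f : comp V f -> comp (bind2 V) (fun y => f y.1).
Proof. by move=> cf; apply: (comp_lift cf); apply: List.incl_appl; apply: List.incl_refl. Qed.

Lemma comp_var T (V : seq (T -> nat)) f : List.In f V -> comp V f.
Proof. by move=> fV S phi G le; apply: computesG_var; apply: le; apply/In_map; exists f. Qed.

Lemma comp_idx1 T (V : seq (T -> nat)) : comp (bind1 V) snd.
Proof. by apply: comp_var; apply/In_cat; right; left. Qed.

Lemma comp_idx T (V : seq (T -> nat)) : comp (bind2 V) (fun y => y.2.1).
Proof. by apply: comp_var; apply/In_cat; right; left. Qed.

Lemma comp_acc T (V : seq (T -> nat)) : comp (bind2 V) (fun y => y.2.2).
Proof. by apply: comp_var; apply/In_cat; right; right; left. Qed.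

Arguments comp_idx1 {T} V.
Arguments comp_idx {T} V.
Arguments comp_acc {T} V.

Lemma comp_succ T (V : seq (T -> nat)) f : comp V f -> comp V (fun x => (f x).+1).
Proof. by move=> cf S phi G le; apply: computesG_succ; apply: cf. Qed.

Lemma comp_const T (V : seq (T -> nat)) c : comp V (fun=> c).
Proof.
elim: c => [|c IH]; last exact: comp_succ IH.
by move=> S phi G _; apply: computesG_zero.
Qed.

Arguments comp_const {T} V c.

Lemma comp_rec T (V : seq (T -> nat)) n a h : comp V n -> comp V a -> comp (bind2 V) h ->
  comp V (fun x => prec (a x) (fun i v => h (x, (i, v))) (n x)).
Proof.
move=> cn ca ch S phi G le.
apply: (@computesG_rec S G (fun y => n (phi y)) (fun y => a (phi y)) (fun y => h (phi y.1, y.2))).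
- exact: cn.
- by apply: ca; apply: List.incl_appl.
- apply: (ch _ (fun y : S * (nat * nat * nat) => (phi y.1, (y.2.1.2, y.2.2)))).
  move=> y /In_map[v /In_cat[/In_map[u uV <-]|[<-|[<-|//]]] <-]; apply/In_cat.
  + left; apply/In_map; exists (fun z => u (phi z)) => //.
    by apply: le; apply/In_map; exists u.
  + by right; right; left.
  + by right; right; right; left.
Qed.

Lemma prt_loop T (V : seq (T -> nat)) n F : comp V n -> prt (bind1 V) F ->
  prt V (fun x => flatten [seq F (x, i) | i <- iota 0 (n x)]).
Proof.
move=> cn cF S phi G le.
apply: (@printsG_loop S G (fun y => n (phi y)) (fun y => F (phi y.1, y.2))); first exact: cn.
apply: (cF _ (fun y : S * (nat * nat) => (phi y.1, y.2.2))).
move=> y /In_map[v /In_cat[/In_map[u uV <-]|[<-|//]] <-]; apply/In_cat.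
- left; apply/In_map; exists (fun z => u (phi z)) => //.
  by apply: le; apply/In_map; exists u.
- by right; right; left.
Qed.

Lemma prt_sym T (V : seq (T -> nat)) b : prt V (fun=> [:: b]).
Proof. by move=> S phi G _; apply: printsG_sym. Qed.

Arguments prt_sym {T} V b.

Lemma prt_cat T (V : seq (T -> nat)) F F' : prt V F -> prt V F' -> prt V (fun x => F x ++ F' x).
Proof. by move=> c c' S phi G le; apply: (@printsG_cat S G (fun y => F (phi y)) (fun y => F' (phi y))); [apply: c|apply: c']. Qed.

(** * Closure of the computable functions under elementary arithmetic *)

Section Arithmetic.
Variables (T : Type) (V : seq (T -> nat)).
Implicit Types (f g : T -> nat) (b c : T -> bool).
Local Notation cmp := (comp V).

Lemma comp_add f g : cmp f -> cmp g -> cmp (fun x => f x + g x).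
Proof.
move=> cf cg; apply: (comp_ext (comp_rec cg cf (comp_succ (comp_acc V)))) => x /=.
by elim: (g x) => [|n IH] /=; rewrite ?addn0 // IH addnS.
Qed.

Lemma comp_pred f : cmp f -> cmp (fun x => (f x).-1).
Proof. by move=> cf; apply: (comp_ext (comp_rec cf (comp_const V 0) (comp_idx V))) => x; case: (f x). Qed.

Lemma comp_not f : cmp f -> cmp (fun x => nat_of_bool (f x == 0)).
Proof.
move=> cf; apply: (comp_ext (comp_rec cf (comp_const V 1) (comp_const _ 0))) => x.
by case: (f x).
Qed.

Lemma comp_if b f g : cmp (fun x => nat_of_bool (b x)) -> cmp f -> cmp g ->
  cmp (fun x => if b x then f x else g x).
Proof.
move=> cb cf cg; apply: (comp_ext (comp_rec cb cg (comp_bind2 cf))) => x.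
by case: (b x).
Qed.

End Arithmetic.

Section Arithmetic2.
Variables (T : Type) (V : seq (T -> nat)).
Implicit Types (f g : T -> nat) (b c : T -> bool).
Local Notation cmp := (comp V).

Lemma comp_sub f g : cmp f -> cmp g -> cmp (fun x => f x - g x).
Proof.
move=> cf cg; apply: (comp_ext (comp_rec cg cf (comp_pred (comp_acc V)))) => x /=.
by elim: (g x) => [|n IH] /=; rewrite ?subn0 // IH subnS.
Qed.

Lemma comp_mul f g : cmp f -> cmp g -> cmp (fun x => f x * g x).
Proof.
move=> cf cg; apply: (comp_ext (comp_rec cg (comp_const V 0) (comp_add (comp_acc V) (comp_bind2 cf)))) => x /=.
by elim: (g x) => [|n IH] /=; rewrite ?muln0 // IH mulnS addnC.
Qed.

Lemma comp_odd f : cmp f -> cmp (fun x => nat_of_bool (odd (f x))).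
Proof.
move=> cf; apply: (comp_ext (comp_rec cf (comp_const V 0) (comp_not (comp_acc V)))) => x /=.
by elim: (f x) => [|n IH] //=; rewrite IH; case: (odd n).
Qed.

Lemma comp_eq f g : cmp f -> cmp g -> cmp (fun x => nat_of_bool (f x == g x)).
Proof.
move=> cf cg; apply: (comp_ext (comp_not (comp_add (comp_sub cf cg) (comp_sub cg cf)))) => x.
by rewrite addn_eq0 !subn_eq0 -eqn_leq.
Qed.

Lemma comp_lt f g : cmp f -> cmp g -> cmp (fun x => nat_of_bool (f x < g x)).
Proof. by move=> cf cg; apply: (comp_not (f := fun x => (f x).+1 - g x)); apply: comp_sub => //; apply: comp_succ. Qed.

Lemma comp_and b c : cmp (fun x => nat_of_bool (b x)) -> cmp (fun x => nat_of_bool (c x)) ->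
  cmp (fun x => nat_of_bool (b x && c x)).
Proof. by move=> cb cc; apply: (comp_ext (comp_mul cb cc)) => x; rewrite mulnb. Qed.

Lemma comp_neg b : cmp (fun x => nat_of_bool (b x)) -> cmp (fun x => nat_of_bool (~~ b x)).
Proof. by move=> cb; apply: (comp_ext (comp_not cb)) => x; case: (b x). Qed.

Lemma comp_double f : cmp f -> cmp (fun x => (f x).*2).
Proof. by move=> cf; apply: (comp_ext (comp_add cf cf)) => x; rewrite addnn. Qed.

End Arithmetic2.

Lemma comp_half T (V : seq (T -> nat)) f : comp V f -> comp V (fun x => (f x)./2).
Proof.
move=> cf; apply: (comp_ext (comp_rec cf (comp_const V 0) (comp_add (comp_acc V) (comp_odd (comp_idx V))))) => x /=.
by elim: (f x) => [|n IH] //=; rewrite IH uphalf_half addnC.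
Qed.

Lemma comp_shr T (V : seq (T -> nat)) f i : comp V f -> comp V i ->
  comp V (fun x => iter (i x) half (f x)).
Proof.
move=> cf ci; apply: (comp_ext (comp_rec ci cf (comp_half (comp_acc V)))) => x /=.
by elim: (i x) => //= n ->.
Qed.

Lemma prt_nil T (V : seq (T -> nat)) : prt V (fun=> [::]).
Proof. by apply: (prt_ext (prt_loop (comp_const V 0) (prt_sym _ None))). Qed.

(** Branching is done by two loops of at most one round, exactly one of which is executed. *)
Lemma prt_if T (V : seq (T -> nat)) (b : T -> bool) F F' : comp V (fun x => nat_of_bool (b x)) ->
  prt V F -> prt V F' -> prt V (fun x => if b x then F x else F' x).
Proof.
move=> cb cF cF'; apply: (prt_ext (prt_cat (prt_loop cb (prt_bind1 cF)) (prt_loop (comp_neg cb) (prt_bind1 cF')))) => x.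
by case: (b x); rewrite //= !cats0.
Qed.

(** The binary digits are read off by repeated halving; [n] rounds are always enough, and surplus
    rounds print nothing. *)
Lemma bits_half n m : n <= m ->
  flatten [seq if 0 < iter i half n then [:: odd (iter i half n)] else [::] | i <- iota 0 m] = bits n.
Proof.
have z k : flatten [seq if 0 < iter i half 0 then [:: odd (iter i half 0)] else [::] | i <- iota 0 k] = [::].
  have h i : iter i half 0 = 0 by elim: i => //= i ->.
  by elim: (iota 0 k) => //= j t ->; rewrite h.
have rec n' m' : 0 < n' -> flatten [seq if 0 < iter i half n' then [:: odd (iter i half n')] else [::] | i <- iota 0 m'.+1]
   = odd n' :: flatten [seq if 0 < iter i half n'./2 then [:: odd (iter i half n'./2)] else [::] | i <- iota 0 m'].
  move=> n0; rewrite /= n0 /=; congr cons; rewrite -[1]addn0 iotaDl -map_comp; congr flatten.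
  by apply: eq_map => i; rewrite /= add1n -iterSr.
rewrite /bits; have := bin_of_natK n; case: (bin_of_nat n) => [|p] /= <-; first by rewrite z.
have pos r : 0 < nat_of_pos r by elim: r => //= r; rewrite NatTrec.doubleE double_gt0.
elim: p m => [p IH|p IH|] m; rewrite [nat_of_pos _]/= ?NatTrec.doubleE; case: m => [|m] pm //.
- by rewrite rec // [odd _]/= odd_double [_./2]/= uphalf_double IH //; lia.
- by have := pos p; lia.
- by rewrite rec ?double_gt0 // odd_double doubleK IH //; have := pos p; lia.
- by rewrite rec // z.
Qed.

Lemma prt_num T (V : seq (T -> nat)) f : comp V f -> prt V (fun x => rcons (map some (bits (f x))) None).
Proof.
move=> cf.
have sh : comp (bind1 V) (fun y => iter y.2 half (f y.1)).
  by apply: comp_shr; [apply: comp_bind1|apply: comp_idx1].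
have pb : prt (bind1 V) (fun y => if 0 < iter y.2 half (f y.1) then
    (if odd (iter y.2 half (f y.1)) then [:: Some true] else [:: Some false]) else [::]).
  apply: prt_if; [by apply: comp_lt => //; apply: comp_const| |exact: prt_nil].
  by apply: prt_if; [apply: comp_odd|apply: prt_sym|apply: prt_sym].
apply: (prt_ext (prt_cat (prt_loop cf pb) (prt_sym V None))) => x.
rewrite -cats1 -(bits_half (leqnn (f x))) map_flatten -map_comp; congr (flatten _ ++ _).
by apply: eq_map => i /=; case: ifP => // _; case: ifP.
Qed.

Definition nums T (V : seq (T -> nat)) (s : T -> seq nat) : Prop := prt V (fun x => word_of_nats (s x)).

Lemma word_of_nats_cat s t : word_of_nats (s ++ t) = word_of_nats s ++ word_of_nats t.
Proof. by rewrite /word_of_nats map_cat flatten_cat. Qed.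

Section Nums.
Variables (T : Type) (V : seq (T -> nat)).

Lemma nums_ext s t : nums V s -> s =1 t -> nums V t.
Proof. by move=> + /functional_extensionality<-. Qed.

Lemma nums_nil : nums V (fun=> [::]). Proof. exact: prt_nil. Qed.

Lemma nums_cat s t : nums V s -> nums V t -> nums V (fun x => s x ++ t x).
Proof. by move=> cs ct; apply: (prt_ext (prt_cat cs ct)) => x; rewrite word_of_nats_cat. Qed.

Lemma nums_one f : comp V f -> nums V (fun x => [:: f x]).
Proof. by move=> cf; apply: (prt_ext (prt_num cf)) => x; rewrite /word_of_nats /= cats0. Qed.

Lemma nums_cons f s : comp V f -> nums V s -> nums V (fun x => f x :: s x).
Proof. by move=> cf cs; apply: (nums_ext (nums_cat (nums_one cf) cs)). Qed.

Lemma nums_loop n s : comp V n -> nums (bind1 V) s ->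
  nums V (fun x => flatten [seq s (x, i) | i <- iota 0 (n x)]).
Proof.
move=> cn cs; apply: (prt_ext (prt_loop cn cs)) => x.
by elim: (iota 0 (n x)) => //= i l ->; rewrite word_of_nats_cat.
Qed.

(** For a list fixed in advance, such as the edge templates: the printing program is unrolled along
    it, since its elements are not numbers that a counter could hold. *)
Lemma nums_seq (U : Type) (l : seq U) (s : U -> T -> seq nat) :
  (forall u, List.In u l -> nums V (s u)) -> nums V (fun x => flatten [seq s u x | u <- l]).
Proof.
elim: l => [|u l IH] h; first exact: nums_nil.
by apply: nums_cat; [apply: h; left|apply: IH => v vl; apply: h; right].
Qed.

End Nums.

Lemma nums_map T (V : seq (T -> nat)) n f : comp V n -> comp (bind1 V) f -> nums V (fun x => [seq f (x, i) | i <- iota 0 (n x)]).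
Proof.
move=> cn cf; apply: (nums_ext (nums_loop cn (nums_one cf))) => x.
by elim: (iota 0 (n x)) => //= i l ->.
Qed.

Lemma nums_pairs T (V : seq (T -> nat)) n m f : comp V n -> comp V m -> comp (bind1 (bind1 V)) f ->
  nums V (fun x => [seq f (x, i, j) | i <- iota 0 (n x), j <- iota 0 (m x)]).
Proof.
move=> cn cm cf; apply: (nums_loop (s := fun y => [seq f (y, j) | j <- iota 0 (m y.1)])) => //.
by apply: (nums_map (f := f)) => //; apply: comp_bind1.
Qed.

(** * Printing the instances *)

Lemma iota_blocks m n : iota 0 (m * n) = flatten [seq [seq c * n + i | i <- iota 0 n] | c <- iota 0 m].
Proof.
elim: m => // m IH; rewrite -[in RHS]addn1 iotaD map_cat flatten_cat -IH /= cats0 add0n.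
by rewrite mulSn addnC iotaD add0n -{2}[m * n]addn0 iotaDl.
Qed.

Section Blocks.
Variables (k nf NQ : nat) (tbl : seq (edge patom)).

Definition ed : edge patom := (0, None, 0).

Lemma size_EV : size (EV k tbl) = size tbl * k.+1.
Proof. by rewrite size_allpairs size_iota. Qed.

Lemma evnE c i : c < size tbl -> i <= k -> evn k tbl (c * k.+1 + i) = (nth ed tbl c, i).
Proof.
rewrite /evn /EV => + ik; elim: (tbl) c => // e t IH [|c] ct.
  by rewrite allpairs_cons nth_cat size_map size_iota ltnS ik (nth_map 0) ?size_iota // nth_iota.
rewrite allpairs_cons nth_cat size_map size_iota mulSn -addnA ltnNge leq_addr /= addKn.
exact: IH.
Qed.

(** Separates the templates, whose number is fixed by the machine, from the loop indices, whose
    number varies with the input: the former are unrolled and the latter looped over. *)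
Lemma flatten_events T (F : nat -> edge patom * nat -> seq T) :
  flatten [seq F j (evn k tbl j) | j <- iota 0 (size (EV k tbl))] =
  flatten [seq flatten [seq F (c * k.+1 + i) (nth ed tbl c, i) | i <- iota 0 k.+1] | c <- iota 0 (size tbl)].
Proof.
have evK := evnE; rewrite size_EV iota_blocks map_flatten -map_comp.
have [K eK] : exists K, K = k.+1 by exists k.+1.
rewrite -eK in evK *.
have fl (U : Type) (l : seq (seq (seq U))) : flatten (flatten l) = flatten (map flatten l).
  by elim: l => //= a l IH; rewrite flatten_cat IH.
rewrite fl -map_comp; congr flatten; apply/eq_in_map => c; rewrite mem_iota => /andP[_ ct] /=.
congr flatten; rewrite -map_comp; apply/eq_in_map => i; rewrite mem_iota => /andP[_ ik] /=.
by rewrite evK //; move: ik; rewrite eK.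
Qed.

Local Notation n_pl := (npl k nf NQ).

Lemma sys_table (f : nat -> nat -> nat) (g : edge patom * nat -> nat -> nat) m :
  (forall t p, t < n_pl -> f t p = (p == t)) -> (forall j p, f (n_pl + j) p = g (evn k tbl j) p) ->
  [seq f t p | t <- iota 0 (n_pl + size (EV k tbl)), p <- iota 0 m] =
  [seq nat_of_bool (p == t) | t <- iota 0 n_pl, p <- iota 0 m] ++
  flatten [seq flatten [seq [seq g (nth ed tbl c, i) p | p <- iota 0 m] | i <- iota 0 k.+1] | c <- iota 0 (size tbl)].
Proof.
move=> h1 h2; rewrite iotaD allpairs_cat add0n; congr cat.
  congr flatten; apply/eq_in_map => t; rewrite mem_iota => /andP[_ tn].
  by apply: eq_map => p; apply: h1.
rewrite -(flatten_events (fun _ x => [seq g x p | p <- iota 0 m])).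
rewrite -{1}[n_pl]addn0 iotaDl allpairs_mapl; congr flatten; apply: eq_map => j.
by apply: eq_map => p; apply: h2.
Qed.

End Blocks.

Ltac cmps := repeat first
  [ assumption | apply: comp_const | apply: comp_add | apply: comp_mul | apply: comp_sub
  | apply: comp_double | apply: comp_half | apply: comp_odd | apply: comp_eq | apply: comp_lt
  | apply: comp_and | apply: comp_neg | apply: comp_if | apply: comp_pred | apply: comp_succ ].

Section Templates.
Variables (Sig : finType) (M : tm Sig void) (T : Type) (V : seq (T -> nat)) (k : T -> nat).
Hypothesis ck : comp V k.
Local Notation nf x := (mnf M (k x)).

Lemma comp_mnf : comp V (fun x => nf x).
Proof. by rewrite /mnf; cmps. Qed.

Lemma comp_ctlp (q i : T -> nat) : comp V q -> comp V i -> comp V (fun x => ctlp (k x) (nf x) (q x) (i x)).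
Proof. by move=> cq ci; have cn := comp_mnf; rewrite /ctlp; cmps. Qed.

Lemma comp_npl c : comp V (fun x => npl (k x) (nf x) c).
Proof. by have cn := comp_mnf; rewrite /npl; cmps. Qed.

Variables (i p : T -> nat).
Hypothesis ci : comp V i.
Hypothesis cp : comp V p.

Lemma comp_ev r : comp V (fun x => ev (i x) r).
Proof. by case: r => b [] /=; rewrite /ev /=; cmps. Qed.

Lemma comp_vplace f : comp V f -> comp V (fun x => vplace (f x)).
Proof. by move=> cf; rewrite /vplace; cmps. Qed.

Lemma comp_vfield f : comp V f -> comp V (fun x => vfield (f x)).
Proof. by move=> cf; rewrite /vfield; cmps. Qed.

Lemma comp_lok l : comp V (fun x => nat_of_bool (lok (k x) (nf x) l (i x))).
Proof.
have cn := comp_mnf.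
case: l => [[r|r|r w|r|[]]|] /=; try have cr := comp_ev r; try have cw := comp_ev w; cmps.
Qed.

Variable e : edge patom.

Lemma comp_eok : comp V (fun x => nat_of_bool (eok (k x) (nf x) (e, i x))).
Proof. exact: comp_lok. Qed.

Lemma comp_pre : comp V (fun x =>
  count_mem (p x) (esrc (k x) (nf x) (e, i x) :: etake (k x) (nf x) (e, i x))).
Proof.
have co := comp_eok.
have cs : comp V (fun x => esrc (k x) (nf x) (e, i x)) by apply: comp_ctlp; cmps.
apply: (comp_add (f := fun x => nat_of_bool (esrc (k x) (nf x) (e, i x) == p x))); first by cmps.
rewrite /etake /=; case: e co {cs} => [[q l] q'] co /=.
have ct c : comp V c -> comp V (fun x => count_mem (p x) (if eok (k x) (nf x) ((q, l, q'), i x) then [:: c x] else [::])).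
  move=> cc; apply: (comp_ext (comp_and co (comp_eq cc cp))) => x.
  by case: (eok _ _ _) => //=; rewrite addn0.
have cn : comp V (fun x => count_mem (p x) (if eok (k x) (nf x) ((q, l, q'), i x) then [::] else [::])).
  by apply: (comp_ext (comp_const V 0)) => x; case: (eok _ _ _).
case: l co ct cn => [[r|r|r w|r|c]|] co ct cn //=; apply: ct; try apply: comp_vplace; exact: comp_ev.
Qed.

Lemma comp_post : comp V (fun x =>
  count_mem (p x) (edst (k x) (nf x) (e, i x) :: eput (k x) (nf x) (e, i x))).
Proof.
have co := comp_eok.
have cnx : comp V (fun x => lnxt e.1.2 (i x)) by case: (e.1.2) => [[r|r|r w|r|[]]|] /=; cmps.
have cs : comp V (fun x => edst (k x) (nf x) (e, i x)).
  by apply: comp_if => //; apply: comp_ctlp; cmps.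
apply: (comp_add (f := fun x => nat_of_bool (edst (k x) (nf x) (e, i x) == p x))); first by cmps.
rewrite /eput /=; case: e co {cs cnx} => [[q l] q'] co /=.
have ct c : comp V c -> comp V (fun x => count_mem (p x) (if eok (k x) (nf x) ((q, l, q'), i x) then [:: c x] else [::])).
  move=> cc; apply: (comp_ext (comp_and co (comp_eq cc cp))) => x.
  by case: (eok _ _ _) => //=; rewrite addn0.
have cn : comp V (fun x => count_mem (p x) (if eok (k x) (nf x) ((q, l, q'), i x) then [::] else [::])).
  by apply: (comp_ext (comp_const V 0)) => x; case: (eok _ _ _).
case: l co ct cn => [[r|r|r w|r|c]|] co ct cn //=; apply: ct; try apply: comp_vplace; exact: comp_ev.
Qed.

Lemma comp_efld b f : comp V f -> comp V (fun x => efld (k x) (nf x) b (e, i x) (f x)).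
Proof.
move=> cf; have co := comp_eok; rewrite /efld /=; apply: comp_and => //.
case: e co => [[q l] q'] co /=.
have z c : comp V c -> comp V (fun x => nat_of_bool (Some (b, c x) == Some (b, f x))).
  by move=> cc; apply: (comp_ext (comp_eq cc cf)) => x; congr nat_of_bool; apply/eqP/eqP => [->|[]].
have z' b' c : b' != b -> comp V (fun x => nat_of_bool (Some (b', c x) == Some (b, f x))).
  by move=> bb; apply: (comp_ext (comp_const V 0)) => x; case: eqP => // -[e']; rewrite e' eqxx in bb.
have z0 : comp V (fun x => nat_of_bool (None == Some (b, f x))) by apply: comp_const.
case: l co => [[r|r|r w|r|c]|] co //=; case: (b) z z' z0 => z z' z0 //; try exact: z'.
- by apply: z; apply: comp_vfield; apply: comp_ev.
- by apply: z; apply: comp_vfield; apply: comp_ev.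
Qed.

Lemma comp_tth f : comp V f -> comp V (fun x => tth (k x) (nf x) (e, i x) (f x)).
Proof.
move=> cf; have cn := comp_mnf; rewrite /tth; apply: comp_if; first by cmps.
  exact: comp_efld.
by apply: comp_efld; cmps.
Qed.

End Templates.

Section PrintInstance.
Variables (Sig : finType) (M : tm Sig void) (T : Type) (V : seq (T -> nat)) (k N : T -> nat).
Hypothesis ck : comp V k.
Hypothesis cN : comp V N.
Local Notation nf x := (mnf M (k x)).
Local Notation n_pl x := (npl (k x) (nf x) (mNQ M)).
Local Notation tbl := (mtbl M).

Let ck1 : comp (bind1 V) (fun y => k y.1) := comp_bind1 ck.
Let ck2 : comp (bind1 (bind1 V)) (fun y => k y.1.1) := comp_bind1 ck1.
Let ci2 : comp (bind1 (bind1 V)) (fun y => y.1.2) := comp_bind1 (comp_idx1 V).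
Let cp2 : comp (bind1 (bind1 V)) snd := comp_idx1 _.

Lemma nums_table (g : T -> edge patom * nat -> nat -> nat) :
  (forall e, comp (bind1 (bind1 V)) (fun y => g y.1.1 (e, y.1.2) y.2)) ->
  nums V (fun x => [seq nat_of_bool (p == t) | t <- iota 0 (n_pl x), p <- iota 0 (n_pl x)] ++
    flatten [seq flatten [seq [seq g x (nth ed tbl c, i) p | p <- iota 0 (n_pl x)] | i <- iota 0 (k x).+1]
      | c <- iota 0 (size tbl)]).
Proof.
move=> cg; have cpl := comp_npl M ck (mNQ M).
apply: nums_cat.
  by apply: (nums_pairs (f := fun y => nat_of_bool (y.2 == y.1.2))) => //; apply: comp_eq.
apply: (nums_seq (s := fun c x => flatten [seq [seq g x (nth ed tbl c, i) p | p <- iota 0 (n_pl x)] | i <- iota 0 (k x).+1])).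
move=> c _; apply: (nums_loop (s := fun y => [seq g y.1 (nth ed tbl c, y.2) p | p <- iota 0 (n_pl y.1)])).
  exact: comp_succ.
by apply: (nums_map (f := fun z => g z.1.1 (nth ed tbl c, z.1.2) z.2)) => //; apply: (comp_bind1 cpl).
Qed.

Lemma nums_csys : nums V (fun x => csys (k x) (nf x) (mNQ M) tbl).
Proof.
have cpl := comp_npl M ck (mNQ M); have cn := comp_mnf M ck.
have cne : comp V (fun x => size (EV (k x) tbl)).
  by apply: (comp_ext (comp_mul (comp_const V (size tbl)) (comp_succ ck))) => x; rewrite size_EV.
apply: nums_cat.
  apply: nums_cons => //; apply: nums_cons; first by cmps.
  apply: nums_cat.
    apply: (nums_ext (nums_table (g := fun x e p =>
      count_mem p (esrc (k x) (nf x) e :: etake (k x) (nf x) e)) _)).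
      by move=> e; apply: (comp_pre M ck2 ci2 cp2).
    move=> x; symmetry; apply: (@sys_table (k x) (nf x) (mNQ M) tbl (tpre (k x) (nf x) (mNQ M) tbl)
      (fun e p => count_mem p (esrc (k x) (nf x) e :: etake (k x) (nf x) e))) => [t p tn|j p].
      by rewrite /tpre tn.
    by rewrite /tpre ltnNge leq_addr addKn.
  apply: (nums_ext (nums_table (g := fun x e p =>
    count_mem p (edst (k x) (nf x) e :: eput (k x) (nf x) e)) _)).
    by move=> e; apply: (comp_post M ck2 ci2 cp2).
  move=> x; symmetry; apply: (@sys_table (k x) (nf x) (mNQ M) tbl (tpost (k x) (nf x) (mNQ M) tbl)
    (fun e p => count_mem p (edst (k x) (nf x) e :: eput (k x) (nf x) e))) => [t p tn|j p].
    by rewrite /tpost tn.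
  by rewrite /tpost ltnNge leq_addr addKn.
apply: nums_cons; first exact: comp_const.
apply: nums_cat.
  apply: nums_cons; first exact: comp_const.
  apply: nums_cons; first exact: comp_const.
  apply: nums_cons => //; apply: nums_cons; first by cmps.
  apply: nums_cat.
    apply: (nums_pairs (f := fun y => nat_of_bool (y.1.2 == nf y.1.1 + y.2))) => //; first by cmps.
    by apply: comp_eq => //; apply: comp_add => //; apply: (comp_mnf M ck2).
  apply: (nums_pairs (f := fun y => nat_of_bool (y.1.2 == y.2))) => //; first by cmps.
  exact: comp_eq.
have cn1 := comp_mnf M ck1.
apply: nums_cat.
  apply: (nums_map (f := fun y => nat_of_bool (y.2 < (nf y.1).*2))) => //.
  by apply: comp_lt; [apply: comp_idx1|apply: comp_double].
apply: nums_cat.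
  by apply: (nums_ext (nums_map cpl (comp_idx1 V))) => x; rewrite map_id.
apply: nums_cons => //.
have fe x := flatten_events (k x) tbl (fun j e => (n_pl x + j) :: [seq tth (k x) (nf x) e t | t <- iota 0 (nf x).*2]).
apply: (nums_ext _ (fun x => esym (fe x))).
apply: (nums_seq (s := fun c x => flatten [seq (n_pl x + (c * (k x).+1 + i)) ::
  [seq tth (k x) (nf x) (nth ed tbl c, i) t | t <- iota 0 (nf x).*2] | i <- iota 0 (k x).+1])).
move=> c _; apply: (nums_loop (s := fun y => (n_pl y.1 + (c * (k y.1).+1 + y.2)) ::
  [seq tth (k y.1) (nf y.1) (nth ed tbl c, y.2) t | t <- iota 0 (nf y.1).*2])); first exact: comp_succ.
have cpl1 := comp_npl M ck1 (mNQ M); have ci1 := comp_idx1 V.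
apply: nums_cons; first by cmps.
apply: (nums_map (f := fun z => tth (k z.1.1) (nf z.1.1) (nth ed tbl c, z.1.2) z.2)); first exact: comp_double.
exact: (comp_tth M ck2 ci2).
Qed.

Lemma nums_regv (U : Type) (W : seq (U -> nat)) (n v : U -> nat) : comp W n -> comp W v ->
  nums W (fun x => regv (n x) (v x)).
Proof.
move=> c1 c2; apply: (nums_map (f := fun y => if y.2 == 0 then v y.1 else 0)) => //.
apply: comp_if; [|exact: comp_bind1|exact: comp_const].
by apply: comp_eq; [apply: comp_idx1|apply: comp_const].
Qed.

Lemma prt_instance : prt V (fun x => instance M (k x) (N x)).
Proof.
have cn := comp_mnf M ck; have cn1 := comp_mnf M ck1.
suff : nums V (fun x => csys (k x) (nf x) (mNQ M) tbl ++ ctok (tok0 M (k x) (N x)) ++ ctok (tok1 M (k x) (N x))) by [].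
apply: nums_cat; first exact: nums_csys.
apply: nums_cat.
  apply: nums_cons.
    apply: (comp_ext (comp_succ (comp_succ cn))) => x.
    by rewrite /tok0 /= size_map size_iota.
  apply: nums_cons; first by apply: comp_ctlp => //; apply: comp_const.
  apply: nums_cons; first exact: comp_const.
  apply: nums_cat.
    apply: (nums_ext (nums_map (f := fun=> 0) cn (comp_const _ 0))) => x.
    have zr n s : [seq 0 | _ <- iota s n] = nseq n 0 by elim: n s => //= n IH s; rewrite IH.
    exact: zr.
  apply: (nums_ext (nums_loop (s := fun y => y.2.*2.+1 :: regv (nf y.1) (if y.2.*2.+1 == 29 then N y.1 else 0)) cn _)).
    have ci1 := comp_idx1 V; apply: nums_cons; first by cmps.
    by apply: nums_regv => //; apply: comp_if; [cmps|apply: comp_bind1|apply: comp_const].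
  by move=> x; rewrite -[RHS]/(flatten (map (fun y : tk => y.1 :: y.2) _)) -map_comp.
apply: nums_cons; first by apply: (comp_ext (comp_const V 2)).
apply: nums_cons; first by apply: comp_ctlp => //; apply: comp_const.
apply: nums_cons; first exact: comp_const.
by apply: (nums_ext (nums_regv cn cN)) => x; rewrite -[RHS]/(regv _ _ ++ [::]) cats0.
Qed.

End PrintInstance.

(** * The machine computing the reduction *)

Lemma onth_rcons T (s : seq T) x j : onth (rcons s x) j = if j == size s then Some x else onth s j.
Proof. by elim: s j => [|y s IH] [|j] //=; rewrite ?IH //; case: j. Qed.

Lemma ribbon_rcons T (s : seq T) x :
  (fun i => if i == Posz (size s) then Some x else ribbon s i) = ribbon (rcons s x).
Proof.
by apply: functional_extensionality => -[j|j] //=; rewrite onth_rcons.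
Qed.

Lemma onth_map S T (f : S -> T) s j : onth (map f s) j = omap f (onth s j).
Proof. by elim: s j => [|y s IH] [|j] //=; apply: IH. Qed.

Section Loop.
Variables (Sig Del W X : finType).

Lemma dexec_loop (t : view Sig Del W X -> bool) p (S : nat -> tapes Sig Del W X) b J :
  (forall j, j < J -> t (rd (S j.+1)) /\ exists n, dexec p (S j.+1) n (S j) /\ n <= b) ->
  ~~ t (rd (S 0)) -> exists n, dexec (DWhile t p) (S J) n (S 0) /\ n <= J * (b + 2) + 1.
Proof.
move=> + t0; elim: J => [|J IH] hb; first by exists 1; split=> //; apply: EDone.
have [tJ [n1 [e1 l1]]] := hb J (ltnSn _).
have [|n2 [e2 l2]] := IH; first by move=> j jJ; apply: hb; lia.
exists (1 + (n1 + (1 + n2))); split; last by rewrite mulSn; lia.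
exact: ELoop e1 e2.
Qed.

Lemma doact_move (mvs : view Sig Del W X -> kind X -> move) s :
  doact (fun v x => (v x, mvs v x)) s = (s.1, fun x => shift (mvs (rd s) x) (s.2 x)).
Proof.
congr pair; apply: functional_extensionality => x; apply: functional_extensionality => i /=.
by case: eqP => // ->.
Qed.
End Loop.

Section Machine.
Variables (Sig : finType) (Mp : tm unit unit) (B : nat) (dg : Sig -> nat) (pm pp : cprog).

(** The 2 accounts for the registers that [pmul] uses by itself. *)
Definition regmax : nat := maxn (maxn (cregs pm) (cregs pp)) 2.
Local Notation D := regmax.

(** One tape for each counter, one for each tape of the simulated machine [Mp], and one whose only
    written cell holds the state of [Mp]. *)
Definition gtape : finType := ('I_D.+1 + ('I_(ntapes Mp).+1 + unit))%type.
Definition gwork : finType := (unit + ((unit + unit + work Mp) + state Mp))%type.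
Local Notation tapesG := (tapes Sig (option bool) gwork gtape).
Local Notation viewG := (view Sig (option bool) gwork gtape).
Local Notation kindG := (kind gtape).
Local Notation actG := (action Sig (option bool) gwork gtape).
Local Notation cellG := (option (Sig + option bool + gwork)).

Definition mark : cellG := Some (inr (inl tt)).
Definition emb (c : cell Mp) : cellG := omap (fun s => inr (inr (inl s))) c.
Definition unemb (c : cellG) : cell Mp := if c is Some (inr (inr (inl s))) then Some s else None.
Definition est (q : state Mp) : cellG := Some (inr (inr (inr q))).

Lemma embK : cancel emb unemb. Proof. by case. Qed.

Variable w : seq Sig.

(* The position of the head of a counter tape is the value of the counter. *)
Definition mk (h : int) (g : nat -> nat) (o : seq (option bool)) (c : config Mp) : tapesG :=
  (fun x : kindG => match x with
    | KIn => ribbon [seq inl (inl a) | a <- w]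
    | KOut => ribbon [seq inl (inr b) | b <- o]
    | KX (inl r) => fun i => if i == 0%R then mark else None
    | KX (inr (inl j)) => fun i => emb (ctape c j i)
    | KX (inr (inr _)) => fun i => if i == 0%R then est (cstate c) else None
    end,
   fun x : kindG => match x with
    | KIn => h
    | KOut => Posz (size o)
    | KX (inl r) => Posz (g r)
    | KX (inr (inl j)) => chead c j
    | KX (inr (inr _)) => 0%R
    end).

Definition on_reg (r : nat) (m : move) (x : kindG) : move :=
  if x is KX (inl r') then if r' == r :> nat then m else Stay else Stay.

Definition aInc (r : nat) : actG := fun v x => (v x, on_reg r MoveR x).
Definition aDec (r : nat) : actG := fun v x => (v x, on_reg r MoveL x).
Definition aOut (b : option bool) : actG :=
  fun v x => if x is KOut then (Some (inl (inr b)), MoveR) else (v x, Stay).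
Definition tPos (r : nat) (v : viewG) : bool := v (KX (inl (inord r))) != mark.

Fixpoint cdp (p : cprog) : dprog Sig (option bool) gwork gtape :=
  match p with
  | WInc r => DAct (aInc r)
  | WDec r => DAct (aDec r)
  | WOut b => DAct (aOut b)
  | WSeq p q => DSeq (cdp p) (cdp q)
  | WWhile r p => DWhile (tPos r) (cdp p)
  end.

Lemma do_inc r h g o c : doact (aInc r) (mk h g o c) = mk h (upd g r (g r).+1) o c.
Proof.
rewrite doact_move; congr pair; apply: functional_extensionality => -[||[r'|[j|u]]] //=.
by rewrite updE; case: eqP => [->|//] /=; rewrite -PoszD addn1.
Qed.

Lemma do_dec r h g o c : 0 < g r -> doact (aDec r) (mk h g o c) = mk h (upd g r (g r).-1) o c.
Proof.
move=> pos; rewrite doact_move; congr pair; apply: functional_extensionality => -[||[r'|[j|u]]] //=.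
by rewrite updE; case: eqP => [->|//] /=; lia.
Qed.

Lemma do_out b h g o c : doact (aOut b) (mk h g o c) = mk h g (rcons o b) c.
Proof.
congr pair; apply: functional_extensionality => -[||x] //=.
- by apply: functional_extensionality => i; case: eqP => // ->.
- by rewrite map_rcons -ribbon_rcons size_map.
- by apply: functional_extensionality => i; case: eqP => // ->.
- by rewrite size_rcons -PoszD addn1.
Qed.

Lemma tPosE r h g o c : r <= D -> tPos r (rd (mk h g o c)) = (0 < g r).
Proof. by move=> rD; rewrite /tPos /rd /= inordK ?ltnS //; case: (g r). Qed.

Lemma cdp_exec p s n s' h c : cexec p s n s' -> cregs p <= D ->
  dexec (cdp p) (mk h s.1 s.2 c) n (mk h s'.1 s'.2 c).
Proof.
elim=> {p s n s'} /=.
- by move=> r g o _; rewrite -do_inc; apply: EAct.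
- by move=> r g o pos _; rewrite -do_dec //; apply: EAct.
- by move=> b g o _; rewrite -do_out; apply: EAct.
- by move=> p q s n s1 m s2 _ IH1 _ IH2; rewrite geq_max => /andP[/IH1 e1 /IH2 e2]; apply: ESeq e1 e2.
- by move=> r p s s0; rewrite geq_max => /andP[rD _]; apply: EDone; rewrite tPosE // s0.
- move=> r p s n s1 m s2 pos _ IH1 _ IH2 /[dup]; rewrite {1}geq_max => /andP[rD /IH1 e1] /IH2 e2.
  by apply: ELoop e1 e2; rewrite tPosE.
Qed.

(** The start of [Mp] on an input of length [i], except that the head on its first tape follows the
    head on the input tape while the input is copied and read again. *)
Definition cfg (i : nat) (h : int) : config Mp :=
  Config (start Mp) (fun j => ribbon (if j == ord0 then nseq i (inl (inl tt)) else [::]))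
    (fun j => if j == ord0 then h else 0%R).

Definition aInit : actG := fun v x => match x with
  | KX (inl _) => (mark, Stay)
  | KX (inr (inr _)) => (est (start Mp), Stay)
  | _ => (v x, Stay)
  end.

Lemma ribbon_nil T i : ribbon [::] i = None :> option T. Proof. by case: i => [[]|]. Qed.

Lemma do_init : doact aInit (initial _ _ _ w) = mk 0%R (fun=> 0) [::] (cfg 0 0%R).
Proof.
congr pair; apply: functional_extensionality => -[||[r|[j|u]]] //=.
- by apply: functional_extensionality => i; case: eqP => // ->.
- by apply: functional_extensionality => i; case: eqP => // ->.
- by apply: functional_extensionality => i; rewrite ribbon_nil.
- by apply: functional_extensionality => i; rewrite !if_same !ribbon_nil; case: eqP => // ->.
- by apply: functional_extensionality => i; rewrite ribbon_nil.
- by case: eqP.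
Qed.

Definition letter1 : cellG := emb (Some (inl (inl tt))).

Definition aCopy : actG := fun v x => match x with
  | KIn => (v x, MoveR)
  | KX (inr (inl j)) => if j == ord0 then (letter1, MoveR) else (v x, Stay)
  | _ => (v x, on_reg 0 MoveR x)
  end.

Definition tIn (v : viewG) : bool := v (KIn gtape) != None.

Definition aBack (m : move) : actG := fun v x => (v x, match x with
  | KIn => m
  | KX (inr (inl j)) => if j == ord0 then m else Stay
  | _ => Stay
  end).

Lemma do_copy (i : nat) g o : doact aCopy (mk i g o (cfg i i)) = mk i.+1 (upd g 0 (g 0).+1) o (cfg i.+1 i.+1).
Proof.
congr pair; apply: functional_extensionality => -[||[r|[j|u]]] //=.
- by apply: functional_extensionality => z; case: eqP => // ->.
- by apply: functional_extensionality => z; case: eqP => // ->.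
- by apply: functional_extensionality => z; case: eqP => // ->.
- apply: functional_extensionality => z; case: (j == ord0); last by case: eqP => // ->.
  have -> : (inl (inl tt) : unit + unit + work Mp) :: nseq i (inl (inl tt)) = rcons (nseq i (inl (inl tt))) (inl (inl tt)).
    by elim: (i) => //= i' ->.
  by rewrite -ribbon_rcons size_nseq; case: eqP.
- by apply: functional_extensionality => z; case: eqP => // ->.
- by rewrite -PoszD addn1.
- by rewrite updE; case: eqP => [->|//] /=; rewrite -PoszD addn1.
- by case: eqP => //= _; rewrite -PoszD addn1.
Qed.

Lemma do_back m h h' g o i : shift m h = h' ->
  doact (aBack m) (mk h g o (cfg i h)) = mk h' g o (cfg i h').
Proof.
move=> <-; rewrite doact_move; congr pair; apply: functional_extensionality => -[||[r|[j|u]]] //=.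
by case: eqP.
Qed.

Lemma tIn_pos i g o c : tIn (rd (mk (Posz i) g o c)) = (i < size w).
Proof.
by rewrite /tIn /rd /= onth_map; elim: (w) i => [|a l IH] [|i] //=.
Qed.

Definition gk (a b : nat) : nat -> nat := fun r => if r == 0 then a else if r == 1 then b else 0.

Lemma copy_phase : exists n, dexec (DWhile tIn (DAct aCopy)) (mk 0%R (fun=> 0) [::] (cfg 0 0%R)) n
  (mk (size w) (gk (size w) 0) [::] (cfg (size w) (size w))) /\ n <= size w * 3 + 1.
Proof.
pose S j := mk (Posz (size w - j)) (gk (size w - j) 0) [::] (cfg (size w - j) (Posz (size w - j))).
have [||n [e l]] := @dexec_loop _ _ _ _ tIn (DAct aCopy) S 1 (size w).
- move=> j jw; split; first by rewrite /S tIn_pos; lia.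
  exists 1; split=> //; rewrite /S; have -> : size w - j = (size w - j.+1).+1 by lia.
  have -> : gk (size w - j.+1).+1 0 = upd (gk (size w - j.+1) 0) 0 (gk (size w - j.+1) 0 0).+1.
    by apply: functional_extensionality => r; rewrite /gk updE; case: eqP.
  by rewrite -do_copy; apply: EAct.
- by rewrite /S tIn_pos subn0 ltnn.
exists n; split=> //; move: e; rewrite /S subnn subn0.
by have -> : gk 0 0 = fun=> 0 by apply: functional_extensionality => r; rewrite /gk; do !case: eqP.
Qed.

Definition aDig (j : nat) : actG := fun v x =>
  (v x, if v (KIn gtape) is Some (inl (inl a)) then if j < dg a then on_reg 1 MoveR x else Stay else Stay).

(** The digit of the scanned letter is added by [B] conditional increments, as one action moves a
    head by at most one cell. *)
Definition digits : dprog Sig (option bool) gwork gtape :=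
  foldr (fun j p => DSeq (DAct (aDig j)) p) (DAct (aBack MoveL)) (iota 0 B).

Lemma do_dig j i a g o c : onth w i = Some a ->
  doact (aDig j) (mk (Posz i) g o c) = mk (Posz i) (upd g 1 (g 1 + (j < dg a))) o c.
Proof.
move=> wi; rewrite doact_move; congr pair.
have -> : rd (mk (Posz i) g o c) (KIn gtape) = Some (inl (inl a)) by rewrite /rd /= onth_map wi.
apply: functional_extensionality => -[||[r|[j'|u]]] /=; rewrite ?if_same //; case: ifP => _ //=.
- by rewrite updE; case: eqP => [->|//] /=; rewrite addn1 -PoszD addn1.
- by rewrite updE; case: eqP => [->|//]; rewrite addn0.
Qed.

Lemma digits_exec i a x y o n : onth w i = Some a -> dg a <= B ->
  dexec digits (mk (Posz i) (gk x y) o (cfg n (Posz i))) (B + 1)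
    (mk (Posz i - 1)%R (gk x (y + dg a)) o (cfg n (Posz i - 1)%R)).
Proof.
move=> wi dB; rewrite /digits.
suff : forall m s y', s + m = B -> y' = y + minn s (dg a) ->
  dexec (foldr (fun j p => DSeq (DAct (aDig j)) p) (DAct (aBack MoveL)) (iota s m))
    (mk (Posz i) (gk x y') o (cfg n (Posz i))) (m + 1)
    (mk (Posz i - 1)%R (gk x (y + dg a)) o (cfg n (Posz i - 1)%R)).
  by move/(_ B 0 y); apply=> //; rewrite min0n addn0.
elim=> [|m IH] s y' sm ->.
  rewrite addn0 in sm; rewrite sm (minn_idPr dB) /= -(@do_back MoveL (Posz i) (Posz i - 1)%R) //.
  exact: EAct.
rewrite /= -[m.+1]add1n -addnA; apply: (ESeq (s1 := mk (Posz i) (gk x (y + minn s.+1 (dg a))) o (cfg n (Posz i)))).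
  have -> : gk x (y + minn s.+1 (dg a)) =
      upd (gk x (y + minn s (dg a))) 1 (gk x (y + minn s (dg a)) 1 + (s < dg a)).
    have em : minn s.+1 (dg a) = minn s (dg a) + (s < dg a) by case: (ltnP s (dg a)) => h; lia.
    by apply: functional_extensionality => -[|[|r]] //=; rewrite /gk /= em addnA.
  by rewrite -(do_dig _ _ _ _ wi); apply: EAct.
by apply: IH => //; lia.
Qed.

Definition pmul : cprog := WSeq pm (WSeq (WWhile 1 (WDec 1)) (WWhile 2 (WSeq (WDec 2) (WInc 1)))).

Variables (mm mp : nat) (F : nat -> nat -> seq (option bool)).
Hypothesis pm_exec : forall x y o, exists n,
  cexec pm (regs [:: x; y], o) n (regs [:: x; y; y * B], o) /\ n <= fast 0 mm (mx [:: x; y]).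
Hypothesis pp_exec : forall x y o, exists n,
  cexec pp (regs [:: x; y], o) n (regs [:: x; y], o ++ F x y) /\ n <= fast 0 mp (mx [:: x; y]).
Hypothesis dg_lt : forall a, dg a < B.

(** Horner's rule starting with the last letter, which is why the input is scanned from right to
    left. *)
Definition val (u : seq Sig) : nat := foldr (fun a acc => acc * B + dg a) 0 u.

Lemma val_lt u : val u < B ^ size u.
Proof.
elim: u => [|a u IH] //=; rewrite expnS.
have : (val u).+1 * B <= B ^ size u * B by rewrite leq_mul2r IH orbT.
by rewrite mulSn [B * _]mulnC; have := dg_lt a; lia.
Qed.

Lemma gkE x y : gk x y = regs [:: x; y].
Proof. by apply: functional_extensionality => -[|[|r]] //; rewrite /regs /= nth_nil. Qed.

Lemma pmul_exec x y o : exists n, cexec pmul (gk x y, o) n (gk x (y * B), o) /\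
  n <= fast 0 mm (mx [:: x; y]) + ((y * 3 + 1) + (y * B * 4 + 1)).
Proof.
have [n1 [e1 l1]] := pm_exec x y o.
have [n2 [e2 l2]] := clear_regs [::] o [:: x; y; y * B] 1; rewrite /= !add0n in e2 l2.
have [//|n3 [e3 l3]] := @move_regs [::] o [:: x; 0; y * B] 2 1; rewrite /= !add0n in e3 l3.
exists (n1 + (n2 + n3)); split; last by lia.
rewrite !gkE; apply: XSeq e1 _; apply: XSeq e2 _.
have -> : regs [:: x; y * B] = regs [:: x; y * B; 0] by apply: functional_extensionality => -[|[|[|[|i]]]].
exact: e3.
Qed.

Definition bmul : nat :=
  fast 0 mm (size w + B ^ size w + 1) + ((B ^ size w * 3 + 1) + (B ^ size w * B * 4 + 1)) + (B + 1).

Lemma mul_phase : exists n, dexec (DWhile tIn (DSeq (cdp pmul) digits))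
  (mk (Posz (size w) - 1)%R (gk (size w) 0) [::] (cfg (size w) (Posz (size w) - 1)%R)) n
  (mk (- 1)%R (gk (size w) (val w)) [::] (cfg (size w) (- 1)%R)) /\ n <= size w * (bmul + 2) + 1.
Proof.
pose S t := mk (Posz t - 1)%R (gk (size w) (val (drop t w))) [::] (cfg (size w) (Posz t - 1)%R).
have [||n [e l]] := @dexec_loop _ _ _ _ tIn (DSeq (cdp pmul) digits) S bmul (size w).
- move=> t tw; have ht : (Posz t.+1 - 1)%R = Posz t by lia.
  rewrite /S ht tIn_pos; split=> //.
  have [a wa] : exists a, onth w t = Some a.
    by elim: (w) t tw {ht} => // a l IH [|t] /=; [exists a|apply: IH].
  have dr : drop t w = a :: drop t.+1 w.
    by elim: (w) t tw wa {ht} => // b l IH [|t] //= tw; [move=> [->]; rewrite drop0|apply: IH].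
  set R := val (drop t.+1 w).
  have RB : R <= B ^ size w.
    apply: leq_trans (ltnW (val_lt _)) _; rewrite size_drop; apply: leq_pexp2l; last by lia.
    by apply: leq_trans (dg_lt a).
  have [n1 [e1 l1]] := pmul_exec (size w) R [::].
  exists (n1 + (B + 1)); split; last first.
    rewrite /bmul leq_add2r; apply: leq_trans l1 _; rewrite leq_add //.
      by apply: fast_leq; rewrite !mx_cons mx_nil !geq_max; lia.
    by rewrite !leq_add // !leq_mul2r RB !orbT.
  have {}e1 := cdp_exec (Posz t) (cfg (size w) (Posz t)) e1; rewrite /= in e1.
  apply: (ESeq (e1 _)).
    by rewrite /regmax !geq_max !leq_max !leqnn !orbT.
  by rewrite dr /=; apply: digits_exec => //; apply: ltnW.
- by [].
by exists n; split=> //; move: e; rewrite /S drop_size drop0.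
Qed.

(** Each simulated step also increments counter 0, so that this counter, which already holds the
    input length, measures the running time of [Mp]. *)
Definition aStep : actG := fun v x =>
  if v (KX (inr (inr tt))) is Some (inr (inr (inr q))) then
    let da := delta q [ffun j => unemb (v (KX (inr (inl j))))] in
    match x with
    | KX (inr (inl j)) => (emb (da.2 j).1, (da.2 j).2)
    | KX (inr (inr _)) => (est da.1, Stay)
    | _ => (v x, on_reg 0 MoveR x)
    end
  else (v x, Stay).

Definition tRun (v : viewG) : bool :=
  if v (KX (inr (inr tt))) is Some (inr (inr (inr q))) then ~~ halting q else false.

Lemma do_step h g o c : ~~ halting (cstate c) ->
  doact aStep (mk h g o c) = mk h (upd g 0 (g 0).+1) o (step c).
Proof.
move=> nh; rewrite /doact /aStep /=.
have -> : [ffun j => unemb (rd (mk h g o c) (KX (inr (inl j))))] = [ffun j => ctape c j (chead c j)].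
  by apply/ffunP => j; rewrite !ffunE /rd /= embK.
rewrite /step (negPf nh); case: (delta _ _) => q act /=.
congr pair; apply: functional_extensionality => -[||[r|[j|u]]] //=.
- by apply: functional_extensionality => z; case: eqP => // ->.
- by apply: functional_extensionality => z; case: eqP => // ->.
- by apply: functional_extensionality => z; case: eqP => // ->.
- by apply: functional_extensionality => z; case: eqP => // ->.
- by apply: functional_extensionality => z; case: eqP.
- by rewrite updE; case: eqP => [->|//] /=; rewrite -PoszD addn1.
Qed.

Lemma run_phase T0 R : halting (cstate (run Mp (nseq (size w) tt) T0)) ->
  (forall t, t < T0 -> ~~ halting (cstate (run Mp (nseq (size w) tt) t))) ->
  exists n, dexec (DWhile tRun (DAct aStep)) (mk 0%R (gk (size w) R) [::] (cfg (size w) 0%R)) n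
    (mk 0%R (gk (size w + T0) R) [::] (run Mp (nseq (size w) tt) T0)) /\ n <= T0 * 3 + 1.
Proof.
move=> hT nhT.
pose S j := mk 0%R (gk (size w + (T0 - j)) R) [::] (run Mp (nseq (size w) tt) (T0 - j)).
have [||n [e l]] := @dexec_loop _ _ _ _ tRun (DAct aStep) S 1 T0.
- move=> j jT; have nh : ~~ halting (cstate (run Mp (nseq (size w) tt) (T0 - j.+1))) by apply: nhT; lia.
  split; first exact: nh.
  exists 1; split=> //; rewrite /S; have -> : T0 - j = (T0 - j.+1).+1 by lia.
  have -> : gk (size w + (T0 - j.+1).+1) R = upd (gk (size w + (T0 - j.+1)) R) 0 (gk (size w + (T0 - j.+1)) R 0).+1.
    by apply: functional_extensionality => r; rewrite /gk updE addnS; case: eqP.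
  by rewrite [run _ _ _.+1]iterS -do_step //; apply: EAct.
- by rewrite /S subn0 /tRun /rd /= hT.
exists n; split=> //; move: e; rewrite /S subnn subn0 addn0.
have -> // : run Mp (nseq (size w) tt) 0 = cfg (size w) 0%R.
rewrite /run /= /init /cfg; congr Config.
  by apply: functional_extensionality => j; rewrite map_nseq.
by apply: functional_extensionality => j; rewrite if_same.
Qed.

Definition gprog : dprog Sig (option bool) gwork gtape :=
  DSeq (DAct aInit) (DSeq (DWhile tIn (DAct aCopy)) (DSeq (DAct (aBack MoveL))
  (DSeq (DWhile tIn (DSeq (cdp pmul) digits)) (DSeq (DAct (aBack MoveR))
  (DSeq (DWhile tRun (DAct aStep)) (cdp pp)))))).

Definition gtime (T0 : nat) : nat :=
  1 + ((size w * 3 + 1) + (1 + ((size w * (bmul + 2) + 1) + (1 +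
    ((T0 * 3 + 1) + fast 0 mp (size w + T0 + B ^ size w + 1)))))).

Lemma generator_run T0 : halting (cstate (run Mp (nseq (size w) tt) T0)) ->
  (forall t, t < T0 -> ~~ halting (cstate (run Mp (nseq (size w) tt) t))) ->
  forall m, gtime T0 <= m -> let c := run (ptm gprog) w m in
  halting (cstate c) /\ outputs c (F (size w + T0) (val w)).
Proof.
move=> hT nhT m gm.
have [n1 [e1 l1]] := copy_phase; have [n2 [e2 l2]] := mul_phase.
have [n3 [e3 l3]] := run_phase (val w) hT nhT.
have [n4 [e4 l4]] := pp_exec (size w + T0) (val w) [::].
have {}e4 := cdp_exec 0%R (run Mp (nseq (size w) tt) T0) e4; rewrite /= -gkE in e4.
have ex : dexec gprog (initial _ _ _ w) (1 + (n1 + (1 + (n2 + (1 + (n3 + n4))))))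
    (mk 0%R (gk (size w + T0) (val w)) (F (size w + T0) (val w)) (run Mp (nseq (size w) tt) T0)).
  apply: ESeq; first exact: EAct.
  rewrite do_init; apply: ESeq e1 _; apply: ESeq; first exact: EAct.
  rewrite (@do_back MoveL (size w) (Posz (size w) - 1)%R) //; apply: ESeq e2 _; apply: ESeq; first exact: EAct.
  rewrite (@do_back MoveR (- 1)%R 0%R) //; apply: ESeq e3 _; apply: e4.
  by rewrite /regmax !leq_max leqnn orbT.
have kdo : kd (ord_max : 'I_#|gtape|.+2) = KOut gtape := kxK (KOut gtape).
rewrite /= (ptm_run ex).
  by split; [rewrite /= inordK|move=> i; rewrite /= kdo].
apply: leq_trans gm; rewrite /gtime !leq_add //; apply: leq_trans l4 _; apply: fast_leq.
by have := val_lt w; rewrite !mx_cons mx_nil !geq_max; lia.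
Qed.

End Machine.

(** * Growth *)

Lemma pow2_fast a : 2 ^ a <= fast 0 2 a.
Proof.
have it j x : 2 ^ j <= (iter j (fast 0 1) x).+1.
  by elim: j => // j IH; rewrite iterS fast01 expnS; move: IH; lia.
rewrite fast_succ; have := it a.+1 a; rewrite expnS; have := expn_gt0 2 a; lia.
Qed.

Lemma bd_pow b m a x : 0 < x -> a <= fast 0 m x -> b ^ a <= fast 0 (maxn 2 (maxn 2 (maxn b m)).+1).+1 x.
Proof.
move=> x0 am; apply: (bd_comp x0 (bd_mul x0 (bd_const b x0) am)).
apply: leq_trans (pow2_fast _); rewrite expnM; case: a {am} => [|a] //.
by rewrite leq_exp2r // ltnW // ltn_expl.
Qed.

Lemma fast0_le_fast1 n x : fast 0 n x <= fast 1 n x.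
Proof.
elim: n x => [|n IH] x; first by rewrite fast_limit; apply: leq_fast_index.
rewrite !fast_succ; elim: x.+1 => //= j IHj.
by apply: leq_trans (IH _) _; apply: fast_leq.
Qed.

Lemma leq_iter_fun (f g : nat -> nat) j x : (forall y, f y <= g y) -> {homo g : y z / y <= z} ->
  iter j f x <= iter j g x.
Proof. by move=> fg gm; elim: j => //= j IH; apply: leq_trans (fg _) (gm _ _ IH). Qed.

(** Each application of F_omega at least doubles [z+1], up to the shift by one, and 2 to the power
    [a+b+1] exceeds both coefficients. *)
Lemma linear_fast a b z : a * z + b <= iter (a + b).+1 (fast 1 0) z.
Proof.
have it j : 2 ^ j * z.+1 <= (iter j (fast 1 0) z).+1.
  elim: j => [|j IH]; first by rewrite mul1n.
  rewrite iterS expnS -mulnA; have : fast 0 1 (iter j (fast 1 0) z) <= fast 1 0 (iter j (fast 1 0) z).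
    by rewrite fast_limit; apply: leq_fast_index.
  by rewrite fast01; move: IH; lia.
have := it (a + b).+1; have : (a + b).+1 < 2 ^ (a + b).+1 by apply: ltn_expl.
move: (2 ^ _) (iter _ _ _) => e i ab le; have : (a + b).+1 * z.+1 <= e * z.+1 by rewrite leq_mul2r (ltnW ab) orbT.
by rewrite mulSn mulnS mulnDl; lia.
Qed.

(** The budget needed is an elementary function of F_{omega 2}(p) and [n], hence bounded by a finite
    level [m] at any [z] above both. A few levels beyond [n + p] suffice to reach such a [z] and to
    apply level [m] to it. *)
Lemma budget_dominates r b s C : exists K, forall n p k, n + p + K <= k ->
  r * (b ^ (n + 3 * (C * F_omega2 p + C) + 2) + s) <= V0 k.
Proof.
pose E z := r * (b ^ (z + 3 * (C * z + C) + 2) + s).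
have [m Em] : exists m, forall z, 0 < z -> E z <= fast 0 m z.
  eexists => z z0; rewrite /E.
  apply: bd_mul => //; first exact: bd_const.
  apply: bd_add => //; last exact: bd_const.
  apply: bd_pow => //; apply: bd_add => //; last exact: bd_const.
  apply: bd_add => //; first exact: bd_arg.
  apply: bd_mul => //; first exact: bd_const.
  apply: bd_add => //; last exact: bd_const.
  by apply: bd_mul => //; [exact: bd_const|exact: bd_arg].
(* With [k = i+2], the value contains two successive applications of F_{omega+i} to some [y > i+1].
   The first reaches F_{omega+p+1}(p), which is F_{omega 2}(p); the second is at least F_omega and
   so dominates level [m]. *)
exists (m + 4) => n p k nk.
have [i ei] : exists i, k = i.+2 by exists k.-2; lia.
rewrite /V0 ei fast_succ -[iter 2 _ 1]/(fast 1 i.+1 (fast 1 i.+1 1)).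
have y_gt := fast_gt_index 1 i.+1 (ltn0Sn 0); set y := fast 1 i.+1 1 in y_gt *.
rewrite fast_succ.
have le2 : iter 2 (fast 1 i) y <= iter y.+1 (fast 1 i) y.
  by apply: leq_iter_count; [exact: fast_gt|lia].
apply: leq_trans le2 => /=; set z := fast 1 i y.
have yz : y < z := fast_gt _ _ _.
have Fz : F_omega2 p <= z.
  by rewrite /F_omega2 fast_limit; apply: leq_fast; lia.
have le0 : fast 0 m z <= fast 1 i z.
  have : fast 1 0 z <= fast 1 i z by apply: leq_fast_index.
  by apply: leq_trans; rewrite fast_limit; apply: leq_fast_index; lia.
apply: leq_trans le0; apply: leq_trans (Em z _); last by lia.
rewrite /E leq_mul2l leq_add2r; apply/orP; right.
case: b {E Em} => [|b]; last first.
  by apply: leq_pexp2l => //; rewrite leq_add2r leq_add ?leq_mul2l ?leq_add2r ?leq_mul2l ?Fz ?orbT //; lia.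
by rewrite !exp0n //; lia.
Qed.

Section Times.
Variables (Sig Del : finType) (M : tm Sig Del) (w : seq Sig).

Lemma run_halted n m : halting (cstate (run M w n)) -> n <= m -> run M w m = run M w n.
Proof.
move=> hn nm; rewrite -(subnK nm) /run iterD; elim: (m - n) => //= j ->.
by rewrite /step -/(run M w n) hn.
Qed.

End Times.

(* A cell holding an output letter has been visited. *)
Lemma written_cells (Sig Del : finType) (M : tm Sig Del) w T : exists2 H : seq int,
  size H <= T & forall i b, ctape (run M w T) ord_max i = Some (inl (inr b)) -> i \in H.
Proof.
elim: T => [|T [H sH hH]].
  exists [::] => // i b; rewrite /run /= /init /=.
  case: i => [j|j] //=; case: ifP => _; last by case: j.
  by elim: (w) j => [|a l IH] [|j] //=; apply: IH.
rewrite /run iterS -/(run M w T) /step; case: ifP => hT; first by exists H => //; apply: leqW.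
case: (delta _ _) => q act; exists (chead (run M w T) ord_max :: H) => //= i b.
by rewrite in_cons; case: eqP => //= _ /hH.
Qed.

Lemma output_size (Sig : finType) (M : tm Sig unit) w T P :
  outputs (run M w T) (nseq P tt) -> P <= T.
Proof.
move=> out; have [H sH hH] := written_cells M w T; apply: leq_trans sH.
rewrite -(size_iota 0 P) -(size_map Posz); apply: uniq_leq_size.
  by rewrite map_inj_uniq ?iota_uniq // => i j [].
move=> i /mapP[j]; rewrite mem_iota /= add0n => jP ->; apply: (hH _ tt); rewrite out /=.
by elim: P j jP {out} => // P IH [|j] //= jP; apply: IH.
Qed.

Lemma gtime_bound (Sig : finType) B mm mp : exists m, forall (w : seq Sig) T0,
  gtime B w mm mp T0 <= fast 0 m (size w + T0 + 1).
Proof.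
eexists => w T0; set x := size w + T0 + 1.
have x0 : 0 < x by rewrite /x addn1.
have hn : size w <= fast 0 0 x by apply: leq_trans (bd_arg x); rewrite /x; lia.
have hT : T0 <= fast 0 0 x by apply: leq_trans (bd_arg x); rewrite /x; lia.
have hB := bd_pow B x0 hn.
have h1 := bd_comp x0 (bd_add x0 (bd_add x0 hn hB) (bd_const 1 x0)) (leqnn (fast 0 mm (size w + B ^ size w + 1))).
have h2 := bd_comp x0 (bd_add x0 (bd_add x0 (bd_add x0 hn hT) hB) (bd_const 1 x0))
  (leqnn (fast 0 mp (size w + T0 + B ^ size w + 1))).
by rewrite /gtime /bmul; bds.
Qed.

(** F_omega dominates any finite level [m] once [m] is added to the argument, and linear terms cost
    finitely many further applications of F_omega, each of which is at most one of F_{omega+n}. *)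
Lemma time_fast k n c C m : k < 2 -> exists c', forall x t, t <= C * iter c (fast k n) x + C ->
  fast 0 m (x + t + 1) <= iter c' (fast 1 n) x.
Proof.
move=> k2; pose j := (C.+1 + (C.+1 + m)).+1; exists (j.+1 + c) => x t tC.
have fk y : fast k n y <= fast 1 n y.
  by case: k k2 {tC} => [|[|//]] _; [exact: fast0_le_fast1|].
set z := iter c (fast 1 n) x.
have z1 : iter c (fast k n) x <= z by apply: leq_iter_fun => //; exact: fast_leq.
have z2 : x <= z by apply: leq_iter_self; exact: fast_gt.
have le1 : x + t + 1 + m <= C.+1 * z + (C.+1 + m).
  have : C * iter c (fast k n) x <= C * z by rewrite leq_mul2l z1 orbT.
  by rewrite mulSn; lia.
have le2 : fast 0 m (x + t + 1) <= fast 1 0 (x + t + 1 + m).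
  by rewrite fast_limit; apply: leq_fast; lia.
apply: (leq_trans le2); apply: (@leq_trans (iter j.+1 (fast 1 0) z)).
  by rewrite iterS; apply: fast_leq; apply: leq_trans le1 (linear_fast _ _ _).
rewrite iterD -/z; apply: leq_iter_fun; last exact: fast_leq.
by move=> y; apply: leq_fast_index.
Qed.

Theorem theorem1 : F_omega2_hard ceos_coverability.
Proof.
move=> Sig L [p [[k0 [n0 [c0 [k02 [Mp [Cp hp]]]]]] [M [C hM]]]].
have halts n : exists t, halting (cstate (run Mp (nseq n tt) t)).
  by eexists; case: (hp (nseq n tt)) => h _; exact: h.
(* The exact halting time replaces [p n]: the generator can measure it by running [Mp], and it is at
   least [p n], since a machine visits at most one new output cell per step. *)
pose T0 n := ex_minn (halts n).
have T0h n : halting (cstate (run Mp (nseq n tt) (T0 n))) by rewrite /T0; case: ex_minnP.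
have T0min n t : halting (cstate (run Mp (nseq n tt) t)) -> T0 n <= t.
  by rewrite /T0; case: ex_minnP => t' _; apply.
have T0le n : T0 n <= Cp * iter c0 (fast k0 n0) n + Cp.
  by apply: T0min; have [+ _] := hp (nseq n tt); rewrite size_nseq.
have pT n : p n <= T0 n.
  have [_] := hp (nseq n tt); rewrite size_nseq (run_halted (T0h n) (T0le n)).
  exact: output_size.
have [K hK] := budget_dominates (nregs M + 4) (base M) #|{: state M}| C.
exists (fun w => instance M (size w + T0 (size w) + K) (Nw M w)); split.
  pose V : seq (nat * nat -> nat) := [:: fst; snd].
  have c1 : comp V fst by apply: comp_var; left.
  have c2 : comp V snd by apply: comp_var; right; left.
  have [pm [mm [mm' hm]]] : computesG V (fun x => x.2 * base M).
    have h := comp_mul c2 (comp_const V (base M)).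
    by apply: (h _ (fun x => x) V); exact: List.incl_refl.
  have [pp [mp hpp]] : printsG V (fun x => instance M (x.1 + K) x.2).
    have h := prt_instance M (comp_add c1 (comp_const V K)) c2.
    by apply: (h _ (fun x => x) V); exact: List.incl_refl.
  have [m hm0] := gtime_bound Sig (base M) mm mp.
  have [c' hc'] := @time_fast k0 n0 c0 Cp m k02.
  (* Level omega + [n0] serves in both cases, also when [p] is computed at the finite level [n0]. *)
  exists 1, n0, c'; split=> //.
  exists (ptm (gprog Mp (base M) (fun a => @dig _ M (Some (inl (inl a)))) pm pp)), 1 => w.
  apply: (@generator_run _ _ _ _ _ _ w mm mp (fun x y => instance M (x + K) y)).
  - by move=> x y o; have [n [e l _]] := hm (x, y) o; exists n.
  - by move=> x y o; have [n [e l]] := hpp (x, y) o; exists n.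
  - by move=> a; apply: dig_lt.
  - exact: T0h.
  - by move=> t tT; apply/negP => /T0min; rewrite leqNgt tT.
  - apply: leq_trans (hm0 _ _) _; apply: leq_trans (hc' _ _ (T0le _)) _.
    by rewrite mul1n leq_addr.
move=> w; have [hw aw] := hM w; split.
  move/aw => acc; set n := C * _ + C in hw acc.
  apply: (@instance_complete _ _ _ _ n (base M ^ (size w + 3 * n + 2) + #|{: state M}|)) => //.
  - exact: leq_addr.
  - exact: leq_addl.
  - by apply: hK; have := pT (size w); lia.
case/instance_sound=> n [hn an]; apply/aw.
set N := C * _ + C in hw *.
(* The accepting run found by simulation need not have the length of the time bound, but a halted
   configuration no longer changes, so both end in the same state. *)
case: (leqP n N) => [nN|/ltnW Nn]; first by rewrite (run_halted hn nN).
by rewrite -(run_halted hw Nn).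
Qed.
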